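(* Assume that $g_\theta$ and $g_\kappa$ both have radius of convergence $R>0$ and are holomorphic in some domain $\Delta_0$, that $g_\kappa^{\{1\}}(R)=1$, and that for some $\theta^*\ge0$, $\delta>0$, $s\in(1,2)$, $a_s>0$, as $z\to R$, $z\in\Delta_0$, $$g_\theta(z)=-\theta^*\log(1-z/R)+O((1-z/R)^\delta),\qquad g_\kappa(z)=g_\kappa(R)-(1-z/R)+a_s(1-z/R)^s+O((1-z/R)^{s+\delta}).$$ Let $f:\Delta_0\to\mathbb C$ be holomorphic with $f(z)=1+O((1-z/R)^\delta)$ as $z\to R$, $z\in\Delta_0$. Then for any $u\ge0$, as $N\to\infty$, $$[z^N]\big[f(z)\exp\{e^{-u/\sqrt N}G_N(z)\}\big]\sim\frac{\exp\{Ng_\kappa(R)-\sqrt N\,u\,g_\kappa(R)+\tfrac12u^2g_\kappa(R)\}}{R^N}\cdot\frac{(Na_s)^{(\theta^*-1)/s}}{s\,\Gamma\big(\frac{s-1+\theta^*}{s}\big)}.$$ In particular, $H_N\sim\dfrac{\exp\{Ng_\kappa(R)\}\cdot(Na_s)^{(\theta^*-1)/s}}{sR^N\,\Gamma\big(\frac{s-1+\theta^*}{s}\big)}$ as $N\to\infty$.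
   Context: $(\theta_j)_{j\ge1}$, $(\kappa_j)_{j\ge1}$ are sequences of nonnegative reals; $g_\theta(z)=\sum_{j\ge1}\theta_jz^j/j$, $g_\kappa(z)=\sum_{j\ge1}\kappa_jz^j/j$, $G_N=g_\theta+Ng_\kappa$. $[z^N]F(z)$ is the coefficient of $z^N$. $H_N=\frac1{N!}\sum_{\sigma\in S_N}\prod_{j=1}^N(\theta_j+N\kappa_j)^{C_j(\sigma)}$, $C_j(\sigma)$ the number of $j$-cycles of $\sigma$. $g^{\{1\}}(z)=zg'(z)$, $g_\kappa^{\{1\}}(R):=\lim_{r\uparrow R}g_\kappa^{\{1\}}(r)$. Domain: for $\eta>0$, $\varphi\in(0,\pi/2)$, $\Delta_0=\{z\in\mathbb C:|z|<R|1+\eta e^{i\varphi}|,\ z\ne R,\ |\arg(z-R)|>\varphi\}$. Logs and powers use principal branches. Standing assumption: $(\kappa_j)$ is non-arithmetic (no integer $j_0>1$ such that $\kappa_j\ne0$ implies $j_0\mid j$) and $\kappa_j>0$ for some $j\ge2$. *)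

(* Defs.v *)
From Stdlib Require Import Reals Arith ClassicalEpsilon.
From Coquelicot Require Import Coquelicot.
Open Scope R_scope.

Definition cexp (z : C) : C :=
  (exp (fst z) * cos (snd z), exp (fst z) * sin (snd z)).

(** Principal logarithm: the unique L with exp L = w and Im L in (-pi, pi]
    (chosen by Hilbert's epsilon; meaningful for w <> 0). *)
Definition Clog (w : C) : C :=
  epsilon (inhabits (RtoC 0))
    (fun L => cexp L = w /\ - PI < snd L <= PI).

Definition Carg (w : C) : R := snd (Clog w).

Definition Cpower (w a : C) : C :=
  match Req_EM_T (Cmod w) 0 with
  | left _ => RtoC 0
  | right _ => cexp (Cmult a (Clog w))
  end.

Definition C_is_derive (f : C -> C) (z l : C) : Prop :=
  @is_derive C_AbsRing C_NormedModule f z l.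
Definition C_ex_derive (f : C -> C) (z : C) : Prop :=
  exists l, C_is_derive f z l.

Definition holomorphic_on (D : C -> Prop) (f : C -> C) : Prop :=
  forall z, D z -> C_ex_derive f z.

Definition cderiv (f : C -> C) (z : C) : C :=
  epsilon (inhabits (RtoC 0)) (fun l => C_is_derive f z l).
Fixpoint cderiv_n (n : nat) (f : C -> C) : C -> C :=
  match n with
  | O => f
  | S m => cderiv (cderiv_n m f)
  end.

Definition zcoef (N : nat) (F : C -> C) : C :=
  Cdiv (cderiv_n N F (RtoC 0)) (RtoC (INR (Factorial.fact N))).

Definition gcoef (c : nat -> R) (j : nat) : R :=
  match j with O => 0 | _ => c j / INR j end.
(** Coefficients of g^{1}(z) = z g'(z) = sum_{j>=1} c_j z^j. *)
Definition g1coef (c : nat -> R) (j : nat) : R :=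
  match j with O => 0 | _ => c j end.

Definition Delta0 (R eta phi : R) (z : C) : Prop :=
  Cmod z < R * Cmod (Cplus (RtoC 1) (Cmult (RtoC eta) (cexp (0, phi))))
  /\ z <> RtoC R
  /\ phi < Rabs (Carg (Cminus z (RtoC R))).

Definition Gamma (x : R) : R :=
  RInt_gen (fun t => Rpower t (x - 1) * exp (- t))
           (at_right 0) (Rbar_locally p_infty).

Definition non_arithmetic (c : nat -> R) : Prop :=
  ~ exists j0 : nat, (1 < j0)%nat /\
      forall j : nat, (1 <= j)%nat -> c j <> 0 -> Nat.divide j0 j.

From mathcomp Require Import all_boot all_order all_algebra all_fingroup.
From mathcomp Require Import Rstruct.

Local Open Scope ring_scope.

Definition cycle_count (N : nat) (s : {perm 'I_N}) (j : nat) : nat :=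
  #|[set c in porbits s | #|c| == j]|.

Definition H (th ka : nat -> R) (N : nat) : R :=
  (\sum_(s : {perm 'I_N})
     \prod_(1 <= j < N.+1) (th j + N%:R * ka j) ^+ cycle_count N s j)
  / (N`!)%:R.

(* Main.v *)
(** By Cauchy's formula the coefficient is a mean over the circle [|z| = R e^{-lam}],
    [lam = (N a_s)^{-1/s}].  With [z = R e^{-w}], [w = lam (1 + i t)], the linear term of
    [g_kappa] cancels against [z^{-N}], and near [z = R] the integrand converges to
    [exp (omega^s - theta* log omega)], [omega = 1 + i t].  The convergence is dominated: near
    [R] because [Re (omega^s)] tends to [-oo] like [-|t|^s], and away from [R] because the
    non-arithmetic nonnegative coefficients [kappa_j] make [Re g_kappa] smaller than
    [g_kappa(R)] by a fixed amount.

    The limit integral is evaluated without contours in the cut plane.  The same circle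
    method applied to the Taylor coefficients of [(1 - z)^{-b}] and Gauss' limit for Gamma
    give the case [s = 1]; the substitution [omega -> omega^s], justified by a homotopy
    along [sigma log (1 + i t)], and an integration by parts that lowers the exponent of
    [omega] give the general case.

    For [H_N], inserting one point into a permutation yields the recursion
    [n h_n = sum_k (theta_k + N kappa_k) h_{n-k}], which the Taylor coefficients of
    [exp G_N] also satisfy. *)

Require Import Defs.
From Stdlib Require Import ZArith Reals Lra Lia Classical ClassicalEpsilon.
From Coquelicot Require Import Coquelicot.
From mathcomp Require all_boot all_algebra all_fingroup Rstruct ring.
Open Scope R_scope.

(** Two difficulties pull against each other. For s > 1 the factor exp(omega^s) gives decay at once
    but no closed formula; for s = 1 the formula comes from Gauss, but |exp(omega)| is constant on
    the line, so absolute convergence rests on omega^{-b} with b >= 2. The passage between the two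
    cases is therefore made at a large exponent, and two integrations by parts bring it down. The
    condition s < 2 is felt in the damping q = e^{-u/sqrt N}: the linear term of g_kappa then
    cancels only up to N(1-q) lam, which is of order N^{1/2-1/s}. At z = R the damping contributes q
    N g_kappa(R), and its expansion to second order produces the terms in u. Complex integration
    runs over segments in the coordinate w: z = e^{-w} turns circles into vertical segments, and
    Goursat's theorem on rectangles with 2 pi i periodicity replaces closed contours. Away from R,
    g_theta and g_kappa are controlled by their values at |z|, since the coefficients are
    nonnegative. For f no such comparison exists; it is bounded by compactness on the closed disc
    minus a neighbourhood of R, which lies in Delta_0. *)

Lemma Cmod_le_abs (z : C) : Cmod z <= Rabs (fst z) + Rabs (snd z).
Proof.
  unfold Cmod. apply Rsqr_incr_0_var; [| pose proof (Rabs_pos (fst z)); pose proof (Rabs_pos (snd z)); lra].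
  rewrite Rsqr_sqrt by (apply Rplus_le_le_0_compat; apply pow2_ge_0).
  rewrite <- (pow2_abs (fst z)), <- (pow2_abs (snd z)). unfold Rsqr.
  pose proof (Rabs_pos (fst z)); pose proof (Rabs_pos (snd z)); nra.
Qed.

Lemma fst_le_Cmod (z : C) : Rabs (fst z) <= Cmod z.
Proof. apply re_le_Cmod. Qed.

Lemma snd_le_Cmod (z : C) : Rabs (snd z) <= Cmod z.
Proof. eapply Rle_trans; [apply Rmax_r | apply Rmax_Cmod]. Qed.

Lemma RtoC_neq (x : R) : x <> 0 -> RtoC x <> 0.
Proof. intros H E. apply H. exact (RtoC_inj x 0 E). Qed.

Lemma norm_CR (z : C_R_NormedModule) : norm z = Cmod z.
Proof.
  unfold norm; simpl; unfold prod_norm, Cmod. f_equal.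
  unfold norm; simpl; unfold abs; simpl.
  rewrite !Rmult_1_r. rewrite <- !Rabs_mult.
  rewrite !Rabs_pos_eq by nra. reflexivity.
Qed.

Lemma Cmod_minus_sym (z w : C) : Cmod (z - w) = Cmod (w - z).
Proof. rewrite <- Cmod_opp. f_equal. ring. Qed.

Lemma Cmod_rev_triangle (z w : C) : Cmod z - Cmod w <= Cmod (z - w).
Proof.
  pose proof (Cmod_triangle (z - w) w) as H.
  replace (z - w + w)%C with z in H by ring. lra.
Qed.

(** * Continuity and differentiability in epsilon form *)

(** Continuity is measured with [Cmod] so that estimates feed into it directly, whichever of the
    uniform structures on [C] a library lemma expects. *)
Definition Ccont (f : C -> C) (z : C) : Prop :=
  forall eps, 0 < eps -> exists d, 0 < d /\
    forall w, Cmod (w - z) < d -> Cmod (f w - f z) < eps.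

Definition RCcont (f : R -> C) (t : R) : Prop :=
  forall eps, 0 < eps -> exists d, 0 < d /\
    forall u, Rabs (u - t) < d -> Cmod (f u - f t) < eps.

Lemma RCcont_continuous (f : R -> C) (t : R) :
  RCcont f t -> continuous (U := C_R_CompleteNormedModule) f t.
Proof.
  intros H P [eps HP].
  destruct (H eps (cond_pos eps)) as [d [Hd H']].
  exists (mkposreal d Hd). intros u Hu. apply HP.
  specialize (H' u Hu).
  split; simpl; unfold ball; simpl; unfold AbsRing_ball, abs, minus, plus, opp; simpl.
  - eapply Rle_lt_trans; [| exact H']. exact (fst_le_Cmod (f u - f t)%C).
  - eapply Rle_lt_trans; [| exact H']. exact (snd_le_Cmod (f u - f t)%C).
Qed.

(** This is the form in which Goursat's theorem, differentiation under the integral sign and the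
    logarithm handle derivatives: an explicit first-order remainder. *)
Lemma C_is_derive_eps (f : C -> C) (z l : C) :
  C_is_derive f z l <->
  forall eps, 0 < eps -> exists d, 0 < d /\
    forall h, Cmod h < d -> Cmod (f (z + h) - f z - h * l)%C <= eps * Cmod h.
Proof.
  split.
  - intros [_ H] eps Heps.
    destruct (H z (fun P HP => HP) (mkposreal eps Heps)) as [d Hd].
    exists d. split; [apply cond_pos|]. intros h Hh.
    assert (Hz : @ball (AbsRing_UniformSpace C_AbsRing) z d (z + h)%C).
    { unfold ball; simpl; unfold AbsRing_ball, abs, minus, plus, opp; simpl.
      replace (z + h + - z)%C with h by ring. exact Hh. }
    specialize (Hd _ Hz). simpl in Hd.
    unfold norm, minus, plus, opp, scal in Hd; simpl in Hd. unfold abs, mult in Hd; simpl in Hd.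
    replace (z + h + - z)%C with h in Hd by ring.
    exact Hd.
  - intros H. split; [apply is_linear_scal_l|].
    intros x Hx.
    (* [is_derive] speaks of every point to which the neighbourhood filter converges; uniqueness of
       limits leaves only [z]. *)
    assert (E : z = x) by exact (@is_filter_lim_locally_unique C_AbsRing (AbsRing_NormedModule C_AbsRing) z x Hx).
    subst x.
    intros eps. destruct (H eps (cond_pos eps)) as [d [Hd H']].
    exists (mkposreal d Hd). intros w Hw.
    unfold ball in Hw; simpl in Hw; unfold AbsRing_ball, abs, minus, plus, opp in Hw; simpl in Hw.
    specialize (H' _ Hw).
    assert (E2 : @eq C (z + (w + - z))%C w) by ring.
    rewrite E2 in H'.
    exact H'.
Qed.

Lemma RC_is_derive_eps (f : R -> C) (t : R) (l : C) :
  (forall eps, 0 < eps -> exists d, 0 < d /\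
    forall h, Rabs h < d -> Cmod (f (t + h)%R - f t - h * l)%C <= eps * Rabs h) ->
  is_derive (V := C_R_NormedModule) f t l.
Proof.
  intros H. split; [apply is_linear_scal_l|].
  intros x Hx.
  assert (E : t = x) by exact (@is_filter_lim_locally_unique R_AbsRing (AbsRing_NormedModule R_AbsRing) t x Hx).
  subst x.
  intros eps. destruct (H eps (cond_pos eps)) as [d [Hd H']].
  exists (mkposreal d Hd). intros w Hw.
  unfold ball in Hw; simpl in Hw; unfold AbsRing_ball, abs, minus, plus, opp in Hw; simpl in Hw.
  specialize (H' _ Hw).
  assert (E2 : @eq R (t + (w + - t)) w) by ring.
  rewrite E2 in H'.
  rewrite norm_CR. unfold minus at 1 2.
  rewrite scal_R_Cmult. exact H'.
Qed.

Lemma RC_is_derive_eps_inv (f : R -> C) (t : R) (l : C) :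
  is_derive (V := C_R_NormedModule) f t l ->
  (forall eps, 0 < eps -> exists d, 0 < d /\
    forall h, Rabs h < d -> Cmod (f (t + h)%R - f t - h * l)%C <= eps * Rabs h).
Proof.
  intros [_ H] eps Heps.
  destruct (H t (fun P HP => HP) (mkposreal eps Heps)) as [d Hd].
  exists d. split; [apply cond_pos|]. intros h Hh.
  assert (Hz : @ball R_UniformSpace t d (t + h)).
  { unfold ball; simpl; unfold AbsRing_ball, abs, minus, plus, opp; simpl.
    replace (t + h + - t) with h by ring. exact Hh. }
  specialize (Hd _ Hz).
  rewrite norm_CR in Hd. unfold minus at 1 2 in Hd. rewrite scal_R_Cmult in Hd.
  unfold minus, plus, opp, norm in Hd; simpl in Hd.
  replace (t + h + - t) with h in Hd by ring. exact Hd.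
Qed.

(** * Complex differentiation *)

(** [C_NormedModule] carries the product uniform structure and [AbsRing_NormedModule C_AbsRing] the one of [Cmod]; they have the same derivatives. *)
Lemma C_is_derive_AbsRing (f : C -> C) (z l : C) :
  C_is_derive f z l <-> is_derive (K := C_AbsRing) (V := AbsRing_NormedModule C_AbsRing) f z l.
Proof. split; intros [_ H]; split; try apply is_linear_scal_l; exact H. Qed.

Lemma C_is_derive_cont (f : C -> C) (z l : C) : C_is_derive f z l -> Ccont f z.
Proof.
  intros H eps Heps. apply C_is_derive_eps with (eps := 1) in H; [|lra].
  destruct H as [d [Hd H]].
  pose proof (Cmod_ge_0 l) as Hl.
  exists (Rmin d (eps / (2 + Cmod l))). split.
  { apply Rmin_pos; [lra|]. apply Rdiv_lt_0_compat; lra. }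
  intros w Hw.
  assert (H1 : Cmod (w - z) < d) by (eapply Rlt_le_trans; [exact Hw | apply Rmin_l]).
  assert (H2 : Cmod (w - z) < eps / (2 + Cmod l)) by (eapply Rlt_le_trans; [exact Hw | apply Rmin_r]).
  specialize (H _ H1). replace (z + (w - z))%C with w in H by ring.
  replace (f w - f z)%C with ((f w - f z - (w - z) * l) + (w - z) * l)%C by ring.
  eapply Rle_lt_trans; [apply Cmod_triangle|].
  rewrite Cmod_mult.
  apply Rmult_lt_compat_r with (r := 2 + Cmod l) in H2; [|lra].
  replace (eps / (2 + Cmod l) * (2 + Cmod l)) with eps in H2 by (field; lra).
  pose proof (Cmod_ge_0 (w - z)). nra.
Qed.

Lemma C_ex_derive_cont (f : C -> C) (z : C) : C_ex_derive f z -> Ccont f z.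
Proof. intros [l H]. eapply C_is_derive_cont; exact H. Qed.

Lemma C_is_derive_unique (f : C -> C) (z l : C) : C_is_derive f z l -> cderiv f z = l.
Proof.
  intros H. rewrite <- (is_C_derive_unique f z l) by exact H. symmetry. apply is_C_derive_unique.
  apply (epsilon_spec (inhabits (RtoC 0)) (fun l => C_is_derive f z l)). exists l. exact H.
Qed.

Lemma C_is_derive_ext_ball (f g : C -> C) (z l : C) (r : R) : 0 < r ->
  (forall w, Cmod (w - z) < r -> f w = g w) -> C_is_derive f z l -> C_is_derive g z l.
Proof.
  intros Hr E H. rewrite C_is_derive_eps in *. intros eps Heps.
  destruct (H eps Heps) as [d [Hd H1]].
  exists (Rmin d r). split; [apply Rmin_pos; lra|]. intros h Hh.
  pose proof (Rmin_l d r). pose proof (Rmin_r d r).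
  rewrite <- !E; [apply H1; lra| |].
  - replace (z - z)%C with (RtoC 0) by ring. rewrite Cmod_0. lra.
  - replace (z + h - z)%C with h by ring. lra.
Qed.

Lemma C_is_derive_const (c z : C) : C_is_derive (fun _ => c) z 0.
Proof. exact (is_derive_const (V := C_NormedModule) c z). Qed.

Lemma C_is_derive_id (z : C) : C_is_derive (fun w => w) z 1.
Proof. apply C_is_derive_AbsRing, (is_derive_id (K := C_AbsRing)). Qed.

Lemma C_is_derive_plus (f g : C -> C) (z a b : C) :
  C_is_derive f z a -> C_is_derive g z b -> C_is_derive (fun w => f w + g w)%C z (a + b)%C.
Proof. exact (is_derive_plus (V := C_NormedModule) f g z a b). Qed.

Lemma C_is_derive_mult (f g : C -> C) (z a b : C) :
  C_is_derive f z a -> C_is_derive g z b ->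
  C_is_derive (fun w => f w * g w)%C z (a * g z + f z * b)%C.
Proof.
  rewrite !C_is_derive_AbsRing. intros H K. apply (is_derive_mult (K := C_AbsRing)); [exact H|exact K|exact Cmult_comm].
Qed.

Lemma C_is_derive_comp (f g : C -> C) (z a b : C) :
  C_is_derive g z a -> C_is_derive f (g z) b ->
  C_is_derive (fun w => f (g w)) z (a * b)%C.
Proof.
  rewrite !C_is_derive_AbsRing. intros H K. exact (is_derive_comp (K := C_AbsRing) (V := AbsRing_NormedModule C_AbsRing) f g z b a K H).
Qed.

Lemma C_is_derive_inv (z : C) : z <> 0 -> C_is_derive (fun w => / w)%C z (- / (z * z))%C.
Proof.
  intros Hz. apply C_is_derive_eps. intros eps He.
  assert (P : 0 < Cmod z) by (apply Cmod_gt_0, Hz).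
  set (m := Cmod z) in *.
  (* The first entry keeps |z + h| >= m/2, so the remainder h^2/(z^2 (z + h)) is at most 2|h|^2/m^3;
     the second makes this at most eps |h|. *)
  exists (Rmin (m / 2) (eps * m ^ 3 / 2)). split.
  { apply Rmin_pos; [lra|]. apply Rdiv_lt_0_compat; [|lra]. apply Rmult_lt_0_compat; [lra|]. apply pow_lt; lra. }
  intros h Hh.
  pose proof (Rmin_l (m / 2) (eps * m ^ 3 / 2)). pose proof (Rmin_r (m / 2) (eps * m ^ 3 / 2)).
  assert (Hzh : m / 2 <= Cmod (z + h)).
  { pose proof (Cmod_rev_triangle z (- h)) as T. rewrite Cmod_opp in T.
    replace (z - - h)%C with (z + h)%C in T by ring. unfold m in *. lra. }
  assert (Nzh : (z + h)%C <> 0) by (apply Cmod_gt_0; lra).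
  replace (/ (z + h) - / z - h * - / (z * z))%C with (h * h * / (z * z * (z + h)))%C
    by (field; auto).
  rewrite !Cmod_mult, Cmod_inv by (repeat apply Cmult_neq_0; auto). rewrite !Cmod_mult. fold m.
  pose proof (Cmod_ge_0 h) as Hh0.
  assert (B : / (m * m * Cmod (z + h)) <= / (m * m * (m / 2))).
  { apply Rinv_le_contravar; [nra|]. apply Rmult_le_compat_l; nra. }
  apply Rle_trans with (Cmod h * (Cmod h * / (m * m * (m / 2)))).
  { rewrite Rmult_assoc. apply Rmult_le_compat_l; [lra|]. apply Rmult_le_compat_l; lra. }
  rewrite (Rmult_comm eps). apply Rmult_le_compat_l; [lra|].
  apply Rmult_le_reg_r with (m * m * (m / 2)); [nra|].
  rewrite Rmult_assoc, Rinv_l by nra.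
  replace (eps * (m * m * (m / 2))) with (eps * m ^ 3 / 2) by field. lra.
Qed.

Lemma C_ex_derive_const (c z : C) : C_ex_derive (fun _ => c) z.
Proof. eexists; apply C_is_derive_const. Qed.
Lemma C_ex_derive_id (z : C) : C_ex_derive (fun w => w) z.
Proof. eexists; apply C_is_derive_id. Qed.
Lemma C_ex_derive_plus (f g : C -> C) (z : C) :
  C_ex_derive f z -> C_ex_derive g z -> C_ex_derive (fun w => f w + g w)%C z.
Proof. intros [a Ha] [b Hb]. eexists; apply C_is_derive_plus; eassumption. Qed.
Lemma C_ex_derive_mult (f g : C -> C) (z : C) :
  C_ex_derive f z -> C_ex_derive g z -> C_ex_derive (fun w => f w * g w)%C z.
Proof. intros [a Ha] [b Hb]. eexists; apply C_is_derive_mult; eassumption. Qed.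
Lemma C_ex_derive_comp (f g : C -> C) (z : C) :
  C_ex_derive g z -> C_ex_derive f (g z) -> C_ex_derive (fun w => f (g w)) z.
Proof. intros [a Ha] [b Hb]. eexists; eapply C_is_derive_comp; eassumption. Qed.
Lemma C_ex_derive_inv (f : C -> C) (z : C) :
  C_ex_derive f z -> f z <> 0 -> C_ex_derive (fun w => / f w)%C z.
Proof.
  intros H Hz. apply (C_ex_derive_comp (fun w => / w)%C f); [exact H|].
  eexists; apply C_is_derive_inv, Hz.
Qed.
Lemma C_is_derive_opp (f : C -> C) (z a : C) :
  C_is_derive f z a -> C_is_derive (fun w => - f w)%C z (- a)%C.
Proof.
  intros H. apply (C_is_derive_ext_ball (fun w => - (1) * f w)%C _ _ _ 1); [lra|intros; ring|].
  replace (- a)%C with (0 * f z + - (1) * a)%C by ring.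
  apply (C_is_derive_mult (fun _ => - (1))%C f); [apply C_is_derive_const|exact H].
Qed.
Lemma C_ex_derive_opp (f : C -> C) (z : C) :
  C_ex_derive f z -> C_ex_derive (fun w => - f w)%C z.
Proof. intros [a Ha]. eexists; apply C_is_derive_opp; eassumption. Qed.
Lemma C_ex_derive_minus (f g : C -> C) (z : C) :
  C_ex_derive f z -> C_ex_derive g z -> C_ex_derive (fun w => f w - g w)%C z.
Proof. intros Hf Hg. apply (C_ex_derive_plus f (fun w => - g w)%C); [|apply C_ex_derive_opp]; assumption. Qed.
Lemma C_ex_derive_div (f g : C -> C) (z : C) :
  C_ex_derive f z -> C_ex_derive g z -> g z <> 0 -> C_ex_derive (fun w => f w / g w)%C z.
Proof. intros Hf Hg H. apply (C_ex_derive_mult f (fun w => / g w)%C); [|apply C_ex_derive_inv]; assumption. Qed.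
Lemma C_ex_derive_pow (f : C -> C) (n : nat) (z : C) :
  C_ex_derive f z -> C_ex_derive (fun w => f w ^ n)%C z.
Proof.
  intros H. induction n as [|n IH]; simpl.
  - apply C_ex_derive_const.
  - apply C_ex_derive_mult; assumption.
Qed.

(** The inner derivative is over the reals and the outer one over [C], so a chain rule over a single
    field does not apply; the estimate is done by hand. *)
Lemma RC_is_derive_comp (f : C -> C) (g : R -> C) (t : R) (a b : C) :
  is_derive (V := C_R_NormedModule) g t a -> C_is_derive f (g t) b ->
  is_derive (V := C_R_NormedModule) (fun u => f (g u)) t (a * b)%C.
Proof.
  intros H1 H2. pose proof (RC_is_derive_eps_inv _ _ _ H1) as K1'. clear H1.
  apply RC_is_derive_eps. rewrite C_is_derive_eps in H2. intros eps He.
  set (M := Cmod a + Cmod b + 2).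
  pose proof (Cmod_ge_0 a); pose proof (Cmod_ge_0 b).
  assert (HM : 0 < M) by (unfold M; lra).
  assert (Hq : 0 < eps / (2 * M)) by (apply Rdiv_lt_0_compat; lra).
  destruct (K1' (Rmin 1 (eps / (2 * M)))) as [d1 [Hd1 K1]]; [apply Rmin_pos; lra|].
  destruct (H2 (eps / (2 * M)) Hq) as [d2 [Hd2 K2]].
  assert (Hd3 : 0 < d2 / M) by (apply Rdiv_lt_0_compat; lra).
  exists (Rmin d1 (d2 / M)). split; [repeat apply Rmin_pos; lra|]. intros h Hh.
  pose proof (Rmin_l d1 (d2 / M)). pose proof (Rmin_r d1 (d2 / M)).
  specialize (K1 h ltac:(lra)).
  pose proof (Rmin_l 1 (eps / (2 * M))). pose proof (Rmin_r 1 (eps / (2 * M))).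
  pose proof (Rabs_pos h).
  set (k := (g (t + h)%R - g t)%C) in *.
  assert (Hk : Cmod k <= M * Rabs h).
  { replace k with ((k - h * a) + h * a)%C by ring.
    eapply Rle_trans; [apply Cmod_triangle|]. rewrite Cmod_mult, Cmod_R.
    unfold M. nra. }
  assert (Hk2 : Cmod k < d2).
  { eapply Rle_lt_trans; [exact Hk|].
    apply Rlt_le_trans with (M * (d2 / M)); [apply Rmult_lt_compat_l; lra|].
    right; field; lra. }
  specialize (K2 _ Hk2). unfold k in K2 at 1. replace (g t + (g (t + h)%R - g t))%C with (g (t + h)) in K2 by ring.
  replace (f (g (t + h)%R) - f (g t) - h * (a * b))%C with
    ((f (g (t + h)%R) - f (g t) - k * b) + (k - h * a) * b)%C by ring.
  eapply Rle_trans; [apply Cmod_triangle|]. rewrite Cmod_mult.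
  assert (Q : eps / (2 * M) * M = eps / 2) by (field; lra).
  set (q := eps / (2 * M)) in *.
  assert (T1 : Cmod (f (g (t + h)%R) - f (g t) - k * b)%C <= eps / 2 * Rabs h).
  { eapply Rle_trans; [exact K2|]. rewrite <- Q. rewrite Rmult_assoc. apply Rmult_le_compat_l; lra. }
  assert (T2 : Cmod (k - h * a) * Cmod b <= (q * Rabs h) * M).
  { apply Rmult_le_compat; try apply Cmod_ge_0; [nra|unfold M; lra]. }
  nra.
Qed.

Lemma RC_is_derive_affine (a b : C) (t : R) :
  is_derive (V := C_R_NormedModule) (fun u : R => a + u * b)%C t b.
Proof.
  apply RC_is_derive_eps. intros eps He. exists 1. split; [lra|]. intros h _.
  rewrite RtoC_plus.
  replace (a + (t + h) * b - (a + t * b) - h * b)%C with (RtoC 0) by ring.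
  rewrite Cmod_0. pose proof (Rabs_pos h). nra.
Qed.

Lemma RC_is_derive_pair (f g : R -> R) (t a b : R) :
  is_derive f t a -> is_derive g t b ->
  is_derive (V := C_R_NormedModule) (fun u => (f u, g u)) t (a, b).
Proof.
  intros [_ H1] [_ H2]. apply RC_is_derive_eps. intros eps He.
  assert (He2 : 0 < eps / 2) by lra.
  destruct (H1 t (fun P HP => HP) (mkposreal _ He2)) as [d1 K1].
  destruct (H2 t (fun P HP => HP) (mkposreal _ He2)) as [d2 K2].
  exists (Rmin d1 d2). split; [apply Rmin_pos; apply cond_pos|]. intros h Hh.
  pose proof (Rmin_l d1 d2). pose proof (Rmin_r d1 d2).
  assert (B1 : @ball R_UniformSpace t d1 (t + h)).
  { unfold ball; simpl; unfold AbsRing_ball, abs, minus, plus, opp; simpl.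
    replace (t + h + - t) with h by ring. lra. }
  assert (B2 : @ball R_UniformSpace t d2 (t + h)).
  { unfold ball; simpl; unfold AbsRing_ball, abs, minus, plus, opp; simpl.
    replace (t + h + - t) with h by ring. lra. }
  specialize (K1 _ B1). specialize (K2 _ B2).
  unfold norm, minus, plus, opp, scal in K1, K2; simpl in K1, K2; unfold abs, mult in K1, K2; simpl in K1, K2.
  replace (t + h + - t) with h in K1, K2 by ring.
  eapply Rle_trans; [apply Cmod_le_abs|]. simpl.
  replace (f (t + h) + - f t + - (h * a - 0 * b)) with (f (t + h) + - f t + - (h * a)) by ring.
  replace (g (t + h) + - g t + - (h * b + 0 * a)) with (g (t + h) + - g t + - (h * b)) by ring.
  lra.
Qed.

Lemma RCcont_affine (f : C -> C) (a b : C) (t : R) :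
  Ccont f (a + t * b)%C -> RCcont (fun u => f (a + u * b)%C) t.
Proof.
  intros H eps He. destruct (H eps He) as [d [Hd K]].
  pose proof (Cmod_ge_0 b).
  exists (d / (1 + Cmod b)). split; [apply Rdiv_lt_0_compat; lra|].
  intros u Hu. apply K.
  replace (a + u * b - (a + t * b))%C with ((u - t)%R * b)%C by (rewrite RtoC_minus; ring).
  rewrite Cmod_mult, Cmod_R.
  apply Rmult_lt_compat_r with (r := 1 + Cmod b) in Hu; [|lra].
  replace (d / (1 + Cmod b) * (1 + Cmod b)) with d in Hu by (field; lra).
  pose proof (Rabs_pos (u - t)). nra.
Qed.

Lemma Ccont_continuous (f : C -> C) (z : C) : Ccont f z <->
  continuous (T := AbsRing_UniformSpace C_AbsRing) (U := AbsRing_UniformSpace C_AbsRing) f z.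
Proof.
  split.
  - intros H P [eps HP]. destruct (H eps (cond_pos eps)) as [d [Hd K]]. exists (mkposreal d Hd). intros w Hw. apply HP, (K w Hw).
  - intros H eps He. destruct (H _ (locally_ball (T := AbsRing_UniformSpace C_AbsRing) (f z) (mkposreal eps He))) as [d Hd].
    exists d. split; [apply cond_pos|]. intros w Hw. exact (Hd w Hw).
Qed.

Lemma Ccont_mult (f g : C -> C) (z : C) : Ccont f z -> Ccont g z -> Ccont (fun w => f w * g w)%C z.
Proof. rewrite !Ccont_continuous. exact (continuous_mult (U := AbsRing_UniformSpace C_AbsRing) (K := C_AbsRing) f g z). Qed.

Lemma Ccont_const (c z : C) : Ccont (fun _ => c) z.
Proof. apply C_ex_derive_cont, C_ex_derive_const. Qed.

Lemma Ccont_comp (f g : C -> C) (z : C) : Ccont g z -> Ccont f (g z) -> Ccont (fun w => f (g w)) z.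
Proof.
  intros Hg Hf eps He. destruct (Hf eps He) as [d [Hd K]]. destruct (Hg d Hd) as [d' [Hd' K']].
  exists d'. split; [exact Hd'|]. intros w Hw. apply K, K', Hw.
Qed.

Lemma Ccont_plus (f g : C -> C) (z : C) : Ccont f z -> Ccont g z -> Ccont (fun w => f w + g w)%C z.
Proof. rewrite !Ccont_continuous. exact (continuous_plus (U := AbsRing_UniformSpace C_AbsRing) (V := AbsRing_NormedModule C_AbsRing) f g z). Qed.

(** * Complex-valued integrals over real intervals *)

Definition CInt (f : R -> C) (a b : R) : C := RInt (V := C_R_CompleteNormedModule) f a b.
Definition ex_CInt (f : R -> C) (a b : R) : Prop := ex_RInt (V := C_R_NormedModule) f a b.
Definition is_CInt (f : R -> C) (a b : R) (l : C) : Prop := is_RInt (V := C_R_NormedModule) f a b l.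

Lemma CInt_correct f a b : ex_CInt f a b -> is_CInt f a b (CInt f a b).
Proof. apply (RInt_correct (V := C_R_CompleteNormedModule)). Qed.

Lemma is_CInt_unique f a b l : is_CInt f a b l -> CInt f a b = l.
Proof. apply (is_RInt_unique (V := C_R_CompleteNormedModule)). Qed.

Lemma ex_CInt_cont (f : R -> C) (a b : R) :
  (forall t, Rmin a b <= t <= Rmax a b -> RCcont f t) -> ex_CInt f a b.
Proof.
  intros H. apply (ex_RInt_continuous (V := C_R_CompleteNormedModule)).
  intros t Ht. apply RCcont_continuous, H, Ht.
Qed.

Lemma CInt_ext (f g : R -> C) (a b : R) :
  (forall t, Rmin a b < t < Rmax a b -> f t = g t) -> CInt f a b = CInt g a b.
Proof. apply (RInt_ext (V := C_R_CompleteNormedModule)). Qed.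

Lemma CInt_point f a : CInt f a a = 0.
Proof. exact (RInt_point (V := C_R_CompleteNormedModule) a f). Qed.

Lemma CInt_Chasles f a b c : ex_CInt f a b -> ex_CInt f b c -> (CInt f a b + CInt f b c)%C = CInt f a c.
Proof. exact (RInt_Chasles (V := C_R_CompleteNormedModule) f a b c). Qed.

Lemma is_CInt_plus f g a b l m :
  is_CInt f a b l -> is_CInt g a b m -> is_CInt (fun t => f t + g t)%C a b (l + m)%C.
Proof. exact (is_RInt_plus (V := C_R_NormedModule) f g a b l m). Qed.

Lemma is_CInt_pair_iff (f : R -> C) a b (l : C) :
  is_CInt f a b l <-> is_RInt (fun t => fst (f t)) a b (fst l) /\ is_RInt (fun t => snd (f t)) a b (snd l).
Proof.
  split.
  - intros H. split.
    + exact (@is_RInt_fct_extend_fst R_NormedModule R_NormedModule f a b l H).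
    + exact (@is_RInt_fct_extend_snd R_NormedModule R_NormedModule f a b l H).
  - intros [H1 H2]. destruct l as [l1 l2].
    exact (@is_RInt_fct_extend_pair R_NormedModule R_NormedModule f a b l1 l2 H1 H2).
Qed.

(** The integral is taken in a real module, which gives linearity for real scalars; complex scalars
    go through the real and imaginary parts. *)
Lemma is_CInt_Cmult (c : C) f a b l :
  is_CInt f a b l -> is_CInt (fun t => c * f t)%C a b (c * l)%C.
Proof.
  rewrite !is_CInt_pair_iff. intros [H1 H2]. destruct c as [c1 c2]. simpl. split.
  - apply (is_RInt_minus (V := R_NormedModule)); apply (is_RInt_scal (V := R_NormedModule)); assumption.
  - apply (is_RInt_plus (V := R_NormedModule)); apply (is_RInt_scal (V := R_NormedModule)); assumption.
Qed.

Lemma is_CInt_const (c : C) a b : is_CInt (fun _ => c) a b ((b - a)%R * c)%C.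
Proof.
  rewrite <- scal_R_Cmult. exact (is_RInt_const (V := C_R_NormedModule) a b c).
Qed.

Lemma ex_CInt_Cmult (c : C) f a b : ex_CInt f a b -> ex_CInt (fun t => c * f t)%C a b.
Proof. intros [l H]. eexists. apply is_CInt_Cmult, H. Qed.

Lemma ex_CInt_const (c : C) a b : ex_CInt (fun _ => c) a b.
Proof. eexists. apply is_CInt_const. Qed.

Lemma CInt_Cmult (c : C) f a b : ex_CInt f a b -> CInt (fun t => c * f t)%C a b = (c * CInt f a b)%C.
Proof. intros H. apply is_CInt_unique, is_CInt_Cmult, CInt_correct, H. Qed.

Lemma CInt_plus f g a b : ex_CInt f a b -> ex_CInt g a b ->
  CInt (fun t => f t + g t)%C a b = (CInt f a b + CInt g a b)%C.
Proof. intros H K. apply is_CInt_unique, is_CInt_plus; apply CInt_correct; assumption. Qed.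

Lemma CInt_const (c : C) a b : CInt (fun _ => c) a b = ((b - a)%R * c)%C.
Proof. apply is_CInt_unique, is_CInt_const. Qed.

Lemma is_CInt_ext f g a b l : (forall t, Rmin a b < t < Rmax a b -> f t = g t) ->
  is_CInt f a b l -> is_CInt g a b l.
Proof. apply (is_RInt_ext (V := C_R_NormedModule)). Qed.

Lemma ex_CInt_minus f g a b : ex_CInt f a b -> ex_CInt g a b -> ex_CInt (fun t => f t - g t)%C a b.
Proof.
  intros [l H] [m K]. eexists. apply (is_RInt_minus (V := C_R_NormedModule)); eassumption.
Qed.

Lemma CInt_minus f g a b : ex_CInt f a b -> ex_CInt g a b ->
  CInt (fun t => f t - g t)%C a b = (CInt f a b - CInt g a b)%C.
Proof.
  intros H K. apply is_CInt_unique.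
  exact (is_RInt_minus (V := C_R_NormedModule) _ _ _ _ _ _ (CInt_correct _ _ _ H) (CInt_correct _ _ _ K)).
Qed.

Lemma CInt_norm_le (f : R -> C) (g : R -> R) a b : a <= b -> ex_CInt f a b -> ex_RInt g a b ->
  (forall t, a <= t <= b -> Cmod (f t) <= g t) -> Cmod (CInt f a b) <= RInt g a b.
Proof.
  intros Hab Hf Hg H. rewrite <- norm_CR.
  apply (norm_RInt_le (V := C_R_NormedModule) f g a b _ _ Hab).
  - intros t Ht. rewrite norm_CR. apply H, Ht.
  - apply CInt_correct, Hf.
  - apply (RInt_correct (V := R_CompleteNormedModule)), Hg.
Qed.

Lemma CInt_norm_const (f : R -> C) (M : R) a b : a <= b -> ex_CInt f a b ->
  (forall t, a <= t <= b -> Cmod (f t) <= M) -> Cmod (CInt f a b) <= (b - a) * M.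
Proof.
  intros Hab Hf H. rewrite <- norm_CR.
  apply (norm_RInt_le_const (V := C_R_NormedModule) f a b _ _ Hab).
  - intros t Ht. rewrite norm_CR. apply H, Ht.
  - apply CInt_correct, Hf.
Qed.

Lemma is_CInt_derive (f df : R -> C) a b :
  (forall t, Rmin a b <= t <= Rmax a b -> is_derive (V := C_R_NormedModule) f t (df t)) ->
  (forall t, Rmin a b <= t <= Rmax a b -> RCcont df t) ->
  is_CInt df a b (f b - f a)%C.
Proof.
  intros H K. apply (is_RInt_derive (V := C_R_CompleteNormedModule) f df a b H).
  intros t Ht. apply RCcont_continuous, K, Ht.
Qed.

(** The fundamental theorem of calculus along the segment t -> p + tq, with dz = q dt. *)
Lemma is_CInt_primitive (F f : C -> C) (p q : C) a b :
  (forall t, Rmin a b <= t <= Rmax a b -> C_is_derive F (p + t * q)%C (f (p + t * q)%C)) ->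
  (forall t, Rmin a b <= t <= Rmax a b -> Ccont f (p + t * q)%C) ->
  is_CInt (fun t => q * f (p + t * q))%C a b (F (p + b * q) - F (p + a * q))%C.
Proof.
  intros H K. apply (is_CInt_derive (fun t => F (p + t * q)%C)).
  - intros t Ht. apply (RC_is_derive_comp F (fun t => p + t * q)%C); [apply RC_is_derive_affine|apply H, Ht].
  - intros t Ht. apply (RCcont_affine (fun z => q * f z)%C).
    apply Ccont_mult; [apply Ccont_const|apply K, Ht].
Qed.

Lemma is_CInt_ex f a b l : is_CInt f a b l -> ex_CInt f a b.
Proof. intros H. exists l. exact H. Qed.

#[global] Opaque C_is_derive CInt is_CInt ex_CInt.

(** * Complex exponential and principal logarithm *)

Lemma cexp_plus (z w : C) : cexp (z + w) = (cexp z * cexp w)%C.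
Proof.
  destruct z as [a b], w as [c d]. unfold cexp, Cplus, Cmult; simpl.
  rewrite exp_plus, cos_plus, sin_plus. f_equal; ring.
Qed.

Lemma cexp_0 : cexp 0 = 1.
Proof. unfold cexp; simpl. rewrite exp_0, cos_0, sin_0. unfold RtoC. f_equal; ring. Qed.

Lemma cexp_R (x : R) : cexp x = exp x.
Proof. unfold cexp; simpl. rewrite cos_0, sin_0. unfold RtoC. f_equal; ring. Qed.

Lemma Cmod_cexp (z : C) : Cmod (cexp z) = exp (fst z).
Proof.
  unfold Cmod, cexp; simpl.
  replace (exp (fst z) * cos (snd z) * (exp (fst z) * cos (snd z) * 1) +
           exp (fst z) * sin (snd z) * (exp (fst z) * sin (snd z) * 1))
    with (Rsqr (exp (fst z)) * (Rsqr (sin (snd z)) + Rsqr (cos (snd z)))) by (unfold Rsqr; ring).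
  rewrite sin2_cos2, Rmult_1_r. apply sqrt_Rsqr. left; apply exp_pos.
Qed.

Lemma cexp_nz (z : C) : cexp z <> 0.
Proof. apply Cmod_gt_0. rewrite Cmod_cexp. apply exp_pos. Qed.

Lemma cexp_opp (z : C) : cexp (- z) = (/ cexp z)%C.
Proof.
  assert (H : (cexp (- z) * cexp z)%C = 1).
  { rewrite <- cexp_plus. replace (- z + z)%C with (RtoC 0) by ring. apply cexp_0. }
  pose proof (cexp_nz z).
  replace (cexp (- z)) with (cexp (- z) * cexp z * / cexp z)%C by (field; assumption).
  rewrite H. ring.
Qed.

Lemma cexp_minus (z w : C) : cexp (z - w) = (cexp z / cexp w)%C.
Proof. unfold Cminus. rewrite cexp_plus, cexp_opp. reflexivity. Qed.

Lemma cexp_pow (z : C) (n : nat) : cexp (INR n * z) = (cexp z ^ n)%C.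
Proof.
  induction n as [|n IH].
  - simpl. replace (0 * z)%C with (RtoC 0) by ring. apply cexp_0.
  - rewrite S_INR, RtoC_plus. replace ((INR n + 1) * z)%C with (z + INR n * z)%C by ring.
    rewrite cexp_plus, IH. reflexivity.
Qed.

Lemma RC_is_derive_cexp_ray (h : C) (t : R) :
  is_derive (V := C_R_NormedModule) (fun u : R => cexp (u * h)) t (h * cexp (t * h))%C.
Proof.
  destruct h as [a b].
  apply (is_derive_ext (V := C_R_NormedModule) (fun u : R => (exp (u * a) * cos (u * b), exp (u * a) * sin (u * b)))).
  { intros u. unfold cexp, Cmult; simpl. replace (u * a - 0 * b) with (u * a) by ring.
    replace (u * b + 0 * a) with (u * b) by ring. reflexivity. }
  replace ((a, b) * cexp (t * (a, b)))%C with
    (a * (exp (t * a) * cos (t * b)) - b * (exp (t * a) * sin (t * b)),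
     a * (exp (t * a) * sin (t * b)) + b * (exp (t * a) * cos (t * b))).
  - apply (RC_is_derive_pair (fun u => exp (u * a) * cos (u * b)) (fun u => exp (u * a) * sin (u * b)));
      auto_derive; try exact I; ring.
  - unfold cexp, Cmult; simpl. replace (t * a - 0 * b) with (t * a) by ring.
    replace (t * b + 0 * a) with (t * b) by ring. f_equal; ring.
Qed.

Lemma RCcont_derive (f : R -> C) (t : R) (l : C) :
  is_derive (V := C_R_NormedModule) f t l -> RCcont f t.
Proof.
  intros H eps He. destruct (RC_is_derive_eps_inv _ _ _ H 1 ltac:(lra)) as [d [Hd K]].
  pose proof (Cmod_ge_0 l).
  exists (Rmin d (eps / (2 + Cmod l))). split; [apply Rmin_pos; [lra|apply Rdiv_lt_0_compat; lra]|].
  intros u Hu.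
  pose proof (Rmin_l d (eps / (2 + Cmod l))). pose proof (Rmin_r d (eps / (2 + Cmod l))).
  specialize (K (u - t) ltac:(lra)). replace (t + (u - t)) with u in K by ring.
  assert (Hu2 : Rabs (u - t) < eps / (2 + Cmod l)) by lra.
  apply Rmult_lt_compat_r with (r := 2 + Cmod l) in Hu2; [|lra].
  replace (eps / (2 + Cmod l) * (2 + Cmod l)) with eps in Hu2 by (field; lra).
  replace (f u - f t)%C with ((f u - f t - (u - t)%R * l) + (u - t)%R * l)%C by ring.
  eapply Rle_lt_trans; [apply Cmod_triangle|]. rewrite Cmod_mult, Cmod_R.
  pose proof (Rabs_pos (u - t)). nra.
Qed.

(** e^h - 1 is the integral of h e^{th} over 0 <= t <= 1, and |e^{th}| <= e^{|h|}. Only the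
    derivative along a real ray is needed, which comes from components; complex differentiability of
    [cexp] is deduced afterwards. *)
Lemma cexp_bound1 (h : C) : Cmod (cexp h - 1)%C <= Cmod h * exp (Cmod h).
Proof.
  assert (H : is_CInt (fun t : R => h * cexp (t * h))%C 0 1 (cexp h - 1)%C).
  { replace (cexp h - 1)%C with (cexp (1 * h) - cexp (0 * h))%C.
    2:{ replace (0 * h)%C with (RtoC 0) by ring. rewrite cexp_0. f_equal. f_equal. ring. }
    apply (is_CInt_derive (fun t : R => cexp (t * h))).
    - intros t _. apply RC_is_derive_cexp_ray.
    - intros t _.
      assert (K : is_derive (V := C_R_NormedModule) (fun u : R => (fun z => h * z)%C (cexp (u * h))) t (h * cexp (t * h) * h)%C).
      { apply (RC_is_derive_comp (fun z => h * z)%C (fun u : R => cexp (u * h))); [apply RC_is_derive_cexp_ray|].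
        evar_last; [apply (C_is_derive_mult (fun _ => h) (fun z => z)); [apply C_is_derive_const|apply C_is_derive_id]|].
        simpl. ring. }
      eapply RCcont_derive, K. }
  rewrite <- (is_CInt_unique _ _ _ _ H).
  replace (Cmod h * exp (Cmod h)) with ((1 - 0) * (Cmod h * exp (Cmod h))) by ring.
  apply CInt_norm_const; [lra|eapply is_CInt_ex, H|].
  intros t Ht. rewrite Cmod_mult, Cmod_cexp. apply Rmult_le_compat_l; [apply Cmod_ge_0|].
  assert (fst (t * h)%C <= Cmod h).
  { destruct h as [a b]; simpl. pose proof (fst_le_Cmod (a, b)) as F. simpl in F.
    pose proof (Rle_abs a). pose proof (Rabs_pos a). nra. }
  destruct H0 as [H0|H0]; [left; apply exp_increasing, H0|rewrite H0; lra].
Qed.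

Lemma exp_le_compat (x y : R) : x <= y -> exp x <= exp y.
Proof. intros [H|H]; [left; apply exp_increasing, H|rewrite H; lra]. Qed.

(** The remainder is the integral of h (e^{th} - 1) over 0 <= t <= 1, to which the first-order bound
    applies. *)
Lemma cexp_bound2 (h : C) : Cmod (cexp h - 1 - h)%C <= Cmod h ^ 2 * exp (Cmod h).
Proof.
  assert (D : forall t, is_derive (V := C_R_NormedModule) (fun u : R => h * (cexp (u * h) - 1))%C t (h * (h * cexp (t * h)))%C).
  { intros t. replace (h * (h * cexp (t * h)))%C with ((h * cexp (t * h)) * h)%C by ring.
    apply (RC_is_derive_comp (fun z => h * (z - 1))%C (fun u : R => cexp (u * h))); [apply RC_is_derive_cexp_ray|].
    apply (C_is_derive_ext_ball (fun z => h * z + h * - (1))%C _ _ _ 1); [lra|intros; ring|].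
    replace h with ((0 * cexp (t * h) + h * 1) + 0)%C at 2 by ring.
    apply (C_is_derive_plus (fun z => h * z)%C (fun _ => h * - (1))%C); [|apply C_is_derive_const].
    apply (C_is_derive_mult (fun _ => h) (fun z => z)); [apply C_is_derive_const|apply C_is_derive_id]. }
  assert (H : is_CInt (fun t : R => h * (cexp (t * h) - 1))%C 0 1 (cexp h - 1 - h)%C).
  { replace (cexp h - 1 - h)%C with ((cexp (1 * h) - 1 * h) - (cexp (0 * h) - 0 * h))%C.
    2:{ replace (0 * h)%C with (RtoC 0) by ring. rewrite cexp_0. replace (1 * h)%C with h by ring. ring. }
    apply (is_CInt_derive (fun t : R => cexp (t * h) - t * h)%C).
    - intros t _.
      replace (h * (cexp (t * h) - 1))%C with (h * (cexp (0 + t * h)  - 1))%C by (do 3 f_equal; ring).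
      assert (E : forall u : R, (cexp (u * h) - u * h)%C = (fun z => cexp z + - z)%C (0 + u * h)%C).
      { intros u. replace (0 + u * h)%C with (u * h)%C by ring. reflexivity. }
      apply (is_derive_ext (V := C_R_NormedModule) (fun u : R => (cexp (u * h) + - (0 + u * h))%C)).
      { intros u. replace (0 + u * h)%C with (u * h)%C by ring. reflexivity. }
      replace (h * (cexp (0 + t * h) - 1))%C with (plus (h * cexp (t * h))%C (- h)%C : C).
      2:{ unfold plus; simpl. replace (0 + t * h)%C with (t * h)%C by ring.
          match goal with |- ?x = ?y => change (@eq C x y) end.
          change (h * cexp (t * h) + - h = h * (cexp (t * h) - 1))%C. ring. }
      apply (is_derive_plus (V := C_R_NormedModule)); [apply RC_is_derive_cexp_ray|].
      replace (- h)%C with (h * - (1))%C by ring.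
      apply (RC_is_derive_comp (fun z => - z)%C (fun u : R => 0 + u * h)%C); [apply RC_is_derive_affine|].
      apply (C_is_derive_opp (fun z => z)). apply C_is_derive_id.
    - intros t _. eapply RCcont_derive, D. }
  rewrite <- (is_CInt_unique _ _ _ _ H).
  replace (Cmod h ^ 2 * exp (Cmod h)) with ((1 - 0) * (Cmod h * (Cmod h * exp (Cmod h)))) by ring.
  apply CInt_norm_const; [lra|eapply is_CInt_ex, H|].
  intros t Ht. rewrite Cmod_mult. apply Rmult_le_compat_l; [apply Cmod_ge_0|].
  eapply Rle_trans; [apply cexp_bound1|].
  assert (Cmod (t * h)%C <= Cmod h).
  { rewrite Cmod_mult, Cmod_R, Rabs_pos_eq by lra. pose proof (Cmod_ge_0 h). nra. }
  apply Rmult_le_compat; [apply Cmod_ge_0|left; apply exp_pos|assumption|apply exp_le_compat; assumption].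
Qed.

Lemma exp_1_lt_3 : exp 1 <= 3.
Proof. apply exp_le_3. Qed.

Lemma C_is_derive_cexp (z : C) : C_is_derive cexp z (cexp z).
Proof.
  apply C_is_derive_eps. intros eps He.
  pose proof (Cmod_cexp z) as M. pose proof (exp_pos (fst z)) as P. rewrite <- M in P.
  exists (Rmin 1 (eps / (3 * Cmod (cexp z)))). split.
  { apply Rmin_pos; [lra|apply Rdiv_lt_0_compat; lra]. }
  intros h Hh.
  pose proof (Rmin_l 1 (eps / (3 * Cmod (cexp z)))). pose proof (Rmin_r 1 (eps / (3 * Cmod (cexp z)))).
  rewrite cexp_plus.
  replace (cexp z * cexp h - cexp z - h * cexp z)%C with (cexp z * (cexp h - 1 - h))%C by ring.
  rewrite Cmod_mult.
  assert (B : Cmod (cexp h - 1 - h)%C <= 3 * Cmod h ^ 2).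
  { eapply Rle_trans; [apply cexp_bound2|]. rewrite Rmult_comm. apply Rmult_le_compat_r; [apply pow2_ge_0|].
    eapply Rle_trans; [apply exp_le_compat with (y := 1); lra|apply exp_1_lt_3]. }
  pose proof (Cmod_ge_0 h).
  assert (Hh2 : Cmod h <= eps / (3 * Cmod (cexp z))) by lra.
  apply Rmult_le_compat_r with (r := 3 * Cmod (cexp z)) in Hh2; [|lra].
  replace (eps / (3 * Cmod (cexp z)) * (3 * Cmod (cexp z))) with eps in Hh2 by (field; lra).
  apply Rle_trans with (Cmod (cexp z) * (3 * Cmod h ^ 2)); [apply Rmult_le_compat_l; lra|].
  replace (Cmod (cexp z) * (3 * Cmod h ^ 2)) with (Cmod h * (3 * Cmod (cexp z)) * Cmod h) by ring.
  apply Rmult_le_compat_r; lra.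
Qed.

Lemma C_ex_derive_cexp (f : C -> C) (z : C) : C_ex_derive f z -> C_ex_derive (fun w => cexp (f w)) z.
Proof. intros H. apply (C_ex_derive_comp cexp f); [exact H|]. eexists; apply C_is_derive_cexp. Qed.

(** By 1 - cos x = 2 sin^2(x/2) and positivity of the sine on (0, pi). It gives the uniqueness of
    the principal logarithm and, later, the equality case in the non-arithmetic condition. *)
Lemma cos_eq_1 (x : R) : Rabs x < 2 * PI -> cos x = 1 -> x = 0.
Proof.
  intros Hx H.
  assert (S : sin (x / 2) = 0).
  { replace x with (2 * (x / 2)) in H by field. rewrite cos_2a_sin in H.
    assert (sin (x / 2) * sin (x / 2) = 0) by lra. nra. }
  destruct (Rtotal_order x 0) as [L|[E|G]]; [|exact E|].
  - exfalso. assert (0 < sin (- (x / 2))).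
    { apply sin_gt_0; [lra|]. rewrite Rabs_left in Hx; lra. }
    rewrite sin_neg in H0. lra.
  - exfalso. assert (0 < sin (x / 2)).
    { apply sin_gt_0; [lra|]. rewrite Rabs_right in Hx; lra. }
    lra.
Qed.

(** Two candidates differ by a number whose exponential is 1 and whose imaginary part is below 2 pi
    in absolute value. *)
Lemma Clog_unique (w L : C) : cexp L = w -> - PI < snd L <= PI -> Clog w = L.
Proof.
  intros H1 H2.
  assert (K : cexp (Clog w) = w /\ - PI < snd (Clog w) <= PI).
  { unfold Clog. apply epsilon_spec. exists L. split; assumption. }
  destruct K as [K1 K2]. set (M := Clog w) in *.
  assert (E : cexp M = cexp L) by congruence.
  assert (E1 : fst M = fst L).
  { apply exp_inv. rewrite <- !Cmod_cexp. congruence. }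
  assert (E3 : cexp (M - L) = 1).
  { rewrite cexp_minus, E. field. apply cexp_nz. }
  assert (E2 : snd M = snd L).
  { destruct M as [m1 m2], L as [l1 l2]; simpl in *. subst l1.
    unfold cexp in E3; simpl in E3. apply (f_equal fst) in E3. simpl in E3.
    replace (m1 + - m1) with 0 in E3 by ring. rewrite exp_0, Rmult_1_l in E3.
    apply cos_eq_1 in E3; [lra|]. apply Rabs_def1; lra. }
  destruct M, L; simpl in *; congruence.
Qed.

Lemma Clog_pos (w : C) : 0 < fst w -> Clog w = (ln (Cmod w), atan (snd w / fst w)).
Proof.
  intros H.
  pose proof (atan_bound (snd w / fst w)) as [A1 A2]. pose proof PI_RGT_0.
  assert (P : 0 < Cmod w).
  { eapply Rlt_le_trans; [|apply fst_le_Cmod]. rewrite Rabs_pos_eq; lra. }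
  apply Clog_unique; [|simpl; lra].
  unfold cexp; simpl. rewrite exp_ln by exact P.
  destruct w as [x y]; simpl in *.
  assert (Q : Cmod (x, y) = x * sqrt (1 + (y / x)²)).
  { unfold Cmod; simpl. rewrite <- (sqrt_Rsqr x) at 3 by lra. rewrite <- sqrt_mult_alt by apply Rle_0_sqr.
    f_equal. unfold Rsqr. field. lra. }
  assert (S : 0 < sqrt (1 + (y / x)²)).
  { apply sqrt_lt_R0. pose proof (Rle_0_sqr (y / x)). lra. }
  rewrite cos_atan, sin_atan, Q. f_equal; field; lra.
Qed.

Lemma cexp_Clog (w : C) : 0 < fst w -> cexp (Clog w) = w.
Proof.
  intros H.
  assert (K : exists L, cexp L = w /\ - PI < snd L <= PI).
  { exists (ln (Cmod w), atan (snd w / fst w)).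
    pose proof (Clog_pos w H) as E.
    pose proof (atan_bound (snd w / fst w)) as [A1 A2]. pose proof PI_RGT_0.
    split; [|simpl; lra].
    assert (P : 0 < Cmod w).
    { eapply Rlt_le_trans; [|apply fst_le_Cmod]. rewrite Rabs_pos_eq; lra. }
    unfold cexp; simpl. rewrite exp_ln by exact P.
    destruct w as [x y]; simpl in *.
    assert (Q : Cmod (x, y) = x * sqrt (1 + (y / x)²)).
    { unfold Cmod; simpl. rewrite <- (sqrt_Rsqr x) at 3 by lra. rewrite <- sqrt_mult_alt by apply Rle_0_sqr.
      f_equal. unfold Rsqr. field. lra. }
    assert (S : 0 < sqrt (1 + (y / x)²)).
    { apply sqrt_lt_R0. pose proof (Rle_0_sqr (y / x)). lra. }
    rewrite cos_atan, sin_atan, Q. f_equal; field; lra. }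
  unfold Clog. apply (epsilon_spec _ _ K).
Qed.

Lemma Clog_mult (a b : C) : 0 < fst a -> 0 < fst b -> Clog (a * b) = (Clog a + Clog b)%C.
Proof.
  intros Ha Hb. apply Clog_unique.
  - rewrite cexp_plus, !cexp_Clog by assumption. reflexivity.
  - rewrite !Clog_pos by assumption. simpl.
    pose proof (atan_bound (snd a / fst a)) as [A1 A2].
    pose proof (atan_bound (snd b / fst b)) as [B1 B2]. lra.
Qed.

Lemma Clog_R (x : R) : 0 < x -> Clog x = ln x.
Proof.
  intros H. rewrite Clog_pos by (simpl; lra). simpl.
  rewrite Cmod_R, Rabs_pos_eq by lra. replace (0 / x) with 0 by (field; lra). rewrite atan_0. reflexivity.
Qed.

Lemma atan_le_id (x : R) : 0 <= x -> 0 <= atan x <= x.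
Proof.
  intros [H|H]; [|subst x; rewrite atan_0; lra].
  destruct (MVT_gen atan 0 x (fun t => / (1 + t ^ 2))) as [c [Hc E]].
  - intros t _. auto_derive; [exact I|]. unfold Rsqr. field. nra.
  - intros t _. apply derivable_continuous_pt, derivable_pt_atan.
  - rewrite atan_0 in E.
    assert (0 < / (1 + c ^ 2) <= 1).
    { pose proof (pow2_ge_0 c). split; [apply Rinv_0_lt_compat; lra|]. apply Rle_trans with (/ 1); [apply Rinv_le_contravar; lra|rewrite Rinv_1; lra]. }
    nra.
Qed.

Lemma Rabs_atan_le (x : R) : Rabs (atan x) <= Rabs x.
Proof.
  destruct (Rle_dec 0 x) as [H|H].
  - pose proof (atan_le_id x H). rewrite !Rabs_pos_eq; lra.
  - assert (H' : 0 <= - x) by lra. pose proof (atan_le_id (- x) H') as K. rewrite atan_opp in K.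
    rewrite !Rabs_left1; lra.
Qed.

Lemma ln_le_sub1 (y : R) : 0 < y -> ln y <= y - 1.
Proof.
  intros H. pose proof (exp_ineq1_le (ln y)) as E. rewrite exp_ln in E by exact H. lra.
Qed.

Lemma ln_ge_1_sub_inv (y : R) : 0 < y -> 1 - / y <= ln y.
Proof.
  intros H. pose proof (ln_le_sub1 (/ y) (Rinv_0_lt_compat _ H)) as E. rewrite ln_Rinv in E by exact H. lra.
Qed.

Lemma fst_1p_pos (p : C) : Cmod p < 1 -> 0 < fst (1 + p)%C.
Proof.
  intros H. simpl. pose proof (fst_le_Cmod p). pose proof (Rabs_def2 (fst p) 1 ltac:(lra)). lra.
Qed.

Lemma Clog_1p_bound (p : C) : Cmod p <= / 2 -> Cmod (Clog (1 + p)) <= 4 * Cmod p.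
Proof.
  intros H. pose proof (Cmod_ge_0 p) as H0.
  assert (Q : 0 < fst (1 + p)%C) by (apply fst_1p_pos; lra).
  rewrite Clog_pos by exact Q.
  eapply Rle_trans; [apply Cmod_le_abs|]. cbn [fst snd].
  assert (M1 : Cmod (1 + p) <= 1 + Cmod p).
  { eapply Rle_trans; [apply Cmod_triangle|]. rewrite Cmod_1. lra. }
  assert (M2 : 1 - Cmod p <= Cmod (1 + p)).
  { pose proof (Cmod_rev_triangle 1 (- p)) as T. rewrite Cmod_1, Cmod_opp in T.
    replace (1 - - p)%C with (1 + p)%C in T by ring. lra. }
  assert (A : Rabs (ln (Cmod (1 + p))) <= 2 * Cmod p).
  { pose proof (ln_le_sub1 (Cmod (1 + p)) ltac:(lra)).
    pose proof (ln_ge_1_sub_inv (Cmod (1 + p)) ltac:(lra)).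
    assert (/ Cmod (1 + p) <= 1 + 2 * Cmod p).
    { apply Rmult_le_reg_r with (Cmod (1 + p)); [lra|]. rewrite Rinv_l by lra. nra. }
    apply Rabs_le. lra. }
  assert (B : Rabs (atan (snd (1 + p)%C / fst (1 + p)%C)) <= 2 * Cmod p).
  { eapply Rle_trans; [apply Rabs_atan_le|]. unfold Rdiv. rewrite Rabs_mult.
    rewrite (Rabs_pos_eq (/ _)) by (left; apply Rinv_0_lt_compat, Q).
    pose proof (snd_le_Cmod p). pose proof (fst_le_Cmod p).
    replace (snd (1 + p)%C) with (snd p) by (simpl; ring).
    assert (/ 2 <= fst (1 + p)%C).
    { simpl. pose proof (Rabs_le_between (fst p) (/ 2)) as [W _]. specialize (W ltac:(lra)). lra. }
    rewrite (Rmult_comm 2). apply Rmult_le_compat; [apply Rabs_pos|left; apply Rinv_0_lt_compat, Q|lra|].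
    replace 2 with (/ / 2) by field. apply Rinv_le_contravar; lra. }
  lra.
Qed.

(** With L = log(1 + p) the difference is L - (e^L - 1), so the quadratic bound for the exponential
    applies; |L| <= 4|p| <= 1 gives the constant 16 * 3. *)
Lemma Clog_1p_bound2 (p : C) : Cmod p <= / 4 -> Cmod (Clog (1 + p) - p) <= 48 * Cmod p ^ 2.
Proof.
  intros H. pose proof (Cmod_ge_0 p) as H0.
  pose proof (Clog_1p_bound p ltac:(lra)) as B. set (L := Clog (1 + p)) in *.
  assert (E : p = (cexp L - 1)%C).
  { unfold L. rewrite cexp_Clog by (apply fst_1p_pos; lra). ring. }
  rewrite E at 1. rewrite Cmod_minus_sym.
  replace (cexp L - 1 - L)%C with (cexp L - 1 - L)%C by ring.
  eapply Rle_trans; [apply cexp_bound2|].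
  pose proof (Cmod_ge_0 L).
  assert (exp (Cmod L) <= 3).
  { eapply Rle_trans; [apply exp_le_compat with (y := 1); lra|apply exp_1_lt_3]. }
  pose proof (exp_pos (Cmod L)).
  assert (Cmod L ^ 2 <= 16 * Cmod p ^ 2) by nra.
  pose proof (pow2_ge_0 (Cmod p)).
  nra.
Qed.

Lemma C_is_derive_Clog (w : C) : 0 < fst w -> C_is_derive Clog w (/ w)%C.
Proof.
  intros Hw. apply C_is_derive_eps. intros eps He.
  assert (P : 0 < Cmod w).
  { eapply Rlt_le_trans; [|apply fst_le_Cmod]. rewrite Rabs_pos_eq; lra. }
  assert (Nw : w <> 0) by (apply Cmod_gt_0, P).
  set (m := Cmod w) in *.
  exists (Rmin (m / 4) (eps * m ^ 2 / 48)). split.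
  { apply Rmin_pos; [lra|]. apply Rdiv_lt_0_compat; [|lra]. apply Rmult_lt_0_compat; [lra|apply pow_lt; lra]. }
  intros h Hh.
  pose proof (Rmin_l (m / 4) (eps * m ^ 2 / 48)). pose proof (Rmin_r (m / 4) (eps * m ^ 2 / 48)).
  (* log(w + h) = log w + log(1 + p), so the derivative at [w] reduces to the expansion at 1. *)
  set (p := (h / w)%C).
  assert (Ep : Cmod p = Cmod h / m) by (unfold p; rewrite Cmod_div by exact Nw; reflexivity).
  pose proof (Cmod_ge_0 h).
  assert (Hp : Cmod p <= / 4).
  { rewrite Ep. apply Rmult_le_reg_r with m; [lra|]. unfold Rdiv. rewrite Rmult_assoc, Rinv_l by lra. lra. }
  replace (w + h)%C with (w * (1 + p))%C by (unfold p; field; exact Nw).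
  rewrite Clog_mult by (try apply fst_1p_pos; lra).
  replace (Clog w + Clog (1 + p) - Clog w - h * / w)%C with (Clog (1 + p) - p)%C by (unfold p; field; exact Nw).
  eapply Rle_trans; [apply Clog_1p_bound2, Hp|]. rewrite Ep.
  apply Rmult_le_reg_r with (m ^ 2); [apply pow_lt; lra|].
  replace (48 * (Cmod h / m) ^ 2 * m ^ 2) with (48 * Cmod h * Cmod h) by (field; lra).
  replace (eps * Cmod h * m ^ 2) with (eps * m ^ 2 * Cmod h) by ring.
  apply Rmult_le_compat_r; lra.
Qed.

Lemma C_ex_derive_Clog (f : C -> C) (z : C) : C_ex_derive f z -> 0 < fst (f z) -> C_ex_derive (fun w => Clog (f w)) z.
Proof. intros H Hz. apply (C_ex_derive_comp Clog f); [exact H|]. eexists; apply C_is_derive_Clog, Hz. Qed.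

(** * Goursat's theorem on rectangles *)

Lemma RCcont_horizontal (G : C -> C) (y t : R) : Ccont G (t, y) -> RCcont (fun u => G (u, y)) t.
Proof.
  intros H eps He. destruct (H eps He) as [d [Hd K]]. exists d. split; [exact Hd|].
  intros u Hu. apply K. eapply Rle_lt_trans; [apply Cmod_le_abs|]. simpl.
  replace (y + - y) with 0 by ring. rewrite Rabs_R0, Rplus_0_r. exact Hu.
Qed.

Lemma RCcont_vertical (G : C -> C) (x t : R) : Ccont G (x, t) -> RCcont (fun u => G (x, u)) t.
Proof.
  intros H eps He. destruct (H eps He) as [d [Hd K]]. exists d. split; [exact Hd|].
  intros u Hu. apply K. eapply Rle_lt_trans; [apply Cmod_le_abs|]. simpl.
  replace (x + - x) with 0 by ring. rewrite Rabs_R0, Rplus_0_l. exact Hu.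
Qed.

Lemma CInt_horizontal (F f : C -> C) (y a b : R) :
  (forall t, Rmin a b <= t <= Rmax a b -> C_is_derive F (t, y) (f (t, y))) ->
  (forall t, Rmin a b <= t <= Rmax a b -> Ccont f (t, y)) ->
  CInt (fun t => f (t, y)) a b = (F (b, y) - F (a, y))%C.
Proof.
  intros H K.
  assert (E : forall t : R, ((0, y) + t * 1)%C = (t, y)).
  { intros t. unfold Cplus, Cmult, RtoC; simpl. f_equal; ring. }
  rewrite <- (E a), <- (E b).
  apply is_CInt_unique.
  apply (is_CInt_ext (fun t : R => 1 * f ((0, y) + t * 1))%C).
  { intros t _. rewrite E. ring. }
  apply is_CInt_primitive; intros t Ht; rewrite E; auto.
Qed.

Lemma CInt_vertical (F f : C -> C) (x a b : R) :
  (forall t, Rmin a b <= t <= Rmax a b -> C_is_derive F (x, t) (f (x, t))) ->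
  (forall t, Rmin a b <= t <= Rmax a b -> Ccont f (x, t)) ->
  (Ci * CInt (fun t => f (x, t)) a b)%C = (F (x, b) - F (x, a))%C.
Proof.
  intros H K.
  assert (E : forall t : R, ((x, 0) + t * Ci)%C = (x, t)).
  { intros t. unfold Cplus, Cmult, RtoC, Ci; simpl. f_equal; ring. }
  rewrite <- CInt_Cmult.
  2:{ apply ex_CInt_cont. intros t Ht. apply RCcont_vertical, K, Ht. }
  rewrite <- (E a), <- (E b).
  apply is_CInt_unique.
  apply (is_CInt_ext (fun t : R => Ci * f ((x, 0) + t * Ci))%C).
  { intros t _. rewrite E. ring. }
  apply is_CInt_primitive; intros t Ht; rewrite E; auto.
Qed.

(** The integral over the counterclockwise boundary of [a, a+h] x [b, b+k], with dz = i dt on the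
    vertical sides. *)
Definition rect_int (G : C -> C) (a b h k : R) : C :=
  (CInt (fun t => G (t, b)) a (a + h) + Ci * CInt (fun t => G ((a + h)%R, t)) b (b + k)
   - CInt (fun t => G (t, (b + k)%R)) a (a + h) - Ci * CInt (fun t => G (a, t)) b (b + k))%C.

Definition cont_rect (G : C -> C) (a b h k : R) : Prop :=
  forall x y, a <= x <= a + h -> b <= y <= b + k -> Ccont G (x, y).

Lemma ex_CInt_horizontal (G : C -> C) (y a b : R) : a <= b ->
  (forall t, a <= t <= b -> Ccont G (t, y)) -> ex_CInt (fun t => G (t, y)) a b.
Proof.
  intros Hab H. apply ex_CInt_cont. intros t Ht. rewrite Rmin_left, Rmax_right in Ht by lra.
  apply RCcont_horizontal, H, Ht.
Qed.

Lemma ex_CInt_vertical (G : C -> C) (x a b : R) : a <= b ->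
  (forall t, a <= t <= b -> Ccont G (x, t)) -> ex_CInt (fun t => G (x, t)) a b.
Proof.
  intros Hab H. apply ex_CInt_cont. intros t Ht. rewrite Rmin_left, Rmax_right in Ht by lra.
  apply RCcont_vertical, H, Ht.
Qed.

(** The four inner sides are traversed twice, in opposite directions. Writing the sides as [h + h]
    and [k + k] avoids halves. *)
Lemma rect_int_split (G : C -> C) (a b h k : R) : 0 < h -> 0 < k ->
  cont_rect G a b (h + h) (k + k) ->
  rect_int G a b (h + h) (k + k) =
  (rect_int G a b h k + rect_int G (a + h) b h k
   + rect_int G a (b + k) h k + rect_int G (a + h) (b + k) h k)%C.
Proof.
  intros Hh Hk HG. unfold rect_int.
  rewrite <- !Rplus_assoc.
  assert (X : forall y, b <= y <= b + k + k ->
    CInt (fun t => G (t, y)) a (a + h + h) = (CInt (fun t => G (t, y)) a (a + h) + CInt (fun t => G (t, y)) (a + h) (a + h + h))%C).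
  { intros y Hy. symmetry. apply CInt_Chasles; apply ex_CInt_horizontal; try lra; intros t Ht; apply HG; lra. }
  assert (Y : forall x, a <= x <= a + h + h ->
    CInt (fun t => G (x, t)) b (b + k + k) = (CInt (fun t => G (x, t)) b (b + k) + CInt (fun t => G (x, t)) (b + k) (b + k + k))%C).
  { intros x Hx. symmetry. apply CInt_Chasles; apply ex_CInt_vertical; try lra; intros t Ht; apply HG; lra. }
  rewrite !X by lra. rewrite !Y by lra. ring.
Qed.

Lemma rect_int_quarter (G : C -> C) (a b h k : R) : 0 < h -> 0 < k ->
  cont_rect G a b (h + h) (k + k) ->
  exists a' b', (a' = a \/ a' = a + h) /\ (b' = b \/ b' = b + k) /\
    Cmod (rect_int G a b (h + h) (k + k)) <= 4 * Cmod (rect_int G a' b' h k).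
Proof.
  intros Hh Hk HG. apply NNPP. intros N.
  pose proof (rect_int_split G a b h k Hh Hk HG) as S.
  set (M := Cmod (rect_int G a b (h + h) (k + k))) in *.
  assert (A : forall a' b', (a' = a \/ a' = a + h) -> (b' = b \/ b' = b + k) ->
    4 * Cmod (rect_int G a' b' h k) < M).
  { intros a' b' Ha Hb. apply Rnot_le_lt. intros L. apply N. exists a', b'. auto. }
  assert (M <= Cmod (rect_int G a b h k) + Cmod (rect_int G (a + h) b h k)
   + Cmod (rect_int G a (b + k) h k) + Cmod (rect_int G (a + h) (b + k) h k)).
  { unfold M. rewrite S.
    eapply Rle_trans; [apply Cmod_triangle|]. apply Rplus_le_compat_r.
    eapply Rle_trans; [apply Cmod_triangle|]. apply Rplus_le_compat_r.
    apply Cmod_triangle. }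
  pose proof (A a b (or_introl eq_refl) (or_introl eq_refl)).
  pose proof (A a _ (or_introl eq_refl) (or_intror eq_refl)).
  pose proof (A _ b (or_intror eq_refl) (or_introl eq_refl)).
  pose proof (A _ _ (or_intror eq_refl) (or_intror eq_refl)).
  lra.
Qed.

Lemma dependent_choice_nat {X : Type} (P : nat -> X -> Prop) (Q : nat -> X -> X -> Prop) (x0 : X) :
  P O x0 -> (forall n x, P n x -> exists y, P (S n) y /\ Q n x y) ->
  exists f : nat -> X, f O = x0 /\ forall n, P n (f n) /\ Q n (f n) (f (S n)).
Proof.
  intros H0 HS.
  set (f := fix f n := match n with O => x0 | S m => epsilon (inhabits x0) (fun y => P (S m) y /\ Q m (f m) y) end).
  exists f. split; [reflexivity|].
  assert (HP : forall n, P n (f n)).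
  { induction n as [|n IH]; [exact H0|].
    destruct (epsilon_spec (inhabits x0) (fun y => P (S n) y /\ Q n (f n) y) (HS n (f n) IH)) as [K _]. exact K. }
  intros n. split; [apply HP|].
  destruct (epsilon_spec (inhabits x0) (fun y => P (S n) y /\ Q n (f n) y) (HS n (f n) (HP n))) as [_ K]. exact K.
Qed.

Lemma half_pow_succ (h : R) (n : nat) : h / 2 ^ n = h / 2 ^ S n + h / 2 ^ S n.
Proof. simpl. field. apply pow_nonzero. lra. Qed.

Lemma div_pow2_pos (h : R) (n : nat) : 0 < h -> 0 < h / 2 ^ n.
Proof. intros H. apply Rdiv_lt_0_compat; [exact H|]. apply pow_lt. lra. Qed.

Lemma is_lim_seq_div_pow2 (h : R) : is_lim_seq (fun n => h / 2 ^ n) 0.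
Proof.
  apply is_lim_seq_ext with (fun n => h * (/ 2) ^ n).
  { intros n. unfold Rdiv. rewrite pow_inv. reflexivity. }
  replace (Finite 0) with (Rbar_mult h 0) by (simpl; f_equal; ring).
  apply is_lim_seq_scal_l. apply is_lim_seq_geom. rewrite Rabs_pos_eq; lra.
Qed.

Lemma nested_limit (x : nat -> R) (h : R) :
  (forall n, x n <= x (S n)) -> (forall n, x (S n) + h / 2 ^ S n <= x n + h / 2 ^ n) -> 0 < h ->
  exists l, forall n, x n <= l <= x n + h / 2 ^ n.
Proof.
  intros I D Hh.
  assert (B : forall n, x n + h / 2 ^ n <= x O + h / 2 ^ O).
  { induction n as [|n IH]; [lra|]. specialize (D n). lra. }
  destruct (ex_finite_lim_seq_incr x (x O + h / 2 ^ O) I) as [l Hl].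
  { intros n. specialize (B n). pose proof (div_pow2_pos h n Hh). lra. }
  exists l. intros n. split.
  - exact (is_lim_seq_incr_compare x l Hl I n).
  - apply (is_lim_seq_decr_compare (fun n => x n + h / 2 ^ n) l); [|exact D].
    replace (Finite l) with (Rbar_plus l 0) by (simpl; f_equal; ring).
    apply is_lim_seq_plus'; [exact Hl|apply is_lim_seq_div_pow2].
Qed.

Lemma rect_int_affine (A B : C) (a b h k : R) : 0 <= h -> 0 <= k ->
  rect_int (fun z => A + B * z)%C a b h k = 0.
Proof.
  intros Hh Hk.
  set (F := fun z : C => (A * z + B * (z * z) * / 2)%C).
  assert (D : forall z, C_is_derive F z (A + B * z)%C).
  { intros z. unfold F.
    replace (A + B * z)%C with ((0 * z + A * 1) + ((0 * (z * z) + B * (1 * z + z * 1)) * / 2 + (B * (z * z)) * 0))%C by field.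
    apply (C_is_derive_plus (fun z => A * z)%C (fun z => B * (z * z) * / 2)%C).
    - apply (C_is_derive_mult (fun _ => A) (fun z => z)); [apply C_is_derive_const|apply C_is_derive_id].
    - apply (C_is_derive_mult (fun z => B * (z * z))%C (fun _ => / 2)%C); [|apply C_is_derive_const].
      apply (C_is_derive_mult (fun _ => B) (fun z => z * z)%C); [apply C_is_derive_const|].
      apply (C_is_derive_mult (fun z => z) (fun z => z)); apply C_is_derive_id. }
  assert (K : forall z, Ccont (fun z => A + B * z)%C z).
  { intros z. apply C_ex_derive_cont, C_ex_derive_plus; [apply C_ex_derive_const|].
    apply C_ex_derive_mult; [apply C_ex_derive_const|apply C_ex_derive_id]. }
  unfold rect_int.
  rewrite !(CInt_horizontal F (fun z => A + B * z)%C) by auto.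
  rewrite !(CInt_vertical F (fun z => A + B * z)%C) by auto.
  ring.
Qed.

Lemma rect_int_minus (G L : C -> C) (a b h k : R) : 0 <= h -> 0 <= k ->
  cont_rect G a b h k -> cont_rect L a b h k ->
  rect_int (fun z => G z - L z)%C a b h k = (rect_int G a b h k - rect_int L a b h k)%C.
Proof.
  intros Hh Hk HG HL. unfold rect_int.
  assert (X : forall y, b <= y <= b + k ->
    CInt (fun t => G (t, y) - L (t, y))%C a (a + h) = (CInt (fun t => G (t, y)) a (a + h) - CInt (fun t => L (t, y)) a (a + h))%C).
  { intros y Hy. apply (CInt_minus (fun t => G (t, y)) (fun t => L (t, y)));
      (apply ex_CInt_horizontal; [lra|]; intros t Ht); [apply HG|apply HL]; lra. }
  assert (Y : forall x, a <= x <= a + h ->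
    CInt (fun t => G (x, t) - L (x, t))%C b (b + k) = (CInt (fun t => G (x, t)) b (b + k) - CInt (fun t => L (x, t)) b (b + k))%C).
  { intros x Hx. apply (CInt_minus (fun t => G (x, t)) (fun t => L (x, t)));
      (apply ex_CInt_vertical; [lra|]; intros t Ht); [apply HG|apply HL]; lra. }
  rewrite !X, !Y by lra. ring.
Qed.

Lemma rect_int_bound (G : C -> C) (a b h k M : R) : 0 <= h -> 0 <= k -> cont_rect G a b h k ->
  (forall x y, a <= x <= a + h -> b <= y <= b + k -> Cmod (G (x, y)) <= M) ->
  Cmod (rect_int G a b h k) <= 2 * (h + k) * M.
Proof.
  intros Hh Hk HG HM. unfold rect_int, Cminus.
  assert (X : forall y, b <= y <= b + k -> Cmod (CInt (fun t => G (t, y)) a (a + h)) <= h * M).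
  { intros y Hy. replace (h * M) with ((a + h - a) * M) by ring. apply CInt_norm_const; [lra| |].
    - apply ex_CInt_horizontal; [lra|]. intros t Ht. apply HG; lra.
    - intros t Ht. apply HM; lra. }
  assert (Y : forall x, a <= x <= a + h -> Cmod (CInt (fun t => G (x, t)) b (b + k)) <= k * M).
  { intros x Hx. replace (k * M) with ((b + k - b) * M) by ring. apply CInt_norm_const; [lra| |].
    - apply ex_CInt_vertical; [lra|]. intros t Ht. apply HG; lra.
    - intros t Ht. apply HM; lra. }
  pose proof (X b ltac:(lra)). pose proof (X (b + k) ltac:(lra)).
  pose proof (Y a ltac:(lra)). pose proof (Y (a + h) ltac:(lra)).
  eapply Rle_trans; [apply Cmod_triangle|].
  eapply Rle_trans; [apply Rplus_le_compat_r, Cmod_triangle|].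
  eapply Rle_trans; [apply Rplus_le_compat_r, Rplus_le_compat_r, Cmod_triangle|].
  rewrite !Cmod_opp, !Cmod_mult, Cmod_Ci. lra.
Qed.

(** Bisection: quarters carrying at least a fourth of the integral shrink to a point (u, v). There
    [G] differs from an affine function, whose boundary integral vanishes, by at most e times the
    distance. Perimeter and distance both scale like 2^{-n}, which cancels the factor 4^n. *)
Lemma goursat (G : C -> C) (a b h k : R) : 0 < h -> 0 < k ->
  (forall x y, a <= x <= a + h -> b <= y <= b + k -> C_ex_derive G (x, y)) ->
  rect_int G a b h k = 0.
Proof.
  intros Hh Hk HG.
  assert (HC : forall a' b' h' k', a <= a' -> a' + h' <= a + h -> b <= b' -> b' + k' <= b + k ->
    cont_rect G a' b' h' k').
  { intros a' b' h' k' ? ? ? ? x y Hx Hy. apply C_ex_derive_cont, HG; lra. }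
  destruct (dependent_choice_nat
    (fun n p => a <= fst p /\ fst p + h / 2 ^ n <= a + h /\ b <= snd p /\ snd p + k / 2 ^ n <= b + k)
    (fun n p q => (fst p <= fst q /\ fst q + h / 2 ^ S n <= fst p + h / 2 ^ n) /\
      (snd p <= snd q /\ snd q + k / 2 ^ S n <= snd p + k / 2 ^ n) /\
      Cmod (rect_int G (fst p) (snd p) (h / 2 ^ n) (k / 2 ^ n)) <=
        4 * Cmod (rect_int G (fst q) (snd q) (h / 2 ^ S n) (k / 2 ^ S n)))
    (a, b)) as [p [p0 Hp]].
  { simpl. lra. }
  { intros n [x y] [H1 [H2 [H3 H4]]]. cbn [fst snd] in *.
    pose proof (div_pow2_pos h (S n) Hh). pose proof (div_pow2_pos k (S n) Hk).
    rewrite (half_pow_succ h n), (half_pow_succ k n) in *.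
    destruct (rect_int_quarter G x y (h / 2 ^ S n) (k / 2 ^ S n)) as [x' [y' [Hx [Hy Q]]]]; try assumption.
    { apply HC; lra. }
    exists (x', y'). cbn [fst snd]. repeat split; try exact Q; destruct Hx, Hy; lra. }
  destruct (nested_limit (fun n => fst (p n)) h) as [u Hu]; [intros n; apply Hp|intros n; apply Hp|exact Hh|].
  destruct (nested_limit (fun n => snd (p n)) k) as [v Hv]; [intros n; apply Hp|intros n; apply Hp|exact Hk|].
  cbv beta in Hu, Hv.
  assert (Huv : a <= u <= a + h /\ b <= v <= b + k).
  { pose proof (Hu O). pose proof (Hv O). rewrite p0 in *. simpl in *. lra. }
  destruct (HG u v) as [l Hl]; [lra|lra|].
  apply Cmod_eq_0. apply Rle_antisym; [|apply Cmod_ge_0].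
  apply le_epsilon. intros eps Heps. rewrite Rplus_0_l.
  (* At stage n the perimeter is 2(h+k)/2^n and the distance to (u, v) is at most (h+k)/2^n, so the
     total bound is 2 e (h+k)^2 = eps. *)
  set (e := eps / (2 * (h + k) ^ 2)).
  assert (He : 0 < e) by (apply Rdiv_lt_0_compat; [lra|]; pose proof (pow_lt (h + k) 2 ltac:(lra)); lra).
  rewrite C_is_derive_eps in Hl. destruct (Hl e He) as [d [Hd K]].
  assert (L : exists n, (h + k) / 2 ^ n < d).
  { pose proof (is_lim_seq_div_pow2 (h + k)) as W. apply is_lim_seq_spec in W.
    destruct (W (mkposreal d Hd)) as [n Hn]. exists n. specialize (Hn n (Nat.le_refl n)). simpl in Hn.
    rewrite Rminus_0_r in Hn. apply Rle_lt_trans with (2 := Hn), Rle_abs. }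
  destruct L as [n Hn].
  assert (It : Cmod (rect_int G a b h k) <= 4 ^ n * Cmod (rect_int G (fst (p n)) (snd (p n)) (h / 2 ^ n) (k / 2 ^ n))).
  { clear Hn. induction n as [|n IH].
    - rewrite p0. simpl. replace (h / 1) with h by field. replace (k / 1) with k by field. lra.
    - eapply Rle_trans; [exact IH|]. destruct (Hp n) as [_ [_ [_ Q]]]. cbn [pow] in *.
      pose proof (pow_lt 4 n ltac:(lra)). nra. }
  eapply Rle_trans; [exact It|]. clear It.
  specialize (Hu n). specialize (Hv n). destruct (Hp n) as [[P1 [P2 [P3 P4]]] _].
  set (x := fst (p n)) in *. set (y := snd (p n)) in *.
  pose proof (div_pow2_pos h n Hh) as Hh'. pose proof (div_pow2_pos k n Hk) as Hk'.
  assert (Shk : h / 2 ^ n + k / 2 ^ n = (h + k) / 2 ^ n) by (field; apply pow_nonzero; lra).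
  set (h' := h / 2 ^ n) in *. set (k' := k / 2 ^ n) in *.
  set (L := fun z : C => ((G (u, v) - (u, v) * l) + l * z)%C).
  assert (CL : forall z, Ccont L z).
  { intros z. apply C_ex_derive_cont. apply C_ex_derive_plus; [apply C_ex_derive_const|].
    apply C_ex_derive_mult; [apply C_ex_derive_const|apply C_ex_derive_id]. }
  assert (E : rect_int G x y h' k' = rect_int (fun z => G z - L z)%C x y h' k').
  { rewrite rect_int_minus by (try lra; try (apply HC; lra); intros ? ? _ _; apply CL).
    unfold L. rewrite rect_int_affine by lra. ring. }
  rewrite E.
  assert (Bd : Cmod (rect_int (fun z => G z - L z)%C x y h' k') <= 2 * (h' + k') * (e * (h' + k'))).
  { apply rect_int_bound; try lra.
    - intros x' y' Hx' Hy'.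
      apply (Ccont_plus G (fun z => - L z)%C); [apply C_ex_derive_cont, HG; lra|].
      apply C_ex_derive_cont, C_ex_derive_opp. apply C_ex_derive_plus; [apply C_ex_derive_const|].
      apply C_ex_derive_mult; [apply C_ex_derive_const|apply C_ex_derive_id].
    - intros x' y' Hx' Hy'.
      set (w := ((x', y') - (u, v))%C).
      assert (Hw : Cmod w <= h' + k').
      { eapply Rle_trans; [apply Cmod_le_abs|]. simpl. apply Rplus_le_compat; apply Rabs_le; lra. }
      specialize (K w ltac:(lra)). unfold L.
      assert (E1 : @eq C ((u, v) + w)%C (x', y')) by (unfold w; ring).
      rewrite E1 in K.
      replace (G (x', y') - (G (u, v) - (u, v) * l + l * (x', y')))%C with (G (x', y') - G (u, v) - w * l)%C by (unfold w; ring).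
      eapply Rle_trans; [exact K|]. apply Rmult_le_compat_l; lra. }
  pose proof (pow_lt 4 n ltac:(lra)) as P4n.
  apply Rle_trans with (4 ^ n * (2 * (h' + k') * (e * (h' + k')))); [apply Rmult_le_compat_l; lra|].
  right. rewrite Shk. unfold e. replace 4 with (2 * 2) by ring. rewrite Rpow_mult_distr. field.
  repeat split; try lra; apply pow_nonzero; lra.
Qed.

(** In Goursat's identity for the rectangle between the two segments, the horizontal sides cancel by
    periodicity. With G(w) = F(e^{-w}) this says that circles of different radius give the same
    mean. *)
Lemma vertical_int_const (G : C -> C) (x1 x2 : R) : x1 < x2 ->
  (forall x y, x1 <= x <= x2 -> C_ex_derive G (x, y)) ->
  (forall x, G (x, PI) = G (x, - PI)) ->
  CInt (fun t => G (x1, t)) (- PI) PI = CInt (fun t => G (x2, t)) (- PI) PI.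
Proof.
  intros H HG HP. pose proof PI_RGT_0.
  pose proof (goursat G x1 (- PI) (x2 - x1) (2 * PI)) as K.
  specialize (K ltac:(lra) ltac:(lra)).
  assert (K' : rect_int G x1 (- PI) (x2 - x1) (2 * PI) = 0) by (apply K; intros; apply HG; lra).
  unfold rect_int in K'. replace (- PI + 2 * PI) with PI in K' by ring.
  replace (x1 + (x2 - x1)) with x2 in K' by ring.
  rewrite (CInt_ext (fun t => G (t, PI)) (fun t => G (t, (- PI)%R))) in K' by (intros; apply HP).
  assert (E : (Ci * (CInt (fun t => G (x2, t)) (- PI) PI - CInt (fun t => G (x1, t)) (- PI) PI))%C = 0).
  { rewrite <- K'. ring. }
  symmetry. apply Ceq_minus.
  replace (CInt (fun t => G (x2, t)) (- PI) PI - CInt (fun t => G (x1, t)) (- PI) PI)%C with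
    (- Ci * (Ci * (CInt (fun t => G (x2, t)) (- PI) PI - CInt (fun t => G (x1, t)) (- PI) PI)))%C.
  - rewrite E. ring.
  - set (X := (CInt _ _ _ - _)%C). replace (- Ci * (Ci * X))%C with (- (Ci * Ci) * X)%C by ring.
    replace (Ci * Ci)%C with (RtoC (-1)) by (unfold Ci, Cmult, RtoC; simpl; f_equal; ring). ring.
Qed.

(** * Cauchy's formula for the Taylor coefficients *)

Lemma RCcont_bounded (f : R -> C) (a b : R) : a <= b ->
  (forall t, a <= t <= b -> RCcont f t) -> exists M, 0 < M /\ forall t, a <= t <= b -> Cmod (f t) <= M.
Proof.
  intros Hab H.
  destruct (continuity_ab_maj (fun t => Cmod (f t)) a b Hab) as [m [Hm _]].
  - intros c Hc eps He. destruct (H c Hc eps He) as [d [Hd K]]. exists d. split; [exact Hd|].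
    intros x [_ Hx]. simpl in *. unfold Rdist in *.
    eapply Rle_lt_trans; [|apply (K x Hx)]. apply Rabs_le.
    pose proof (Cmod_rev_triangle (f x) (f c)). pose proof (Cmod_rev_triangle (f c) (f x)).
    rewrite Cmod_minus_sym in H1. lra.
  - exists (Cmod (f m) + 1). split; [pose proof (Cmod_ge_0 (f m)); lra|].
    intros t Ht. specialize (Hm t Ht). lra.
Qed.

(** Compactness of the segment, in the form of a gauge [g]. The radius of continuity is 2 [g]
    because a nearby point is off by less than [g] in each of the two coordinates. *)
Lemma uniform_cont_vertical (G : C -> C) (x0 a b : R) :
  (forall y, a <= y <= b -> Ccont G (x0, y)) -> forall eps, 0 < eps ->
  exists d, 0 < d /\ forall x y, Rabs (x - x0) < d -> a <= y <= b ->
    Cmod (G (x, y) - G (x0, y)) <= eps.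
Proof.
  intros H eps He.
  assert (K : forall y, exists d : posreal, a <= y <= b -> forall w, Cmod (w - (x0, y)) < 2 * d -> Cmod (G w - G (x0, y)) < eps / 2).
  { intros y. destruct (classic (a <= y <= b)) as [Hy|Hy].
    - destruct (H y Hy (eps / 2)) as [d [Hd W]]; [lra|]. assert (Hd2 : 0 < d / 2) by lra.
      exists (mkposreal _ Hd2). intros _ w Hw. apply W. simpl in Hw. lra.
    - exists (mkposreal 1 Rlt_0_1). tauto. }
  set (g := fun y => epsilon (inhabits (mkposreal 1 Rlt_0_1)) (fun d : posreal => a <= y <= b -> forall w, Cmod (w - (x0, y)) < 2 * d -> Cmod (G w - G (x0, y)) < eps / 2)).
  assert (Hg : forall y, a <= y <= b -> forall w, Cmod (w - (x0, y)) < 2 * (g y) -> Cmod (G w - G (x0, y)) < eps / 2).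
  { intros y. unfold g. apply (epsilon_spec (inhabits (mkposreal 1 Rlt_0_1)) _ (K y)). }
  destruct (compactness_value_1d a b g) as [d Hd].
  exists d. split; [apply cond_pos|]. intros x y Hx Hy.
  apply NNPP. intros N. apply (Hd y Hy). intros [t [Ht [Hyt Hdt]]]. apply N.
  assert (A : Cmod (G (x, y) - G (x0, t)) < eps / 2).
  { apply Hg; [exact Ht|]. eapply Rle_lt_trans; [apply Cmod_le_abs|]. cbn [fst snd Cminus Cplus Copp].
    change (Rabs (x - x0) + Rabs (y - t) < 2 * g t). lra. }
  assert (B : Cmod (G (x0, y) - G (x0, t)) < eps / 2).
  { apply Hg; [exact Ht|]. eapply Rle_lt_trans; [apply Cmod_le_abs|].
    change (Rabs (x0 - x0) + Rabs (y - t) < 2 * g t). replace (x0 - x0) with 0 by ring.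
    rewrite Rabs_R0. pose proof (cond_pos (g t)). lra. }
  replace (G (x, y) - G (x0, y))%C with ((G (x, y) - G (x0, t)) - (G (x0, y) - G (x0, t)))%C by ring.
  eapply Rle_trans; [apply Cmod_triangle|]. rewrite Cmod_opp. lra.
Qed.

(** [cmean F x] is the integral of [F (e^{-x-iy})] over [-pi <= y <= pi]. *)
Definition cmean (F : C -> C) (x : R) : C := CInt (fun y => F (cexp (- (x, y)))) (- PI) PI.

Lemma Cmod_circ (x y : R) : Cmod (cexp (- (x, y))) = exp (- x).
Proof. apply Cmod_cexp. Qed.

Lemma C_ex_derive_cexp_opp (z : C) : C_ex_derive (fun w => cexp (- w)) z.
Proof. apply C_ex_derive_cexp, C_ex_derive_opp, C_ex_derive_id. Qed.

Lemma Ccont_circ (F : C -> C) (x y : R) : Ccont F (cexp (- (x, y))) -> Ccont (fun w => F (cexp (- w))) (x, y).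
Proof.
  intros H. apply (Ccont_comp F (fun w => cexp (- w))); [|exact H].
  apply C_ex_derive_cont, C_ex_derive_cexp_opp.
Qed.

Lemma RCcont_circ (F : C -> C) (x y : R) : Ccont F (cexp (- (x, y))) -> RCcont (fun y => F (cexp (- (x, y)))) y.
Proof. intros H. apply (RCcont_vertical (fun w => F (cexp (- w)))), Ccont_circ, H. Qed.

Lemma ex_cmean (F : C -> C) (x : R) : (forall z, Cmod z = exp (- x) -> Ccont F z) ->
  ex_CInt (fun y => F (cexp (- (x, y)))) (- PI) PI.
Proof.
  intros H. apply ex_CInt_cont. intros t _. apply RCcont_circ, H, Cmod_circ.
Qed.

Lemma cexp_periodic (x : R) : cexp (- (x, PI)) = cexp (- (x, (- PI)%R)).
Proof.
  unfold cexp; simpl. rewrite Ropp_involutive, cos_neg, sin_neg, sin_PI. f_equal; ring.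
Qed.

Lemma cmean_const (F : C -> C) (x1 x2 : R) : x1 <= x2 ->
  (forall z, exp (- x2) <= Cmod z <= exp (- x1) -> C_ex_derive F z) -> cmean F x1 = cmean F x2.
Proof.
  intros [H|H] HF; [|rewrite H; reflexivity].
  apply (vertical_int_const (fun w => F (cexp (- w)))); [exact H| |].
  - intros x y Hx. apply (C_ex_derive_comp F (fun w => cexp (- w))); [apply C_ex_derive_cexp_opp|].
    apply HF. rewrite Cmod_circ. split; apply exp_le_compat; lra.
  - intros x. rewrite cexp_periodic. reflexivity.
Qed.

Lemma cmean_bound (F : C -> C) (x M : R) : (forall z, Cmod z = exp (- x) -> Ccont F z) ->
  (forall z, Cmod z = exp (- x) -> Cmod (F z) <= M) -> Cmod (cmean F x) <= 2 * PI * M.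
Proof.
  intros HF HM. replace (2 * PI * M) with ((PI - - PI) * M) by ring. pose proof PI_RGT_0.
  apply CInt_norm_const; [lra|apply ex_cmean, HF|]. intros t _. apply HM, Cmod_circ.
Qed.

Lemma cmean_plus (F G : C -> C) (x : R) : (forall z, Cmod z = exp (- x) -> Ccont F z) ->
  (forall z, Cmod z = exp (- x) -> Ccont G z) ->
  cmean (fun z => F z + G z)%C x = (cmean F x + cmean G x)%C.
Proof. intros HF HG. apply CInt_plus; apply ex_cmean; assumption. Qed.

Lemma cmean_Cmult (c : C) (F : C -> C) (x : R) : (forall z, Cmod z = exp (- x) -> Ccont F z) ->
  cmean (fun z => c * F z)%C x = (c * cmean F x)%C.
Proof. intros HF. apply CInt_Cmult, ex_cmean, HF. Qed.

Lemma cmean_ext (F G : C -> C) (x : R) : (forall z, Cmod z = exp (- x) -> F z = G z) -> cmean F x = cmean G x.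
Proof. intros H. apply CInt_ext. intros t _. apply H, Cmod_circ. Qed.

Lemma cmean_const_fun (c : C) (x : R) : cmean (fun _ => c) x = ((2 * PI)%R * c)%C.
Proof. unfold cmean. rewrite CInt_const. do 2 f_equal. ring. Qed.

(** The mean depends continuously on the radius. This carries a value onto a circle on which [F] is
    continuous but perhaps not differentiable. *)
Lemma cmean_limit (F : C -> C) (x0 : R) (c : C) : (forall z, Cmod z = exp (- x0) -> Ccont F z) ->
  (forall d, 0 < d -> exists x, Rabs (x - x0) < d /\ cmean F x = c /\ forall z, Cmod z = exp (- x) -> Ccont F z) ->
  cmean F x0 = c.
Proof.
  intros HF H. apply Ceq_minus, Cmod_eq_0, Rle_antisym; [|apply Cmod_ge_0].
  apply le_epsilon. intros eps He. rewrite Rplus_0_l. pose proof PI_RGT_0.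
  destruct (uniform_cont_vertical (fun w => F (cexp (- w))) x0 (- PI) PI) with (eps := eps / (2 * PI)) as [d [Hd K]].
  - intros y _. apply Ccont_circ, HF, Cmod_circ.
  - apply Rdiv_lt_0_compat; lra.
  - destruct (H d Hd) as [x [Hx [<- HFx]]].
    unfold cmean. rewrite <- CInt_minus by (apply ex_cmean; assumption).
    replace eps with ((PI - - PI) * (eps / (2 * PI))) by (field; lra).
    apply CInt_norm_const; [lra|apply ex_CInt_minus; apply ex_cmean; assumption|].
    intros t Ht. rewrite Cmod_minus_sym. apply (K x t Hx Ht).
Qed.

Lemma exp_opp_small (x d : R) : 0 < d -> exists x', x <= x' /\ exp (- x') < d.
Proof.
  intros Hd. exists (Rmax x (1 - ln d)). split; [apply Rmax_l|].
  rewrite <- (exp_ln d) at 2 by exact Hd. apply exp_increasing. pose proof (Rmax_r x (1 - ln d)). lra.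
Qed.

Lemma exp_le_reg (x y : R) : exp x <= exp y -> x <= y.
Proof. intros H. apply Rnot_lt_le. intros L. apply exp_increasing in L. lra. Qed.

Section Cauchy.

Variables (F : C -> C) (rho : R).
Hypothesis HF : forall z, Cmod z < rho -> C_ex_derive F z.

(** The difference quotient extends continuously to [a], but its differentiability there is not yet
    known. So the circle is moved inwards to |z| = |a|, carried across by continuity, and then
    shrunk to 0, where the factor z makes the mean vanish. *)
Lemma cmean_diff_quotient (a : C) (x : R) : exp (- x) < rho -> Cmod a < exp (- x) ->
  cmean (fun z => (F z - F a) / (z - a) * z)%C x = 0.
Proof.
  intros Hx Ha.
  destruct (HF a) as [l Hl]; [lra|].
  set (D := fun z : C => if Ceq_dec z a then l else ((F z - F a) / (z - a))%C).
  assert (Dne : forall z, z <> a -> D z = ((F z - F a) / (z - a))%C).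
  { intros z Hz. unfold D. destruct (Ceq_dec z a); [contradiction|reflexivity]. }
  assert (DD : forall z, Cmod z < rho -> z <> a -> C_ex_derive D z).
  { intros z Hz Hza.
    assert (P : 0 < Cmod (z - a)) by (apply Cmod_gt_0, Cminus_eq_contra, Hza).
    assert (Q : C_ex_derive (fun z => (F z - F a) / (z - a))%C z).
    { apply C_ex_derive_div.
      - apply C_ex_derive_minus; [apply HF, Hz|apply C_ex_derive_const].
      - apply C_ex_derive_minus; [apply C_ex_derive_id|apply C_ex_derive_const].
      - apply Cminus_eq_contra, Hza. }
    destruct Q as [m Hm]. exists m. revert Hm. apply C_is_derive_ext_ball with (r := Cmod (z - a)); [exact P|].
    intros w Hw. symmetry. apply Dne. intros ->. rewrite Cmod_minus_sym in Hw. lra. }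
  assert (DC : forall z, Cmod z < rho -> Ccont D z).
  { intros z Hz. destruct (Ceq_dec z a) as [E|E]; [subst z|apply C_ex_derive_cont, DD; assumption].
    intros eps He. rewrite C_is_derive_eps in Hl. destruct (Hl (eps / 2)) as [d [Hd K]]; [lra|].
    exists d. split; [exact Hd|]. intros w Hw. specialize (K _ Hw).
    replace (D a) with l by (unfold D; destruct (Ceq_dec a a); congruence).
    destruct (Ceq_dec w a) as [->|E].
    - unfold D. destruct (Ceq_dec a a); [|congruence]. replace (l - l)%C with (RtoC 0) by ring. rewrite Cmod_0. exact He.
    - rewrite Dne by exact E.
      assert (P : 0 < Cmod (w - a)) by (apply Cmod_gt_0, Cminus_eq_contra, E).
      replace (a + (w - a))%C with w in K by ring.
      replace ((F w - F a) / (w - a) - l)%C with ((F w - F a - (w - a) * l) / (w - a))%C by (field; apply Cminus_eq_contra, E).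
      rewrite Cmod_div by (apply Cminus_eq_contra, E).
      apply Rmult_lt_reg_r with (Cmod (w - a)); [exact P|]. unfold Rdiv at 1. rewrite Rmult_assoc, Rinv_l by lra. nra. }
  set (H := fun z : C => (D z * z)%C).
  assert (HD : forall z, Cmod z < rho -> z <> a -> C_ex_derive H z).
  { intros z Hz Hza. apply C_ex_derive_mult; [apply DD; assumption|apply C_ex_derive_id]. }
  assert (HC : forall z, Cmod z < rho -> Ccont H z).
  { intros z Hz. apply Ccont_mult; [apply DC, Hz|apply C_ex_derive_cont, C_ex_derive_id]. }
  (* Circles inside |z| = |a|, or all circles if a = 0, shrink to the origin without meeting [a],
     and H(0) = 0. *)
  assert (C1 : forall t, exp (- t) < rho -> (exp (- t) < Cmod a \/ a = 0) -> cmean H t = 0).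
  { intros t Ht Hat. apply Cmod_eq_0, Rle_antisym; [|apply Cmod_ge_0].
    apply le_epsilon. intros eps He. rewrite Rplus_0_l. pose proof PI_RGT_0.
    pose proof (Cmod_ge_0 a) as Ha0.
    destruct (HC 0 ltac:(rewrite Cmod_0; lra) (eps / (2 * PI))) as [d [Hd K]]; [apply Rdiv_lt_0_compat; lra|].
    destruct (exp_opp_small t d Hd) as [t' [Ht' Hd']].
    rewrite (cmean_const H t t' Ht').
    - replace eps with (2 * PI * (eps / (2 * PI))) by (field; lra).
      apply cmean_bound.
      + intros z Hz. apply HC. rewrite Hz. apply Rle_lt_trans with (2 := Ht). apply exp_le_compat. lra.
      + intros z Hz. left. specialize (K z). replace (z - 0)%C with z in K by ring.
        replace (H z - H 0)%C with (H z) in K by (unfold H; ring). apply K. rewrite Hz. exact Hd'.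
    - intros z Hz. apply HD; [lra|]. intros ->.
      destruct Hat as [Hat|Hat]; [lra|]. subst a. rewrite Cmod_0 in Hz. pose proof (exp_pos (- t')). lra. }
  assert (C2 : cmean H x = 0).
  { destruct (Ceq_dec a 0) as [E|E]; [apply C1; auto|].
    assert (Pa : 0 < Cmod a) by (apply Cmod_gt_0, E).
    set (xa := - ln (Cmod a)).
    assert (Exa : exp (- xa) = Cmod a) by (unfold xa; rewrite Ropp_involutive; apply exp_ln, Pa).
    assert (Hxa : x < xa).
    { apply Ropp_lt_cancel. apply exp_lt_inv. lra. }
    (* The circle through [a] is approached from inside here, and from outside just below. *)
    assert (Cxa : cmean H xa = 0).
    { apply cmean_limit.
      - intros z Hz. apply HC. lra.
      - intros d Hd. exists (xa + d / 2).
        assert (exp (- (xa + d / 2)) < Cmod a) by (rewrite <- Exa; apply exp_increasing; lra).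
        split; [rewrite Rabs_pos_eq; lra|]. split; [apply C1; lra|]. intros z Hz. apply HC. lra. }
    rewrite <- Cxa. symmetry. apply cmean_limit.
    - intros z Hz. apply HC. lra.
    - intros d Hd. exists (Rmax x (xa - d / 2)).
      pose proof (Rmax_l x (xa - d / 2)). pose proof (Rmax_r x (xa - d / 2)).
      assert (Lt : Rmax x (xa - d / 2) < xa) by (apply Rmax_lub_lt; lra).
      assert (exp (- (Rmax x (xa - d / 2))) <= exp (- x)) by (apply exp_le_compat; lra).
      assert (Cmod a < exp (- (Rmax x (xa - d / 2)))) by (rewrite <- Exa; apply exp_increasing; lra).
      split; [rewrite Rabs_left; lra|]. split.
      + symmetry. apply cmean_const; [lra|]. intros z Hz. apply HD; [lra|]. intros ->. lra.
      + intros z Hz. apply HC. lra. }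
  rewrite <- C2. apply cmean_ext. intros z Hz. unfold H. rewrite Dne; [reflexivity|].
  intros ->. lra.
Qed.

End Cauchy.

Lemma Cmod_sub_pos (z a : C) : Cmod a < Cmod z -> (z - a)%C <> 0.
Proof. intros H E. apply Ceq_minus in E. subst. lra. Qed.

(** The mean does not depend on the radius beyond |a|, and for large radius the kernel tends to 1
    uniformly. *)
Lemma cmean_kernel (a : C) (x : R) : Cmod a < exp (- x) -> cmean (fun z => z / (z - a))%C x = (2 * PI)%R.
Proof.
  intros Ha. pose proof PI_RGT_0.
  assert (HD : forall z, Cmod a < Cmod z -> C_ex_derive (fun z => z / (z - a))%C z).
  { intros z Hz. apply C_ex_derive_div; [apply C_ex_derive_id| |apply Cmod_sub_pos, Hz].
    apply C_ex_derive_minus; [apply C_ex_derive_id|apply C_ex_derive_const]. }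
  apply Ceq_minus, Cmod_eq_0, Rle_antisym; [|apply Cmod_ge_0].
  apply le_epsilon. intros eps He. rewrite Rplus_0_l.
  set (e := eps / (2 * PI)). assert (He' : 0 < e) by (apply Rdiv_lt_0_compat; lra).
  pose proof (Cmod_ge_0 a) as Ha0.
  (* On |z| = r the kernel differs from 1 by at most |a|/(r - |a|) <= e. *)
  set (r := Rmax (exp (- x)) (Cmod a / e + Cmod a + 1)).
  assert (Hr : exp (- x) <= r) by apply Rmax_l.
  assert (Hr2 : Cmod a / e + Cmod a + 1 <= r) by apply Rmax_r.
  assert (0 < r) by (pose proof (exp_pos (- x)); lra).
  assert (Er : exp (- - ln r) = r) by (rewrite Ropp_involutive; apply exp_ln; lra).
  assert (Q : 0 <= Cmod a / e) by (apply Rmult_le_pos; [lra|left; apply Rinv_0_lt_compat, He']).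
  rewrite <- (cmean_const _ (- ln r) x).
  - replace (RtoC (2 * PI)) with (cmean (fun _ => 1) (- ln r)) by (rewrite cmean_const_fun; ring).
    unfold cmean.
    rewrite <- CInt_minus.
    + change (Cmod (cmean (fun z => z / (z - a) - 1)%C (- ln r)) <= eps).
      replace eps with (2 * PI * e) by (unfold e; field; lra).
      apply cmean_bound; rewrite Er.
      * intros z Hz. apply C_ex_derive_cont, C_ex_derive_minus; [apply HD; lra|apply C_ex_derive_const].
      * intros z Hz.
        assert (Nz : (z - a)%C <> 0) by (apply Cmod_sub_pos; lra).
        replace (z / (z - a) - 1)%C with (a / (z - a))%C by (field; exact Nz).
        rewrite Cmod_div by exact Nz. pose proof (Cmod_rev_triangle z a) as T.
        assert (P : 0 < Cmod (z - a)) by lra.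
        apply Rmult_le_reg_r with (Cmod (z - a)); [exact P|]. unfold Rdiv. rewrite Rmult_assoc, Rinv_l by lra.
        rewrite Rmult_1_r. apply Rle_trans with (e * (Cmod a / e)); [right; field; lra|].
        apply Rmult_le_compat_l; lra.
    + apply (ex_cmean (fun z => z / (z - a))%C). intros z Hz. apply C_ex_derive_cont, HD. lra.
    + apply ex_CInt_const.
  - apply Ropp_le_cancel. apply exp_le_reg. rewrite Er. exact Hr.
  - intros z Hz. apply HD. lra.
Qed.

Lemma cauchy_formula (F : C -> C) (rho x : R) (a : C) :
  (forall z, Cmod z < rho -> C_ex_derive F z) -> exp (- x) < rho -> Cmod a < exp (- x) ->
  cmean (fun z => F z * z / (z - a))%C x = ((2 * PI)%R * F a)%C.
Proof.
  intros HF Hx Ha.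
  assert (HK : forall z, Cmod z = exp (- x) -> C_ex_derive (fun z => z / (z - a))%C z).
  { intros z Hz. apply C_ex_derive_div; [apply C_ex_derive_id| |apply Cmod_sub_pos; lra].
    apply C_ex_derive_minus; [apply C_ex_derive_id|apply C_ex_derive_const]. }
  rewrite (cmean_ext _ (fun z => (F z - F a) / (z - a) * z + F a * (z / (z - a)))%C).
  - rewrite cmean_plus.
    + rewrite (cmean_diff_quotient F rho HF a x Hx Ha).
      rewrite (cmean_Cmult (F a) (fun z => z / (z - a))%C), (cmean_kernel a x Ha).
      * ring.
      * intros z Hz. apply C_ex_derive_cont, HK, Hz.
    + intros z Hz. apply C_ex_derive_cont, C_ex_derive_mult; [|apply C_ex_derive_id].
      apply C_ex_derive_div; [| |apply Cmod_sub_pos; lra]; apply C_ex_derive_minus;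
        try apply C_ex_derive_const; [apply HF; lra|apply C_ex_derive_id].
    + intros z Hz. apply C_ex_derive_cont, C_ex_derive_mult; [apply C_ex_derive_const|apply HK, Hz].
  - intros z Hz. field. apply Cmod_sub_pos. lra.
Qed.

(** The constant is uniform in zeta, which permits differentiation under the integral sign. The
    induction rests on P - Q = h P Q for P = 1/(zeta - h) and Q = 1/zeta. *)
Lemma inv_pow_expansion (m : nat) : forall M, 0 < M -> exists K, 0 < K /\ forall zeta h : C,
  zeta <> 0 -> (zeta - h)%C <> 0 -> Cmod (/ zeta) <= M -> Cmod (/ (zeta - h)) <= M ->
  Cmod ((/ (zeta - h)) ^ m - (/ zeta) ^ m - h * (INR m * (/ zeta) ^ S m)) <= K * Cmod h ^ 2.
Proof.
  intros M HM. induction m as [|m [K [HK IH]]].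
  - exists 1. split; [lra|]. intros zeta h _ _ _ _. simpl.
    replace (1 - 1 - h * (0 * (/ zeta * 1)))%C with (RtoC 0) by ring. rewrite Cmod_0. pose proof (pow2_ge_0 (Cmod h)). simpl in *. lra.
  - exists (M * K + (1 + INR m) * M ^ (3 + m)).
    pose proof (pos_INR m) as Im. pose proof (pow_lt M (3 + m) HM) as Pm.
    split; [nra|]. intros zeta h Hz Hzh B1 B2.
    specialize (IH zeta h Hz Hzh B1 B2).
    set (P := (/ (zeta - h))%C) in *. set (Q := (/ zeta)%C) in *.
    assert (PQ : (P - Q)%C = (h * (P * Q))%C) by (unfold P, Q; field; auto).
    replace (P ^ S m - Q ^ S m - h * (INR (S m) * Q ^ S (S m)))%C with
      (P * (P ^ m - Q ^ m - h * (INR m * Q ^ S m)) + h * h * ((1 + INR m) * (P * Q ^ S (S m))))%C.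
    2:{ rewrite S_INR, RtoC_plus.
        replace (P * (P ^ m - Q ^ m - h * (INR m * Q ^ S m)) + h * h * ((1 + INR m) * (P * Q ^ S (S m))))%C
          with (P ^ S m - Q ^ m * P - h * (INR m * (P * Q ^ S m)) + h * (1 + INR m) * Q ^ S m * (h * (P * Q)))%C
          by (simpl; ring).
        rewrite <- PQ. replace P with (Q + h * (P * Q))%C at 2 by (rewrite <- PQ; ring).
        assert (PQ2 : (h * (P * Q) * Q)%C = (P * Q - Q * Q)%C) by (rewrite <- PQ; ring).
        replace (P ^ S m - Q ^ m * (Q + h * (P * Q)) - h * (INR m * (P * Q ^ S m)) + h * (1 + INR m) * Q ^ S m * (P - Q))%C
          with (P ^ S m - Q ^ S m - h * (Q ^ S m * P) - h * (INR m * (P * Q ^ S m)) + h * (1 + INR m) * Q ^ S m * (P - Q))%C by (simpl; ring).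
        simpl; ring. }
    eapply Rle_trans; [apply Cmod_triangle|]. rewrite !Cmod_mult, Cmod_pow.
    assert (I1 : Cmod (1 + INR m) = 1 + INR m).
    { rewrite <- RtoC_plus, Cmod_R, Rabs_pos_eq; lra. }
    rewrite I1.
    pose proof (Cmod_ge_0 P). pose proof (Cmod_ge_0 Q). pose proof (Cmod_ge_0 h).
    assert (T1 : Cmod P * Cmod (P ^ m - Q ^ m - h * (INR m * Q ^ S m)) <= M * (K * Cmod h ^ 2)).
    { apply Rmult_le_compat; try assumption. apply Cmod_ge_0. }
    assert (T2 : Cmod P * Cmod Q ^ S (S m) <= M ^ (3 + m)).
    { change (M ^ (3 + m)) with (M * M ^ S (S m)). apply Rmult_le_compat; try assumption; [apply pow_le; assumption|].
      apply pow_incr. lra. }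
    assert (T3 : Cmod h * Cmod h * ((1 + INR m) * (Cmod P * Cmod Q ^ S (S m))) <= Cmod h * Cmod h * ((1 + INR m) * M ^ (3 + m))).
    { apply Rmult_le_compat_l; [nra|]. apply Rmult_le_compat_l; lra. }
    nra.
Qed.

(** Cauchy's integral for the n-th derivative at [a], up to the factor n!/(2 pi); the extra z is the
    Jacobian of z = e^{-w}. *)
Definition cauchy_int (F : C -> C) (x : R) (n : nat) (a : C) : C :=
  cmean (fun z => F z * z * (/ (z - a)) ^ S n)%C x.

Lemma Ccont_inv_pow (Phi : C -> C) (n : nat) (a z : C) : Ccont Phi z -> Cmod a < Cmod z ->
  Ccont (fun z => Phi z * (/ (z - a)) ^ n)%C z.
Proof.
  intros HP Ha. apply Ccont_mult; [exact HP|]. apply C_ex_derive_cont, C_ex_derive_pow.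
  apply (C_ex_derive_inv (fun z => z - a)%C); [|apply Cmod_sub_pos, Ha].
  apply C_ex_derive_minus; [apply C_ex_derive_id|apply C_ex_derive_const].
Qed.

Lemma C_is_derive_cauchy_int (F : C -> C) (x : R) (n : nat) (a : C) :
  (forall z, Cmod z = exp (- x) -> Ccont F z) -> Cmod a < exp (- x) ->
  C_is_derive (cauchy_int F x n) a (INR (S n) * cauchy_int F x (S n) a)%C.
Proof.
  intros HF Ha. pose proof PI_RGT_0. pose proof (Cmod_ge_0 a) as Ha0.
  set (r := exp (- x)) in *.
  assert (HP : forall z, Cmod z = r -> Ccont (fun z => F z * z)%C z).
  { intros z Hz. apply Ccont_mult; [apply HF, Hz|apply C_ex_derive_cont, C_ex_derive_id]. }
  destruct (RCcont_bounded (fun y => (fun z => F z * z)%C (cexp (- (x, y)))) (- PI) PI) as [B [HB0 HB]]; [lra| |].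
  { intros t _. apply (RCcont_circ (fun z => F z * z)%C), HP, Cmod_circ. }
  (* For |h| < d both [a] and [a + h] stay at distance at least d from the circle, whence the bound
     1/d on the two inverses. *)
  set (d := (r - Cmod a) / 2).
  destruct (inv_pow_expansion (S n) (/ d)) as [K [HK HE]]; [apply Rinv_0_lt_compat; unfold d; lra|].
  apply C_is_derive_eps. intros eps He.
  exists (Rmin d (eps / (2 * PI * (B * K)))).
  assert (BK : 0 < B * K) by nra.
  split. { apply Rmin_pos; [unfold d; lra|]. apply Rdiv_lt_0_compat; [lra|]. nra. }
  intros h Hh.
  pose proof (Rmin_l d (eps / (2 * PI * (B * K)))). pose proof (Rmin_r d (eps / (2 * PI * (B * K)))).
  assert (Hah : Cmod (a + h) < r).
  { eapply Rle_lt_trans; [apply Cmod_triangle|]. unfold d in *. lra. }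
  pose proof (Cmod_ge_0 h) as Hh0.
  assert (Con : forall m b, Cmod b < r -> forall z, Cmod z = r -> Ccont (fun z => F z * z * (/ (z - b)) ^ m)%C z).
  { intros m b Hb z Hz. apply (Ccont_inv_pow (fun z => F z * z)%C); [apply HP, Hz|lra]. }
  assert (E : (cauchy_int F x n (a + h) - cauchy_int F x n a - h * (INR (S n) * cauchy_int F x (S n) a))%C =
    cmean (fun z => F z * z * ((/ (z - (a + h))) ^ S n - (/ (z - a)) ^ S n - h * (INR (S n) * (/ (z - a)) ^ S (S n))))%C x).
  { rewrite (cmean_ext _ (fun z => F z * z * (/ (z - (a + h))) ^ S n
       + (- (1) * (F z * z * (/ (z - a)) ^ S n) + (- h * INR (S n)) * (F z * z * (/ (z - a)) ^ S (S n))))%C) by (intros; ring).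
    rewrite cmean_plus, cmean_plus.
    - rewrite (cmean_Cmult (- (1)) (fun z => F z * z * (/ (z - a)) ^ S n)%C) by (intros; apply Con; assumption).
      rewrite (cmean_Cmult (- h * INR (S n)) (fun z => F z * z * (/ (z - a)) ^ S (S n))%C) by (intros; apply Con; assumption).
      unfold cauchy_int. ring.
    - intros z Hz. apply Ccont_mult; [apply Ccont_const|apply Con; assumption].
    - intros z Hz. apply Ccont_mult; [apply Ccont_const|apply Con; assumption].
    - intros z Hz. apply Con; assumption.
    - intros z Hz. apply Ccont_plus; (apply Ccont_mult; [apply Ccont_const|apply Con; assumption]). }
  rewrite E.
  apply Rle_trans with (2 * PI * (B * (K * Cmod h ^ 2))).
  - unfold cmean. replace (2 * PI) with (PI - - PI) by ring. apply CInt_norm_const; [lra| |].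
    + apply (ex_cmean (fun z => F z * z * ((/ (z - (a + h))) ^ S n - (/ (z - a)) ^ S n - h * (INR (S n) * (/ (z - a)) ^ S (S n))))%C).
      intros z Hz. apply Ccont_mult; [apply HP, Hz|]. apply C_ex_derive_cont.
      assert (I : forall b, Cmod b < r -> C_ex_derive (fun z => / (z - b))%C z).
      { intros b Hb. apply (C_ex_derive_inv (fun z => z - b)%C); [|apply Cmod_sub_pos; fold r in Hz; lra].
        apply C_ex_derive_minus; [apply C_ex_derive_id|apply C_ex_derive_const]. }
      apply C_ex_derive_minus; [apply C_ex_derive_minus|]; try (apply C_ex_derive_pow, I; assumption).
      apply C_ex_derive_mult; [apply C_ex_derive_const|].
      apply C_ex_derive_mult; [apply C_ex_derive_const|]. apply C_ex_derive_pow, I, Ha.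
    + intros t Ht. rewrite Cmod_mult.
      assert (Hz : Cmod (cexp (- (x, t))) = r) by apply Cmod_circ.
      specialize (HB t Ht). cbv beta in HB.
      set (z := cexp (- (x, t))) in *.
      apply Rmult_le_compat; try apply Cmod_ge_0; [exact HB|].
      replace (z - (a + h))%C with (z - a - h)%C by ring.
      pose proof (Cmod_rev_triangle z a) as T1. pose proof (Cmod_rev_triangle z (a + h)) as T2.
      replace (z - (a + h))%C with (z - a - h)%C in T2 by ring.
      pose proof (Cmod_triangle a h) as T3.
      assert (Nd : 0 < d) by (unfold d; lra).
      assert (L1 : d <= Cmod (z - a)) by (unfold d in *; lra).
      assert (L2 : d <= Cmod (z - a - h)) by (unfold d in *; lra).
      assert (N1 : (z - a)%C <> 0) by (apply Cmod_gt_0; lra).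
      assert (N2 : (z - a - h)%C <> 0) by (apply Cmod_gt_0; lra).
      apply HE; try assumption; rewrite Cmod_inv by assumption; apply Rinv_le_contravar; lra.
  - assert (Hh2 : Cmod h <= eps / (2 * PI * (B * K))) by lra.
    apply Rmult_le_compat_r with (r := 2 * PI * (B * K)) in Hh2; [|nra].
    replace (eps / (2 * PI * (B * K)) * (2 * PI * (B * K))) with eps in Hh2 by (field; split; nra).
    replace (2 * PI * (B * (K * Cmod h ^ 2))) with (Cmod h * (2 * PI * (B * K)) * Cmod h) by ring.
    apply Rmult_le_compat_r; lra.
Qed.

Lemma cderiv_n_cauchy (F : C -> C) (rho x : R) (n : nat) :
  (forall z, Cmod z < rho -> C_ex_derive F z) -> exp (- x) < rho ->
  forall a, Cmod a < exp (- x) ->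
  cderiv_n n F a = ((INR (Factorial.fact n) / (2 * PI))%R * cauchy_int F x n a)%C.
Proof.
  intros HF Hx. pose proof PI_RGT_0 as HPi.
  assert (HPC : RtoC PI <> 0) by (apply RtoC_neq; lra).
  assert (H2PC : RtoC (2 * PI) <> 0) by (apply RtoC_neq; lra).
  induction n as [|n IH]; intros a Ha.
  - simpl cderiv_n. unfold cauchy_int.
    rewrite (cmean_ext _ (fun z => F z * z / (z - a))%C).
    + rewrite (cauchy_formula F rho x a HF Hx Ha). simpl. rewrite RtoC_div by lra. field. exact H2PC.
    + intros z Hz. simpl. unfold Cdiv. ring.
  - simpl cderiv_n. apply C_is_derive_unique.
    apply C_is_derive_ext_ball with (f := fun a => ((INR (Factorial.fact n) / (2 * PI))%R * cauchy_int F x n a)%C) (r := exp (- x) - Cmod a); [lra| |].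
    + intros w Hw. symmetry. apply IH.
      replace w with (a + (w - a))%C by ring. eapply Rle_lt_trans; [apply Cmod_triangle|]. lra.
    + replace ((INR (Factorial.fact (S n)) / (2 * PI))%R * cauchy_int F x (S n) a)%C with
        (0 * cauchy_int F x n a + (INR (Factorial.fact n) / (2 * PI))%R * (INR (S n) * cauchy_int F x (S n) a))%C.
      * apply (C_is_derive_mult (fun _ => RtoC (INR (Factorial.fact n) / (2 * PI))) (cauchy_int F x n)); [apply C_is_derive_const|].
        apply C_is_derive_cauchy_int; [|exact Ha]. intros z Hz. apply C_ex_derive_cont, HF. lra.
      * change (Factorial.fact (S n)) with (S n * Factorial.fact n)%nat. rewrite mult_INR.
        replace (INR (S n) * INR (Factorial.fact n) / (2 * PI))%R with (INR (S n) * (INR (Factorial.fact n) / (2 * PI)))%R by (field; lra).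
        rewrite (RtoC_mult (INR (S n))). ring.
Qed.

(** The link between [zcoef], defined through iterated derivatives at 0, and circle means; any
    radius below [rho] may be used. *)
Lemma zcoef_cmean (F : C -> C) (rho x : R) (n : nat) :
  (forall z, Cmod z < rho -> C_ex_derive F z) -> exp (- x) < rho ->
  zcoef n F = (/ (2 * PI)%R * cmean (fun z => F z / z ^ n)%C x)%C.
Proof.
  intros HF Hx. unfold zcoef. pose proof PI_RGT_0 as HPi. pose proof (INR_fact_lt_0 n) as Hf.
  rewrite (cderiv_n_cauchy F rho x n HF Hx 0) by (rewrite Cmod_0; apply exp_pos).
  assert (N1 : RtoC (2 * PI) <> 0) by (apply RtoC_neq; lra).
  assert (N2 : RtoC (INR (Factorial.fact n)) <> 0) by (apply RtoC_neq; lra).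
  rewrite RtoC_div by lra. unfold cauchy_int.
  rewrite (cmean_ext _ (fun z => F z / z ^ n)%C).
  - field. split; assumption.
  - intros z Hz. replace (z - 0)%C with z by ring.
    assert (Nz : z <> 0) by (apply Cmod_gt_0; rewrite Hz; apply exp_pos).
    rewrite Cpow_inv by exact Nz. simpl. field. repeat split; try exact Nz; apply Cpow_nz, Nz.
Qed.

Lemma C_ex_derive_cderiv_n (F : C -> C) (rho : R) (n : nat) :
  (forall z, Cmod z < rho -> C_ex_derive F z) ->
  forall z, Cmod z < rho -> C_ex_derive (cderiv_n n F) z.
Proof.
  intros HF z Hz. set (r := (Cmod z + rho) / 2).
  pose proof (Cmod_ge_0 z).
  assert (Er : exp (- - ln r) = r) by (rewrite Ropp_involutive; apply exp_ln; unfold r; lra).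
  assert (Hr : Cmod z < r < rho) by (unfold r; lra).
  destruct (C_ex_derive_mult (fun _ => RtoC (INR (Factorial.fact n) / (2 * PI))) (cauchy_int F (- ln r) n) z) as [l Hl].
  - apply C_ex_derive_const.
  - eexists. apply C_is_derive_cauchy_int; rewrite Er; [|lra]. intros w Hw. apply C_ex_derive_cont, HF. lra.
  - exists l. revert Hl. apply C_is_derive_ext_ball with (r := r - Cmod z); [lra|].
    intros w Hw. symmetry. apply cderiv_n_cauchy with (rho := rho); rewrite ?Er; try assumption; [lra|].
    replace w with (z + (w - z))%C by ring. eapply Rle_lt_trans; [apply Cmod_triangle|]. lra.
Qed.

(** * Taylor coefficients of products, exponentials and power series *)

Fixpoint csum (f : nat -> C) (n : nat) : C :=
  match n with O => 0 | S m => (csum f m + f m)%C end.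

Lemma csum_ext (f g : nat -> C) (n : nat) : (forall k, (k < n)%nat -> f k = g k) -> csum f n = csum g n.
Proof.
  induction n as [|n IH]; intros H; [reflexivity|]. simpl. rewrite IH, H by (intros; try apply H; lia). reflexivity.
Qed.

Lemma csum_plus (f g : nat -> C) (n : nat) : csum (fun k => f k + g k)%C n = (csum f n + csum g n)%C.
Proof. induction n as [|n IH]; simpl; [ring|rewrite IH; ring]. Qed.

Lemma csum_Cmult (c : C) (f : nat -> C) (n : nat) : csum (fun k => c * f k)%C n = (c * csum f n)%C.
Proof. induction n as [|n IH]; simpl; [ring|rewrite IH; ring]. Qed.

Lemma csum_shift (f : nat -> C) (n : nat) : csum f (S n) = (f O + csum (fun k => f (S k)) n)%C.
Proof. induction n as [|n IH]; [simpl; ring|]. simpl in *. rewrite IH. ring. Qed.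

Section Coefficients.

Variable rho : R.
Hypothesis Hrho : 0 < rho.

Let x0 := - ln (rho / 2).
Local Lemma x0_radius : exp (- x0) < rho.
Proof. unfold x0. rewrite Ropp_involutive, exp_ln; lra. Qed.

Definition holo_disc (F : C -> C) : Prop := forall z, Cmod z < rho -> C_ex_derive F z.

Lemma zcoef_ext_disc (F G : C -> C) (n : nat) : holo_disc F -> (forall z, Cmod z < rho -> F z = G z) ->
  zcoef n F = zcoef n G.
Proof.
  intros HF E.
  assert (HG : holo_disc G).
  { intros z Hz. destruct (HF z Hz) as [l Hl]. exists l. revert Hl. apply C_is_derive_ext_ball with (r := rho - Cmod z); [lra|].
    intros w Hw. apply E. replace w with (z + (w - z))%C by ring. eapply Rle_lt_trans; [apply Cmod_triangle|]. lra. }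
  rewrite (zcoef_cmean F rho x0 n HF x0_radius), (zcoef_cmean G rho x0 n HG x0_radius).
  f_equal. apply cmean_ext. intros z Hz. rewrite E; [reflexivity|]. rewrite Hz. apply x0_radius.
Qed.

Lemma Ccont_div_pow (F : C -> C) (n : nat) (z : C) : Ccont F z -> z <> 0 -> Ccont (fun z => F z / z ^ n)%C z.
Proof.
  intros HF Hz. apply Ccont_mult; [exact HF|]. apply C_ex_derive_cont.
  apply (C_ex_derive_inv (fun z => z ^ n)%C); [|apply Cpow_nz, Hz].
  apply (C_ex_derive_pow (fun z => z)), C_ex_derive_id.
Qed.

Lemma nz_of_Cmod_exp (z : C) (x : R) : Cmod z = exp x -> z <> 0.
Proof. intros H. apply Cmod_gt_0. rewrite H. apply exp_pos. Qed.

Lemma zcoef_plus (F G : C -> C) (n : nat) : holo_disc F -> holo_disc G ->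
  zcoef n (fun z => F z + G z)%C = (zcoef n F + zcoef n G)%C.
Proof.
  intros HF HG. pose proof x0_radius.
  rewrite (zcoef_cmean F rho x0), (zcoef_cmean G rho x0), (zcoef_cmean (fun z => F z + G z)%C rho x0); try assumption.
  - rewrite (cmean_ext _ (fun z => F z / z ^ n + G z / z ^ n)%C) by (intros; unfold Cdiv; ring).
    rewrite cmean_plus; [ring|..]; intros z Hz; (apply Ccont_div_pow; [apply C_ex_derive_cont|eapply nz_of_Cmod_exp, Hz]);
    [apply HF|apply HG]; lra.
  - intros z Hz. apply C_ex_derive_plus; auto.
Qed.

Lemma zcoef_Cmult (c : C) (F : C -> C) (n : nat) : holo_disc F ->
  zcoef n (fun z => c * F z)%C = (c * zcoef n F)%C.
Proof.
  intros HF. pose proof x0_radius.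
  rewrite (zcoef_cmean F rho x0), (zcoef_cmean (fun z => c * F z)%C rho x0); try assumption.
  - rewrite (cmean_ext _ (fun z => c * (F z / z ^ n))%C) by (intros; unfold Cdiv; ring).
    rewrite cmean_Cmult; [ring|]. intros z Hz. apply Ccont_div_pow; [apply C_ex_derive_cont, HF; lra|eapply nz_of_Cmod_exp, Hz].
  - intros z Hz. apply C_ex_derive_mult; [apply C_ex_derive_const|auto].
Qed.

Lemma cderiv_n_cderiv (F : C -> C) (n : nat) : cderiv_n n (cderiv F) = cderiv_n (S n) F.
Proof. induction n as [|n IH]; [reflexivity|]. simpl in *. rewrite IH. reflexivity. Qed.

Lemma zcoef_cderiv (F : C -> C) (n : nat) : zcoef n (cderiv F) = (INR (S n) * zcoef (S n) F)%C.
Proof.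
  unfold zcoef. rewrite cderiv_n_cderiv.
  change (Factorial.fact (S n)) with (S n * Factorial.fact n)%nat. rewrite mult_INR, RtoC_mult.
  assert (RtoC (INR (S n)) <> 0) by (apply RtoC_neq, not_0_INR; lia).
  assert (RtoC (INR (Factorial.fact n)) <> 0) by (apply RtoC_neq, INR_fact_neq_0).
  field; repeat split; assumption.
Qed.

Lemma holo_disc_cderiv (F : C -> C) : holo_disc F -> holo_disc (cderiv F).
Proof. intros HF. exact (C_ex_derive_cderiv_n F rho 1 HF). Qed.

Lemma cderiv_correct (F : C -> C) (z : C) : C_ex_derive F z -> C_is_derive F z (cderiv F z).
Proof. intros [l H]. rewrite (C_is_derive_unique _ _ _ H). exact H. Qed.

Lemma zcoef_0 (F : C -> C) : zcoef 0 F = F 0.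
Proof. unfold zcoef. simpl. field.  Qed.

(** Induction through (n+1)[z^{n+1}] FG = [z^n](F'G + FG'). The weight n+1 splits as k + (n+1-k),
    one part for each of the two products. *)
Lemma zcoef_mult (n : nat) : forall F G : C -> C, holo_disc F -> holo_disc G ->
  zcoef n (fun z => F z * G z)%C = csum (fun k => zcoef k F * zcoef (n - k) G)%C (S n).
Proof.
  induction n as [|n IH]; intros F G HF HG.
  - simpl. rewrite !zcoef_0. ring.
  - assert (HF' := holo_disc_cderiv F HF). assert (HG' := holo_disc_cderiv G HG).
    assert (N : RtoC (INR (S n)) <> 0) by (apply RtoC_neq, not_0_INR; lia).
    assert (E : (INR (S n) * zcoef (S n) (fun z => F z * G z))%C =
      (INR (S n) * csum (fun k => zcoef k F * zcoef (S n - k) G) (S (S n)))%C).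
    { rewrite <- zcoef_cderiv.
      rewrite <- (zcoef_ext_disc (fun z => cderiv F z * G z + F z * cderiv G z)%C).
      - rewrite zcoef_plus, !IH by (try assumption; intros z Hz; apply C_ex_derive_mult; auto).
        rewrite <- csum_Cmult.
        rewrite (csum_ext (fun k => INR (S n) * (zcoef k F * zcoef (S n - k) G))%C
          (fun k => INR k * (zcoef k F * zcoef (S n - k) G) + INR (S n - k) * (zcoef k F * zcoef (S n - k) G))%C).
        2:{ intros k Hk. replace (INR (S n)) with (INR k + INR (S n - k)) by (rewrite minus_INR by lia; ring).
            rewrite RtoC_plus. ring. }
        rewrite csum_plus. f_equal.
        + rewrite (csum_shift _ (S n)). cbv beta. change (RtoC (INR 0)) with (RtoC 0). rewrite Cmult_0_l, Cplus_0_l.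
          apply csum_ext. intros k Hk. rewrite zcoef_cderiv. replace (S n - S k)%nat with (n - k)%nat by lia. ring.
        +
          change (csum (fun k => zcoef k F * zcoef (n - k) (cderiv G))%C (S n) =
            (csum (fun k => INR (S n - k) * (zcoef k F * zcoef (S n - k) G)) (S n) + INR (S n - S n) * (zcoef (S n) F * zcoef (S n - S n) G))%C).
          rewrite Nat.sub_diag. change (RtoC (INR 0)) with (RtoC 0). rewrite Cmult_0_l, Cplus_0_r.
          apply csum_ext. intros k Hk. rewrite zcoef_cderiv. replace (S n - k)%nat with (S (n - k)) by lia. ring.
      - intros z Hz. apply C_ex_derive_plus; apply C_ex_derive_mult; auto.
      - intros z Hz. symmetry. apply C_is_derive_unique. apply C_is_derive_mult; apply cderiv_correct; auto. }
    apply (f_equal (fun w => / INR (S n) * w)%C) in E. rewrite !Cmult_assoc, Cinv_l, !Cmult_1_l in E by exact N. exact E.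
Qed.

(** Compare coefficients in (e^G)' = G' e^G. *)
Lemma zcoef_cexp (G : C -> C) (n : nat) : holo_disc G ->
  (INR (S n) * zcoef (S n) (fun z => cexp (G z)))%C =
  csum (fun k => INR (S k) * zcoef (S k) G * zcoef (n - k) (fun z => cexp (G z)))%C (S n).
Proof.
  intros HG. rewrite <- zcoef_cderiv.
  assert (HE : holo_disc (fun z => cexp (G z))) by (intros z Hz; apply C_ex_derive_cexp; auto).
  rewrite <- (zcoef_ext_disc (fun z => cderiv G z * cexp (G z))%C).
  - rewrite zcoef_mult; [|apply holo_disc_cderiv, HG|exact HE].
    apply csum_ext. intros k Hk. rewrite zcoef_cderiv. reflexivity.
  - intros z Hz. apply C_ex_derive_mult; [apply holo_disc_cderiv|]; auto.
  - intros z Hz. symmetry. apply C_is_derive_unique.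
    apply (C_is_derive_comp cexp G); [apply cderiv_correct; auto|apply C_is_derive_cexp].
Qed.

End Coefficients.

(** ** Power series with nonnegative coefficients *)

Lemma is_pseries_csum (b : nat -> R) (z l : C) :
  is_pseries (fun j => RtoC (b j)) z l ->
  forall eps, 0 < eps -> exists n0, forall n, (n0 <= n)%nat -> Cmod (csum (fun k => b k * z ^ k) n - l)%C < eps.
Proof.
  intros H eps He.
  destruct (H (fun w => Cmod (w - l)%C < eps)) as [n0 Hn0].
  - assert (He2 : 0 < eps / 2) by lra. exists (mkposreal _ He2). intros w Hw.
    eapply Rle_lt_trans; [apply Cmod_le_abs|].
    first [ destruct Hw as [H1 H2];
      unfold ball in H1, H2; simpl in H1, H2; unfold AbsRing_ball, abs, minus, plus, opp in H1, H2; simpl in H1, H2;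
      simpl; lra
    | unfold ball in Hw; simpl in Hw; unfold AbsRing_ball, abs, minus, plus, opp in Hw; simpl in Hw;
      pose proof (fst_le_Cmod (w - l)); pose proof (snd_le_Cmod (w - l)); unfold Cminus in *; lra ].
  - exists (S n0). intros n Hn. destruct n as [|n]; [lia|]. specialize (Hn0 n ltac:(lia)).
    replace (csum (fun k => b k * z ^ k)%C (S n)) with (sum_n (fun k => scal (pow_n z k) (RtoC (b k))) n : C); [exact Hn0|].
    assert (P : forall k, (pow_n z k : C) = (z ^ k)%C).
    { induction k as [|k IH]; [reflexivity|]. simpl. rewrite IH. reflexivity. }
    clear Hn0 Hn. induction n as [|n IH].
    + rewrite sum_O. simpl. change (@eq C (1 * b O)%C (0 + b O * 1)%C). ring.
    + rewrite sum_Sn, IH. rewrite (P (S n)).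
      change (@eq C (csum (fun k => b k * z ^ k)%C (S n) + z ^ S n * b (S n))%C (csum (fun k => b k * z ^ k) (S n) + b (S n) * z ^ S n)%C). ring.
Qed.

Section PowerSeries.

Variables (b : nat -> R) (g : C -> C) (rho : R).
Hypothesis Hb : forall k, 0 <= b k.
Hypothesis Hg : forall z : C, Cmod z < rho -> is_pseries (fun j => RtoC (b j)) z (g z).

Let S_ (z : C) (n : nat) : C := csum (fun k => b k * z ^ k)%C n.

Lemma pseries_sum_tail (z : C) (m d : nat) :
  Cmod (S_ z (m + d) - S_ z m)%C <= fst (S_ (Cmod z) (m + d)) - fst (S_ (Cmod z) m).
Proof.
  unfold S_. induction d as [|d IH].
  - rewrite Nat.add_0_r. replace (csum (fun k => b k * z ^ k) m - csum (fun k => b k * z ^ k) m)%C with (RtoC 0) by ring.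
    rewrite Cmod_0. lra.
  - rewrite Nat.add_succ_r. cbn [csum].
    replace (csum (fun k => b k * z ^ k) (m + d) + b (m + d)%nat * z ^ (m + d) - csum (fun k => b k * z ^ k) m)%C
      with ((csum (fun k => b k * z ^ k) (m + d) - csum (fun k => b k * z ^ k) m) + b (m + d)%nat * z ^ (m + d))%C by ring.
    eapply Rle_trans; [apply Cmod_triangle|].
    rewrite Cmod_mult, Cmod_pow, Cmod_R, Rabs_pos_eq by apply Hb.
    rewrite <- RtoC_pow, <- RtoC_mult. cbn [fst Cplus RtoC]. lra.
Qed.

(** With nonnegative coefficients the tail at z is dominated by the tail at |z|; this is the limit d
    -> oo of the finite version. *)
Lemma pseries_tail_bound (z : C) (m : nat) : Cmod z < rho ->
  Cmod (g z - S_ z m)%C <= fst (g (Cmod z)) - fst (S_ (Cmod z) m).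
Proof.
  intros Hz. apply le_epsilon. intros eps He.
  assert (Hz' : Cmod (RtoC (Cmod z)) < rho) by (rewrite Cmod_R, Rabs_pos_eq; [exact Hz|apply Cmod_ge_0]).
  destruct (is_pseries_csum b z _ (Hg z Hz) (eps / 2)) as [n1 H1]; [lra|].
  destruct (is_pseries_csum b (Cmod z) _ (Hg (Cmod z) Hz') (eps / 2)) as [n2 H2]; [lra|].
  set (d := (n1 + n2)%nat).
  specialize (H1 (m + d)%nat ltac:(lia)). specialize (H2 (m + d)%nat ltac:(lia)).
  pose proof (pseries_sum_tail z m d) as T. unfold S_ in *.
  set (A := csum (fun k => b k * z ^ k)%C (m + d)) in *.
  set (B := csum (fun k => b k * Cmod z ^ k)%C (m + d)) in *.
  replace (g z - csum (fun k => b k * z ^ k) m)%C with (- (A - g z) + (A - csum (fun k => b k * z ^ k) m))%C by ring.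
  eapply Rle_trans; [apply Cmod_triangle|]. rewrite Cmod_opp.
  pose proof (fst_le_Cmod (B - g (Cmod z))) as F. cbn [fst Cminus Cplus Copp] in F.
  pose proof (Rabs_le_between (fst B + - fst (g (Cmod z))) (eps / 2)) as [W _]. specialize (W ltac:(lra)). lra.
Qed.

(** Whatever the first m terms lose in real part on moving from |z| to z, the whole series loses at
    least that much. With m = 0 it gives Re g(z) <= g(|z|), and for large m the spectral gap away
    from R. *)
Lemma pseries_Re_le (z : C) (m : nat) : Cmod z < rho ->
  fst (g z) <= fst (g (Cmod z)) - (fst (S_ (Cmod z) m) - fst (S_ z m)).
Proof.
  intros Hz. pose proof (pseries_tail_bound z m Hz) as T.
  pose proof (fst_le_Cmod (g z - S_ z m)) as F. cbn [fst Cminus Cplus Copp] in F.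
  pose proof (Rle_abs (fst (g z) + - fst (S_ z m))). lra.
Qed.

Lemma pseries_incr (r r' : R) : 0 <= r <= r' -> r' < rho -> fst (g r) <= fst (g r').
Proof.
  intros Hr Hr'. apply le_epsilon. intros eps He.
  destruct (is_pseries_csum b r (g r) (Hg r ltac:(rewrite Cmod_R, Rabs_pos_eq; lra)) (eps / 2)) as [n1 H1]; [lra|].
  destruct (is_pseries_csum b r' (g r') (Hg r' ltac:(rewrite Cmod_R, Rabs_pos_eq; lra)) (eps / 2)) as [n2 H2]; [lra|].
  specialize (H1 (n1 + n2)%nat ltac:(lia)). specialize (H2 (n1 + n2)%nat ltac:(lia)).
  set (n := (n1 + n2)%nat) in *.
  assert (L : fst (csum (fun k => b k * r ^ k)%C n) <= fst (csum (fun k => b k * r' ^ k)%C n)).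
  { clear H1 H2. induction n as [|n IH]; [simpl; lra|]. cbn [csum Cplus fst].
    apply Rplus_le_compat; [exact IH|]. rewrite <- !RtoC_pow, <- !RtoC_mult. cbn [fst RtoC].
    apply Rmult_le_compat_l; [apply Hb|]. apply pow_incr. lra. }
  set (A := csum (fun k => b k * r ^ k)%C n) in *. set (B := csum (fun k => b k * r' ^ k)%C n) in *.
  pose proof (fst_le_Cmod (A - g r)) as F1. pose proof (fst_le_Cmod (B - g r')) as F2. cbn [fst Cminus Cplus Copp] in F1, F2.
  pose proof (Rabs_le_between (fst A + - fst (g r)) (eps / 2)) as [W1 _]. specialize (W1 ltac:(lra)).
  pose proof (Rabs_le_between (fst B + - fst (g r')) (eps / 2)) as [W2 _]. specialize (W2 ltac:(lra)). lra.
Qed.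

(** Orthogonality of characters: for a nonzero integer multiple s of i, the function e^{ys} has the
    2 pi periodic primitive e^{ys}/s. *)
Lemma cmean_monomial (x : R) (k n : nat) : cmean (fun z => z ^ k / z ^ n)%C x = if Nat.eq_dec k n then RtoC (2 * PI) else 0.
Proof.
  assert (Hrot : forall j : nat, (0 < j)%nat -> cmean (fun z => z ^ j)%C x = 0 /\ cmean (fun z => / z ^ j)%C x = 0).
  { intros j Hj.
    assert (Nj : INR j <> 0) by (apply not_0_INR; lia).
    assert (NjC : (Ci * INR j)%C <> 0) by (apply Cmult_neq_0; [apply Ci_nz|apply RtoC_neq, Nj]).
    assert (Key : forall s : C, (s = - Ci * INR j \/ s = Ci * INR j)%C ->
      CInt (fun y : R => cexp (y * s)) (- PI) PI = 0).
    { intros s Hs.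
      assert (Ns : s <> 0).
      { destruct Hs as [->| ->]; [|exact NjC]. intros E. apply NjC.
        replace (Ci * INR j)%C with (- (- Ci * INR j))%C by ring. rewrite E. ring. }
      assert (Hper : cexp (PI * s) = cexp ((- PI)%R * s)).
      { assert (P : cexp ((2 * PI)%R * s) = 1).
        { assert (Cos : cos (2 * PI * INR j) = 1 /\ sin (2 * PI * INR j) = 0).
          { pose proof (cos_period 0 j) as C1. pose proof (sin_period 0 j) as C2.
            rewrite cos_0 in C1. rewrite sin_0 in C2.
            replace (0 + 2 * INR j * PI) with (2 * PI * INR j) in * by ring. auto. }
          destruct Cos as [Co Si].
          assert (Es : ((2 * PI)%R * s)%C = (0, - (2 * PI * INR j)) \/ ((2 * PI)%R * s)%C = (0, 2 * PI * INR j)).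
          { destruct Hs as [->| ->]; [left|right]; unfold Cmult, Copp, Ci, RtoC; cbn [fst snd]; f_equal; ring. }
          destruct Es as [->| ->]; unfold cexp; cbn [fst snd]; rewrite ?cos_neg, ?sin_neg, Co, Si, exp_0;
            unfold RtoC; f_equal; ring. }
        replace (PI * s)%C with ((- PI)%R * s + (2 * PI)%R * s)%C.
        - rewrite cexp_plus, P. ring.
        - rewrite RtoC_opp, RtoC_mult. ring. }
      assert (I : is_CInt (fun y : R => s * cexp (y * s))%C (- PI) PI 0).
      { replace (RtoC 0) with (cexp (PI * s) - cexp ((- PI)%R * s))%C by (rewrite Hper; ring).
        apply (is_CInt_derive (fun y : R => cexp (y * s))).
        - intros t _. apply RC_is_derive_cexp_ray.
        - intros t _. eapply RCcont_derive.
          apply (RC_is_derive_comp (fun z => s * z)%C (fun u : R => cexp (u * s))); [apply RC_is_derive_cexp_ray|].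
          apply C_is_derive_mult; [apply C_is_derive_const|apply C_is_derive_id]. }
      apply is_CInt_Cmult with (c := (/ s)%C) in I.
      replace (RtoC 0) with (/ s * 0)%C by ring. apply is_CInt_unique.
      revert I. apply is_CInt_ext. intros t _. field. exact Ns. }
    assert (Ez : forall y, (cexp (- (x, y)) ^ j)%C = (exp (- (INR j * x)) * cexp (y * (- Ci * INR j)))%C).
    { intros y. rewrite <- cexp_pow, <- cexp_R, <- cexp_plus. f_equal.
      unfold Cmult, Cplus, Copp, Ci, RtoC; cbn [fst snd]. f_equal; ring. }
    assert (Ez' : forall y, (/ cexp (- (x, y)) ^ j)%C = (exp (INR j * x) * cexp (y * (Ci * INR j)))%C).
    { intros y. rewrite <- cexp_pow, <- cexp_opp, <- cexp_R, <- cexp_plus. f_equal.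
      unfold Cmult, Cplus, Copp, Ci, RtoC; cbn [fst snd]. f_equal; ring. }
    split; unfold cmean.
    - rewrite (CInt_ext _ (fun y : R => exp (- (INR j * x)) * cexp (y * (- Ci * INR j)))%C) by (intros; apply Ez).
      rewrite CInt_Cmult.
      + rewrite Key by auto. ring.
      + apply ex_CInt_cont. intros t _. eapply RCcont_derive, RC_is_derive_cexp_ray.
    - rewrite (CInt_ext _ (fun y : R => exp (INR j * x) * cexp (y * (Ci * INR j)))%C) by (intros; apply Ez').
      rewrite CInt_Cmult.
      + rewrite Key by auto. ring.
      + apply ex_CInt_cont. intros t _. eapply RCcont_derive, RC_is_derive_cexp_ray. }
  destruct (Nat.eq_dec k n) as [->|N].
  - rewrite (cmean_ext _ (fun _ => 1)).
    + rewrite cmean_const_fun. ring.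
    + intros z Hz. field. apply Cpow_nz. eapply nz_of_Cmod_exp, Hz.
  - destruct (Nat.lt_ge_cases k n) as [L|L].
    + rewrite (cmean_ext _ (fun z => / z ^ (n - k))%C); [apply Hrot; lia|].
      intros z Hz. assert (Nz : z <> 0) by (eapply nz_of_Cmod_exp, Hz).
      replace n with (k + (n - k))%nat at 1 by lia. rewrite Cpow_add_r. field. split; apply Cpow_nz, Nz.
    + rewrite (cmean_ext _ (fun z => z ^ (k - n))%C); [apply Hrot; lia|].
      intros z Hz. assert (Nz : z <> 0) by (eapply nz_of_Cmod_exp, Hz).
      replace k with ((k - n) + n)%nat at 1 by lia. rewrite Cpow_add_r. field. apply Cpow_nz, Nz.
Qed.

Lemma cmean_partial_sum (x : R) (n m : nat) :
  cmean (fun z => S_ z m / z ^ n)%C x = if Nat.ltb n m then ((2 * PI)%R * b n)%C else 0.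
Proof.
  unfold S_. induction m as [|m IH].
  - simpl. rewrite (cmean_ext _ (fun _ => 0)) by (intros; unfold Cdiv; ring). rewrite cmean_const_fun. ring.
  - rewrite (cmean_ext _ (fun z => csum (fun k => b k * z ^ k) m / z ^ n + b m * (z ^ m / z ^ n))%C) by (intros; simpl; unfold Cdiv; ring).
    rewrite cmean_plus.
    + rewrite IH, cmean_Cmult, cmean_monomial.
      * destruct (Nat.eq_dec m n) as [E|E].
        -- subst m. rewrite Nat.ltb_irrefl. replace (n <? S n) with true by (symmetry; apply Nat.ltb_lt; lia). ring.
        -- destruct (Nat.ltb_spec n m); destruct (Nat.ltb_spec n (S m)); try lia; ring.
      * intros z Hz. apply (Ccont_div_pow (fun z => z ^ m)%C); [|eapply nz_of_Cmod_exp, Hz].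
        apply C_ex_derive_cont. apply (C_ex_derive_pow (fun z => z)), C_ex_derive_id.
    + intros z Hz. apply Ccont_div_pow; [|eapply nz_of_Cmod_exp, Hz].
      clear IH. induction m as [|m IH]; [apply (Ccont_const 0)|]. simpl. apply Ccont_plus; [exact IH|].
      apply Ccont_mult; [apply Ccont_const|]. apply C_ex_derive_cont. apply (C_ex_derive_pow (fun z => z)), C_ex_derive_id.
    + intros z Hz. apply Ccont_mult; [apply Ccont_const|]. apply (Ccont_div_pow (fun z => z ^ m)%C); [|eapply nz_of_Cmod_exp, Hz].
      apply C_ex_derive_cont. apply (C_ex_derive_pow (fun z => z)), C_ex_derive_id.
Qed.

(** A partial sum reaching beyond degree n has the right mean by orthogonality, and the tail bound
    makes the error uniformly small on the circle. *)
Lemma zcoef_pseries (n : nat) : 0 < rho -> (forall z, Cmod z < rho -> C_ex_derive g z) -> zcoef n g = b n.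
Proof.
  intros Hrho HD. set (x := - ln (rho / 2)). pose proof PI_RGT_0.
  assert (Er : exp (- x) = rho / 2) by (unfold x; rewrite Ropp_involutive, exp_ln; lra).
  rewrite (zcoef_cmean g rho x n HD) by lra.
  assert (N : RtoC (2 * PI) <> 0) by (apply RtoC_neq; lra).
  assert (E : cmean (fun z => g z / z ^ n)%C x = ((2 * PI)%R * b n)%C); [|rewrite E; field; exact N].
  apply Ceq_minus, Cmod_eq_0, Rle_antisym; [|apply Cmod_ge_0].
  apply le_epsilon. intros eps He. rewrite Rplus_0_l.
  assert (Pn : 0 < (rho / 2) ^ n) by (apply pow_lt; lra).
  (* The factor (rho/2)^n pays for the division by z^n on |z| = rho/2. *)
  set (e := eps / (2 * PI) * (rho / 2) ^ n).
  assert (He' : 0 < e) by (apply Rmult_lt_0_compat; [apply Rdiv_lt_0_compat; lra|exact Pn]).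
  assert (Hr : Cmod (RtoC (rho / 2)) < rho) by (rewrite Cmod_R, Rabs_pos_eq; lra).
  destruct (is_pseries_csum b _ _ (Hg _ Hr) e He') as [m Hm].
  set (m' := S (m + n)). specialize (Hm m' ltac:(unfold m'; lia)).
  replace ((2 * PI)%R * b n)%C with (cmean (fun z => S_ z m' / z ^ n)%C x).
  2:{ rewrite cmean_partial_sum. replace (n <? m') with true; [reflexivity|]. symmetry. apply Nat.ltb_lt. unfold m'. lia. }
  assert (CS : forall z, Ccont (fun z => S_ z m') z).
  { intros z. unfold S_. generalize m'. intros j. induction j as [|j IH]; [apply (Ccont_const 0)|]. simpl. apply Ccont_plus; [exact IH|].
    apply Ccont_mult; [apply Ccont_const|]. apply C_ex_derive_cont. apply (C_ex_derive_pow (fun z => z)), C_ex_derive_id. }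
  assert (Cg : forall z, Cmod z = exp (- x) -> Ccont g z) by (intros z Hz; apply C_ex_derive_cont, HD; lra).
  replace (cmean (fun z => g z / z ^ n)%C x - cmean (fun z => S_ z m' / z ^ n)%C x)%C with
    (cmean (fun z => g z / z ^ n + - (1) * (S_ z m' / z ^ n))%C x).
  2:{ rewrite cmean_plus, cmean_Cmult; [ring|..].
      - intros z Hz. apply Ccont_div_pow; [apply CS|eapply nz_of_Cmod_exp, Hz].
      - intros z Hz. apply Ccont_div_pow; [apply Cg, Hz|eapply nz_of_Cmod_exp, Hz].
      - intros z Hz. apply Ccont_mult; [apply Ccont_const|]. apply Ccont_div_pow; [apply CS|eapply nz_of_Cmod_exp, Hz]. }
  replace eps with (2 * PI * (e / (rho / 2) ^ n)) by (unfold e; field; lra).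
  apply cmean_bound.
  - intros z Hz. apply Ccont_plus; [|apply Ccont_mult; [apply Ccont_const|]]; apply Ccont_div_pow;
      try (eapply nz_of_Cmod_exp, Hz); [apply Cg, Hz|apply CS].
  - intros z Hz. assert (Nz : z <> 0) by (eapply nz_of_Cmod_exp, Hz).
    replace (g z / z ^ n + - (1) * (S_ z m' / z ^ n))%C with ((g z - S_ z m') / z ^ n)%C by (field; apply Cpow_nz, Nz).
    rewrite Cmod_div by apply Cpow_nz, Nz. rewrite Cmod_pow, Hz, Er.
    apply Rmult_le_compat_r; [left; apply Rinv_0_lt_compat, Pn|].
    eapply Rle_trans; [apply pseries_tail_bound; lra|]. rewrite Hz, Er.
    pose proof (fst_le_Cmod (csum (fun k => b k * RtoC (rho / 2) ^ k) m' - g (RtoC (rho / 2)))%C) as F.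
    cbn [fst Cminus Cplus Copp] in F. unfold S_.
    match type of F with Rabs ?t <= _ => pose proof (Rle_abs (- t)) as W; rewrite Rabs_Ropp in W end. lra.
Qed.

End PowerSeries.

(** * Permutations by cycle type *)

Module CycleIndex.

Import all_boot all_algebra all_fingroup Rstruct ring.
Import GRing.Theory Num.Theory.
Local Open Scope ring_scope.

Lemma porbit_min (T : finType) (s : {perm T}) (x : T) (A : {set T}) :
  x \in A -> (forall y, y \in A -> s y \in A) -> porbit s x \subset A.
Proof.
move=> xA sA; apply/subsetP => _ /porbitP[i ->].
by elim: i => [|i IH]; rewrite ?expg0 ?perm1 // expgSr permM; apply: sA.
Qed.

Lemma porbit_step (T : finType) (s : {perm T}) (x y : T) :
  y \in porbit s x -> s y \in porbit s x.
Proof. by rewrite -!eq_porbit_mem => /eqP <-; rewrite eq_porbit_mem (mem_porbit s 1). Qed.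

Section CycleInsertion.

Variables (n : nat) (i : 'I_n.+1) (s : 'S_n).

Local Notation up := (fun A : {set 'I_n} => [set lift i x | x in A]).

Lemma up_inj : injective up.
Proof. by apply: imset_inj; apply: lift_inj. Qed.

Lemma card_up (A : {set 'I_n}) : #|up A| = #|A|.
Proof. by rewrite card_imset //; apply: lift_inj. Qed.

Lemma i_notin_up (A : {set 'I_n}) : i \notin up A.
Proof. by apply/imsetP => -[x _ /eqP]; rewrite (negPf (neq_lift _ _)). Qed.

Lemma porbit_lift_perm_fix : porbit (lift_perm i i s) i = [set i].
Proof.
apply/eqP; rewrite eqEsubset sub1set porbit_id andbT.
apply: porbit_min; rewrite ?set11 // => y /set1P->.
by rewrite lift_perm_id set11.
Qed.

Lemma porbit_lift_perm (k : 'I_n) : porbit (lift_perm i i s) (lift i k) = up (porbit s k).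
Proof.
apply/eqP; rewrite eqEsubset; apply/andP; split.
  apply: porbit_min; first by apply: imset_f; apply: porbit_id.
  move=> _ /imsetP[y yk ->]; rewrite lift_perm_lift; apply: imset_f.
  exact: porbit_step.
apply/subsetP => _ /imsetP[_ /porbitP[j ->] ->].
elim: j => [|j IH]; first by rewrite expg0 perm1 porbit_id.
by rewrite expgSr permM -(lift_perm_lift i i); apply: porbit_step.
Qed.

Variable k : 'I_n.

(** Puts [i] into the cycle of [k], directly after [k]. In a product of permutations the left factor
    acts first. *)
Let t := (tperm i (lift i k) * lift_perm i i s)%g.

Lemma insert_i : t i = lift i (s k).
Proof. by rewrite permM tpermL lift_perm_lift. Qed.

Lemma insert_k : t (lift i k) = i.
Proof. by rewrite permM tpermR lift_perm_id. Qed.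

Lemma insert_other (l : 'I_n) : l != k -> t (lift i l) = lift i (s l).
Proof.
move=> lk; rewrite permM tpermD ?lift_perm_lift ?neq_lift //.
by rewrite (inj_eq (@lift_inj _ i)) eq_sym.
Qed.

(** A step of [s] is a step of [t], except at [k], where [t] makes the detour through [i] and needs
    two steps. *)
Lemma up_sub_porbit_insert (l : 'I_n) : up (porbit s l) \subset porbit t (lift i l).
Proof.
apply/subsetP => _ /imsetP[_ /porbitP[j ->] ->].
elim: j => [|j IH]; first by rewrite expg0 perm1 porbit_id.
rewrite expgSr permM; set z := (s ^+ j)%g l in IH *.
have [zk|zk] := eqVneq z k; last by rewrite -insert_other //; apply: porbit_step.
rewrite zk -insert_i; apply: porbit_step.
by rewrite -[X in X \in _]insert_k; apply: porbit_step; rewrite -zk.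
Qed.

Lemma porbit_insert : porbit t i = i |: up (porbit s k).
Proof.
have ik : porbit t (lift i k) = porbit t i.
  by apply/eqP; rewrite eq_sym eq_porbit_mem -{1}insert_k porbit_step ?porbit_id.
apply/eqP; rewrite eqEsubset; apply/andP; split.
  apply: porbit_min; first by rewrite setU11.
  move=> y /setU1P[->|/imsetP[z zk ->]].
    by rewrite insert_i setU1r // imset_f // porbit_step ?porbit_id.
  have [->|zk'] := eqVneq z k; first by rewrite insert_k setU11.
  by rewrite insert_other // setU1r // imset_f // porbit_step.
by rewrite subUset sub1set porbit_id /= -ik up_sub_porbit_insert.
Qed.

Lemma porbit_insert_other (l : 'I_n) : l \notin porbit s k -> porbit t (lift i l) = up (porbit s l).
Proof.
move=> lk; apply/eqP; rewrite eqEsubset up_sub_porbit_insert andbT.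
apply: porbit_min; first by apply: imset_f; apply: porbit_id.
move=> _ /imsetP[y yl ->]; rewrite insert_other.
  by apply: imset_f; apply: porbit_step.
by apply: contraNneq lk => <-; rewrite porbit_sym.
Qed.

Lemma porbits_lift_perm :
  porbits (lift_perm i i s) :\ porbit (lift_perm i i s) i = [set up c | c in porbits s].
Proof.
apply/setP => c; rewrite !inE; apply/andP/imsetP.
  case=> ci /imsetP[x _ cx]; move: ci; rewrite {}cx.
  case: (unliftP i x) => [l ->|->]; last by rewrite eqxx.
  by rewrite porbit_lift_perm => _; exists (porbit s l); rewrite ?imset_f.
case=> d /imsetP[l _ ->] ->; rewrite porbit_lift_perm_fix; split.
  by apply: contraTneq (i_notin_up (porbit s l)) => ->; rewrite set11.
by rewrite -porbit_lift_perm imset_f.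
Qed.

Lemma porbits_insert : porbits t :\ porbit t i = [set up c | c in porbits s :\ porbit s k].
Proof.
apply/setP => c; rewrite !inE; apply/andP/imsetP.
  case=> ci /imsetP[x _ cx]; move: ci; rewrite {}cx.
  case: (unliftP i x) => [l ->|->]; last by rewrite eqxx.
  have [lk|lk] := boolP (l \in porbit s k).
    rewrite eq_porbit_mem porbit_insert setU1r ?imset_f //.
  by rewrite porbit_insert_other // => _; exists (porbit s l); rewrite // !inE eq_porbit_mem lk imset_f.
case=> d /setD1P[dk /imsetP[l _ dl]] ->; rewrite {}dl in dk *.
rewrite porbit_insert; split.
  by apply: contraTneq (i_notin_up (porbit s l)) => ->; rewrite setU11.
by rewrite -porbit_insert_other ?imset_f // -eq_porbit_mem.
Qed.

End CycleInsertion.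

(** Permutations are sorted by the preimage x of [i]. Multiplying by the transposition of [i] and x
    leaves the stabiliser of [i], which [lift_perm i i] parametrises by 'S_n. *)
Lemma sum_perm_insert (V : nmodType) (n : nat) (i : 'I_n.+1) (F : 'S_n.+1 -> V) :
  \sum_s F s = \sum_(x : 'I_n.+1) \sum_(s : 'S_n) F (tperm i x * lift_perm i i s)%g.
Proof.
rewrite (partition_big (fun s : 'S_n.+1 => (s^-1)%g i) predT) //=.
apply: eq_bigr => x _.
rewrite (reindex_inj (mulgI (tperm i x))) /=.
rewrite (reindex (lift_perm i i)) /=.
  apply: eq_bigl => s; rewrite invMg permM tpermV lift_permV lift_perm_id tpermL eqxx //.
(* The inverse of [lift_perm]: the point [i] and its image are deleted. The default of [odflt] is
   never reached, since s (lift i k) differs from s i. *)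
pose ulsf i (s : 'S_n.+1) k := odflt k (unlift (s i) (s (lift i k))).
have ulsfK j (s : 'S_n.+1) k: lift (s j) (ulsf j s k) = s (lift j k).
  rewrite /ulsf; have:= neq_lift j k.
  by rewrite -(can_eq (permK s)) => /unlift_some[] ? ? ->.
have inj_ulsf: injective (ulsf i _).
  move=> s; apply: can_inj (ulsf (s i) s^-1%g) _ => k'.
  by rewrite {1}/ulsf ulsfK !permK liftK.
exists (fun s => perm (inj_ulsf s)) => [s _ | s].
  by apply/permP=> k'; rewrite permE /ulsf lift_perm_lift lift_perm_id liftK.
rewrite !inE => E.
have si0 : s i = i.
  move/eqP: E; rewrite invMg permM tpermV => E.
  have E2 : (s^-1)%g i = i by apply: (@perm_inj _ (tperm i x)); rewrite E tpermL.
  by rewrite -{1}E2 permKV.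
apply/permP=> k; case: (unliftP i k) => [k'|] ->; rewrite ?lift_perm_id //.
by rewrite lift_perm_lift -{1}si0 permE ulsfK.
Qed.

Section Weights.

Variables (K : comNzRingType) (a : nat -> K).

Definition cycle_weight (n : nat) (s : 'S_n) : K := \prod_(c in porbits s) a #|c|.
Definition cycle_index (n : nat) : K := \sum_(s : 'S_n) cycle_weight n s.
(** The cycle through [i] is weighted by an arbitrary function of its length. This freedom closes
    the recursion: an insertion lengthens the marked cycle by one and so only shifts [phi]. *)
Definition marked_index (n : nat) (i : 'I_n) (phi : nat -> K) : K :=
  \sum_(s : 'S_n) phi #|porbit s i| * \prod_(c in porbits s :\ porbit s i) a #|c|.

Lemma cycle_index_marked (n : nat) (i : 'I_n) : cycle_index n = marked_index n i a.
Proof.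
apply: eq_bigr => s _; rewrite /cycle_weight (big_setD1 (porbit s i)) //=.
exact: imset_f.
Qed.

(** Removing [i] leaves two cases: [i] was a fixed point, or it followed some [k], whose cycle is
    then marked with length one less. *)
Lemma marked_index_rec (n : nat) (i : 'I_n.+1) (phi : nat -> K) :
  marked_index n.+1 i phi = phi 1%N * cycle_index n +
    \sum_(k : 'I_n) marked_index n k (fun j => phi j.+1).
Proof.
rewrite /marked_index (sum_perm_insert _ n i) (bigD1_ord i) //=; congr (_ + _).
  rewrite mulr_sumr; apply: eq_bigr => s _.
  rewrite tperm1 mul1g porbits_lift_perm porbit_lift_perm_fix cards1.
  rewrite big_imset /=; last by move=> c d _ _; apply: up_inj.
  by congr (_ * _); apply: eq_bigr => c _; rewrite card_up.
apply: eq_bigr => k _; apply: eq_bigr => s _.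
rewrite porbits_insert porbit_insert cardsU1 i_notin_up card_up add1n.
rewrite big_imset /=; last by move=> c d _ _; apply: up_inj.
by congr (_ * _); apply: eq_bigr => c _; rewrite card_up.
Qed.

Lemma cycle_index0 : cycle_index 0 = 1.
Proof.
rewrite /cycle_index (big_pred1 1%g) => [|s]; last by apply/esym/eqP/permP => -[].
rewrite /cycle_weight big_pred0 // => c; apply/negP => /imsetP[[]]; done.
Qed.

(** The iterated recursion. The falling factorial counts the ordered choices of the k other points
    on the cycle of [i]. *)
Lemma marked_index_eq (n : nat) (i : 'I_n.+1) (phi : nat -> K) :
  marked_index n.+1 i phi = \sum_(k < n.+1) phi k.+1 * cycle_index (n - k) *+ n ^_ k.
Proof.
elim: n i phi => [|n IH] i phi.
  by rewrite marked_index_rec !big_ord_recl !big_ord0 /= ffactn0 mulr1n subnn.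
rewrite marked_index_rec [in RHS]big_ord_recl /= ffactn0 mulr1n subn0; congr (_ + _).
rewrite (eq_bigr _ (fun k _ => IH k _)) sumr_const card_ord -sumrMnl.
apply: eq_bigr => k _; rewrite -mulrnA /bump /= add1n subSS; congr (_ *+ _).
by rewrite ffactnS /= mulnC.
Qed.

Lemma cycle_index_rec (n : nat) :
  cycle_index n.+1 = \sum_(k < n.+1) a k.+1 * cycle_index (n - k) *+ n ^_ k.
Proof. by rewrite (cycle_index_marked _ ord0) marked_index_eq. Qed.

Lemma cycle_weight_count (n : nat) (s : 'S_n) :
  cycle_weight n s = \prod_(1 <= j < n.+1) a j ^+ cycle_count n s j.
Proof.
rewrite /cycle_weight.
have Hc (c : {set 'I_n}) : c \in porbits s -> (0 < #|c| < n.+1)%N.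
  case/imsetP=> x _ ->; rewrite lt0n card_porbit_neq0 /= ltnS.
  by rewrite -[X in (_ <= X)%N](card_ord n) max_card.
pose f (c : {set 'I_n}) : 'I_n.+1 := inord #|c|.
rewrite (partition_big f predT) //=.
(* Grouping by length ranges over 0, ..., n; the class of length 0 is empty because orbits are
   nonempty. *)
rewrite big_add1 /= big_mkord big_ord_recl big_pred0 ?mul1r; last first.
  move=> c; apply/negP => /andP[/Hc/andP[c0 cn] /eqP /(congr1 val)] /=.
  by rewrite inordK // => E; rewrite E in c0.
apply: eq_bigr => j _; rewrite /cycle_count -prodr_const.
apply: eq_big => [c|c].
  rewrite inE; apply: andb_id2l => cs; case/andP: (Hc c cs) => c0 cn.
  by rewrite -val_eqE /= inordK.
case/andP=> cs /eqP/(congr1 val) /=; case/andP: (Hc c cs) => c0 cn.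
by rewrite inordK // => ->.
Qed.

End Weights.

Lemma H_cycle_index (th ka : nat -> R) (n : nat) :
  H th ka n = cycle_index _ (fun j => th j + n%:R * ka j) n / n`!%:R.
Proof.
by rewrite /H; congr (_ / _); apply: eq_bigr => s _; rewrite cycle_weight_count.
Qed.

Lemma mul_div_cancel (K : fieldType) (N m r q x w : K) : r != 0 -> q != 0 -> N * (m * r) = q ->
  N * (x * w * m / q) = x * (w / r).
Proof.
move=> r0 q0 E; have : N * (m * r) != 0 by rewrite E.
by rewrite !mulf_eq0 !negb_or -E => /andP[N0 /andP[m0 _]]; field; rewrite N0 m0 r0.
Qed.

(** Division by factorials absorbs the falling factorial, as (n+1) * n^_k * (n-k)! = (n+1)!. *)
Lemma normalized_cycle_index_rec (a : nat -> R) (n : nat) :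
  n.+1%:R * (cycle_index _ a n.+1 / n.+1`!%:R) =
  \sum_(k < n.+1) a k.+1 * (cycle_index _ a (n - k) / (n - k)`!%:R) :> R.
Proof.
have F m : (m`!%:R : R) != 0 by rewrite pnatr_eq0 -lt0n fact_gt0.
have S1 : (n.+1%:R : R) != 0 by rewrite pnatr_eq0.
rewrite cycle_index_rec mulr_suml mulr_sumr; apply: eq_bigr => k _.
have kn : (k <= n)%N by rewrite -ltnS.
have E : (n.+1)%:R * ((n ^_ k)%:R * (n - k)`!%:R) = n.+1`!%:R :> R.
  by rewrite -!natrM ffact_fact // factS.
by rewrite -[_ *+ (n ^_ k)]mulr_natr; exact: (mul_div_cancel _ _ _ _ _ _ _ (F _) (F _) E).
Qed.

Lemma csum_big (F : nat -> R) (n : nat) : RtoC (\sum_(k < n) F k) = csum (fun k => RtoC (F k)) n.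
Proof.
elim: n => [|n IH]; first by rewrite big_ord0.
by rewrite big_ord_recr /= -IH -RtoC_plus.
Qed.

(** The weights keep the parameter [N] fixed while the size n of the permutations varies; [H] is
    recovered at n = N. The statement uses the Stdlib operations, ready for the analytic side. *)
Lemma H_recurrence (th ka : nat -> R) (N : nat) : exists h : nat -> R,
  [/\ h 0%N = IZR 1, H th ka N = h N &
  forall n, RtoC (Rmult (INR n.+1) (h n.+1)) =
    csum (fun k => RtoC (Rmult (Rplus (th k.+1) (Rmult (INR N) (ka k.+1))) (h (Nat.sub n k)))) n.+1].
Proof.
exists (fun m => cycle_index _ (fun j => th j + N%:R * ka j) m / m`!%:R).
split; [by rewrite cycle_index0 divr1|exact: H_cycle_index|].
move=> n; pose a j := th j + N%:R * ka j.
have E := normalized_cycle_index_rec a n.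
pose F (k : nat) : R := Rmult (Rplus (th k.+1) (Rmult (INR N) (ka k.+1))) (cycle_index _ a (n - k) / (n - k)`!%:R).
rewrite -(csum_big F); congr RtoC.
transitivity (n.+1%:R * (cycle_index _ a n.+1 / n.+1`!%:R) : R); first by rewrite INRE.
apply: (eq_trans E); apply: eq_bigr => k _; by rewrite /F INRE.
Qed.

End CycleIndex.

(** * Dominated convergence for integrals over growing intervals *)

Definition Climit_infty (F : R -> C) (l : C) : Prop :=
  forall eps, 0 < eps -> exists T0, 0 < T0 /\ forall T, T0 <= T -> Cmod (F T - l) <= eps.

Definition Climit_seq (u : nat -> C) (l : C) : Prop :=
  forall eps, 0 < eps -> exists n0, forall n, (n0 <= n)%nat -> Cmod (u n - l) <= eps.

Lemma is_RInt_inv_sq (C0 a b : R) : a <= b -> (0 < a \/ b < 0) ->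
  is_RInt (fun t => C0 / t ^ 2) a b (C0 * (/ a - / b)).
Proof.
  intros Hab Hs.
  replace (C0 * (/ a - / b)) with (minus ((fun t => - C0 / t) b) ((fun t => - C0 / t) a)).
  2:{ unfold minus, plus, opp; simpl. field. destruct Hs; lra. }
  apply (is_RInt_derive (V := R_CompleteNormedModule) (fun t => - C0 / t)); rewrite Rmin_left, Rmax_right by lra; intros t Ht.
  - auto_derive; [destruct Hs; lra|]. field. destruct Hs; lra.
  - apply (ex_derive_continuous (K := R_AbsRing) (V := R_NormedModule)). auto_derive. destruct Hs; nra.
Qed.

Lemma CInt_tail_right (f : R -> C) (C0 a b : R) : 0 < a -> a <= b -> 0 <= C0 -> ex_CInt f a b ->
  (forall t, a <= t <= b -> Cmod (f t) <= C0 / (1 + t ^ 2)) -> Cmod (CInt f a b) <= C0 / a.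
Proof.
  intros Ha Hab HC Hf H.
  pose proof (is_RInt_inv_sq C0 a b Hab (or_introl Ha)) as I.
  eapply Rle_trans; [apply (CInt_norm_le f (fun t => C0 / t ^ 2)); [exact Hab|exact Hf|eexists; exact I|]|].
  - intros t Ht. eapply Rle_trans; [apply H, Ht|]. apply Rmult_le_compat_l; [exact HC|]. apply Rinv_le_contravar; nra.
  - rewrite (is_RInt_unique _ _ _ _ I). unfold Rdiv. apply Rmult_le_compat_l; [exact HC|].
    pose proof (Rinv_0_lt_compat b ltac:(lra)). lra.
Qed.

Lemma CInt_tail_left (f : R -> C) (C0 a b : R) : 0 < a -> a <= b -> 0 <= C0 -> ex_CInt f (- b) (- a) ->
  (forall t, - b <= t <= - a -> Cmod (f t) <= C0 / (1 + t ^ 2)) -> Cmod (CInt f (- b) (- a)) <= C0 / a.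
Proof.
  intros Ha Hab HC Hf H.
  pose proof (is_RInt_inv_sq C0 (- b) (- a) ltac:(lra) (or_intror (ltac:(lra) : - a < 0))) as I.
  eapply Rle_trans; [apply (CInt_norm_le f (fun t => C0 / t ^ 2)); [lra|exact Hf|eexists; exact I|]|].
  - intros t Ht. eapply Rle_trans; [apply H, Ht|]. apply Rmult_le_compat_l; [exact HC|]. apply Rinv_le_contravar; nra.
  - rewrite (is_RInt_unique _ _ _ _ I). unfold Rdiv. apply Rmult_le_compat_l; [exact HC|].
    rewrite !Rinv_opp. pose proof (Rinv_0_lt_compat b ltac:(lra)). lra.
Qed.

Lemma ex_CInt_cont_le (f : R -> C) (a b : R) : a <= b -> (forall t, a <= t <= b -> RCcont f t) -> ex_CInt f a b.
Proof. intros Hab H. apply ex_CInt_cont. intros t Ht. rewrite Rmin_left, Rmax_right in Ht by lra. apply H, Ht. Qed.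

(** The parameter [k] distinguishes half lines ([k = 0]) from symmetric intervals ([k = 1]). *)
Lemma CInt_truncation (f : R -> C) (k C0 T L : R) : k = 0 \/ k = 1 -> 0 < T <= L -> 0 <= C0 ->
  (forall t, - k * L <= t <= L -> RCcont f t) ->
  (forall t, - k * L <= t <= L -> Cmod (f t) <= C0 / (1 + t ^ 2)) ->
  Cmod (CInt f (- k * L) L - CInt f (- k * T) T) <= 2 * C0 / T.
Proof.
  intros Hk HT HC Hf H.
  assert (HkT : - k * L <= - k * T <= 0) by (destruct Hk; subst; lra).
  assert (E1 : ex_CInt f (- k * L) (- k * T)) by (apply ex_CInt_cont_le; [lra|]; intros; apply Hf; lra).
  assert (E2 : ex_CInt f (- k * T) T) by (apply ex_CInt_cont_le; [lra|]; intros; apply Hf; lra).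
  assert (E3 : ex_CInt f T L) by (apply ex_CInt_cont_le; [lra|]; intros; apply Hf; lra).
  assert (E4 : ex_CInt f (- k * T) L) by (apply ex_CInt_cont_le; [lra|]; intros; apply Hf; lra).
  rewrite <- (CInt_Chasles f (- k * L) (- k * T) L), <- (CInt_Chasles f (- k * T) T L) by assumption.
  replace (CInt f (- k * L) (- k * T) + (CInt f (- k * T) T + CInt f T L) - CInt f (- k * T) T)%C
    with (CInt f (- k * L) (- k * T) + CInt f T L)%C by ring.
  eapply Rle_trans; [apply Cmod_triangle|].
  assert (B3 : Cmod (CInt f T L) <= C0 / T) by (apply CInt_tail_right; try assumption; try lra; intros; apply H; lra).
  assert (P : 0 <= C0 / T) by (apply Rmult_le_pos; [exact HC|left; apply Rinv_0_lt_compat; lra]).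
  assert (B1 : Cmod (CInt f (- k * L) (- k * T)) <= C0 / T).
  { destruct Hk as [->| ->].
    - replace (- 0 * L) with 0 by ring. replace (- 0 * T) with 0 by ring. rewrite CInt_point, Cmod_0. exact P.
    - replace (- (1) * L) with (- L) in * by ring. replace (- (1) * T) with (- T) in * by ring.
      apply CInt_tail_left; try assumption; try lra. intros; apply H; lra. }
  replace (2 * C0 / T) with (C0 / T + C0 / T) by (field; lra). lra.
Qed.

Section DominatedConvergence.

(** The dominating function is C0/(1 + t^2). The condition [- k * Rabs t <= t] reads t >= 0 when k =
    0 and is no restriction when k = 1. *)
Variables (k C0 : R) (g_ : nat -> R -> C) (g : R -> C) (L : nat -> R).
Hypothesis Hk : k = 0 \/ k = 1.
Hypothesis HC0 : 0 <= C0.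
Hypothesis HL : forall T, exists n0, forall n, (n0 <= n)%nat -> T <= L n.
Hypothesis Hg_cont : exists n0, forall n, (n0 <= n)%nat -> forall t, - k * L n <= t <= L n -> RCcont (g_ n) t.
Hypothesis Hg : forall t, - k * Rabs t <= t -> RCcont g t.
Hypothesis Hconv : forall T eps, 0 < T -> 0 < eps -> exists n0, forall n, (n0 <= n)%nat ->
  forall t, - k * T <= t <= T -> Cmod (g_ n t - g t) <= eps.
Hypothesis Hdom : exists n0, forall n, (n0 <= n)%nat -> forall t, - k * L n <= t <= L n ->
  Cmod (g_ n t) <= C0 / (1 + t ^ 2).

Lemma dominated_convergence_aux (eps : R) : 0 < eps -> exists T0, 0 < T0 /\ forall T, T0 <= T ->
  exists n0, forall n, (n0 <= n)%nat -> Cmod (CInt (g_ n) (- k * L n) (L n) - CInt g (- k * T) T) <= eps.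
Proof.
  (* For T >= T0 the tails, at most 2 C0/T uniformly in n, take half of eps; the other half is for
     uniform convergence up to T. *)
  intros He. set (T0 := 4 * C0 / eps + 1).
  assert (P0 : 0 <= 4 * C0 / eps) by (apply Rmult_le_pos; [lra|left; apply Rinv_0_lt_compat; lra]).
  assert (HT0 : 0 < T0) by (unfold T0; lra).
  exists T0. split; [exact HT0|]. intros T HT.
  destruct (HL T) as [n1 H1]. destruct Hg_cont as [n2 H2]. destruct Hdom as [n3 H3].
  destruct (Hconv T (eps / (4 * T))) as [n4 H4]; [lra|apply Rdiv_lt_0_compat; lra|].
  exists (n1 + n2 + n3 + n4)%nat. intros n Hn.
  specialize (H1 n ltac:(lia)). specialize (H2 n ltac:(lia)). specialize (H3 n ltac:(lia)). specialize (H4 n ltac:(lia)).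
  pose proof (CInt_truncation (g_ n) k C0 T (L n) Hk ltac:(lra) HC0 H2 H3) as Tr.
  assert (HkT : - k * L n <= - k * T /\ - T <= - k * T <= 0) by (destruct Hk as [E|E]; rewrite E; lra).
  assert (E1 : ex_CInt (g_ n) (- k * T) T) by (apply ex_CInt_cont_le; [lra|]; intros; apply H2; lra).
  assert (E2 : ex_CInt g (- k * T) T).
  { apply ex_CInt_cont_le; [lra|]. intros t Ht. apply Hg. destruct Hk as [E|E]; rewrite E in *; [lra|].
    pose proof (Rabs_pos t). unfold Rabs. destruct (Rcase_abs t); lra. }
  assert (D : Cmod (CInt (g_ n) (- k * T) T - CInt g (- k * T) T) <= eps / 2).
  { rewrite <- CInt_minus by assumption.
    apply Rle_trans with ((T - - k * T) * (eps / (4 * T))).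
    - apply CInt_norm_const; [lra|apply ex_CInt_minus; assumption|]. intros t Ht. apply H4; lra.
    - apply Rle_trans with ((2 * T) * (eps / (4 * T))); [|right; field; lra].
      apply Rmult_le_compat_r; [left; apply Rdiv_lt_0_compat; lra|lra]. }
  assert (B : 2 * C0 / T <= eps / 2).
  { apply Rmult_le_reg_r with T; [lra|]. unfold Rdiv at 1. rewrite Rmult_assoc, Rinv_l by lra.
    assert (4 * C0 / eps <= T) by (unfold T0 in *; lra).
    apply Rmult_le_compat_r with (r := eps) in H; [|lra]. replace (4 * C0 / eps * eps) with (4 * C0) in H by (field; lra). lra. }
  replace (CInt (g_ n) (- k * L n) (L n) - CInt g (- k * T) T)%C with
    ((CInt (g_ n) (- k * L n) (L n) - CInt (g_ n) (- k * T) T) + (CInt (g_ n) (- k * T) T - CInt g (- k * T) T))%C by ring.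
  eapply Rle_trans; [apply Cmod_triangle|]. lra.
Qed.

Lemma dominated_convergence (l : C) : Climit_infty (fun T => CInt g (- k * T) T) l ->
  Climit_seq (fun n => CInt (g_ n) (- k * L n) (L n)) l.
Proof.
  intros H eps He. destruct (H (eps / 2)) as [T1 [HT1 K1]]; [lra|].
  destruct (dominated_convergence_aux (eps / 2)) as [T2 [HT2 K2]]; [lra|].
  destruct (K2 (Rmax T1 T2) (Rmax_r _ _)) as [n0 Hn0]. specialize (K1 (Rmax T1 T2) (Rmax_l _ _)). cbv beta in K1.
  exists n0. intros n Hn. specialize (Hn0 n Hn).
  replace (CInt (g_ n) (- k * L n) (L n) - l)%C with
    ((CInt (g_ n) (- k * L n) (L n) - CInt g (- k * Rmax T1 T2) (Rmax T1 T2)) + (CInt g (- k * Rmax T1 T2) (Rmax T1 T2) - l))%C by ring.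
  eapply Rle_trans; [apply Cmod_triangle|]. lra.
Qed.

End DominatedConvergence.

(** The truncation bound makes the integrals up to integer ends a Cauchy sequence, and the same
    bound compares an arbitrary end with an integer one. *)
Lemma Climit_infty_exists (k C0 : R) (g : R -> C) : k = 0 \/ k = 1 -> 0 <= C0 ->
  (forall t, - k * Rabs t <= t -> RCcont g t) ->
  (forall t, - k * Rabs t <= t -> Cmod (g t) <= C0 / (1 + t ^ 2)) ->
  exists l, Climit_infty (fun T => CInt g (- k * T) T) l.
Proof.
  intros Hk HC Hg Hb.
  assert (Hkt : forall L t, - k * L <= t <= L -> - k * Rabs t <= t).
  { intros L t Ht. destruct Hk as [E|E]; rewrite E in *; [lra|]. unfold Rabs. destruct (Rcase_abs t); lra. }
  assert (Tr : forall T L, 0 < T <= L -> Cmod (CInt g (- k * L) L - CInt g (- k * T) T) <= 2 * C0 / T).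
  { intros T L HT. apply CInt_truncation; try assumption; intros t Ht; [apply Hg|apply Hb]; eapply Hkt; eassumption. }
  set (u := fun n : nat => CInt g (- k * INR (S n)) (INR (S n))).
  assert (Cau : forall eps, 0 < eps -> exists n0, forall n m, (n0 <= n)%nat -> (n0 <= m)%nat -> Cmod (u n - u m) < eps).
  { intros eps He. destruct (INR_unbounded (4 * C0 / eps)) as [n0 Hn0].
    exists n0.
    assert (W : forall n m, (n0 <= n <= m)%nat -> Cmod (u m - u n) < eps).
    { intros n m Hnm.
      assert (P : 0 < INR (S n)) by (apply lt_0_INR; lia).
      eapply Rle_lt_trans; [apply Tr; split; [exact P|apply le_INR; lia]|].
      apply Rmult_lt_reg_r with (INR (S n)); [exact P|]. unfold Rdiv. rewrite Rmult_assoc, Rinv_l by lra.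
      assert (Q : INR n0 <= INR (S n)) by (apply le_INR; lia).
      assert (Q2 : 4 * C0 / eps < INR (S n)) by lra.
      apply Rmult_lt_compat_r with (r := eps) in Q2; [|lra]. replace (4 * C0 / eps * eps) with (4 * C0) in Q2 by (field; lra). nra. }
    intros n m Hn Hm. destruct (Nat.le_ge_cases n m); [rewrite Cmod_minus_sym|]; apply W; lia. }
  assert (L1 : ex_finite_lim_seq (fun n => fst (u n))).
  { apply ex_lim_seq_cauchy_corr. intros eps. destruct (Cau eps (cond_pos eps)) as [n0 Hn0]. exists n0. intros n m Hn Hm.
    eapply Rle_lt_trans; [|apply (Hn0 n m Hn Hm)]. exact (fst_le_Cmod (u n - u m)). }
  assert (L2 : ex_finite_lim_seq (fun n => snd (u n))).
  { apply ex_lim_seq_cauchy_corr. intros eps. destruct (Cau eps (cond_pos eps)) as [n0 Hn0]. exists n0. intros n m Hn Hm.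
    eapply Rle_lt_trans; [|apply (Hn0 n m Hn Hm)]. exact (snd_le_Cmod (u n - u m)). }
  destruct L1 as [l1 L1]. destruct L2 as [l2 L2].
  set (l := ((l1, l2) : C)). exists l. intros eps He.
  apply is_lim_seq_spec in L1. apply is_lim_seq_spec in L2.
  assert (He4 : 0 < eps / 4) by lra.
  destruct (L1 (mkposreal _ He4)) as [n1 H1]. destruct (L2 (mkposreal _ He4)) as [n2 H2]. simpl in H1, H2.
  assert (PC : 0 <= 4 * C0 / eps) by (apply Rmult_le_pos; [lra|left; apply Rinv_0_lt_compat; lra]).
  destruct (INR_unbounded (4 * C0 / eps)) as [n3 H3].
  set (n := (n1 + n2 + n3)%nat).
  assert (Pn : 0 < INR (S n)) by (apply lt_0_INR; lia).
  exists (INR (S n)). split; [exact Pn|]. intros T HT.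
  assert (B1 : Cmod (u n - l) <= eps / 2).
  { unfold l. eapply Rle_trans; [apply Cmod_le_abs|]. specialize (H1 n ltac:(unfold n; lia)). specialize (H2 n ltac:(unfold n; lia)).
    cbn [fst snd Cminus Cplus Copp]. unfold Rminus in *. lra. }
  assert (B2 : 2 * C0 / INR (S n) <= eps / 2).
  { apply Rmult_le_reg_r with (INR (S n)); [exact Pn|]. unfold Rdiv at 1. rewrite Rmult_assoc, Rinv_l by lra.
    assert (Q : INR n3 <= INR (S n)) by (apply le_INR; unfold n; lia).
    assert (Q2 : 4 * C0 / eps < INR (S n)) by lra.
    apply Rmult_lt_compat_r with (r := eps) in Q2; [|lra]. replace (4 * C0 / eps * eps) with (4 * C0) in Q2 by (field; lra). nra. }
  replace (CInt g (- k * T) T - l)%C with ((CInt g (- k * T) T - u n) + (u n - l))%C by ring.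
  eapply Rle_trans; [apply Cmod_triangle|].
  assert (B3 : Cmod (CInt g (- k * T) T - u n) <= 2 * C0 / INR (S n)) by (apply Tr; lra). lra.
Qed.

Lemma Climit_seq_unique (u : nat -> C) (l m : C) : Climit_seq u l -> Climit_seq u m -> l = m.
Proof.
  intros H K. apply Ceq_minus, Cmod_eq_0, Rle_antisym; [|apply Cmod_ge_0].
  apply le_epsilon. intros eps He. destruct (H (eps / 2)) as [T1 K1]; [lra|]. destruct (K (eps / 2)) as [T2 K2]; [lra|].
  specialize (K1 (T1 + T2)%nat ltac:(lia)). specialize (K2 (T1 + T2)%nat ltac:(lia)).
  replace (l - m)%C with (- (u (T1 + T2)%nat - l) + (u (T1 + T2)%nat - m))%C by ring.
  eapply Rle_trans; [apply Cmod_triangle|]. rewrite Cmod_opp. lra.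
Qed.

Lemma Climit_seq_ext (u v : nat -> C) (l : C) (n1 : nat) : (forall n, (n1 <= n)%nat -> u n = v n) -> Climit_seq u l -> Climit_seq v l.
Proof.
  intros E H eps He. destruct (H eps He) as [n0 Hn0]. exists (n0 + n1)%nat. intros n Hn. rewrite <- E by lia. apply Hn0. lia.
Qed.

Lemma Climit_seq_const (c : C) : Climit_seq (fun _ => c) c.
Proof.
  intros eps He. exists O. intros _ _. replace (c - c)%C with (RtoC 0) by ring. rewrite Cmod_0. lra.
Qed.

Lemma Climit_seq_mult (u v : nat -> C) (l m : C) : Climit_seq u l -> Climit_seq v m -> Climit_seq (fun n => u n * v n)%C (l * m)%C.
Proof.
  intros H K eps He.
  set (M := Cmod l + Cmod m + 1). pose proof (Cmod_ge_0 l). pose proof (Cmod_ge_0 m).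
  assert (HM : 1 <= M) by (unfold M; lra).
  set (q := Rmin 1 (eps / (3 * M))).
  assert (Hq : 0 < eps / (3 * M)) by (apply Rdiv_lt_0_compat; lra).
  assert (q1 : q <= 1) by apply Rmin_l.
  assert (q2 : q <= eps / (3 * M)) by apply Rmin_r.
  assert (q0 : 0 < q) by (apply Rmin_pos; lra).
  destruct (H q q0) as [n1 K1]. destruct (K q q0) as [n2 K2].
  exists (n1 + n2)%nat. intros n Hn. specialize (K1 n ltac:(lia)). specialize (K2 n ltac:(lia)).
  replace (u n * v n - l * m)%C with ((u n - l) * (v n - m) + (u n - l) * m + l * (v n - m))%C by ring.
  eapply Rle_trans; [apply Cmod_triangle|].
  eapply Rle_trans; [apply Rplus_le_compat_r, Cmod_triangle|].
  rewrite !Cmod_mult.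
  assert (Q : q * M <= eps / 3).
  { apply Rle_trans with (eps / (3 * M) * M); [apply Rmult_le_compat_r; lra|]. right; field; lra. }
  pose proof (Cmod_ge_0 (u n - l)); pose proof (Cmod_ge_0 (v n - m)).
  unfold M in *. nra.
Qed.

Lemma is_lim_seq_Climit (u : nat -> R) (l : R) : is_lim_seq u l -> Climit_seq (fun n => RtoC (u n)) l.
Proof.
  intros H eps He. apply is_lim_seq_spec in H. destruct (H (mkposreal eps He)) as [n0 Hn0]. exists n0. intros n Hn.
  rewrite <- RtoC_minus, Cmod_R. left. apply (Hn0 n Hn).
Qed.

(** Scaling the circle of radius [e^{-lam}]: the angle is [lam * t] with [|t| <= pi / lam]. *)
Lemma cmean_scaling (F : C -> C) (lam : R) : 0 < lam -> (forall z, Cmod z = exp (- lam) -> Ccont F z) ->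
  cmean F lam = (lam * CInt (fun t => F (cexp (- (lam * (1, t))))) (- (1) * (PI / lam)) (PI / lam))%C.
Proof.
  intros Hl HF. unfold cmean. rewrite <- CInt_Cmult.
  - pose proof (RInt_comp_lin (V := C_R_CompleteNormedModule) (fun y => F (cexp (- (lam, y)))) lam 0 (- (1) * (PI / lam)) (PI / lam)) as E.
    replace (lam * (- (1) * (PI / lam)) + 0) with (- PI) in E by (field; lra).
    replace (lam * (PI / lam) + 0) with PI in E by (field; lra).
    specialize (E (ex_cmean F lam HF)).
    transitivity (RInt (V := C_R_CompleteNormedModule) (fun y => F (cexp (- (lam, y)))) (- PI) PI).
    { reflexivity. }
    rewrite <- E. apply CInt_ext. intros t _. rewrite scal_R_Cmult.
    do 4 f_equal. unfold Cmult, RtoC; cbn [fst snd]. f_equal; ring.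
  - apply ex_CInt_cont. intros t _.
    intros eps He.
    assert (E : forall u, (- (lam * (1, u)))%C = (- (lam, (lam * u)%R))%C).
    { intros u. unfold Cmult, Copp, RtoC; cbn [fst snd]. f_equal; ring. }
    destruct (RCcont_circ F lam (lam * t) (HF _ (Cmod_circ _ _)) eps He) as [d [Hd K]].
    exists (d / lam). split; [apply Rdiv_lt_0_compat; lra|]. intros u Hu. rewrite !E.
    apply K. rewrite <- Rmult_minus_distr_l, Rabs_mult, (Rabs_pos_eq lam) by lra.
    apply Rmult_lt_compat_l with (r := lam) in Hu; [|lra]. replace (lam * (d / lam)) with d in Hu by (field; lra). exact Hu.
Qed.

(** * Gauss' limit for the Gamma function *)

(** [Rpower 0 y = 1] in Stdlib, hence this truncated power, continuous on the whole line for [0 < y]. *)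
Definition pospow (y t : R) : R := if Rle_dec t 0 then 0 else Rpower t y.

Lemma pospow_pos (y t : R) : 0 < t -> pospow y t = Rpower t y.
Proof. intros H. unfold pospow. destruct (Rle_dec t 0); [lra|reflexivity]. Qed.

Lemma pospow_nonpos (y t : R) : t <= 0 -> pospow y t = 0.
Proof. intros H. unfold pospow. destruct (Rle_dec t 0); [reflexivity|lra]. Qed.

Lemma pospow_ge_0 (y t : R) : 0 <= pospow y t.
Proof. unfold pospow. destruct (Rle_dec t 0); [lra|]. left; apply exp_pos. Qed.

Lemma Rpower_S (t y : R) : 0 < t -> Rpower t y = t * Rpower t (y - 1).
Proof.
  intros H. rewrite <- (Rpower_1 t) at 2 by exact H. rewrite <- Rpower_plus. f_equal. ring.
Qed.

Lemma Rpower_lt_base_small (y eps : R) : 0 < y -> 0 < eps -> exists d, 0 < d /\ forall t, 0 < t < d -> Rpower t y < eps.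
Proof.
  intros Hy He. exists (Rpower eps (/ y)). split; [apply exp_pos|]. intros t Ht.
  replace eps with (Rpower (Rpower eps (/ y)) y).
  - apply Rlt_Rpower_l; lra.
  - rewrite Rpower_mult, Rinv_l, Rpower_1 by lra. reflexivity.
Qed.

Lemma continuous_pospow (y t : R) : 0 < y -> continuous (pospow y) t.
Proof.
  intros Hy. destruct (Rtotal_order t 0) as [H|[H|H]].
  - apply (continuous_ext_loc _ (fun _ => 0)); [|apply continuous_const].
    assert (P : 0 < - t) by lra. exists (mkposreal _ P). intros u Hu.
    symmetry. apply pospow_nonpos. apply Rabs_def2 in Hu. simpl in Hu. unfold minus, plus, opp in Hu; simpl in Hu. lra.
  - subst t. apply continuity_pt_filterlim. intros eps He.
    destruct (Rpower_lt_base_small y eps Hy He) as [d [Hd K]]. exists d. split; [exact Hd|].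
    intros u [_ Hu]. simpl in *. unfold Rdist in *. rewrite (pospow_nonpos y 0) by lra. rewrite Rminus_0_r in *.
    rewrite Rabs_pos_eq by apply pospow_ge_0. destruct (Rle_dec u 0) as [L|L].
    + rewrite pospow_nonpos by exact L. exact He.
    + rewrite pospow_pos by lra. apply K. rewrite Rabs_pos_eq in Hu; lra.
  - apply (continuous_ext_loc _ (fun u => Rpower u y)).
    + exists (mkposreal _ H). intros u Hu. symmetry. apply pospow_pos.
      apply Rabs_def2 in Hu. simpl in Hu. unfold minus, plus, opp in Hu; simpl in Hu. lra.
    + apply (ex_derive_continuous (K := R_AbsRing) (V := R_NormedModule) (fun u => Rpower u y)).
      unfold Rpower. auto_derive. exact H.
Qed.

(** At t = 0 the right difference quotient is h^{y-1}, which tends to 0 because y > 1. *)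
Lemma is_derive_pospow (y t : R) : 1 < y -> is_derive (pospow y) t (y * pospow (y - 1) t).
Proof.
  intros Hy. destruct (Rtotal_order t 0) as [H|[H|H]].
  - rewrite (pospow_nonpos (y - 1)) by lra. rewrite Rmult_0_r.
    apply (is_derive_ext_loc (fun _ => 0)); [|apply (is_derive_const (K := R_AbsRing) (V := R_NormedModule) 0)].
    assert (P : 0 < - t) by lra. exists (mkposreal _ P). intros u Hu.
    symmetry. apply pospow_nonpos. apply Rabs_def2 in Hu. simpl in Hu. unfold minus, plus, opp in Hu; simpl in Hu. lra.
  - subst t. rewrite (pospow_nonpos (y - 1)) by lra. rewrite Rmult_0_r.
    apply is_derive_Reals. intros eps He.
    destruct (Rpower_lt_base_small (y - 1) eps ltac:(lra) He) as [d [Hd K]].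
    exists (mkposreal d Hd). intros h Hh0 Hh. simpl in Hh.
    rewrite (pospow_nonpos y 0), Rplus_0_l by lra. rewrite !Rminus_0_r.
    destruct (Rle_dec h 0) as [L|L].
    + rewrite pospow_nonpos by exact L. unfold Rdiv. rewrite Rmult_0_l, Rabs_R0. exact He.
    + rewrite pospow_pos, Rpower_S by lra. replace (h * Rpower h (y - 1) / h) with (Rpower h (y - 1)) by (field; lra).
      rewrite Rabs_pos_eq by (left; apply exp_pos). apply K. rewrite Rabs_pos_eq in Hh; lra.
  - rewrite pospow_pos by lra. apply (is_derive_ext_loc (fun u => Rpower u y)).
    + exists (mkposreal _ H). intros u Hu. symmetry. apply pospow_pos.
      apply Rabs_def2 in Hu. simpl in Hu. unfold minus, plus, opp in Hu; simpl in Hu. lra.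
    + replace (y * Rpower t (y - 1)) with (y * (Rpower t y / t)).
      * unfold Rpower. auto_derive; [exact H|]. field. lra.
      * rewrite (Rpower_S t y H). field. lra.
Qed.

(** The rising factorial b(b+1)...(b+m-1). *)
Fixpoint poch (b : R) (m : nat) : R := match m with O => 1 | S m' => poch b m' * (b + INR m') end.

Lemma poch_S (b : R) (m : nat) : poch b (S m) = poch b m * (b + INR m).
Proof. reflexivity. Qed.

Lemma poch_pos (b : R) (m : nat) : 0 < b -> 0 < poch b m.
Proof. intros Hb. induction m as [|m IH]; [simpl; lra|]. rewrite poch_S. pose proof (pos_INR m). nra. Qed.

Lemma poch_shift (b : R) (m : nat) : poch b (S m) = b * poch (b + 1) m.
Proof.
  induction m as [|m IH]; [simpl; ring|]. rewrite poch_S, IH, poch_S, S_INR. ring.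
Qed.

(** Integration by parts trades one factor (1 - t/n) for one more power of t; hence the induction on
    m with y general. *)
Lemma beta_integral (n : R) (m : nat) : 0 < n -> forall y, 1 < y ->
  is_RInt (fun t => pospow (y - 1) t * (1 - t / n) ^ m) 0 n (Rpower n y * INR (Factorial.fact m) / poch y (S m)).
Proof.
  intros Hn. induction m as [|m IH]; intros y Hy.
  - replace (Rpower n y * INR (Factorial.fact 0) / poch y 1) with (minus ((fun t => pospow y t / y) n) ((fun t => pospow y t / y) 0)).
    2:{ unfold minus, plus, opp; simpl. rewrite pospow_pos, pospow_nonpos by lra. field. lra. }
    apply (is_RInt_ext (V := R_NormedModule) (fun t => pospow (y - 1) t)); [intros; simpl; ring|].
    apply (is_RInt_derive (V := R_CompleteNormedModule) (fun t => pospow y t / y)).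
    + intros t _. apply (is_derive_ext (fun t => / y * pospow y t)); [intros; simpl; field; lra|].
      replace (pospow (y - 1) t) with (/ y * (y * pospow (y - 1) t)) by (field; lra).
      apply is_derive_scal, is_derive_pospow, Hy.
    + intros t _. apply continuous_pospow. lra.
  - specialize (IH (y + 1) ltac:(lra)).
    replace (y + 1 - 1) with y in IH by ring.
    assert (D : is_RInt (fun t => y * pospow (y - 1) t * (1 - t / n) ^ S m + pospow y t * (- (INR (S m) / n) * (1 - t / n) ^ m)) 0 n 0).
    { replace 0 with (minus ((fun t => pospow y t * (1 - t / n) ^ S m) n) ((fun t => pospow y t * (1 - t / n) ^ S m) 0)) at 2.
      2:{ unfold minus, plus, opp; cbn -[pow INR]. rewrite (pospow_nonpos y 0) by lra.
          replace (1 - n / n) with 0 by (field; lra). simpl. ring. }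
      apply (is_RInt_derive (V := R_CompleteNormedModule) (fun t => pospow y t * (1 - t / n) ^ S m)).
      - intros t _. apply (is_derive_mult (pospow y) (fun t => (1 - t / n) ^ S m)); [apply is_derive_pospow, Hy| |intros; apply Rmult_comm].
        auto_derive; [exact I|]. change (match m with O => 1 | S _ => INR m + 1 end) with (INR (S m)). replace (1 + - (t * / n)) with (1 - t / n) by (field; lra). field. lra.
      - intros t _. apply (continuous_plus (V := R_NormedModule)).
        + apply (continuous_mult (K := R_AbsRing)).
          * apply (continuous_mult (K := R_AbsRing)); [apply continuous_const|]. apply continuous_pospow; lra.
          * apply (ex_derive_continuous (K := R_AbsRing) (V := R_NormedModule)). auto_derive. exact I.
        + apply (continuous_mult (K := R_AbsRing)); [apply continuous_pospow; lra|].
          apply (ex_derive_continuous (K := R_AbsRing) (V := R_NormedModule)). auto_derive. exact I. }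
    apply (is_RInt_scal (V := R_NormedModule) _ _ _ (INR (S m) / n)) in IH.
    pose proof (is_RInt_plus (V := R_NormedModule) _ _ _ _ _ _ D IH) as S1.
    apply (is_RInt_scal (V := R_NormedModule) _ _ _ (/ y)) in S1.
    replace (Rpower n y * INR (Factorial.fact (S m)) / poch y (S (S m))) with
      (scal (/ y) (plus 0 (scal (INR (S m) / n) (Rpower n (y + 1) * INR (Factorial.fact m) / poch (y + 1) (S m))))).
    + revert S1. apply is_RInt_ext. intros t _. unfold scal, plus; simpl. unfold mult; simpl. field. lra.
    + unfold scal, plus; cbn -[INR poch Factorial.fact]. unfold mult; cbn -[INR poch Factorial.fact].
      rewrite (poch_shift y (S m)). change (Factorial.fact (S m)) with (S m * Factorial.fact m)%nat. rewrite mult_INR.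
      rewrite (Rpower_S n (y + 1)) by exact Hn. replace (y + 1 - 1) with y by ring.
      pose proof (poch_pos (y + 1) (S m) ltac:(lra)). field. lra.
Qed.

Definition is_Gamma (y l : R) : Prop :=
  is_RInt_gen (fun t => Rpower t (y - 1) * exp (- t)) (at_right 0) (Rbar_locally p_infty) l.

Lemma Gamma_unique (y l : R) : is_Gamma y l -> Gamma y = l.
Proof.
  intros H. unfold Gamma. apply is_RInt_gen_unique. exact H.
Qed.

(** The tangent of the logarithm at 2y gives y ln t <= y ln(2y) + t/2 - y. *)
Lemma pow_exp_bound (y : R) : 0 < y -> exists c, 0 < c /\ forall t, 0 < t -> Rpower t y * exp (- t) <= c * exp (- (t / 2)).
Proof.
  intros Hy. exists (exp (y * ln (2 * y))). split; [apply exp_pos|]. intros t Ht.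
  unfold Rpower. rewrite <- !exp_plus. apply exp_le_compat.
  pose proof (ln_le_sub1 (t / (2 * y)) ltac:(apply Rdiv_lt_0_compat; lra)) as L.
  unfold Rdiv in L. rewrite ln_mult in L; [|lra|apply Rinv_0_lt_compat; lra]. rewrite ln_Rinv in L by lra.
  apply Rmult_le_compat_l with (r := y) in L; [|lra].
  replace (y * (t * / (2 * y) - 1)) with (t / 2 - y) in L by (field; lra). lra.
Qed.

(** Since e^{t/2} >= (1 + t/4)^2 and 16 (1 + t/4)^2 = (4 + t)^2 >= 1 + t^2. *)
Lemma exp_half_bound (t : R) : 0 <= t -> exp (- (t / 2)) <= 16 / (1 + t ^ 2).
Proof.
  intros Ht. pose proof (exp_ineq1_le (t / 4)) as E.
  apply Rmult_le_reg_r with (1 + t ^ 2); [nra|]. unfold Rdiv at 2. rewrite Rmult_assoc, Rinv_l by nra.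
  apply Rmult_le_reg_l with (exp (t / 2)); [apply exp_pos|].
  rewrite <- Rmult_assoc, <- exp_plus. replace (t / 2 + - (t / 2)) with 0 by ring. rewrite exp_0.
  replace (t / 2) with (t / 4 + t / 4) by field. rewrite exp_plus.
  assert ((1 + t / 4) * (1 + t / 4) <= exp (t / 4) * exp (t / 4)) by (apply Rmult_le_compat; lra). nra.
Qed.

Definition gamma_integrand (y t : R) : R := pospow (y - 1) t * exp (- t).

Lemma gamma_integrand_bound (y : R) : 1 < y -> exists c, 0 < c /\ forall t, 0 <= t ->
  0 <= gamma_integrand y t <= c / (1 + t ^ 2).
Proof.
  intros Hy. destruct (pow_exp_bound (y - 1) ltac:(lra)) as [c [Hc K]].
  exists (c * 16). split; [lra|]. intros t Ht. unfold gamma_integrand. split.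
  - apply Rmult_le_pos; [apply pospow_ge_0|left; apply exp_pos].
  - destruct (Rle_lt_or_eq_dec 0 t Ht) as [P|E].
    + rewrite pospow_pos by exact P. eapply Rle_trans; [apply K, P|].
      unfold Rdiv. rewrite Rmult_assoc. apply Rmult_le_compat_l; [lra|]. apply exp_half_bound, Ht.
    + subst t. rewrite pospow_nonpos by lra. rewrite Rmult_0_l. apply Rmult_le_pos; [lra|]. left. apply Rinv_0_lt_compat. nra.
Qed.

Lemma continuous_RCcont (f : R -> R) (t : R) : continuous f t -> RCcont (fun u => RtoC (f u)) t.
Proof.
  intros H eps He. apply continuity_pt_filterlim in H. destruct (H eps He) as [d [Hd K]].
  exists d. split; [exact Hd|]. intros u Hu. rewrite <- RtoC_minus, Cmod_R.
  destruct (Req_dec u t) as [->|N].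
  - replace (f t - f t) with 0 by ring. rewrite Rabs_R0. exact He.
  - apply (K u). split; [split; [exact I|lra]|exact Hu].
Qed.

Lemma is_CInt_RtoC (f : R -> R) (a b l : R) : is_RInt f a b l -> is_CInt (fun t => RtoC (f t)) a b l.
Proof.
  intros H. apply is_CInt_pair_iff. simpl. split; [exact H|].
  pose proof (is_RInt_const (V := R_NormedModule) a b 0) as K.
  evar_last; [exact K|]. unfold scal; simpl; unfold mult; simpl. ring.
Qed.

Lemma continuous_gamma_integrand (y t : R) : 1 < y -> continuous (gamma_integrand y) t.
Proof.
  intros Hy. apply (continuous_mult (K := R_AbsRing)); [apply continuous_pospow; lra|].
  apply (ex_derive_continuous (K := R_AbsRing) (V := R_NormedModule)). auto_derive. exact I.
Qed.

Lemma pow_diff_le (a b : R) (n : nat) : 0 <= b <= a -> a <= 1 -> a ^ n - b ^ n <= INR n * (a - b).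
Proof.
  intros Hb Ha. induction n as [|n IH]; [simpl; lra|]. rewrite S_INR. simpl.
  replace (a * a ^ n - b * b ^ n) with (a * (a ^ n - b ^ n) + (a - b) * b ^ n) by ring.
  assert (0 <= b ^ n <= 1) by (split; [apply pow_le; lra|rewrite <- (pow1 n); apply pow_incr; lra]).
  assert (b ^ n <= a ^ n) by (apply pow_incr; lra).
  assert (a * (a ^ n - b ^ n) <= a ^ n - b ^ n) by nra.
  nra.
Qed.

Lemma exp_pow (x : R) (n : nat) : exp x ^ n = exp (INR n * x).
Proof.
  induction n as [|n IH]; [simpl; rewrite Rmult_0_l, exp_0; reflexivity|].
  rewrite S_INR. simpl. rewrite IH, <- exp_plus. f_equal. ring.
Qed.

(** With x = t/n one has 0 <= e^{-x} - (1 - x) <= x^2, and n-th powers of numbers in [0, 1] differ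
    by at most n times the difference of the bases. *)
Lemma one_minus_pow_bounds (n : nat) (t : R) : (0 < n)%nat -> 0 <= t <= INR n ->
  0 <= (1 - t / INR n) ^ n <= exp (- t) /\ exp (- t) - (1 - t / INR n) ^ n <= t ^ 2 / INR n.
Proof.
  intros Hn Ht. assert (P : 0 < INR n) by (apply lt_0_INR; lia).
  assert (Q : 0 <= t / INR n <= 1).
  { split; [apply Rmult_le_pos; [lra|left; apply Rinv_0_lt_compat, P]|].
    apply Rmult_le_reg_r with (INR n); [exact P|]. unfold Rdiv. rewrite Rmult_assoc, Rinv_l by lra. lra. }
  assert (E : exp (- t) = exp (- (t / INR n)) ^ n) by (rewrite exp_pow; f_equal; field; lra).
  set (x := t / INR n) in *.
  pose proof (exp_ineq1_le (- x)) as L.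
  assert (U : exp (- x) <= 1) by (rewrite <- exp_0; apply exp_le_compat; lra).
  assert (V : exp (- x) - (1 - x) <= x ^ 2).
  { destruct (Req_dec x 0) as [->|Nx].
    - rewrite Ropp_0, exp_0. lra.
    - pose proof (exp_ineq1_le x) as L2. rewrite exp_Ropp.
      assert (/ exp x <= / (1 + x)) by (apply Rinv_le_contravar; lra).
      assert (/ (1 + x) <= 1 - x + x ^ 2).
      { apply Rmult_le_reg_r with (1 + x); [lra|]. rewrite Rinv_l by lra.
        replace ((1 - x + x ^ 2) * (1 + x)) with (1 + x ^ 3) by ring. pose proof (pow_le x 3 ltac:(lra)). lra. }
      lra. }
  rewrite E. repeat split.
  - apply pow_le. lra.
  - apply pow_incr. lra.
  - eapply Rle_trans; [apply pow_diff_le; lra|].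
    apply Rle_trans with (INR n * x ^ 2); [apply Rmult_le_compat_l; lra|]. right. unfold x. field. lra.
Qed.

(** (1 - t/n)^n increases to at most e^{-t} and converges to it, so dominated convergence on the
    half line sends the beta integrals to Euler's integral. The condition y > 1 keeps the integrand
    continuous at 0. *)
Lemma gauss_limit (y : R) : 1 < y -> exists l,
  Climit_infty (fun T => CInt (fun t => RtoC (gamma_integrand y t)) (- 0 * T) T) l /\
  Climit_seq (fun n => RtoC (Rpower (INR n) y * INR (Factorial.fact n) / poch y (S n))) l.
Proof.
  intros Hy. destruct (gamma_integrand_bound y Hy) as [c [Hc B]].
  assert (Cg : forall t, RCcont (fun t => RtoC (gamma_integrand y t)) t).
  { intros t. apply continuous_RCcont, continuous_gamma_integrand, Hy. }
  assert (Bg : forall t, 0 <= t -> Cmod (gamma_integrand y t) <= c / (1 + t ^ 2)).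
  { intros t Ht. rewrite Cmod_R, Rabs_pos_eq; apply B, Ht. }
  destruct (Climit_infty_exists 0 c (fun t => RtoC (gamma_integrand y t))) as [l Hl]; [auto|lra|auto| |].
  { intros t Ht. apply Bg. lra. }
  exists l. split; [exact Hl|].
  apply (Climit_seq_ext (fun n => CInt (fun t => RtoC (pospow (y - 1) t * (1 - t / INR n) ^ n)) (- 0 * INR n) (INR n)) _ _ 1).
  { intros n Hn. replace (- 0 * INR n) with 0 by ring. apply is_CInt_unique, is_CInt_RtoC, beta_integral; [apply lt_0_INR; lia|exact Hy]. }
  apply (dominated_convergence 0 c (fun n t => RtoC (pospow (y - 1) t * (1 - t / INR n) ^ n)) (fun t => RtoC (gamma_integrand y t)) INR).
  - auto.
  - lra.
  - intros T. destruct (INR_unbounded T) as [n0 Hn0]. exists n0. intros n Hn. apply le_INR in Hn. lra.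
  - exists 1%nat. intros n Hn t _. apply continuous_RCcont.
    apply (continuous_mult (K := R_AbsRing)); [apply continuous_pospow; lra|].
    apply (ex_derive_continuous (K := R_AbsRing) (V := R_NormedModule)). auto_derive. exact I.
  - auto.
  - intros T eps HT He.
    set (M := Rpower T (y - 1)). assert (HM : 0 < M) by apply exp_pos.
    destruct (INR_unbounded (M * T ^ 2 / eps + T)) as [n0 Hn0].
    assert (Q : 0 <= M * T ^ 2 / eps) by (apply Rmult_le_pos; [apply Rmult_le_pos; [lra|apply pow2_ge_0]|left; apply Rinv_0_lt_compat; lra]).
    exists (S n0). intros n Hn t Ht. assert (Hn' : INR n0 <= INR n) by (apply le_INR; lia).
    assert (Ht' : 0 <= t <= INR n) by lra.
    destruct (one_minus_pow_bounds n t ltac:(lia) Ht') as [[B1 B2] B3].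
    rewrite <- RtoC_minus, Cmod_R. unfold gamma_integrand. rewrite <- Rmult_minus_distr_l, Rabs_mult.
    rewrite (Rabs_pos_eq (pospow _ _)) by apply pospow_ge_0. rewrite (Rabs_left1 (_ - _)) by lra.
    assert (PM : pospow (y - 1) t <= M).
    { destruct (Rle_dec t 0); [rewrite pospow_nonpos by lra; lra|]. rewrite pospow_pos by lra. apply Rle_Rpower_l; lra. }
    apply Rle_trans with (M * (T ^ 2 / INR n)).
    + apply Rmult_le_compat; [apply pospow_ge_0|lra|exact PM|].
      apply Rle_trans with (t ^ 2 / INR n); [lra|]. apply Rmult_le_compat_r; [left; apply Rinv_0_lt_compat; lra|]. apply pow_incr. lra.
    + assert (Q2 : M * T ^ 2 / eps <= INR n) by lra.
      apply Rmult_le_compat_r with (r := eps) in Q2; [|lra]. replace (M * T ^ 2 / eps * eps) with (M * T ^ 2) in Q2 by (field; lra).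
      apply Rmult_le_reg_r with (INR n); [lra|]. replace (M * (T ^ 2 / INR n) * INR n) with (M * T ^ 2) by (field; lra). lra.
  - exists 1%nat. intros n Hn t Ht. assert (Ht' : 0 <= t <= INR n) by lra.
    destruct (one_minus_pow_bounds n t ltac:(lia) Ht') as [[B1 B2] _].
    eapply Rle_trans; [|apply (Bg t); lra]. rewrite !Cmod_R. unfold gamma_integrand. rewrite !Rabs_mult.
    apply Rmult_le_compat_l; [apply Rabs_pos|]. rewrite !Rabs_pos_eq; lra.
  - exact Hl.
Qed.

(** Translates the limit of integrals over [0, T] into the integral that is improper at both ends.
    The integrand is at most c, so the piece [0, a] costs at most c a. *)
Lemma is_Gamma_of_limit (y : R) (l : C) : 1 < y ->
  Climit_infty (fun T => CInt (fun t => RtoC (gamma_integrand y t)) (- 0 * T) T) l -> l = RtoC (fst l) /\ is_Gamma y (fst l).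
Proof.
  intros Hy Hl.
  destruct (gamma_integrand_bound y Hy) as [c [Hc B]].
  assert (Ex : forall a b, ex_RInt (gamma_integrand y) a b).
  { intros a b. apply (ex_RInt_continuous (V := R_CompleteNormedModule)). intros t _. apply continuous_gamma_integrand, Hy. }
  assert (E : forall T, CInt (fun t => RtoC (gamma_integrand y t)) (- 0 * T) T = RtoC (RInt (gamma_integrand y) 0 T)).
  { intros T. replace (- 0 * T) with 0 by ring. apply is_CInt_unique, is_CInt_RtoC, (RInt_correct (V := R_CompleteNormedModule)), Ex. }
  split.
  - destruct l as [l1 l2]. unfold RtoC; simpl. f_equal.
    destruct (Req_dec l2 0) as [Z|NZ]; [exact Z|exfalso].
    assert (P : 0 < Rabs l2) by (apply Rabs_pos_lt, NZ).
    destruct (Hl (Rabs l2 / 2)) as [T0 [_ K]]; [lra|]. specialize (K T0 (Rle_refl _)). cbv beta in K. rewrite E in K.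
    pose proof (snd_le_Cmod (RtoC (RInt (gamma_integrand y) 0 T0) - (l1, l2))) as F. cbn [snd Cminus Cplus Copp RtoC] in F.
    rewrite Rplus_0_l, Rabs_Ropp in F. lra.
  - intros P [eps HP].
    destruct (Hl (eps / 2)) as [T0 [HT0 K]]; [pose proof (cond_pos eps); lra|].
    assert (Hd : 0 < Rmin 1 (eps / (4 * c))).
    { apply Rmin_pos; [lra|]. apply Rdiv_lt_0_compat; [apply cond_pos|lra]. }
    unfold filtermapi.
    apply (Filter_prod _ _ _ (fun a => 0 < a < Rmin 1 (eps / (4 * c))) (fun b => Rmax 1 T0 < b)).
    + exists (mkposreal _ Hd). intros a Ha Ha0. apply Rabs_def2 in Ha. simpl in Ha. unfold minus, plus, opp in Ha; simpl in Ha. lra.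
    + exists (Rmax 1 T0). auto.
    + intros a b Ha Hb. cbn [fst snd].
      pose proof (Rmax_l 1 T0). pose proof (Rmax_r 1 T0). pose proof (Rmin_l 1 (eps / (4 * c))). pose proof (Rmin_r 1 (eps / (4 * c))).
      exists (RInt (gamma_integrand y) a b). split.
      * apply (is_RInt_ext (V := R_NormedModule) (gamma_integrand y)).
        -- intros t Ht. rewrite Rmin_left in Ht by lra. unfold gamma_integrand. rewrite pospow_pos by lra. reflexivity.
        -- apply (RInt_correct (V := R_CompleteNormedModule)), Ex.
      * apply HP. specialize (K b ltac:(lra)). cbv beta in K. rewrite E in K.
        pose proof (fst_le_Cmod (RtoC (RInt (gamma_integrand y) 0 b) - l)) as F. cbn [fst Cminus Cplus Copp RtoC] in F.
        pose proof (RInt_Chasles (V := R_CompleteNormedModule) (gamma_integrand y) 0 a b (Ex _ _) (Ex _ _)) as Ch.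
        unfold plus in Ch; simpl in Ch.
        assert (Ba : Rabs (RInt (gamma_integrand y) 0 a) <= (a - 0) * c).
        { apply (norm_RInt_le_const (V := R_NormedModule) (gamma_integrand y) 0 a); [lra| |apply (RInt_correct (V := R_CompleteNormedModule)), Ex].
          intros t Ht. unfold norm; simpl; unfold abs; simpl. rewrite Rabs_pos_eq by (apply B; lra).
          eapply Rle_trans; [apply B; lra|]. apply Rle_trans with (c * / 1); [|lra].
          apply Rmult_le_compat_l; [lra|]. apply Rinv_le_contravar; nra. }
        assert (Ba2 : (a - 0) * c < eps / 2).
        { apply Rlt_le_trans with (eps / (4 * c) * c); [apply Rmult_lt_compat_r; lra|]. pose proof (cond_pos eps).
          replace (eps / (4 * c) * c) with (eps / 4) by (field; lra). lra. }
        unfold ball; simpl; unfold AbsRing_ball, abs, minus, plus, opp; simpl.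
        change (Rabs (RInt (gamma_integrand y) a b + - fst l) < eps).
        replace (RInt (gamma_integrand y) a b) with (RInt (gamma_integrand y) 0 b - RInt (gamma_integrand y) 0 a) by (rewrite <- Ch; ring).
        replace (RInt (gamma_integrand y) 0 b - RInt (gamma_integrand y) 0 a + - fst l) with
          ((RInt (gamma_integrand y) 0 b + - fst l) + - RInt (gamma_integrand y) 0 a) by ring.
        eapply Rle_lt_trans; [apply Rabs_triang|]. rewrite Rabs_Ropp. lra.
Qed.

(** Gamma(y+1) = y Gamma(y) by parts, read downwards: it reaches 0 < y <= 1, where the integrand is
    not covered by the truncated power. Both boundary terms t^y e^{-t} tend to 0. *)
Lemma is_Gamma_down (y l : R) : 0 < y -> is_Gamma (y + 1) l -> is_Gamma y (l / y).
Proof.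
  intros Hy H P [eps HP].
  assert (He : 0 < eps * y / 3) by (pose proof (cond_pos eps); nra).
  assert (HB : locally l (fun v : R => Rabs (v - l) < eps * y / 3)).
  { exists (mkposreal _ He). intros v Hv. exact Hv. }
  destruct (H _ HB) as [Qa Qb HQa HQb HQ].
  unfold filtermapi in *.
  destruct (Rpower_lt_base_small y (eps * y / 3) Hy He) as [d [Hd Kd]].
  destruct (pow_exp_bound y Hy) as [c [Hc Kc]].
  assert (HT : exists T0, 1 < T0 /\ forall b, T0 < b -> Rpower b y * exp (- b) < eps * y / 3).
  { exists (1 + Rmax 1 (c * 16 / (eps * y / 3))). pose proof (Rmax_l 1 (c * 16 / (eps * y / 3))). pose proof (Rmax_r 1 (c * 16 / (eps * y / 3))).
    split; [lra|]. intros b Hb.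
    eapply Rle_lt_trans; [apply Kc; lra|]. eapply Rle_lt_trans; [apply Rmult_le_compat_l; [lra|apply exp_half_bound; lra]|].
    assert (Q : c * 16 / (eps * y / 3) < b) by lra.
    apply Rmult_lt_compat_r with (r := eps * y / 3) in Q; [|exact He].
    replace (c * 16 / (eps * y / 3) * (eps * y / 3)) with (c * 16) in Q by (field; pose proof (cond_pos eps); nra).
    apply Rmult_lt_reg_r with (1 + b ^ 2); [nra|]. replace (c * (16 / (1 + b ^ 2)) * (1 + b ^ 2)) with (c * 16) by (field; nra).
    assert (b < 1 + b ^ 2) by nra. nra. }
  destruct HT as [T0 [HT0 KT]].
  apply (Filter_prod _ _ _ (fun a => Qa a /\ 0 < a < Rmin 1 d) (fun b => Qb b /\ T0 < b)).
  - apply filter_and; [exact HQa|]. assert (Hm : 0 < Rmin 1 d) by (apply Rmin_pos; lra).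
    exists (mkposreal _ Hm). intros a Ha Ha0. apply Rabs_def2 in Ha. simpl in Ha. unfold minus, plus, opp in Ha; simpl in Ha. lra.
  - apply filter_and; [exact HQb|]. exists T0. auto.
  - intros a b [Ha [Ha1 Ha2]] [Hb Hb2]. cbn [fst snd] in *.
    pose proof (Rmin_l 1 d). pose proof (Rmin_r 1 d).
    destruct (HQ a b Ha Hb) as [v [Iv Bv]]. cbn [fst snd] in Iv.
    replace (y + 1 - 1) with y in Iv by ring.
    exists ((Rpower b y * exp (- b) - Rpower a y * exp (- a) + v) / y). split.
    + assert (D : is_RInt (fun t => y * Rpower t (y - 1) * exp (- t) - Rpower t y * exp (- t)) a b (Rpower b y * exp (- b) - Rpower a y * exp (- a))).
      { apply (is_RInt_derive (V := R_CompleteNormedModule) (fun t => Rpower t y * exp (- t))); intros t Ht; rewrite Rmin_left in Ht by lra.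
        - replace (y * Rpower t (y - 1)) with (y * (Rpower t y / t)) by (rewrite (Rpower_S t y) by lra; field; lra).
          unfold Rpower. auto_derive; [lra|]. field. lra.
        - apply (ex_derive_continuous (K := R_AbsRing) (V := R_NormedModule)). unfold Rpower. auto_derive. repeat split; lra. }
      pose proof (is_RInt_plus (V := R_NormedModule) _ _ _ _ _ _ D Iv) as S1.
      apply (is_RInt_scal (V := R_NormedModule) _ _ _ (/ y)) in S1.
      replace ((Rpower b y * exp (- b) - Rpower a y * exp (- a) + v) / y) with (scal (/ y) (plus (Rpower b y * exp (- b) - Rpower a y * exp (- a)) v)).
      2:{ unfold scal, plus; simpl; unfold mult; simpl. field. lra. }
      revert S1. apply is_RInt_ext. intros t _. unfold scal, plus; simpl; unfold mult; simpl. field. lra.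
    + apply HP. unfold ball; simpl; unfold AbsRing_ball, abs, minus, plus, opp; simpl.
      assert (A1 : 0 < Rpower a y * exp (- a) < eps * y / 3).
      { split; [apply Rmult_lt_0_compat; apply exp_pos|].
        eapply Rle_lt_trans; [|apply (Kd a); lra]. rewrite <- (Rmult_1_r (Rpower a y)) at 2.
        apply Rmult_le_compat_l; [left; apply exp_pos|]. rewrite <- exp_0. apply exp_le_compat. lra. }
      assert (B1 : 0 < Rpower b y * exp (- b) < eps * y / 3) by (split; [apply Rmult_lt_0_compat; apply exp_pos|apply KT, Hb2]).
      replace ((Rpower b y * exp (- b) - Rpower a y * exp (- a) + v) / y + - (l / y)) with
        ((Rpower b y * exp (- b) - Rpower a y * exp (- a) + (v - l)) / y) by (field; lra).
      unfold Rdiv. rewrite Rabs_mult, (Rabs_pos_eq (/ y)) by (left; apply Rinv_0_lt_compat, Hy).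
      apply Rmult_lt_reg_r with y; [exact Hy|]. rewrite Rmult_assoc, Rinv_l, Rmult_1_r by lra.
      apply Rabs_def2 in Bv. apply Rabs_def1; lra.
Qed.

(** * Hankel's formula for the Gamma function on a vertical line *)

Lemma Cmod_vline_sqr (t : R) : Cmod (1, t) ^ 2 = 1 + t ^ 2.
Proof. rewrite Cmod2_alt. simpl. ring. Qed.

Lemma Cmod_vline_ge_1 (t : R) : 1 <= Cmod (1, t).
Proof. pose proof (fst_le_Cmod (1, t)) as F. simpl in F. rewrite Rabs_pos_eq in F; lra. Qed.

Lemma Cmod_vline_le (t : R) : Cmod (1, t) <= 1 + Rabs t.
Proof. eapply Rle_trans; [apply Cmod_le_abs|]. simpl. rewrite (Rabs_pos_eq 1); lra. Qed.

Lemma Cmod_vline_ge (t : R) : Rabs t <= Cmod (1, t).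
Proof. apply (snd_le_Cmod (1, t)). Qed.

Lemma Clog_vline (t : R) : Clog (1, t) = (ln (Cmod (1, t)), atan t).
Proof. rewrite Clog_pos by (simpl; lra). cbn [fst snd]. do 2 f_equal. field. Qed.

Lemma ln_Cmod_vline_ge_0 (t : R) : 0 <= ln (Cmod (1, t)).
Proof. rewrite <- ln_1. pose proof (Cmod_vline_ge_1 t). destruct H as [H|H]; [left; apply ln_increasing; lra|rewrite <- H; lra]. Qed.

Lemma Cmod_Clog_vline (t : R) : Cmod (Clog (1, t)) <= ln (Cmod (1, t)) + 2.
Proof.
  rewrite Clog_vline. eapply Rle_trans; [apply Cmod_le_abs|]. cbn [fst snd].
  pose proof (ln_Cmod_vline_ge_0 t). pose proof (atan_bound t). pose proof PI_4.
  rewrite (Rabs_pos_eq (ln _)) by assumption. assert (Rabs (atan t) <= 2) by (apply Rabs_le; lra). lra.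
Qed.

Lemma inv_vline_sqr_bound (y t : R) : 2 <= y -> exp (- (y * ln (Cmod (1, t)))) <= 1 / (1 + t ^ 2).
Proof.
  intros Hy. rewrite <- Cmod_vline_sqr. pose proof (Cmod_vline_ge_1 t). pose proof (ln_Cmod_vline_ge_0 t).
  apply Rle_trans with (exp (- (2 * ln (Cmod (1, t))))); [apply exp_le_compat; nra|].
  rewrite exp_Ropp. replace (2 * ln (Cmod (1, t))) with (ln (Cmod (1, t)) + ln (Cmod (1, t))) by ring.
  rewrite exp_plus, exp_ln by lra. unfold Rdiv. rewrite Rmult_1_l. right. f_equal. ring.
Qed.

(** sin t >= t - t^3/6, and t^2/6 <= 2/3 on this interval. *)
Lemma sin_ge_third (t : R) : 0 <= t <= 2 -> t / 3 <= sin t.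
Proof.
  intros Ht. destruct (pre_sin_bound t 0 ltac:(lra) ltac:(lra)) as [H _].
  unfold sin_approx, sum_f_R0, sin_term in H. simpl in H.
  assert (t * t <= 4) by nra. nra.
Qed.

(** |1 - e^{-w}|^2 = (1-e)^2 + 4 e sin^2(y/2) with e = e^{-x}. Together with 1 - e >= x/2, e >= 1/3
    and |sin(y/2)| >= |y|/6 this gives the domination on the whole circle when s = 1. *)
Lemma one_sub_exp_lower (x y : R) : 0 < x <= 1 -> - PI <= y <= PI ->
  Cmod (x, y) / 6 <= Cmod (1 - cexp (- (x, y)))%C.
Proof.
  intros Hx Hy. pose proof PI_4.
  apply Rsqr_incr_0_var; [|apply Cmod_ge_0]. rewrite !Rsqr_pow2.
  unfold Rdiv. rewrite Rpow_mult_distr, !Cmod2_alt.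
  unfold cexp, Re, Im; cbn [fst snd Cminus Cplus Copp RtoC]. rewrite cos_neg, sin_neg.
  set (e := exp (- x)).
  assert (E1 : e <= 1 - x / 2).
  { unfold e. pose proof (exp_ineq1_le x). rewrite exp_Ropp.
    apply Rle_trans with (/ (1 + x)); [apply Rinv_le_contravar; lra|].
    apply Rmult_le_reg_r with (1 + x); [lra|]. rewrite Rinv_l by lra. nra. }
  assert (E2 : / 3 <= e).
  { unfold e. rewrite exp_Ropp. apply Rinv_le_contravar; [apply exp_pos|].
    eapply Rle_trans; [apply exp_le_compat with (y := 1); lra|apply exp_1_lt_3]. }
  assert (Cy : 1 - cos y = 2 * sin (y / 2) ^ 2).
  { replace y with (2 * (y / 2)) at 1 by field. rewrite cos_2a_sin. ring. }
  assert (S : y ^ 2 / 36 <= sin (y / 2) ^ 2).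
  { destruct (Rle_dec 0 y) as [P|P].
    - pose proof (sin_ge_third (y / 2) ltac:(lra)). nra.
    - pose proof (sin_ge_third (- (y / 2)) ltac:(lra)) as W. rewrite sin_neg in W. nra. }
  pose proof (sin2_cos2 y) as SC. unfold Rsqr in SC.
  replace ((1 + - (e * cos y)) ^ 2 + (0 + - (e * - sin y)) ^ 2)
    with (1 - 2 * e * cos y + e ^ 2 * (sin y * sin y + cos y * cos y)) by ring.
  rewrite SC.
  replace (1 - 2 * e * cos y + e ^ 2 * 1) with ((1 - e) ^ 2 + 2 * e * (1 - cos y)) by ring. rewrite Cy.
  assert (x ^ 2 / 4 <= (1 - e) ^ 2) by nra.
  assert (2 * e * (2 * sin (y / 2) ^ 2) >= 4 / 3 * (y ^ 2 / 36)).
  { assert (0 <= y ^ 2) by apply pow2_ge_0. nra. }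
  pose proof (pow2_ge_0 x). pose proof (pow2_ge_0 y). nra.
Qed.

Lemma one_sub_exp_expansion (w : C) : w <> 0 -> Cmod w <= 1 -> exists p : C,
  (1 - cexp (- w))%C = (w * (1 + p))%C /\ Cmod p <= 3 * Cmod w.
Proof.
  intros Hw H1. exists ((1 - cexp (- w) - w) / w)%C. split; [field; exact Hw|].
  rewrite Cmod_div by exact Hw. assert (P : 0 < Cmod w) by (apply Cmod_gt_0, Hw).
  replace (1 - cexp (- w) - w)%C with (- (cexp (- w) - 1 - - w))%C by ring. rewrite Cmod_opp.
  pose proof (cexp_bound2 (- w)) as B. rewrite Cmod_opp in B.
  apply Rmult_le_reg_r with (Cmod w); [exact P|]. unfold Rdiv. rewrite Rmult_assoc, Rinv_l, Rmult_1_r by lra.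
  eapply Rle_trans; [exact B|].
  assert (exp (Cmod w) <= 3) by (eapply Rle_trans; [apply exp_le_compat with (y := 1); lra|apply exp_1_lt_3]).
  pose proof (pow2_ge_0 (Cmod w)). nra.
Qed.

Lemma nz_of_fst_pos (w : C) : 0 < fst w -> w <> 0.
Proof. intros H E. subst w. simpl in H. lra. Qed.

Lemma Clog_one_sub_exp (w : C) : 0 < fst w -> Cmod w <= / 6 -> Cmod (Clog (1 - cexp (- w)) - Clog w) <= 12 * Cmod w.
Proof.
  intros Hw H6. pose proof (nz_of_fst_pos w Hw) as Nw.
  destruct (one_sub_exp_expansion w Nw ltac:(lra)) as [p [E Hp]].
  rewrite E, Clog_mult by (try apply fst_1p_pos; lra).
  replace (Clog w + Clog (1 + p) - Clog w)%C with (Clog (1 + p)) by ring.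
  eapply Rle_trans; [apply Clog_1p_bound; lra|lra].
Qed.

Lemma Clog_scale (lam : R) (w : C) : 0 < lam -> 0 < fst w -> Clog (lam * w) = (ln lam + Clog w)%C.
Proof. intros Hl Hw. rewrite Clog_mult by (simpl; lra). rewrite Clog_R by exact Hl. reflexivity. Qed.

Lemma fst_Rmult (lam : R) (w : C) : fst (lam * w)%C = lam * fst w.
Proof. simpl. ring. Qed.

Lemma snd_Rmult (lam : R) (w : C) : snd (lam * w)%C = lam * snd w.
Proof. simpl. ring. Qed.

Lemma cexp_sub_1_le (Y : C) : Cmod Y <= 1 -> Cmod (cexp Y - 1)%C <= 3 * Cmod Y.
Proof.
  intros H. eapply Rle_trans; [apply cexp_bound1|]. pose proof (Cmod_ge_0 Y).
  assert (exp (Cmod Y) <= 3) by (eapply Rle_trans; [apply exp_le_compat with (y := 1); lra|apply exp_1_lt_3]). nra.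
Qed.

Definition binom_fun (b : R) (z : C) : C := cexp (- b * Clog (1 - z)).

Lemma fst_1m_pos (z : C) : Cmod z < 1 -> 0 < fst (1 - z)%C.
Proof. intros H. apply (fst_1p_pos (- z)). rewrite Cmod_opp. exact H. Qed.

Lemma C_is_derive_binom_fun (b : R) (z : C) : Cmod z < 1 -> C_is_derive (binom_fun b) z (b * / (1 - z) * binom_fun b z)%C.
Proof.
  intros Hz. pose proof (fst_1m_pos z Hz) as P. pose proof (nz_of_fst_pos _ P) as N.
  unfold binom_fun.
  apply (C_is_derive_comp cexp (fun z => - b * Clog (1 - z))%C); [|apply C_is_derive_cexp].
  replace (b * / (1 - z))%C with (0 * Clog (1 - z) + - b * ((0 + - (1)) * / (1 - z)))%C by ring.
  apply (C_is_derive_mult (fun _ => - b)%C (fun z => Clog (1 - z))); [apply C_is_derive_const|].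
  apply (C_is_derive_comp Clog (fun z => 1 - z)%C); [|apply C_is_derive_Clog, P].
  apply (C_is_derive_plus (fun _ => 1) (fun z => - z)%C); [apply C_is_derive_const|].
  apply (C_is_derive_opp (fun z => z)), C_is_derive_id.
Qed.

Lemma holo_binom_fun (b : R) : holo_disc 1 (binom_fun b).
Proof. intros z Hz. eexists. apply C_is_derive_binom_fun, Hz. Qed.

Lemma zcoef_shift (rho : R) (F : C -> C) (n : nat) : 0 < rho -> holo_disc rho F ->
  zcoef (S n) (fun z => z * F z)%C = zcoef n F.
Proof.
  intros Hr HF. set (x := - ln (rho / 2)).
  assert (Hx : exp (- x) < rho) by (unfold x; rewrite Ropp_involutive, exp_ln; lra).
  rewrite (zcoef_cmean F rho x n HF Hx), (zcoef_cmean (fun z => z * F z)%C rho x); [|intros z Hz; apply C_ex_derive_mult; [apply C_ex_derive_id|apply HF, Hz]|exact Hx].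
  f_equal. apply cmean_ext. intros z Hz. pose proof (nz_of_Cmod_exp z _ Hz) as N. simpl. field. split; [apply Cpow_nz, N|exact N].
Qed.

(** Coefficients of (1 - z) F' = b F, the differential equation of F(z) = (1 - z)^{-b}. *)
Lemma zcoef_binom_fun (b : R) (n : nat) : zcoef n (binom_fun b) = (poch b n / INR (Factorial.fact n))%R.
Proof.
  induction n as [|n IH].
  - rewrite zcoef_0. unfold binom_fun. replace (1 - 0)%C with (RtoC 1) by ring.
    rewrite Clog_R, ln_1 by lra. replace (- b * 0)%C with (RtoC 0) by ring. rewrite cexp_0. simpl. f_equal. field.
  - assert (HD : holo_disc 1 (cderiv (binom_fun b))) by apply holo_disc_cderiv, holo_binom_fun.
    assert (HZ : holo_disc 1 (fun z => z * cderiv (binom_fun b) z)%C) by (intros z Hz; apply C_ex_derive_mult; [apply C_ex_derive_id|apply HD, Hz]).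
    assert (E : (zcoef n (cderiv (binom_fun b)) + - (1) * zcoef n (fun z => z * cderiv (binom_fun b) z))%C = (b * zcoef n (binom_fun b))%C).
    { rewrite <- (zcoef_Cmult 1 ltac:(lra) b _ n (holo_binom_fun b)).
      rewrite <- (zcoef_Cmult 1 ltac:(lra) (- (1)) _ n HZ).
      rewrite <- (zcoef_plus 1) by (first [lra|assumption|intros z Hz; apply C_ex_derive_mult; [apply C_ex_derive_const|apply HZ, Hz]]).
      apply (zcoef_ext_disc 1); [lra| |].
      - intros z Hz. apply C_ex_derive_plus; [apply HD, Hz|]. apply C_ex_derive_mult; [apply C_ex_derive_const|apply HZ, Hz].
      - intros z Hz. rewrite (C_is_derive_unique _ _ _ (C_is_derive_binom_fun b z Hz)).
        pose proof (nz_of_fst_pos _ (fst_1m_pos z Hz)). field. assumption. }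
    rewrite zcoef_cderiv in E.
    assert (E2 : zcoef n (fun z => z * cderiv (binom_fun b) z)%C = (INR n * zcoef n (binom_fun b))%C).
    { destruct n as [|n]; [rewrite zcoef_0; simpl; ring|]. rewrite (zcoef_shift 1) by (try lra; exact HD). apply zcoef_cderiv. }
    rewrite E2, IH in E.
    assert (E3 : (INR (S n) * zcoef (S n) (binom_fun b))%C = ((b + INR n) * (poch b n / INR (Factorial.fact n)))%R).
    { rewrite RtoC_mult, RtoC_plus.
      replace (INR (S n) * zcoef (S n) (binom_fun b))%C with (INR (S n) * zcoef (S n) (binom_fun b) + - (1) * (INR n * (poch b n / INR (Factorial.fact n))%R) + INR n * (poch b n / INR (Factorial.fact n))%R)%C by ring.
      rewrite E. ring. }
    assert (N : RtoC (INR (S n)) <> 0) by (apply RtoC_neq, not_0_INR; lia).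
    replace (zcoef (S n) (binom_fun b)) with (/ INR (S n) * (INR (S n) * zcoef (S n) (binom_fun b)))%C by (field; exact N).
    rewrite E3, <- RtoC_inv, <- RtoC_mult by (apply not_0_INR; lia). f_equal.
    rewrite poch_S. change (Factorial.fact (S n)) with (S n * Factorial.fact n)%nat. rewrite mult_INR.
    pose proof (INR_fact_neq_0 n). pose proof (not_0_INR (S n) ltac:(lia)). field. split; assumption.
Qed.

(** exp(omega^sig) omega^{-q} on omega = 1 + it. For sig = 1 it is the integrand of Hankel's
    formula, whose integral in t is 2 pi/Gamma(q). *)
Definition hankel_int (sig q t : R) : C := cexp (cexp (sig * Clog (1, t)) - q * Clog (1, t)).

Lemma RCcont_vline (Psi : C -> C) (t : R) : C_ex_derive Psi (1, t) -> RCcont (fun u => Psi (1, u)) t.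
Proof. intros H. apply RCcont_vertical, C_ex_derive_cont, H. Qed.

Lemma C_ex_derive_Clog_id (w : C) : 0 < fst w -> C_ex_derive Clog w.
Proof. intros H. eexists. apply C_is_derive_Clog, H. Qed.

Lemma RCcont_hankel_int (sig q t : R) : RCcont (hankel_int sig q) t.
Proof.
  assert (D : C_ex_derive Clog (1, t)) by (apply C_ex_derive_Clog_id; simpl; lra).
  apply (RCcont_vline (fun w => cexp (cexp (sig * Clog w) - q * Clog w))).
  apply C_ex_derive_cexp, C_ex_derive_minus; [apply C_ex_derive_cexp|];
    (apply C_ex_derive_mult; [apply C_ex_derive_const|exact D]).
Qed.

Lemma fst_hankel_exponent (sig q t : R) :
  fst (cexp (sig * Clog (1, t)) - q * Clog (1, t))%C =
  exp (sig * ln (Cmod (1, t))) * cos (sig * atan t) - q * ln (Cmod (1, t)).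
Proof.
  rewrite Clog_vline. unfold cexp. cbn [fst snd Cminus Cplus Copp].
  rewrite !fst_Rmult, snd_Rmult. cbn [fst snd]. ring.
Qed.

(** On this line |e^omega| = e, so all the decay comes from |omega|^{-b}, and b >= 2 is needed to
    reach 1/(1 + t^2). *)
Lemma hankel_int_1_bound (b t : R) : 2 <= b -> Cmod (hankel_int 1 b t) <= 3 / (1 + t ^ 2).
Proof.
  intros Hb. unfold hankel_int. rewrite Cmod_cexp, fst_hankel_exponent, !Rmult_1_l.
  pose proof (Cmod_vline_ge_1 t) as G. rewrite exp_ln by lra.
  assert (E : Cmod (1, t) * cos (atan t) = 1).
  { pose proof (cexp_Clog (1, t) ltac:(simpl; lra)) as X. rewrite Clog_vline in X.
    apply (f_equal fst) in X. unfold cexp in X; cbn [fst snd] in X. rewrite exp_ln in X by lra. exact X. }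
  rewrite E. unfold Rminus. rewrite exp_plus.
  replace (3 / (1 + t ^ 2)) with (3 * (1 / (1 + t ^ 2))) by (unfold Rdiv; ring).
  apply Rmult_le_compat; [left; apply exp_pos|left; apply exp_pos|apply exp_1_lt_3|apply inv_vline_sqr_bound, Hb].
Qed.

Lemma INR_eventually_ge (M : R) : exists n0, forall n, (n0 <= n)%nat -> M <= INR n.
Proof. destruct (INR_unbounded M) as [n0 H]. exists n0. intros n Hn. apply le_INR in Hn. lra. Qed.

(** The n-th coefficient of (1 - z)^{-b} is known exactly, and on the circle of radius e^{-1/n} its
    Cauchy integral converges, after scaling, to the integral on the line. Gauss' limit evaluates
    the same sequence through Gamma(b). *)
Lemma hankel_line (b : R) : 2 <= b -> exists l g : C,
  Climit_infty (fun T => CInt (hankel_int 1 b) (- (1) * T) T) l /\ g = RtoC (fst g) /\ is_Gamma b (fst g) /\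
  (l * g)%C = RtoC (2 * PI).
Proof.
  intros Hb. pose proof PI_RGT_0 as HPi.
  destruct (gauss_limit b ltac:(lra)) as [g [Hg1 Hg2]].
  destruct (is_Gamma_of_limit b g ltac:(lra) Hg1) as [G1 G2].
  destruct (Climit_infty_exists 1 3 (hankel_int 1 b)) as [l Hl]; [auto|lra|intros; apply RCcont_hankel_int|intros; apply hankel_int_1_bound, Hb|].
  exists l, g. repeat split; try assumption.
  set (lam := fun n => / INR n).
  set (zz := fun n t => cexp (- (lam n * (1, t)))).
  set (g_ := fun n t => (Rpower (INR n) (- b) * (binom_fun b (zz n t) / zz n t ^ n))%C).
  assert (Hlam : forall n, (1 <= n)%nat -> 0 < lam n <= 1).
  { intros n Hn. unfold lam. assert (1 <= INR n) by (apply (le_INR 1); exact Hn).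
    split; [apply Rinv_0_lt_compat; lra|]. rewrite <- Rinv_1. apply Rinv_le_contravar; lra. }
  assert (Hzz : forall n t, Cmod (zz n t) = exp (- lam n)).
  { intros n t. unfold zz. rewrite Cmod_cexp. f_equal. cbn [fst Copp]. rewrite fst_Rmult. simpl. ring. }
  assert (Hzz1 : forall n t, (1 <= n)%nat -> Cmod (zz n t) < 1).
  { intros n t Hn. rewrite Hzz, <- exp_0. apply exp_increasing. specialize (Hlam n Hn). lra. }
  assert (Eg : forall n t, (1 <= n)%nat -> g_ n t = cexp ((1, t) - b * (Clog (1 - zz n t) + ln (INR n)))).
  { intros n t Hn. assert (PN : 0 < INR n) by (apply lt_0_INR; lia).
    unfold g_, binom_fun. unfold Rpower. rewrite <- cexp_R.
    replace (zz n t ^ n)%C with (cexp (- (1, t))).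
    - unfold Cdiv. rewrite <- cexp_opp, <- !cexp_plus. f_equal. rewrite RtoC_mult, RtoC_opp. ring.
    - unfold zz. rewrite <- cexp_pow. f_equal. unfold lam. rewrite RtoC_inv by lra.
      field. apply RtoC_neq. lra. }
  assert (LIM : Climit_seq (fun n => CInt (g_ n) (- (1) * (PI / lam n)) (PI / lam n)) l).
  { apply (dominated_convergence 1 (3 * exp (b * ln 6)) g_ (hankel_int 1 b) (fun n => PI / lam n)).
    - auto.
    (* The constant 3 * 6^b: 3 bounds |e^{1+it}|, and 6^b comes from |1 - z| >= |w|/6. *)
    - pose proof (exp_pos (b * ln 6)); lra.
    - intros T. destruct (INR_eventually_ge (T / PI)) as [n0 Hn0]. exists (S n0). intros n Hn. specialize (Hn0 n ltac:(lia)).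
      assert (PN : 0 < INR n) by (apply lt_0_INR; lia).
      unfold lam, Rdiv. rewrite Rinv_inv. apply Rmult_le_compat_l with (r := PI) in Hn0; [|lra].
      replace (PI * (T / PI)) with T in Hn0 by (field; lra). exact Hn0.
    - exists 1%nat. intros n Hn t _.
      apply (RCcont_vline (fun w => Rpower (INR n) (- b) * (binom_fun b (cexp (- (lam n * w))) / cexp (- (lam n * w)) ^ n))%C).
      assert (D : C_ex_derive (fun w => cexp (- (lam n * w))) (1, t)).
      { apply C_ex_derive_cexp, C_ex_derive_opp, C_ex_derive_mult; [apply C_ex_derive_const|apply C_ex_derive_id]. }
      apply C_ex_derive_mult; [apply C_ex_derive_const|]. apply C_ex_derive_div.
      + apply (C_ex_derive_comp (binom_fun b) (fun w => cexp (- (lam n * w)))); [exact D|]. apply holo_binom_fun, (Hzz1 n t Hn).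
      + apply (C_ex_derive_pow (fun w => cexp (- (lam n * w)))), D.
      + apply Cpow_nz, cexp_nz.
    - intros; apply RCcont_hankel_int.
    - intros T eps HT He.
      set (M := 12 * b * (1 + T)).
      assert (HM : 0 < M) by (unfold M; nra).
      (* The three summands give |w| <= 1/6, |Y| <= 1 and |Y| <= eps/9; the final error is at most 3
         * 3 |Y|. *)
      destruct (INR_eventually_ge (6 * (1 + T) + M + 9 * M / eps)) as [n0 Hn0].
      assert (Q0 : 0 <= 9 * M / eps) by (apply Rmult_le_pos; [lra|left; apply Rinv_0_lt_compat; lra]).
      exists (S n0). intros n Hn t Ht. specialize (Hn0 n ltac:(lia)).
      assert (PN : 0 < INR n) by (apply lt_0_INR; lia).
      rewrite (Eg n t ltac:(lia)). unfold hankel_int.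
      replace (cexp (1 * Clog (1, t))) with ((1, t) : C) by (rewrite Cmult_1_l, cexp_Clog by (simpl; lra); reflexivity).
      set (w := (lam n * (1, t))%C).
      assert (Hw : 0 < fst w) by (unfold w; rewrite fst_Rmult; simpl; specialize (Hlam n ltac:(lia)); lra).
      assert (Mw : Cmod w <= (1 + T) / INR n).
      { unfold w. rewrite Cmod_mult, Cmod_R, Rabs_pos_eq by (specialize (Hlam n ltac:(lia)); lra). unfold lam, Rdiv. rewrite Rmult_comm.
        apply Rmult_le_compat_r; [left; apply Rinv_0_lt_compat, PN|]. pose proof (Cmod_vline_le t). assert (Rabs t <= T) by (apply Rabs_le; lra). lra. }
      assert (W6 : (1 + T) / INR n <= / 6).
      { apply Rmult_le_reg_r with (INR n); [exact PN|]. unfold Rdiv. rewrite Rmult_assoc, Rinv_l by lra. lra. }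
      pose proof (Clog_one_sub_exp w Hw ltac:(lra)) as B.
      assert (Ew : Clog w = (Clog (1, t) - ln (INR n))%C).
      { unfold w. rewrite Clog_scale by (try (simpl; lra); specialize (Hlam n ltac:(lia)); lra). unfold lam. rewrite ln_Rinv by exact PN. rewrite RtoC_opp. ring. }
      set (Y := (- b * (Clog (1 - cexp (- w)) - Clog w))%C).
      assert (HY : Cmod Y <= M / INR n).
      { unfold Y. rewrite Cmod_mult, Cmod_opp, Cmod_R, Rabs_pos_eq by lra.
        apply Rle_trans with (b * (12 * ((1 + T) / INR n))); [apply Rmult_le_compat_l; lra|]. unfold M, Rdiv. right. ring. }
      assert (Y1 : M / INR n <= 1).
      { apply Rmult_le_reg_r with (INR n); [exact PN|]. unfold Rdiv. rewrite Rmult_assoc, Rinv_l by lra. lra. }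
      assert (Y2 : M / INR n <= eps / 9).
      { apply Rmult_le_reg_r with (INR n); [exact PN|]. unfold Rdiv. rewrite Rmult_assoc, Rinv_l by lra.
        assert (Z : 9 * M / eps <= INR n) by lra. apply Rmult_le_compat_r with (r := eps) in Z; [|lra].
        replace (9 * M / eps * eps) with (9 * M) in Z by (field; lra). lra. }
      replace ((1, t) - b * (Clog (1 - zz n t) + ln (INR n)))%C with (((1, t) - b * Clog (1, t)) + Y)%C.
      2:{ unfold Y. rewrite Ew. unfold zz. fold w. ring. }
      rewrite cexp_plus.
      set (A := cexp ((1, t) - b * Clog (1, t))).
      assert (HA : Cmod A <= 3).
      { pose proof (hankel_int_1_bound b t Hb) as HB. unfold hankel_int in HB.
        replace (cexp (1 * Clog (1, t))) with ((1, t) : C) in HB by (rewrite Cmult_1_l, cexp_Clog by (simpl; lra); reflexivity).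
        unfold A. eapply Rle_trans; [exact HB|]. apply Rle_trans with (3 * / 1); [|lra].
        apply Rmult_le_compat_l; [lra|]. apply Rinv_le_contravar; [lra|]. pose proof (pow2_ge_0 t); lra. }
      replace (A * cexp Y - A)%C with (A * (cexp Y - 1))%C by ring. rewrite Cmod_mult.
      apply Rle_trans with (3 * (3 * (eps / 9))); [|right; field].
      apply Rmult_le_compat; [apply Cmod_ge_0|apply Cmod_ge_0|exact HA|].
      eapply Rle_trans; [apply cexp_sub_1_le; lra|]. lra.
    - exists 1%nat. intros n Hn t Ht. assert (PN : 0 < INR n) by (apply lt_0_INR; lia).
      rewrite (Eg n t Hn), Cmod_cexp. specialize (Hlam n Hn).
      assert (Ez : zz n t = cexp (- (lam n, lam n * t))).
      { unfold zz. do 2 f_equal. unfold Cmult, RtoC; cbn [fst snd]. f_equal; ring. }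
      pose proof (one_sub_exp_lower (lam n) (lam n * t) Hlam) as Low.
      assert (Hlt : - PI <= lam n * t <= PI).
      { replace (- (1) * (PI / lam n)) with (- PI / lam n) in Ht by (field; lra).
        destruct Ht as [T1 T2]. apply Rmult_le_compat_l with (r := lam n) in T1; [|lra]. apply Rmult_le_compat_l with (r := lam n) in T2; [|lra].
        replace (lam n * (- PI / lam n)) with (- PI) in T1 by (field; lra). replace (lam n * (PI / lam n)) with PI in T2 by (field; lra). lra. }
      specialize (Low Hlt). rewrite <- Ez in Low.
      assert (Mw : Cmod (lam n, lam n * t) = lam n * Cmod (1, t)).
      { replace (lam n, lam n * t) with (lam n * (1, t))%C by (unfold Cmult, RtoC; cbn [fst snd]; f_equal; ring).
        rewrite Cmod_mult, Cmod_R, Rabs_pos_eq by lra. reflexivity. }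
      rewrite Mw in Low. pose proof (Cmod_vline_ge_1 t) as G.
      rewrite Clog_pos by (apply fst_1m_pos, Hzz1, Hn).
      cbn [fst snd Cminus Cplus Copp]. rewrite fst_Rmult. cbn [fst snd Cminus Cplus Copp RtoC].
      assert (LN : ln (Cmod (1, t)) - ln 6 <= ln (Cmod (1 + - zz n t)) + ln (INR n)).
      { rewrite <- ln_mult; [|change (1 + - zz n t)%C with (1 - zz n t)%C; nra|exact PN].
        assert (E6 : ln (Cmod (1, t)) - ln 6 = ln (Cmod (1, t) / 6)) by (unfold Rdiv; rewrite ln_mult, ln_Rinv by lra; ring).
        rewrite E6. change (1 + - zz n t)%C with (1 - zz n t)%C.
        assert (Q : Cmod (1, t) / 6 <= Cmod (1 - zz n t) * INR n).
        { apply Rmult_le_compat_r with (r := INR n) in Low; [|lra].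
          replace (lam n * Cmod (1, t) / 6 * INR n) with (Cmod (1, t) / 6) in Low by (unfold lam; field; lra). exact Low. }
        destruct Q as [Q|Q]; [left; apply ln_increasing; lra|rewrite Q; lra]. }
      apply Rle_trans with (exp 1 * (exp (b * ln 6) * exp (- (b * ln (Cmod (1, t)))))).
      + rewrite <- !exp_plus. apply exp_le_compat. change (1 + - zz n t)%C with (1 - zz n t)%C in LN. apply Rmult_le_compat_l with (r := b) in LN; [|lra]. lra.
      + replace (3 * exp (b * ln 6) / (1 + t ^ 2)) with (3 * (exp (b * ln 6) * (1 / (1 + t ^ 2)))) by (unfold Rdiv; ring).
        apply Rmult_le_compat; [left; apply exp_pos|left; apply Rmult_lt_0_compat; apply exp_pos|apply exp_1_lt_3|].
        apply Rmult_le_compat_l; [left; apply exp_pos|apply inv_vline_sqr_bound, Hb].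
    - exact Hl. }
  assert (EQ : forall n, (1 <= n)%nat -> CInt (g_ n) (- (1) * (PI / lam n)) (PI / lam n) =
     (2 * PI * (poch b n / INR (Factorial.fact n) * (INR n * Rpower (INR n) (- b))))%R).
  { intros n Hn. assert (PN : 0 < INR n) by (apply lt_0_INR; lia). specialize (Hlam n Hn).
    assert (N2 : RtoC (2 * PI) <> 0) by (apply RtoC_neq; lra).
    assert (Hexp : exp (- lam n) < 1) by (rewrite <- exp_0; apply exp_increasing; lra).
    assert (CF : forall z, Cmod z = exp (- lam n) -> Ccont (fun z => binom_fun b z / z ^ n)%C z).
    { intros z Hz. apply Ccont_div_pow; [apply C_ex_derive_cont, holo_binom_fun; lra|eapply nz_of_Cmod_exp, Hz]. }
    pose proof (zcoef_cmean (binom_fun b) 1 (lam n) n (holo_binom_fun b) Hexp) as Z.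
    rewrite zcoef_binom_fun, cmean_scaling in Z by (try exact CF; lra).
    unfold g_. rewrite CInt_Cmult.
    - fold (zz n).
      set (I := CInt _ _ _) in *.
      match type of Z with _ = (_ * (_ * ?J))%C => set (I' := J) in Z end.
      assert (EI : I = I') by reflexivity. rewrite EI.
      rewrite (RtoC_mult (2 * PI)), (RtoC_mult (poch b n / _)), Z, (RtoC_mult (INR n)). unfold lam. rewrite RtoC_inv by lra. field.
      split; [apply RtoC_neq; lra|exact N2].
    - apply ex_CInt_cont. intros t _.
      apply (RCcont_vline (fun w => (binom_fun b (cexp (- (lam n * w))) / cexp (- (lam n * w)) ^ n))%C).
      assert (D : C_ex_derive (fun w => cexp (- (lam n * w))) (1, t)).
      { apply C_ex_derive_cexp, C_ex_derive_opp, C_ex_derive_mult; [apply C_ex_derive_const|apply C_ex_derive_id]. }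
      apply C_ex_derive_div.
      + apply (C_ex_derive_comp (binom_fun b) (fun w => cexp (- (lam n * w)))); [exact D|]. apply holo_binom_fun, (Hzz1 n t Hn).
      + apply (C_ex_derive_pow (fun w => cexp (- (lam n * w)))), D.
      + apply Cpow_nz, cexp_nz. }
  pose proof (Climit_seq_mult _ _ _ _ LIM Hg2) as PR.
  apply (Climit_seq_unique _ _ _ PR).
  (* In the product of the two sequences everything cancels except n/(b + n), because Gauss' limit
     has one more Pochhammer factor than the coefficient. *)
  assert (LR : is_lim_seq (fun n => 2 * PI * (INR n / (b + INR n))) (2 * PI)).
  { replace (Finite (2 * PI)) with (Rbar_mult (2 * PI) 1) by (simpl; f_equal; ring).
    apply is_lim_seq_scal_l.
    apply is_lim_seq_ext with (fun n => 1 - b * / (b + INR n)).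
    { intros n. pose proof (pos_INR n). field. lra. }
    replace (Finite 1) with (Rbar_minus 1 (Rbar_mult b 0)) by (simpl; f_equal; ring).
    apply is_lim_seq_minus'; [apply is_lim_seq_const|]. apply (is_lim_seq_scal_l (fun n => / (b + INR n)) b 0).
    replace (Finite 0) with (Rbar_inv p_infty) by reflexivity. apply is_lim_seq_inv; [|discriminate].
    replace p_infty with (Rbar_plus b p_infty) by reflexivity.
    apply is_lim_seq_plus with b p_infty; [apply is_lim_seq_const|apply is_lim_seq_INR|reflexivity]. }
  apply is_lim_seq_Climit in LR. revert LR. apply Climit_seq_ext with (n1 := 1%nat). intros n Hn.
  assert (PN : 0 < INR n) by (apply lt_0_INR; lia).
  rewrite EQ by exact Hn. rewrite <- RtoC_mult. f_equal.
  rewrite poch_S, Rpower_Ropp. pose proof (poch_pos b n ltac:(lra)). pose proof (INR_fact_lt_0 n). pose proof (exp_pos (b * ln (INR n))).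
  unfold Rpower. field. repeat split; lra.
Qed.

(** The logarithmic kernel [- log (1 - a/z)] is a primitive in [a] of the Cauchy kernel [1/(z - a)]. *)
Lemma holo_primitive (F : C -> C) (rho x : R) :
  (forall z, Cmod z < rho -> C_ex_derive F z) -> exp (- x) < rho ->
  exists P, forall a, Cmod a < exp (- x) -> C_is_derive P a (F a).
Proof.
  intros HF Hx. pose proof PI_RGT_0 as HPi.
  set (r := exp (- x)) in *.
  assert (N2 : RtoC (2 * PI) <> 0) by (apply RtoC_neq; lra).
  set (K := fun (a z : C) => (- (1) * Clog (1 - a / z))%C).
  set (P := fun a => (/ (2 * PI)%R * cmean (fun z => F z * z * K a z)%C x)%C).
  exists P. intros a Ha.
  assert (HP : forall z, Cmod z = r -> Ccont (fun z => F z * z)%C z).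
  { intros z Hz. apply Ccont_mult; [apply C_ex_derive_cont, HF; lra|apply C_ex_derive_cont, C_ex_derive_id]. }
  destruct (RCcont_bounded (fun y => (fun z => F z * z)%C (cexp (- (x, y)))) (- PI) PI) as [B [HB0 HB]]; [lra| |].
  { intros t _. apply (RCcont_circ (fun z => F z * z)%C), HP, Cmod_circ. }
  assert (Hpos : forall b z, Cmod b < r -> Cmod z = r -> 0 < fst (1 - b / z)%C).
  { intros b z Hb Hz. apply fst_1m_pos. assert (Nz : z <> 0) by (eapply nz_of_Cmod_exp, Hz). rewrite Cmod_div by exact Nz. rewrite Hz.
    apply Rmult_lt_reg_r with r; [apply exp_pos|]. unfold Rdiv. rewrite Rmult_assoc, Rinv_l by (apply Rgt_not_eq, exp_pos). lra. }
  assert (CK : forall b z, Cmod b < r -> Cmod z = r -> C_ex_derive (K b) z).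
  { intros b z Hb Hz. apply C_ex_derive_mult; [apply C_ex_derive_const|]. apply (C_ex_derive_Clog (fun z => 1 - b / z)%C); [|apply Hpos; assumption].
    apply C_ex_derive_minus; [apply C_ex_derive_const|]. apply C_ex_derive_div; [apply C_ex_derive_const|apply C_ex_derive_id|].
    eapply nz_of_Cmod_exp, Hz. }
  assert (CKc : forall b z, Cmod b < r -> Cmod z = r -> Ccont (fun z => F z * z * K b z)%C z).
  { intros b z Hb Hz. apply (Ccont_mult (fun z => F z * z)%C); [apply HP, Hz|apply C_ex_derive_cont, CK; assumption]. }
  assert (CI1 : forall z, Cmod z = r -> C_ex_derive (fun z => / (z - a))%C z).
  { intros z Hz. apply (C_ex_derive_inv (fun z => z - a)%C); [|apply Cmod_sub_pos; lra].
    apply C_ex_derive_minus; [apply C_ex_derive_id|apply C_ex_derive_const]. }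
  assert (EF : F a = (/ (2 * PI)%R * cmean (fun z => F z * z * / (z - a))%C x)%C).
  { change (fun z => F z * z * / (z - a))%C with (fun z => F z * z / (z - a))%C.
    rewrite (cauchy_formula F rho x a HF Hx Ha). field. exact N2. }
  (* Then |z - a| >= 4d on the circle, and |h| < d keeps |h/(z - a)| <= 1/4, the range of the
     quadratic bound for log(1 + p). *)
  set (d := (r - Cmod a) / 4). assert (Hd : 0 < d) by (unfold d; lra).
  apply C_is_derive_eps. intros eps He.
  set (M := B * 48 / (d * d)). assert (HM : 0 < M).
  { unfold M. apply Rdiv_lt_0_compat; [lra|nra]. }
  exists (Rmin d (eps / M)). split; [apply Rmin_pos; [exact Hd|apply Rdiv_lt_0_compat; lra]|].
  intros h Hh. pose proof (Rmin_l d (eps / M)). pose proof (Rmin_r d (eps / M)).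
  pose proof (Cmod_ge_0 h) as Hh0.
  assert (Hah : Cmod (a + h) < r) by (eapply Rle_lt_trans; [apply Cmod_triangle|]; unfold d in *; lra).
  assert (E : (P (a + h) - P a - h * F a)%C = (/ (2 * PI)%R * cmean (fun z => F z * z * (K (a + h) z - K a z - h * / (z - a))) x)%C).
  { rewrite EF. unfold P.
    rewrite (cmean_ext (fun z => F z * z * (K (a + h) z - K a z - h * / (z - a)))%C (fun z => F z * z * K (a + h) z + (- (1) * (F z * z * K a z) + - h * (F z * z * / (z - a))))%C) by (intros; ring).
    rewrite cmean_plus, cmean_plus, !cmean_Cmult.
    - ring.
    - intros z Hz. apply (Ccont_mult (fun z => F z * z)%C); [apply HP, Hz|apply C_ex_derive_cont, CI1, Hz].
    - intros z Hz. apply CKc; assumption.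
    - intros z Hz. apply Ccont_mult; [apply Ccont_const|]. apply CKc; assumption.
    - intros z Hz. apply Ccont_mult; [apply Ccont_const|]. apply (Ccont_mult (fun z => F z * z)%C); [apply HP, Hz|apply C_ex_derive_cont, CI1, Hz].
    - intros z Hz. apply CKc; assumption.
    - intros z Hz. apply Ccont_plus; (apply Ccont_mult; [apply Ccont_const|]); [apply CKc; assumption|].
      apply (Ccont_mult (fun z => F z * z)%C); [apply HP, Hz|apply C_ex_derive_cont, CI1, Hz]. }
  rewrite E, Cmod_mult, Cmod_inv by exact N2. rewrite Cmod_R, Rabs_pos_eq by lra.
  apply Rle_trans with (/ (2 * PI) * (2 * PI * (M * Cmod h ^ 2))).
  - apply Rmult_le_compat_l; [left; apply Rinv_0_lt_compat; lra|].
    unfold cmean. replace (2 * PI) with (PI - - PI) by ring. apply CInt_norm_const; [lra| |].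
    + apply (ex_cmean (fun z => F z * z * (K (a + h) z - K a z - h * / (z - a)))%C).
      intros z Hz. apply (Ccont_mult (fun z => F z * z)%C); [apply HP, Hz|]. apply C_ex_derive_cont.
      apply C_ex_derive_minus; [apply C_ex_derive_minus; apply CK; assumption|].
      apply C_ex_derive_mult; [apply C_ex_derive_const|apply CI1, Hz].
    + intros t Ht. specialize (HB t Ht). cbv beta in HB.
      assert (Hz : Cmod (cexp (- (x, t))) = r) by apply Cmod_circ.
      set (z := cexp (- (x, t))) in *.
      assert (Nz : z <> 0) by (eapply nz_of_Cmod_exp, Hz).
      assert (Nza : (z - a)%C <> 0) by (apply Cmod_sub_pos; lra).
      assert (Lz : 4 * d <= Cmod (z - a)) by (pose proof (Cmod_rev_triangle z a); unfold d; lra).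
      set (p := (- (h / (z - a)))%C).
      assert (Ep : Cmod p = Cmod h / Cmod (z - a)) by (unfold p; rewrite Cmod_opp, Cmod_div by exact Nza; reflexivity).
      assert (Pp : Cmod p <= / 4).
      { rewrite Ep. apply Rmult_le_reg_r with (Cmod (z - a)); [lra|]. unfold Rdiv. rewrite Rmult_assoc, Rinv_l by lra. lra. }
      assert (EK : (K (a + h) z - K a z - h * / (z - a))%C = (- (1) * (Clog (1 + p) - p))%C).
      { unfold K. replace (1 - (a + h) / z)%C with ((1 - a / z) * (1 + p))%C by (unfold p; field; split; assumption).
        rewrite Clog_mult by (first [apply Hpos; assumption|apply fst_1p_pos; lra]). unfold p. field. exact Nza. }
      rewrite EK, !Cmod_mult, Cmod_opp, Cmod_1, Rmult_1_l.
      rewrite <- Cmod_mult.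
      unfold M. replace (B * 48 / (d * d) * Cmod h ^ 2) with (B * (48 * (Cmod h / d) ^ 2)) by (field; lra).
      apply Rmult_le_compat; [apply Cmod_ge_0|apply Cmod_ge_0|exact HB|].
      eapply Rle_trans; [apply Clog_1p_bound2, Pp|]. apply Rmult_le_compat_l; [lra|]. apply pow_incr. split; [apply Cmod_ge_0|].
      rewrite Ep. apply Rmult_le_compat_l; [exact Hh0|]. apply Rinv_le_contravar; lra.
  - replace (/ (2 * PI) * (2 * PI * (M * Cmod h ^ 2))) with (M * Cmod h * Cmod h) by (field; lra).
    apply Rmult_le_compat_r; [exact Hh0|].
    assert (Hq : Cmod h <= eps / M) by lra. apply Rmult_le_compat_l with (r := M) in Hq; [|lra].
    replace (M * (eps / M)) with eps in Hq by (field; lra). exact Hq.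
Qed.

(** Re (1 + it)^sig equals 1 at t = 0 and does not increase with |t|: its derivative has the sign of
    u cos(sig atan u) - sin(sig atan u) = - sin((sig-1) atan u)/cos(atan u). *)
Lemma Re_vline_pow_le_1 (sig t : R) : 1 <= sig <= 2 -> exp (sig * ln (Cmod (1, t))) * cos (sig * atan t) <= 1.
Proof.
  intros Hs.
  assert (Main : forall u, 0 <= u -> exp (sig * (ln (1 + u ^ 2) / 2)) * cos (sig * atan u) <= 1).
  { intros u Hu. destruct Hu as [Hu|Hu].
    2:{ subst u. rewrite atan_0, Rmult_0_r, cos_0. replace (1 + 0 ^ 2) with 1 by ring. rewrite ln_1.
        replace (sig * (0 / 2)) with 0 by field. rewrite exp_0. lra. }
    set (f := fun u => exp (sig * (ln (1 + u ^ 2) / 2)) * cos (sig * atan u)).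
    set (df := fun u => sig / (1 + u ^ 2) * exp (sig * (ln (1 + u ^ 2) / 2)) * (u * cos (sig * atan u) - sin (sig * atan u))).
    assert (D : forall v, is_derive f v (df v)).
    { intros v. unfold f, df. assert (0 < 1 + v ^ 2) by (pose proof (pow2_ge_0 v); lra).
      auto_derive; [simpl in *; lra|]. unfold Rsqr. simpl. unfold Rdiv. field. simpl in *; lra. }
    destruct (MVT_gen f 0 u df) as [c [Hc E]].
    - intros v _. apply D.
    - intros v _. apply continuity_pt_filterlim. apply (ex_derive_continuous (K := R_AbsRing) (V := R_NormedModule)). eexists; apply D.
    - rewrite Rmin_left, Rmax_right in Hc by lra.
      assert (F0 : f 0 = 1).
      { unfold f. rewrite atan_0, Rmult_0_r, cos_0. replace (1 + 0 ^ 2) with 1 by ring. rewrite ln_1.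
        replace (sig * (0 / 2)) with 0 by field. rewrite exp_0. lra. }
      assert (Neg : df c <= 0).
      { unfold df. pose proof (atan_le_id c ltac:(lra)) as A1. pose proof (atan_bound c) as A2. pose proof PI_RGT_0.
        assert (Cp : 0 < cos (atan c)) by (apply cos_gt_0; lra).
        assert (Ec : c * cos (sig * atan c) - sin (sig * atan c) = - sin ((sig - 1) * atan c) / cos (atan c)).
        { replace ((sig - 1) * atan c) with (sig * atan c - atan c) by ring. rewrite sin_minus.
          pose proof (tan_atan c) as Et. unfold tan in Et.
          assert (Es : sin (atan c) = c * cos (atan c)).
          { apply (f_equal (fun x => x * cos (atan c))) in Et. unfold Rdiv in Et. rewrite Rmult_assoc, Rinv_l, Rmult_1_r in Et by lra. exact Et. }
          rewrite Es. field. lra. }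
        rewrite Ec.
        assert (0 <= sin ((sig - 1) * atan c)) by (apply sin_ge_0; nra).
        assert (0 < sig / (1 + c ^ 2)) by (apply Rdiv_lt_0_compat; nra).
        assert (0 <= sin ((sig - 1) * atan c) / cos (atan c)) by (apply Rmult_le_pos; [assumption|left; apply Rinv_0_lt_compat, Cp]).
        pose proof (exp_pos (sig * (ln (1 + c ^ 2) / 2))).
        unfold Rdiv in *. rewrite Ropp_mult_distr_l_reverse.
        assert (0 <= sig * / (1 + c ^ 2) * exp (sig * (ln (1 + c ^ 2) * / 2))) by (apply Rmult_le_pos; lra). nra. }
      fold (f u). rewrite F0 in E. nra. }
  assert (EL : ln (Cmod (1, t)) = ln (1 + (Rabs t) ^ 2) / 2).
  { rewrite pow2_abs, <- Cmod_vline_sqr. pose proof (Cmod_vline_ge_1 t).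
    replace (Cmod (1, t) ^ 2) with (Cmod (1, t) * Cmod (1, t)) by ring. rewrite ln_mult by lra. field. }
  rewrite EL.
  replace (cos (sig * atan t)) with (cos (sig * atan (Rabs t))); [apply Main, Rabs_pos|].
  unfold Rabs. destruct (Rcase_abs t); [|reflexivity]. rewrite atan_opp.
  replace (sig * - atan t) with (- (sig * atan t)) by ring. apply cos_neg.
Qed.

Lemma RC_is_derive_vline (t : R) : is_derive (V := C_R_NormedModule) (fun u : R => (1, u) : C) t Ci.
Proof.
  apply (is_derive_ext (V := C_R_NormedModule) (fun u : R => (1 + u * Ci)%C)).
  - intros u. unfold Cplus, Cmult, RtoC, Ci; simpl. f_equal; ring.
  - apply RC_is_derive_affine.
Qed.

Lemma C_is_derive_scal_Clog (c w : C) : 0 < fst w -> C_is_derive (fun w => c * Clog w)%C w (c * / w)%C.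
Proof.
  intros Hw. replace (c * / w)%C with (0 * Clog w + c * / w)%C by ring.
  apply (C_is_derive_mult (fun _ => c) Clog); [apply C_is_derive_const|apply C_is_derive_Clog, Hw].
Qed.

Lemma fst_vline_pos (t : R) : 0 < fst ((1, t) : C).
Proof. simpl. lra. Qed.

Lemma cexp_opp_Clog (w : C) : 0 < fst w -> cexp (- Clog w) = (/ w)%C.
Proof. intros H. rewrite cexp_opp, cexp_Clog by exact H. reflexivity. Qed.

(** The bound ln y <= 2 sqrt y - 2 turns (ln y + 2)/y into 2/sqrt y. It controls the segments
    joining the end points in the homotopy. *)
Lemma hankel_decay (T : R) : 1 <= T ->
  exp (- ln (Cmod (1, T))) * Cmod (Clog (1, T)) <= 4 / sqrt T /\
  exp (- ln (Cmod (1, (- T)%R))) * Cmod (Clog (1, (- T)%R)) <= 4 / sqrt T.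
Proof.
  intros HT.
  assert (Main : forall t, Rabs t = T -> exp (- ln (Cmod (1, t))) * Cmod (Clog (1, t)) <= 4 / sqrt T).
  { intros t Ht. pose proof (Cmod_vline_ge t) as G. rewrite Ht in G.
    set (y := Cmod (1, t)) in *. rewrite exp_Ropp, exp_ln by lra.
    pose proof (Cmod_Clog_vline t) as B. fold y in B.
    assert (S1 : 1 <= sqrt T) by (rewrite <- sqrt_1; apply sqrt_le_1_alt; lra).
    assert (S2 : sqrt T <= sqrt y) by (apply sqrt_le_1_alt; lra).
    assert (Sy : sqrt y * sqrt y = y) by (apply sqrt_sqrt; lra).
    assert (L : ln y <= 2 * sqrt y - 2).
    { rewrite <- Sy at 1. rewrite ln_mult by lra. pose proof (ln_le_sub1 (sqrt y) ltac:(lra)). lra. }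
    apply Rle_trans with (/ y * (2 * sqrt y)).
    { apply Rmult_le_compat_l; [left; apply Rinv_0_lt_compat; lra|lra]. }
    replace (/ y * (2 * sqrt y)) with (2 / sqrt y) by (rewrite <- Sy at 2; field; lra).
    apply Rle_trans with (2 / sqrt T).
    - apply Rmult_le_compat_l; [lra|]. apply Rinv_le_contravar; lra.
    - apply Rmult_le_compat_r; [left; apply Rinv_0_lt_compat; lra|lra]. }
  split; apply Main; [apply Rabs_pos_eq; lra|rewrite Rabs_Ropp; apply Rabs_pos_eq; lra].
Qed.

(** In the variable [zeta = sigma log (1 + i t)] both integrals are integrals of the entire function [exp (e^zeta + (1 - b) zeta)]; the contributions joining the end points of the two curves tend to [0]. *)
Lemma hankel_homotopy (sig b : R) (l : C) : 1 <= sig <= 2 -> 2 <= b ->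
  Climit_infty (fun T => CInt (hankel_int 1 b) (- (1) * T) T) l ->
  Climit_infty (fun T => CInt (hankel_int sig (1 + sig * (b - 1))) (- (1) * T) T) (l / sig)%C.
Proof.
  intros Hs Hb Hl eps He.
  assert (NS : RtoC sig <> 0) by (apply RtoC_neq; lra).
  destruct (Hl (eps / 2)) as [T1 [HT1 K1]]; [lra|].
  (* Makes 12/sqrt T <= eps/4, so the two joining segments together cost at most eps/2. *)
  set (T2 := (48 / eps) ^ 2).
  exists (Rmax 1 (Rmax T1 T2)).
  pose proof (Rmax_l 1 (Rmax T1 T2)). pose proof (Rmax_r 1 (Rmax T1 T2)). pose proof (Rmax_l T1 T2). pose proof (Rmax_r T1 T2).
  split; [lra|]. intros T HT. specialize (K1 T ltac:(lra)).
  set (h := fun zeta : C => cexp (cexp zeta + (1 - b) * zeta)).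
  assert (Hh : forall z, C_ex_derive h z).
  { intros z. apply C_ex_derive_cexp, C_ex_derive_plus; [apply C_ex_derive_cexp, C_ex_derive_id|].
    apply C_ex_derive_mult; [apply C_ex_derive_const|apply C_ex_derive_id]. }
  (* A disc containing c log(1 + it) for |t| <= T and 0 <= c <= 2, so one primitive serves both
     curves and the segments between them. *)
  set (r := 2 * (T + 3) + 1).
  assert (Er : exp (- - ln r) = r) by (rewrite Ropp_involutive, exp_ln; unfold r; lra).
  destruct (holo_primitive h (r + 1) (- ln r)) as [P HP]; [intros; apply Hh|lra|]. rewrite Er in HP.
  assert (Hlog : forall t c, - T <= t <= T -> 0 <= c <= 2 -> Cmod (c * Clog (1, t)) < r).
  { intros t c Ht Hc. rewrite Cmod_mult, Cmod_R, Rabs_pos_eq by lra.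
    pose proof (Cmod_Clog_vline t) as B. pose proof (ln_le_sub1 (Cmod (1, t)) ltac:(pose proof (Cmod_vline_ge_1 t); lra)) as L.
    pose proof (Cmod_vline_le t) as V. assert (Rabs t <= T) by (apply Rabs_le; lra). pose proof (Cmod_ge_0 (Clog (1, t))).
    apply Rle_lt_trans with (2 * (T + 3)); [apply Rmult_le_compat; lra|unfold r; lra]. }
  (* Under zeta = c log omega the Jacobian c/omega joins omega^{c(1-b)}, which explains the exponent
     1 + c(b-1). *)
  assert (Seg : forall c, 1 <= c <= 2 ->
    (Ci * c * CInt (hankel_int c (1 + c * (b - 1))) (- (1) * T) T)%C = (P (c * Clog (1, T)) - P (c * Clog (1, (- T)%R)))%C).
  { intros c Hc. replace (- (1) * T) with (- T) by ring.
    rewrite <- CInt_Cmult by (apply ex_CInt_cont; intros; apply RCcont_hankel_int).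
    apply is_CInt_unique.
    apply (is_CInt_derive (fun t => P (c * Clog (1, t)))%C).
    - intros t Ht. rewrite Rmin_left, Rmax_right in Ht by lra.
      replace (Ci * c * hankel_int c (1 + c * (b - 1)) t)%C with (Ci * ((c * / (1, t)) * h (c * Clog (1, t))))%C.
      + apply (RC_is_derive_comp (fun w => P (c * Clog w))%C (fun u : R => (1, u) : C)); [apply RC_is_derive_vline|].
        apply (C_is_derive_comp P (fun w => c * Clog w)%C); [apply C_is_derive_scal_Clog, fst_vline_pos|].
        apply HP, Hlog; lra.
      + unfold hankel_int, h. rewrite <- (cexp_opp_Clog (1, t)) by apply fst_vline_pos.
        replace (Ci * (c * cexp (- Clog (1, t)) * cexp (cexp (c * Clog (1, t)) + (1 - b) * (c * Clog (1, t)))))%C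
          with (Ci * c * (cexp (- Clog (1, t)) * cexp (cexp (c * Clog (1, t)) + (1 - b) * (c * Clog (1, t)))))%C by ring.
        rewrite <- cexp_plus. do 2 f_equal. rewrite RtoC_plus, RtoC_mult, RtoC_minus. ring.
    - intros t _.
      assert (CH : Ccont (fun z => Ci * c * z)%C (hankel_int c (1 + c * (b - 1)) t)).
      { apply C_ex_derive_cont, C_ex_derive_mult; [apply C_ex_derive_const|apply C_ex_derive_id]. }
      intros e Hee. destruct (CH e Hee) as [d [Hd Kd]]. destruct (RCcont_hankel_int c (1 + c * (b - 1)) t d Hd) as [d' [Hd' Kd']].
      exists d'. split; [exact Hd'|]. intros u Hu. apply Kd, Kd', Hu. }
  assert (End : forall t, Rabs t = T -> Cmod (P (sig * Clog (1, t)) - P (1 * Clog (1, t)))%C <= 12 / sqrt T).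
  { intros t Ht.
    assert (HtT : - T <= t <= T) by (apply Rabs_le_between; lra).
    assert (Dec : exp (- ln (Cmod (1, t))) * Cmod (Clog (1, t)) <= 4 / sqrt T).
    { destruct (hankel_decay T ltac:(lra)) as [D1 D2]. unfold Rabs in Ht. destruct (Rcase_abs t); [replace t with (- T) by lra; exact D2|subst t; exact D1]. }
    set (q := Clog (1, t)) in *.
    assert (I : is_CInt (fun x : R => q * h (0 + x * q))%C 1 sig (P (0 + sig * q) - P (0 + 1 * q))%C).
    { apply is_CInt_primitive; rewrite Rmin_left, Rmax_right by lra; intros x Hx.
      - apply HP. replace (0 + x * q)%C with (x * q)%C by ring. apply Hlog; lra.
      - apply C_ex_derive_cont, Hh. }
    replace (0 + sig * q)%C with (sig * q)%C in I by ring. replace (0 + 1 * q)%C with (1 * q)%C in I by ring.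
    rewrite <- (is_CInt_unique _ _ _ _ I).
    replace (12 / sqrt T) with (1 * (12 / sqrt T)) by ring.
    assert (S1 : 0 < sqrt T) by (apply sqrt_lt_R0; lra).
    eapply Rle_trans; [apply (CInt_norm_const _ (12 / sqrt T)); [lra|eapply is_CInt_ex, I|]|].
    - intros x Hx. rewrite Cmod_mult. unfold h. rewrite Cmod_cexp.
      replace (0 + x * q)%C with (x * q)%C by ring.
      assert (Ef : fst (cexp (x * q) + (1 - b) * (x * q))%C = exp (x * ln (Cmod (1, t))) * cos (x * atan t) + (1 - b) * (x * ln (Cmod (1, t)))).
      { unfold q. rewrite Clog_vline. unfold cexp. rewrite <- RtoC_minus. cbn [fst snd Cplus]. rewrite !fst_Rmult, snd_Rmult. reflexivity. }
      rewrite Ef. pose proof (Re_vline_pow_le_1 x t ltac:(lra)) as R1. pose proof (ln_Cmod_vline_ge_0 t) as L0.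
      set (Lt := ln (Cmod (1, t))) in *.
      assert (E1 : exp (exp (x * Lt) * cos (x * atan t) + (1 - b) * (x * Lt)) <= 3 * exp (- Lt)).
      { rewrite exp_plus. apply Rmult_le_compat; [left; apply exp_pos|left; apply exp_pos| |].
        - eapply Rle_trans; [apply exp_le_compat, R1|apply exp_1_lt_3].
        - apply exp_le_compat. assert (Lt <= x * Lt) by nra. nra. }
      apply Rle_trans with (Cmod q * (3 * exp (- Lt))); [apply Rmult_le_compat_l; [apply Cmod_ge_0|exact E1]|].
      replace (12 / sqrt T) with (3 * (4 / sqrt T)) by (field; lra). nra.
    - apply Rmult_le_compat_r; [|lra]. left. apply Rdiv_lt_0_compat; lra. }
  assert (D : (Ci * sig * (CInt (hankel_int sig (1 + sig * (b - 1))) (- (1) * T) T - l / sig))%C =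
    ((P (sig * Clog (1, T)) - P (1 * Clog (1, T))) - (P (sig * Clog (1, (- T)%R)) - P (1 * Clog (1, (- T)%R))) + Ci * (CInt (hankel_int 1 b) (- (1) * T) T - l))%C).
  { pose proof (Seg sig Hs) as S1. pose proof (Seg 1 ltac:(lra)) as S2.
    replace (1 + 1 * (b - 1)) with b in S2 by ring.
    transitivity ((P (sig * Clog (1, T)) - P (sig * Clog (1, (- T)%R))) - Ci * l)%C.
    - rewrite <- S1. field. exact NS.
    - replace (P (sig * Clog (1, T)) - P (1 * Clog (1, T)) - (P (sig * Clog (1, (- T)%R)) - P (1 * Clog (1, (- T)%R))))%C
        with (P (sig * Clog (1, T)) - P (sig * Clog (1, (- T)%R)) - (P (1 * Clog (1, T)) - P (1 * Clog (1, (- T)%R))))%C by ring.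
      rewrite <- S2. ring. }
  apply (f_equal Cmod) in D. rewrite !Cmod_mult, Cmod_Ci, Cmod_R, Rabs_pos_eq in D by lra. rewrite Rmult_1_l in D.
  set (X := Cmod (CInt (hankel_int sig (1 + sig * (b - 1))) (- (1) * T) T - l / sig)) in *.
  assert (0 <= X) by apply Cmod_ge_0.
  apply Rle_trans with (sig * X); [nra|]. rewrite D.
  eapply Rle_trans; [apply Cmod_triangle|]. rewrite Cmod_mult, Cmod_Ci, Rmult_1_l.
  assert (B1 : Cmod (P (sig * Clog (1, T)) - P (1 * Clog (1, T)))%C <= 12 / sqrt T) by (apply End, Rabs_pos_eq; lra).
  assert (B2 : Cmod (P (sig * Clog (1, (- T)%R)) - P (1 * Clog (1, (- T)%R)))%C <= 12 / sqrt T) by (apply End; rewrite Rabs_Ropp; apply Rabs_pos_eq; lra).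
  assert (B3 : 12 / sqrt T <= eps / 4).
  { assert (S : 48 / eps <= sqrt T).
    { apply Rle_trans with (sqrt T2); [|apply sqrt_le_1_alt; lra]. unfold T2. rewrite <- Rsqr_pow2, sqrt_Rsqr; [lra|].
      left. apply Rdiv_lt_0_compat; lra. }
    assert (S1 : 0 < sqrt T) by (apply sqrt_lt_R0; lra).
    apply Rmult_le_reg_r with (sqrt T); [exact S1|]. replace (12 / sqrt T * sqrt T) with 12 by (field; lra).
    apply Rmult_le_compat_r with (r := eps) in S; [|lra]. replace (48 / eps * eps) with 48 in S by (field; lra). lra. }
  assert (B4 : Cmod (P (sig * Clog (1, T)) - P (1 * Clog (1, T)) - (P (sig * Clog (1, (- T)%R)) - P (1 * Clog (1, (- T)%R))))%C <= eps / 2).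
  { eapply Rle_trans; [apply Cmod_triangle|]. rewrite Cmod_opp. lra. }
  lra.
Qed.

(** Integration of the derivative of [exp (w^s - (q + s - 1) log w)] along the vertical line. *)
Lemma hankel_step (s q : R) (l : C) : 1 <= s <= 2 -> 0 < q + s - 1 ->
  Climit_infty (fun T => CInt (hankel_int s (q + s)) (- (1) * T) T) l ->
  Climit_infty (fun T => CInt (hankel_int s q) (- (1) * T) T) (((q + s - 1) / s)%R * l)%C.
Proof.
  intros Hs Hq Hl eps He.
  set (c := q + s - 1) in *.
  assert (NS : RtoC s <> 0) by (apply RtoC_neq; lra).
  destruct (Hl (eps / (2 * c))) as [T1 [HT1 K1]]; [apply Rdiv_lt_0_compat; lra|].
  (* Each boundary term is at most e |omega|^{-c}, that is at most 3 * eps/12. *)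
  destruct (Rpower_lt_base_small c (eps / 12) Hq) as [d [Hd Kd]]; [lra|].
  exists (Rmax 1 (Rmax T1 (2 / d))).
  pose proof (Rmax_l 1 (Rmax T1 (2 / d))). pose proof (Rmax_r 1 (Rmax T1 (2 / d))). pose proof (Rmax_l T1 (2 / d)). pose proof (Rmax_r T1 (2 / d)).
  split; [lra|]. intros T HT. specialize (K1 T ltac:(lra)).
  replace (- (1) * T) with (- T) in * by ring.
  set (f := fun w => cexp (cexp (s * Clog w) - c * Clog w)).
  assert (HI : forall q', ex_CInt (hankel_int s q') (- T) T) by (intros q'; apply ex_CInt_cont; intros; apply RCcont_hankel_int).
  assert (I : is_CInt (fun t => Ci * (s * hankel_int s q t - c * hankel_int s (q + s) t))%C (- T) T (f (1, T) - f (1, (- T)%R))%C).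
  { apply (is_CInt_derive (fun t => f (1, t))).
    - intros t _.
      apply (RC_is_derive_comp f (fun u : R => (1, u) : C)); [apply RC_is_derive_vline|].
      set (w := (1, t) : C).
      replace (s * hankel_int s q t - c * hankel_int s (q + s) t)%C with ((s * / w * cexp (s * Clog w) + - (c * / w)) * f w)%C.
      + apply (C_is_derive_comp cexp (fun w => cexp (s * Clog w) - c * Clog w)%C); [|apply C_is_derive_cexp].
        apply C_is_derive_plus.
        * apply (C_is_derive_comp cexp (fun w => s * Clog w)%C); [apply C_is_derive_scal_Clog, fst_vline_pos|apply C_is_derive_cexp].
        * apply (C_is_derive_opp (fun w => c * Clog w)%C), C_is_derive_scal_Clog, fst_vline_pos.
      + unfold hankel_int, f. fold w. rewrite <- (cexp_opp_Clog w) by apply fst_vline_pos.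
        replace ((s * cexp (- Clog w) * cexp (s * Clog w) + - (c * cexp (- Clog w))) * cexp (cexp (s * Clog w) - c * Clog w))%C
          with (s * (cexp (- Clog w) * cexp (s * Clog w) * cexp (cexp (s * Clog w) - c * Clog w)) - c * (cexp (- Clog w) * cexp (cexp (s * Clog w) - c * Clog w)))%C by ring.
        rewrite <- !cexp_plus. unfold c. rewrite RtoC_minus, !RtoC_plus. f_equal; [do 2 f_equal; ring|]. do 2 f_equal. ring.
    - intros t _. apply (RCcont_vline (fun w => Ci * (s * cexp (cexp (s * Clog w) - q * Clog w) - c * cexp (cexp (s * Clog w) - (q + s)%R * Clog w)))%C).
      assert (D : C_ex_derive Clog (1, t)) by (apply C_ex_derive_Clog_id; simpl; lra).
      assert (D2 : forall q' : R, C_ex_derive (fun w => cexp (cexp (s * Clog w) - q' * Clog w)) (1, t)).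
      { intros q'. apply C_ex_derive_cexp, C_ex_derive_minus; [apply C_ex_derive_cexp|]; (apply C_ex_derive_mult; [apply C_ex_derive_const|exact D]). }
      apply C_ex_derive_mult; [apply C_ex_derive_const|]. apply C_ex_derive_minus; (apply C_ex_derive_mult; [apply C_ex_derive_const|]);
        [apply D2|apply (D2 (q + s))]. }
  apply is_CInt_unique in I. rewrite CInt_Cmult in I.
  2:{ apply ex_CInt_minus; apply ex_CInt_Cmult, HI. }
  rewrite CInt_minus, !CInt_Cmult in I by (first [apply HI|apply ex_CInt_Cmult, HI]).
  assert (Dec : forall t, Rabs t = T -> Cmod (f (1, t)) <= eps / 4).
  { intros t Ht. unfold f. rewrite Cmod_cexp, fst_hankel_exponent. unfold Rminus. rewrite exp_plus.
    pose proof (Re_vline_pow_le_1 s t Hs) as R1. pose proof (Cmod_vline_ge t) as G. rewrite Ht in G.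
    assert (Q : exp (- (c * ln (Cmod (1, t)))) < eps / 12).
    { replace (- (c * ln (Cmod (1, t)))) with (c * ln (/ Cmod (1, t))) by (rewrite ln_Rinv by lra; ring).
      apply (Kd (/ Cmod (1, t))). split; [apply Rinv_0_lt_compat; lra|].
      apply Rle_lt_trans with (/ (2 / d)).
      - apply Rinv_le_contravar; [apply Rdiv_lt_0_compat; lra|lra].
      - unfold Rdiv. rewrite Rinv_mult, Rinv_inv. lra. }
    apply Rle_trans with (3 * (eps / 12)); [|lra].
    apply Rmult_le_compat; [left; apply exp_pos|left; apply exp_pos| |lra].
    eapply Rle_trans; [apply exp_le_compat, R1|apply exp_1_lt_3]. }
  assert (B1 : Cmod (f (1, T)) <= eps / 4) by (apply Dec, Rabs_pos_eq; lra).
  assert (B2 : Cmod (f (1, (- T)%R)) <= eps / 4) by (apply Dec; rewrite Rabs_Ropp; apply Rabs_pos_eq; lra).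
  set (X := CInt (hankel_int s q) (- T) T) in *. set (Y := CInt (hankel_int s (q + s)) (- T) T) in *.
  assert (E : (Ci * s * (X - (c / s)%R * l))%C = ((f (1, T) - f (1, (- T)%R)) + Ci * c * (Y - l))%C).
  { rewrite <- I, RtoC_div by lra. field. exact NS. }
  apply (f_equal Cmod) in E. rewrite !Cmod_mult, Cmod_Ci, Cmod_R, Rabs_pos_eq in E by lra. rewrite Rmult_1_l in E.
  pose proof (Cmod_ge_0 (X - (c / s)%R * l)) as X0.
  apply Rle_trans with (s * Cmod (X - (c / s)%R * l)); [nra|]. rewrite E.
  eapply Rle_trans; [apply Cmod_triangle|]. rewrite !Cmod_mult, Cmod_Ci, Cmod_R, Rabs_pos_eq by lra.
  assert (B3 : Cmod (f (1, T) - f (1, (- T)%R)) <= eps / 2) by (eapply Rle_trans; [apply Cmod_triangle|]; rewrite Cmod_opp; lra).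
  assert (B4 : c * Cmod (Y - l) <= eps / 2).
  { apply Rle_trans with (c * (eps / (2 * c))); [apply Rmult_le_compat_l; lra|right; field; lra]. }
  lra.
Qed.

(** Start at b + 2 with b = (s-1+theta)/s, where the case s = 1 is available. The homotopy gives
    exponent theta + 2s and a factor 1/s. Two steps down to theta bring the factors b + 1 and b,
    which match Gamma(b+2) = (b+1) b Gamma(b). *)
Lemma hankel_formula (s theta : R) : 1 < s < 2 -> 0 <= theta -> exists l : C,
  Climit_infty (fun T => CInt (hankel_int s theta) (- (1) * T) T) l /\
  (l * (s * Gamma ((s - 1 + theta) / s))%R)%C = RtoC (2 * PI).
Proof.
  intros Hs Ht. set (b := (s - 1 + theta) / s).
  assert (Hb : 0 < b) by (apply Rdiv_lt_0_compat; lra).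
  destruct (hankel_line (b + 2)) as [l [g [Hl [Hg [HG E]]]]]; [lra|].
  apply (hankel_homotopy s) in Hl; [|lra|lra].
  replace (1 + s * (b + 2 - 1)) with (theta + s + s) in Hl by (unfold b; field; lra).
  apply hankel_step in Hl; [|lra|lra]. apply hankel_step in Hl; [|lra|lra].
  eexists. split; [exact Hl|].
  replace (b + 2) with (b + 1 + 1) in HG by ring.
  apply is_Gamma_down in HG; [|lra]. apply is_Gamma_down in HG; [|lra].
  rewrite (Gamma_unique _ _ HG).
  rewrite <- E. transitivity (l * fst g)%C; [|rewrite <- Hg; reflexivity].
  replace ((theta + s + s - 1) / s) with (b + 1) by (unfold b; field; lra).
  replace ((theta + s - 1) / s) with b by (unfold b; field; lra).
  replace (s * (fst g / (b + 1) / b)) with (s * fst g * / (b * (b + 1))) by (field; lra).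
  rewrite RtoC_mult, RtoC_mult, RtoC_inv by nra. rewrite RtoC_mult.
  field. repeat split; apply RtoC_neq; lra.
Qed.

(** * Local expansions in the coordinate [z = R e^{-w}] *)

(** The logarithm of -w is explicit; pi is added or subtracted according to the sign of its
    argument, to stay within the principal strip. *)
Lemma Clog_spec_neg (w : C) : fst w < 0 -> cexp (Clog w) = w /\ - PI < snd (Clog w) <= PI.
Proof.
  intros Hw. unfold Clog. apply epsilon_spec.
  assert (P : 0 < fst (- w)%C) by (simpl; lra).
  pose proof (cexp_Clog (- w) P) as E. pose proof (Clog_pos (- w) P) as L.
  pose proof (atan_bound (snd (- w)%C / fst (- w)%C)) as [A1 A2]. rewrite L in E.
  set (t := atan (snd (- w)%C / fst (- w)%C)) in *. set (m := ln (Cmod (- w))) in *.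
  assert (Ew : w = (- cexp (m, t))%C) by (rewrite E; ring).
  destruct (Rle_dec t 0) as [T|T].
  - exists (m, t + PI). split; [|simpl; lra]. rewrite Ew. unfold cexp, Copp; cbn [fst snd].
    rewrite neg_cos, neg_sin. f_equal; ring.
  - exists (m, t - PI). split; [|simpl; lra]. rewrite Ew. unfold cexp, Copp; cbn [fst snd].
    rewrite cos_minus, sin_minus, cos_PI, sin_PI. f_equal; ring.
Qed.

Lemma Carg_neg (w : C) : fst w < 0 -> PI / 2 < Rabs (Carg w).
Proof.
  intros Hw. destruct (Clog_spec_neg w Hw) as [E B]. unfold Carg.
  apply Rnot_le_lt. intros L. apply Rabs_le_between in L.
  assert (C0 : 0 <= cos (snd (Clog w))) by (apply cos_ge_0; lra).
  apply (f_equal fst) in E. unfold cexp in E; cbn [fst] in E. pose proof (exp_pos (fst (Clog w))). nra.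
Qed.

Lemma fst_lt_of_Cmod_le (z : C) (R0 : R) : Cmod z <= R0 -> z <> R0 -> fst z < R0.
Proof.
  intros Hz Hne. pose proof (fst_le_Cmod z) as F. pose proof (Rle_abs (fst z)).
  apply Rnot_le_lt. intros L. assert (E : fst z = R0) by lra. apply Hne.
  pose proof (Cmod2_alt z) as M. unfold Re, Im in M. pose proof (Cmod_ge_0 z).
  assert (E2 : Cmod z = R0) by lra. rewrite E2, E in M.
  assert (S : snd z = 0) by nra. destruct z; simpl in *. subst. reflexivity.
Qed.

(** For |z| <= R and z not R, the difference z - R has negative real part, hence an argument beyond
    pi/2 > phi; and |1 + eta e^{i phi}| > 1. *)
Lemma disc_Delta0 (R0 eta phi : R) (z : C) : 0 < R0 -> 0 < eta -> 0 < phi < PI / 2 ->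
  Cmod z <= R0 -> z <> R0 -> Delta0 R0 eta phi z.
Proof.
  intros HR He Hp Hz Hne. repeat split; [|exact Hne|].
  - apply Rle_lt_trans with (R0 * 1); [lra|]. apply Rmult_lt_compat_l; [exact HR|].
    eapply Rlt_le_trans; [|apply fst_le_Cmod].
    assert (0 < cos phi) by (apply cos_gt_0; lra).
    unfold cexp; simpl. rewrite exp_0. apply Rlt_le_trans with (2 := Rle_abs _). nra.
  - eapply Rlt_trans; [apply Hp|]. apply Carg_neg. pose proof (fst_lt_of_Cmod_le z R0 Hz Hne). simpl. lra.
Qed.

Lemma Cmod_circle (R0 : R) (w : C) : 0 <= R0 -> Cmod (R0 * cexp (- w)) = R0 * exp (- fst w).
Proof. intros H. rewrite Cmod_mult, Cmod_R, Rabs_pos_eq, Cmod_cexp by exact H. reflexivity. Qed.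

Lemma Cmod_circle_lt (R0 : R) (w : C) : 0 < R0 -> 0 < fst w -> Cmod (R0 * cexp (- w)) < R0.
Proof.
  intros H Hw. rewrite Cmod_circle by lra. rewrite <- (Rmult_1_r R0) at 2. apply Rmult_lt_compat_l; [exact H|].
  rewrite <- exp_0. apply exp_increasing. lra.
Qed.

Lemma lt_disc_Delta0 (R0 eta phi : R) (z : C) : 0 < R0 -> 0 < eta -> 0 < phi < PI / 2 ->
  Cmod z < R0 -> Delta0 R0 eta phi z.
Proof.
  intros HR He Hp Hz. apply disc_Delta0; try assumption; [lra|]. intros ->. rewrite Cmod_R, Rabs_pos_eq in Hz; lra.
Qed.

Lemma Rpower_le_1 (x y : R) : 0 < x <= 1 -> 0 <= y -> Rpower x y <= 1.
Proof.
  intros Hx Hy. rewrite <- exp_0. apply exp_le_compat.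
  assert (ln x <= 0) by (rewrite <- ln_1; destruct (proj2 Hx) as [H|H]; [left; apply ln_increasing; lra|rewrite H; lra]). nra.
Qed.

Lemma Rpower_anti (x y z : R) : 0 < x <= 1 -> z <= y -> Rpower x y <= Rpower x z.
Proof.
  intros Hx Hy. apply exp_le_compat.
  assert (ln x <= 0) by (rewrite <- ln_1; destruct (proj2 Hx) as [H|H]; [left; apply ln_increasing; lra|rewrite H; lra]). nra.
Qed.

Lemma Rpower_mult_base (x y p : R) : 0 < x -> 0 < y -> Rpower (x * y) p = Rpower x p * Rpower y p.
Proof. intros Hx Hy. unfold Rpower. rewrite ln_mult by assumption. rewrite <- exp_plus. f_equal. ring. Qed.

Lemma one_sub_circle (R0 : R) (w : C) : 0 < R0 -> (1 - R0 * cexp (- w) / R0)%C = (1 - cexp (- w))%C.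
Proof. intros H. field. apply RtoC_neq. lra. Qed.

Lemma one_sub_exp_facts (w : C) : 0 < fst w -> Cmod w <= / 6 ->
  0 < Cmod w /\ 0 < Cmod (1 - cexp (- w)) <= 2 * Cmod w /\ Cmod (1 - cexp (- w) - w)%C <= 3 * Cmod w ^ 2 /\ 0 < fst (1 - cexp (- w))%C.
Proof.
  intros Hw H6. pose proof (nz_of_fst_pos w Hw) as N. assert (P : 0 < Cmod w) by (apply Cmod_gt_0, N).
  destruct (one_sub_exp_expansion w N ltac:(lra)) as [p [E Hp]].
  assert (Q : 0 < fst (1 - cexp (- w))%C).
  { apply fst_1m_pos. rewrite Cmod_cexp, <- exp_0. apply exp_increasing. simpl. lra. }
  repeat split; try assumption.
  - apply Cmod_gt_0, nz_of_fst_pos, Q.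
  - rewrite E, Cmod_mult. assert (Cmod (1 + p) <= 2) by (eapply Rle_trans; [apply Cmod_triangle|]; rewrite Cmod_1; lra).
    pose proof (Cmod_ge_0 (1 + p)). nra.
  - rewrite E. replace (w * (1 + p) - w)%C with (w * p)%C by ring. rewrite Cmod_mult. pose proof (Cmod_ge_0 p). nra.
Qed.

Lemma Rpower_double_bound (w x delta d : R) : 0 < w <= 1 -> 0 < x <= 2 * w -> 0 < d <= delta ->
  Rpower x delta <= Rpower 2 delta * Rpower w d.
Proof.
  intros Hw Hx Hd. apply Rle_trans with (Rpower (2 * w) delta); [apply Rle_Rpower_l; lra|].
  rewrite Rpower_mult_base by lra. apply Rmult_le_compat_l; [left; apply exp_pos|]. apply Rpower_anti; lra.
Qed.

Section LocalExpansions.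

Variables (R0 eta phi delta d : R).
Hypothesis (HR : 0 < R0) (Heta : 0 < eta) (Hphi : 0 < phi < PI / 2) (Hd : 0 < d < 1) (Hdd : d <= delta).

Lemma circle_in_Delta0 (w : C) (eps : R) : 0 < fst w -> Cmod w <= / 6 -> Cmod w < eps / (2 * R0) ->
  Delta0 R0 eta phi (R0 * cexp (- w)) /\ Cmod (R0 * cexp (- w) - R0) < eps.
Proof.
  intros Hw H6 He. split; [apply lt_disc_Delta0; try assumption; apply Cmod_circle_lt; assumption|].
  destruct (one_sub_exp_facts w Hw H6) as [P [[Q1 Q2] _]].
  replace (R0 * cexp (- w) - R0)%C with (- (R0 * (1 - cexp (- w))))%C by ring.
  rewrite Cmod_opp, Cmod_mult, Cmod_R, Rabs_pos_eq by lra.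
  apply Rle_lt_trans with (R0 * (2 * Cmod w)); [apply Rmult_le_compat_l; lra|].
  apply Rmult_lt_compat_r with (r := 2 * R0) in He; [|lra]. replace (eps / (2 * R0) * (2 * R0)) with eps in He by (field; lra). lra.
Qed.

Lemma Cmod_le_Rpower (w : C) : 0 < Cmod w <= 1 -> Cmod w <= Rpower (Cmod w) d.
Proof. intros H. rewrite <- (Rpower_1 (Cmod w)) at 1 by lra. apply Rpower_anti; lra. Qed.

Lemma expansion_f (f : C -> C) :
  (exists K eps, 0 < eps /\ forall z, Delta0 R0 eta phi z -> Cmod (z - RtoC R0)%C < eps ->
     Cmod (f z - 1)%C <= K * Rpower (Cmod (1 - z / RtoC R0)%C) delta) ->
  exists K eps, 0 < K /\ 0 < eps <= / 24 /\ forall w, 0 < fst w -> Cmod w <= eps ->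
     Cmod (f (R0 * cexp (- w)) - 1)%C <= K * Rpower (Cmod w) d.
Proof.
  intros [K [eps [He H]]].
  (* [Rabs K + 1] makes the constant positive whatever the sign of [K]; the power of 2 comes from |1
     - e^{-w}| <= 2|w|. The radius keeps |z - R| <= 2R|w| below [eps]. *)
  exists ((Rabs K + 1) * Rpower 2 delta), (Rmin (/ 24) (eps / (4 * R0))).
  pose proof (Rabs_pos K). pose proof (exp_pos (delta * ln 2)) as P2.
  assert (Q : 0 < eps / (4 * R0)) by (apply Rdiv_lt_0_compat; lra).
  pose proof (Rmin_l (/ 24) (eps / (4 * R0))). pose proof (Rmin_r (/ 24) (eps / (4 * R0))).
  split; [apply Rmult_lt_0_compat; [lra|exact P2]|]. split; [split; [apply Rmin_pos; lra|lra]|].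
  intros w Hw Hw2.
  destruct (one_sub_exp_facts w Hw ltac:(lra)) as [P [Q12 _]].
  destruct (circle_in_Delta0 w eps Hw ltac:(lra)) as [D1 D2].
  { apply Rle_lt_trans with (eps / (4 * R0)); [lra|]. apply Rmult_lt_compat_l; [exact He|]. apply Rinv_lt_contravar; nra. }
  specialize (H _ D1 D2). rewrite one_sub_circle in H by exact HR.
  eapply Rle_trans; [exact H|]. rewrite Rmult_assoc.
  assert (B : Rpower (Cmod (1 - cexp (- w))) delta <= Rpower 2 delta * Rpower (Cmod w) d) by (apply Rpower_double_bound; lra).
  pose proof (exp_pos (delta * ln (Cmod (1 - cexp (- w))))) as P3. fold (Rpower (Cmod (1 - cexp (- w))) delta) in P3.
  pose proof (Rle_abs K). nra.
Qed.

Lemma expansion_gth (gth : C -> C) (thetas : R) : 0 <= thetas ->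
  (exists K eps, 0 < eps /\ forall z, Delta0 R0 eta phi z -> Cmod (z - RtoC R0)%C < eps ->
     Cmod (gth z - (- RtoC thetas * Clog (1 - z / RtoC R0)))%C <= K * Rpower (Cmod (1 - z / RtoC R0)%C) delta) ->
  exists K eps, 0 < K /\ 0 < eps <= / 24 /\ forall w, 0 < fst w -> Cmod w <= eps ->
     Cmod (gth (R0 * cexp (- w)) - (- thetas * Clog w))%C <= K * Rpower (Cmod w) d.
Proof.
  intros Ht [K [eps [He H]]].
  exists ((Rabs K + 1) * Rpower 2 delta + 12 * thetas), (Rmin (/ 24) (eps / (4 * R0))).
  pose proof (Rabs_pos K). pose proof (exp_pos (delta * ln 2)) as P2.
  assert (Q : 0 < eps / (4 * R0)) by (apply Rdiv_lt_0_compat; lra).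
  pose proof (Rmin_l (/ 24) (eps / (4 * R0))). pose proof (Rmin_r (/ 24) (eps / (4 * R0))).
  split; [assert (0 < (Rabs K + 1) * Rpower 2 delta) by (apply Rmult_lt_0_compat; [lra|exact P2]); lra|]. split; [split; [apply Rmin_pos; lra|lra]|].
  intros w Hw Hw2.
  destruct (one_sub_exp_facts w Hw ltac:(lra)) as [P [Q12 _]].
  destruct (circle_in_Delta0 w eps Hw ltac:(lra)) as [D1 D2].
  { apply Rle_lt_trans with (eps / (4 * R0)); [lra|]. apply Rmult_lt_compat_l; [exact He|]. apply Rinv_lt_contravar; nra. }
  specialize (H _ D1 D2). rewrite one_sub_circle in H by exact HR.
  pose proof (Clog_one_sub_exp w Hw ltac:(lra)) as L.
  replace (gth (R0 * cexp (- w)) - (- thetas * Clog w))%C with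
    ((gth (R0 * cexp (- w)) - (- thetas * Clog (1 - cexp (- w)))) + - (thetas * (Clog (1 - cexp (- w)) - Clog w)))%C by ring.
  eapply Rle_trans; [apply Cmod_triangle|]. rewrite Cmod_opp, Cmod_mult, Cmod_R, Rabs_pos_eq by exact Ht.
  rewrite Rmult_plus_distr_r. apply Rplus_le_compat.
  - eapply Rle_trans; [exact H|]. rewrite Rmult_assoc.
    assert (B : Rpower (Cmod (1 - cexp (- w))) delta <= Rpower 2 delta * Rpower (Cmod w) d) by (apply Rpower_double_bound; lra).
    pose proof (exp_pos (delta * ln (Cmod (1 - cexp (- w))))) as P3. fold (Rpower (Cmod (1 - cexp (- w))) delta) in P3.
    pose proof (Rle_abs K). nra.
  - pose proof (Cmod_le_Rpower w ltac:(lra)).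
    apply Rle_trans with (thetas * (12 * Rpower (Cmod w) d)); [apply Rmult_le_compat_l; lra|lra].
Qed.

(** With v = 1 - e^{-w}, replacing v by w costs O(w^2) in the linear term and a factor 1 + O(w) in
    v^s. Both are within O(|w|^{s+d}), as s + d <= 2 and d < 1. *)
Lemma expansion_gka (gka : C -> C) (s a_s K0 : R) : 1 < s < 2 -> 0 < a_s -> s + d <= 2 ->
  (exists K eps, 0 < eps /\ forall z, Delta0 R0 eta phi z -> Cmod (z - RtoC R0)%C < eps ->
     Cmod (gka z - (RtoC K0 - (1 - z / RtoC R0) + RtoC a_s * Cpower (1 - z / RtoC R0) (RtoC s)))%C
       <= K * Rpower (Cmod (1 - z / RtoC R0)%C) (s + delta)) ->
  exists K eps, 0 < K /\ 0 < eps <= / 24 /\ forall w, 0 < fst w -> Cmod w <= eps ->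
     Cmod (gka (R0 * cexp (- w)) - (K0 - w + a_s * cexp (s * Clog w)))%C <= K * Rpower (Cmod w) (s + d).
Proof.
  intros Hs Ha Hsd [K [eps [He H]]].
  (* The 3 is the constant in |v - w| <= 3|w|^2; 72 = 3 * 24 comes from |e^X - 1| <= 3|X| and |X| <=
     24|w|. *)
  exists ((Rabs K + 1) * Rpower 2 (s + delta) + 3 + a_s * 72), (Rmin (/ 24) (eps / (4 * R0))).
  pose proof (Rabs_pos K). pose proof (exp_pos ((s + delta) * ln 2)) as P2.
  assert (Q : 0 < eps / (4 * R0)) by (apply Rdiv_lt_0_compat; lra).
  pose proof (Rmin_l (/ 24) (eps / (4 * R0))). pose proof (Rmin_r (/ 24) (eps / (4 * R0))).
  split; [assert (0 < (Rabs K + 1) * Rpower 2 (s + delta)) by (apply Rmult_lt_0_compat; [lra|exact P2]); lra|]. split; [split; [apply Rmin_pos; lra|lra]|].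
  intros w Hw Hw2.
  destruct (one_sub_exp_facts w Hw ltac:(lra)) as [P [Q12 [Q3 Q4]]].
  destruct (circle_in_Delta0 w eps Hw ltac:(lra)) as [D1 D2].
  { apply Rle_lt_trans with (eps / (4 * R0)); [lra|]. apply Rmult_lt_compat_l; [exact He|]. apply Rinv_lt_contravar; nra. }
  specialize (H _ D1 D2). rewrite one_sub_circle in H by exact HR.
  pose proof (Clog_one_sub_exp w Hw ltac:(lra)) as L.
  set (v := (1 - cexp (- w))%C) in *.
  assert (Ev : Cpower v s = cexp (s * Clog v)).
  { unfold Cpower. destruct (Req_EM_T (Cmod v) 0); [lra|reflexivity]. }
  rewrite Ev in H.
  set (X := (s * (Clog v - Clog w))%C).
  assert (HX : Cmod X <= 24 * Cmod w).
  { unfold X. rewrite Cmod_mult, Cmod_R, Rabs_pos_eq by lra. pose proof (Cmod_ge_0 (Clog v - Clog w)). nra. }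
  assert (EX : cexp (s * Clog v) = (cexp (s * Clog w) * cexp X)%C).
  { rewrite <- cexp_plus. f_equal. unfold X. ring. }
  assert (Mw : Cmod (cexp (s * Clog w)) = Rpower (Cmod w) s).
  { rewrite Cmod_cexp, fst_Rmult, Clog_pos by exact Hw. reflexivity. }
  rewrite EX in H.
  replace (gka (R0 * cexp (- w)) - (K0 - w + a_s * cexp (s * Clog w)))%C with
    ((gka (R0 * cexp (- w)) - (K0 - v + a_s * (cexp (s * Clog w) * cexp X))) + (- (v - w) + a_s * (cexp (s * Clog w) * (cexp X - 1))))%C by ring.
  eapply Rle_trans; [apply Cmod_triangle|]. rewrite 2!Rmult_plus_distr_r, Rplus_assoc.
  apply Rplus_le_compat; [|eapply Rle_trans; [apply Cmod_triangle|]; apply Rplus_le_compat].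
  - eapply Rle_trans; [exact H|]. rewrite Rmult_assoc.
    assert (B : Rpower (Cmod v) (s + delta) <= Rpower 2 (s + delta) * Rpower (Cmod w) (s + d)).
    { apply Rpower_double_bound; lra. }
    pose proof (exp_pos ((s + delta) * ln (Cmod v))) as P3. fold (Rpower (Cmod v) (s + delta)) in P3.
    pose proof (Rle_abs K). nra.
  - rewrite Cmod_opp. eapply Rle_trans; [exact Q3|]. apply Rmult_le_compat_l; [lra|].
    replace (Cmod w ^ 2) with (Rpower (Cmod w) 2); [apply Rpower_anti; lra|].
    replace 2 with (INR 2) at 1 by (simpl; ring). apply Rpower_pow. exact P.
  - rewrite !Cmod_mult, Cmod_R, Rabs_pos_eq, Mw by lra. rewrite Rmult_assoc. apply Rmult_le_compat_l; [lra|].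
    pose proof (cexp_sub_1_le X ltac:(lra)) as B.
    rewrite Rpower_plus. pose proof (Cmod_le_Rpower w ltac:(lra)). pose proof (exp_pos (s * ln (Cmod w))) as P3. fold (Rpower (Cmod w) s) in P3.
    replace (72 * (Rpower (Cmod w) s * Rpower (Cmod w) d)) with (Rpower (Cmod w) s * (72 * Rpower (Cmod w) d)) by ring.
    apply Rmult_le_compat_l; lra.
Qed.

End LocalExpansions.

(** * Bounds away from the singularity *)

Lemma Re_vline_pow_bound (s : R) : 1 < s < 2 -> exists b0 C1, 0 < b0 /\ 0 < C1 /\ forall t,
  exp (s * ln (Cmod (1, t))) * cos (s * atan t) <= C1 - b0 * exp (s * ln (Cmod (1, t))).
Proof.
  intros Hs. pose proof PI_RGT_0 as HPi.
  (* An angle with s a strictly between pi/2 and s pi/2. Beyond it cos(s atan t) <= cos(s a) < 0;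
     below it |1 + it|^s is bounded by [W]. *)
  set (a := PI * (s + 1) / (4 * s)).
  assert (Ha : s * a = PI * (s + 1) / 4) by (unfold a; field; lra).
  assert (Ha2 : 0 < a < PI / 2).
  { split; [unfold a; apply Rdiv_lt_0_compat; nra|]. apply Rmult_lt_reg_l with s; [lra|]. rewrite Ha. nra. }
  set (b0 := - cos (s * a)).
  assert (Hb0 : 0 < b0).
  { unfold b0. rewrite Ha. assert (cos (PI * (s + 1) / 4) < 0); [|lra]. apply cos_lt_0; nra. }
  assert (Hb1 : b0 <= 1) by (unfold b0; pose proof (COS_bound (s * a)); lra).
  set (W := exp (s * ln (1 + tan a))).
  assert (Ht : 0 < tan a) by (apply tan_gt_0; lra).
  exists b0, (2 * W). assert (HW : 0 < W) by apply exp_pos. repeat split; [exact Hb0|lra|]. intros t.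
  assert (Ec : cos (s * atan t) = cos (s * atan (Rabs t))).
  { unfold Rabs. destruct (Rcase_abs t); [|reflexivity]. rewrite atan_opp.
    replace (s * - atan t) with (- (s * atan t)) by ring. symmetry; apply cos_neg. }
  set (M := exp (s * ln (Cmod (1, t)))). assert (HM : 0 < M) by apply exp_pos.
  destruct (Rle_dec (tan a) (Rabs t)) as [L|L].
  - assert (A1 : a <= atan (Rabs t)).
    { rewrite <- (atan_tan a) by lra. destruct L as [L|L]; [left; apply atan_increasing, L|rewrite L; lra]. }
    pose proof (atan_bound (Rabs t)) as [_ A2].
    assert (cos (s * atan t) <= - b0).
    { rewrite Ec. unfold b0. rewrite Ropp_involutive. apply cos_decr_1; nra. }
    nra.
  - assert (M <= W).
    { unfold M, W. apply exp_le_compat. apply Rmult_le_compat_l; [lra|]. pose proof (Cmod_vline_le t). pose proof (Cmod_vline_ge_1 t).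
      left. apply ln_increasing; lra. }
    pose proof (COS_bound (s * atan t)). nra.
Qed.

Lemma Ccont_bounded_rect (G : C -> C) (a b a' b' : R) :
  (forall x y, a <= x <= b -> a' <= y <= b' -> Ccont G (x, y)) ->
  exists M, 0 < M /\ forall x y, a <= x <= b -> a' <= y <= b' -> Cmod (G (x, y)) <= M.
Proof.
  intros HG.
  (* A single gauge serves twice, as a radius and, through its inverse, as a bound for |G|. *)
  set (Pr := fun x y (d : posreal) => a <= x <= b -> a' <= y <= b' -> forall w, Cmod (w - (x, y)) < 2 * d -> Cmod (G w) <= / d).
  assert (K : forall x y, exists d : posreal, Pr x y d).
  { intros x y. destruct (classic (a <= x <= b /\ a' <= y <= b')) as [[Hx Hy]|N].
    - destruct (HG x y Hx Hy 1 Rlt_0_1) as [d [Hd W]].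
      pose proof (Cmod_ge_0 (G (x, y))).
      assert (Hm : 0 < Rmin (d / 2) (/ (1 + Cmod (G (x, y))))).
      { apply Rmin_pos; [lra|]. apply Rinv_0_lt_compat. lra. }
      exists (mkposreal _ Hm). intros _ _ w Hw. simpl in *.
      pose proof (Rmin_l (d / 2) (/ (1 + Cmod (G (x, y))))). pose proof (Rmin_r (d / 2) (/ (1 + Cmod (G (x, y))))).
      specialize (W w ltac:(lra)).
      apply Rle_trans with (1 + Cmod (G (x, y))).
      + pose proof (Cmod_rev_triangle (G w) (G (x, y))). lra.
      + rewrite <- (Rinv_inv (1 + Cmod (G (x, y)))) at 1. apply Rinv_le_contravar; assumption.
    - exists (mkposreal 1 Rlt_0_1). intros Hx Hy. tauto. }
  set (g := fun x y => epsilon (inhabits (mkposreal 1 Rlt_0_1)) (Pr x y)).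
  assert (Hg : forall x y, Pr x y (g x y)) by (intros x y; apply (epsilon_spec (inhabits (mkposreal 1 Rlt_0_1)) _ (K x y))).
  destruct (compactness_value_2d a b a' b' g) as [d Hd].
  exists (/ d). split; [apply Rinv_0_lt_compat, cond_pos|]. intros x y Hx Hy.
  apply NNPP. intros N. apply (Hd x y Hx Hy). intros [u [v [Hu [Hv [H1 [H2 H3]]]]]]. apply N.
  apply Rle_trans with (/ g u v); [|apply Rinv_le_contravar; [apply cond_pos|exact H3]].
  apply (Hg u v Hu Hv). eapply Rle_lt_trans; [apply Cmod_le_abs|].
  change (Rabs (x - u) + Rabs (y - v) < 2 * g u v). lra.
Qed.

Lemma circle_ne_R0 (R0 x y : R) : 0 < R0 -> 0 <= x -> 0 < Rabs y <= PI -> (R0 * cexp (- (x, y)))%C <> R0.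
Proof.
  intros HR Hx Hy E. pose proof PI_RGT_0.
  assert (E1 : cexp (- (x, y)) = 1).
  { replace (cexp (- (x, y))) with (/ R0 * (R0 * cexp (- (x, y))))%C by (field; apply RtoC_neq; lra). rewrite E. field. apply RtoC_neq; lra. }
  pose proof (Cmod_cexp (- (x, y))) as M. rewrite E1, Cmod_1 in M. simpl in M.
  assert (X : x = 0). { rewrite <- exp_0 in M. apply exp_inv in M. lra. }
  subst x. unfold cexp in E1. apply (f_equal fst) in E1. simpl in E1. rewrite Ropp_0, exp_0, Rmult_1_l in E1.
  apply cos_eq_1 in E1; [|rewrite Rabs_Ropp; lra]. assert (y = 0) by lra. subst y. rewrite Rabs_R0 in Hy. lra.
Qed.

(** The two rectangles in w, closed at x = 0, map into the closed disc without R, hence into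
    [Delta0], so compactness gives a bound uniform up to the boundary circle. *)
Lemma far_bound_f (f : C -> C) (R0 eta phi e : R) : 0 < R0 -> 0 < eta -> 0 < phi < PI / 2 -> 0 < e ->
  holomorphic_on (Delta0 R0 eta phi) f ->
  exists M, 0 < M /\ forall x y, 0 <= x <= 1 -> e <= Rabs y <= PI -> Cmod (f (R0 * cexp (- (x, y)))%C) <= M.
Proof.
  intros HR Heta Hphi He Hf.
  assert (Cn : forall x y, 0 <= x -> e <= Rabs y <= PI -> Ccont (fun w => f (R0 * cexp (- w)))%C (x, y)).
  { intros x y Hx Hy. apply C_ex_derive_cont. apply (C_ex_derive_comp f (fun w => R0 * cexp (- w))%C).
    - apply C_ex_derive_mult; [apply C_ex_derive_const|apply C_ex_derive_cexp_opp].
    - apply Hf. apply disc_Delta0; try assumption; [|apply circle_ne_R0; try assumption; lra].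
      rewrite Cmod_circle by lra. simpl. rewrite <- (Rmult_1_r R0) at 2. apply Rmult_le_compat_l; [lra|].
      rewrite <- exp_0. apply exp_le_compat. lra. }
  destruct (Ccont_bounded_rect (fun w => f (R0 * cexp (- w)))%C 0 1 e PI) as [M1 [P1 H1]].
  { intros x y Hx Hy. apply Cn; [lra|]. rewrite Rabs_pos_eq; lra. }
  destruct (Ccont_bounded_rect (fun w => f (R0 * cexp (- w)))%C 0 1 (- PI) (- e)) as [M2 [P2 H2]].
  { intros x y Hx Hy. apply Cn; [lra|]. rewrite Rabs_left1; lra. }
  exists (M1 + M2). split; [lra|]. intros x y Hx Hy. unfold Rabs in Hy. destruct (Rcase_abs y).
  - specialize (H2 x y Hx ltac:(lra)). cbv beta in H2. lra.
  - specialize (H1 x y Hx ltac:(lra)). cbv beta in H1. lra.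
Qed.

Lemma cos_eq_1_divide (j m n : nat) : (0 < n)%nat -> cos (INR j * (2 * PI * INR m / INR n)) = 1 -> Nat.divide n (j * m).
Proof.
  intros Hn H. pose proof PI_RGT_0. assert (Pn : 0 < INR n) by (apply lt_0_INR; lia).
  pose proof (Nat.div_mod (j * m) n ltac:(lia)) as D. pose proof (Nat.mod_upper_bound (j * m) n ltac:(lia)) as U.
  set (k := (j * m / n)%nat) in *. set (r := ((j * m) mod n)%nat) in *.
  replace (INR j * (2 * PI * INR m / INR n)) with (2 * PI * INR r / INR n + 2 * INR k * PI) in H.
  2:{ replace (INR j * (2 * PI * INR m / INR n)) with (2 * PI * INR (j * m) / INR n) by (rewrite mult_INR; field; lra).
      rewrite D, plus_INR, mult_INR. field. lra. }
  rewrite cos_period in H.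
  assert (R1 : INR r / INR n < 1).
  { apply Rmult_lt_reg_r with (INR n); [exact Pn|]. unfold Rdiv. rewrite Rmult_assoc, Rinv_l by lra. rewrite Rmult_1_r, Rmult_1_l. apply lt_INR, U. }
  assert (R0 : 0 <= INR r / INR n) by (apply Rmult_le_pos; [apply pos_INR|left; apply Rinv_0_lt_compat, Pn]).
  apply cos_eq_1 in H.
  - assert (INR r = 0). { replace (INR r) with (2 * PI * INR r / INR n * (INR n / (2 * PI))) by (field; lra). rewrite H. ring. }
    assert (r = 0%nat) by (apply INR_eq; exact H1). exists k. lia.
  - replace (2 * PI * INR r / INR n) with (2 * PI * (INR r / INR n)) by (field; lra). rewrite Rabs_pos_eq by nra. nra.
Qed.

(** Otherwise n divides j m for every j in the support, and by Gauss' lemma n/gcd(n, m), which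
    exceeds 1, divides all these j. *)
Lemma nonarithmetic_witness (kappa : nat -> R) (n m : nat) : non_arithmetic kappa -> (0 < m < n)%nat ->
  exists j, (1 <= j)%nat /\ kappa j <> 0 /\ cos (INR j * (2 * PI * INR m / INR n)) <> 1.
Proof.
  intros Hna Hm. apply NNPP. intros N. apply Hna.
  set (g := Nat.gcd n m).
  assert (Hg : (0 < g)%nat) by (assert (g <> 0%nat) by (unfold g; rewrite Nat.gcd_eq_0; lia); lia).
  destruct (Nat.gcd_divide_l n m) as [n' Hn']. destruct (Nat.gcd_divide_r n m) as [m' Hm']. fold g in Hn', Hm'.
  exists n'. split.
  - assert (Hnm : (m' < n')%nat) by nia. assert ((0 < m')%nat) by nia. lia.
  - intros j Hj Hk.
    assert (C1 : cos (INR j * (2 * PI * INR m / INR n)) = 1) by (apply NNPP; intros NC; apply N; exists j; auto).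
    apply cos_eq_1_divide in C1; [|lia].
    apply Nat.gauss with m'.
    + destruct C1 as [q Hq]. exists q. apply (Nat.mul_cancel_r _ _ g); [lia|]. nia.
    + assert (G1 : (Nat.gcd (n' * g) (m' * g) = Nat.gcd n' m' * g)%nat) by apply Nat.gcd_mul_mono_r.
      rewrite <- Hn', <- Hm' in G1. fold g in G1. nia.
Qed.

Fixpoint rsum (f : nat -> R) (n : nat) : R := match n with O => 0 | S m => rsum f m + f m end.

Lemma rsum_ge_0 (f : nat -> R) (n : nat) : (forall k, 0 <= f k) -> 0 <= rsum f n.
Proof. intros H. induction n as [|n IH]; simpl; [lra|]. specialize (H n). lra. Qed.

Lemma rsum_le (f g : nat -> R) (n : nat) : (forall k, (k < n)%nat -> f k <= g k) -> rsum f n <= rsum g n.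
Proof. intros H. induction n as [|n IH]; simpl; [lra|]. pose proof (H n ltac:(lia)). assert (rsum f n <= rsum g n) by (apply IH; intros; apply H; lia). lra. Qed.

Lemma rsum_pos (f : nat -> R) (n j : nat) : (forall k, 0 <= f k) -> (j < n)%nat -> 0 < f j -> 0 < rsum f n.
Proof.
  intros H. induction n as [|n IH]; intros Hj P; [lia|]. simpl. pose proof (rsum_ge_0 f n H). pose proof (H n).
  destruct (Nat.eq_dec j n) as [->|]; [lra|]. specialize (IH ltac:(lia) P). lra.
Qed.

(** A fixed index n >= 2 with kappa_n > 0 settles every angle except the finitely many y = 2 pi i/n;
    each of those has a witness j. A finite partial sum is thus positive on [e, pi], and continuity
    gives its minimum. *)
Lemma nonarithmetic_gap (kappa : nat -> R) (R0 e : R) : (forall j, (1 <= j)%nat -> 0 <= kappa j) ->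
  non_arithmetic kappa -> (exists j, (2 <= j)%nat /\ 0 < kappa j) -> 0 < R0 -> 0 < e <= PI ->
  exists M c, 0 < c /\ forall y, e <= Rabs y <= PI ->
    c <= rsum (fun j => gcoef kappa j * R0 ^ j * (1 - cos (INR j * y))) M.
Proof.
  intros Hk Hna [n [Hn Hkn]] HR He. pose proof PI_RGT_0.
  assert (Gp : forall j, (1 <= j)%nat -> kappa j <> 0 -> 0 < gcoef kappa j).
  { intros j Hj Hkj. destruct j as [|j]; [lia|]. change (gcoef kappa (S j)) with (kappa (S j) / INR (S j)). pose proof (Hk (S j) Hj). apply Rdiv_lt_0_compat; [lra|apply lt_0_INR; lia]. }
  assert (G0 : forall j, 0 <= gcoef kappa j).
  { intros j. destruct j as [|j]; [simpl; lra|]. destruct (Req_dec (kappa (S j)) 0) as [E|E]; [|left; apply Gp; [lia|exact E]].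
    change (gcoef kappa (S j)) with (kappa (S j) / INR (S j)). rewrite E. unfold Rdiv. rewrite Rmult_0_l. lra. }
  (* A common bound for the finitely many witnesses, so that one partial sum covers all exceptional
     angles. *)
  assert (W : forall m, exists J, forall i, (0 < i < n)%nat -> (i <= m)%nat -> exists j, (1 <= j < J)%nat /\ kappa j <> 0 /\ cos (INR j * (2 * PI * INR i / INR n)) <> 1).
  { induction m as [|m [J IH]]; [exists O; intros; lia|].
    destruct (classic (0 < S m < n)%nat) as [S1|S1].
    - destruct (nonarithmetic_witness kappa n (S m) Hna S1) as [j [J1 [J2 J3]]]. exists (J + j + 1)%nat. intros i Hi Him.
      destruct (Nat.eq_dec i (S m)) as [->|Ne]; [exists j; repeat split; try assumption; lia|].
      destruct (IH i Hi ltac:(lia)) as [j' [J1' [J2' J3']]]. exists j'. repeat split; try assumption; lia.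
    - exists J. intros i Hi Him. apply IH; lia. }
  destruct (W n) as [J HJ]. set (M := (J + n + 1)%nat).
  set (h := fun y => rsum (fun j => gcoef kappa j * R0 ^ j * (1 - cos (INR j * y))) M).
  assert (T0 : forall y k, 0 <= gcoef kappa k * R0 ^ k * (1 - cos (INR k * y))).
  { intros y k. pose proof (COS_bound (INR k * y)). repeat apply Rmult_le_pos; [apply G0|apply pow_le; lra|lra]. }
  assert (Tp : forall y k, (1 <= k < M)%nat -> kappa k <> 0 -> cos (INR k * y) <> 1 -> 0 < h y).
  { intros y k Hk1 Hk2 Hc. apply rsum_pos with (j := k); [apply T0|lia|]. pose proof (COS_bound (INR k * y)).
    repeat apply Rmult_lt_0_compat; [apply Gp; [lia|exact Hk2]|apply pow_lt, HR|lra]. }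
  assert (Pos : forall y, 0 < y <= PI -> 0 < h y).
  { intros y Hy. destruct (classic (cos (INR n * y) = 1)) as [E|E].
    - assert (Pn : 0 < INR n) by (apply lt_0_INR; lia).
      (* cos(n y) = 1 forces x to be an integer; it is compared with the integer just below
         [up x]. *)
      set (x := INR n * y / (2 * PI)).
      assert (X0 : 0 <= x) by (apply Rmult_le_pos; [nra|left; apply Rinv_0_lt_compat; lra]).
      destruct (archimed x) as [A1 A2]. set (z := up x) in *.
      assert (Z0 : (0 < z)%Z) by (apply lt_IZR; lra).
      set (i := Z.to_nat (z - 1)).
      assert (Ei : INR i = IZR z - 1) by (unfold i; rewrite INR_IZR_INZ, Z2Nat.id by lia; rewrite minus_IZR; reflexivity).
      assert (Ey : INR n * y = 2 * PI * (x - INR i) + 2 * INR i * PI) by (unfold x; field; lra).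
      assert (Hfrac : 0 <= x - INR i < 1 \/ x - INR i = 1) by lra.
      assert (Exi : exists i', x = INR i').
      { destruct Hfrac as [F|F].
        - exists i. rewrite Ey, cos_period in E. apply cos_eq_1 in E; [|rewrite Rabs_pos_eq; nra]. nra.
        - exists (S i). rewrite S_INR. lra. }
      destruct Exi as [i' Ex].
      assert (Eyy : y = 2 * PI * INR i' / INR n) by (rewrite <- Ex; unfold x; field; lra).
      assert (Hi : (0 < i' < n)%nat).
      { split.
        - apply INR_lt. simpl. rewrite <- Ex. unfold x. apply Rdiv_lt_0_compat; nra.
        - apply INR_lt. rewrite <- Ex. unfold x. apply Rmult_lt_reg_r with (2 * PI); [lra|].
          replace (INR n * y / (2 * PI) * (2 * PI)) with (INR n * y) by (field; lra). nra. }
      destruct (HJ i' Hi ltac:(lia)) as [j [J1 [J2 J3]]]. apply (Tp y j); [unfold M; lia|exact J2|]. rewrite Eyy. exact J3.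
    - apply (Tp y n); [unfold M; lia|lra|exact E]. }
  assert (Cont : forall y, continuity_pt h y).
  { intros y. apply continuity_pt_filterlim. unfold h. clear.
    change (continuous (fun y => rsum (fun j => gcoef kappa j * R0 ^ j * (1 - cos (INR j * y))) M) y).
    induction M as [|M IH].
    - apply continuous_const.
    - apply (continuous_plus (V := R_NormedModule) (fun y => rsum (fun j => gcoef kappa j * R0 ^ j * (1 - cos (INR j * y))) M) (fun y => gcoef kappa M * R0 ^ M * (1 - cos (INR M * y)))); [exact IH|].
      apply (ex_derive_continuous (K := R_AbsRing) (V := R_NormedModule)). auto_derive. exact I. }
  destruct (continuity_ab_min h e PI (proj2 He) (fun y _ => Cont y)) as [y0 [Hmin Hy0]].
  exists M, (h y0). split; [apply Pos; lra|]. intros y Hy.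
  replace (rsum (fun j => gcoef kappa j * R0 ^ j * (1 - cos (INR j * y))) M) with (h (Rabs y)); [apply Hmin; lra|].
  unfold h. clear. induction M as [|M IH]; [reflexivity|]. simpl. rewrite IH. f_equal. f_equal. f_equal.
  unfold Rabs. destruct (Rcase_abs y); [|reflexivity]. replace (INR M * - y) with (- (INR M * y)) by ring. apply cos_neg.
Qed.

(** * The saddle-point integral *)

Lemma zcoef_circle (F : C -> C) (R0 lam : R) (N : nat) : 0 < R0 -> 0 < lam -> holo_disc R0 F ->
  zcoef N F = ((lam / (2 * PI) / R0 ^ N)%R *
    CInt (fun t => F (R0 * cexp (- (lam * (1, t)))) * cexp (INR N * (lam * (1, t)))) (- (1) * (PI / lam)) (PI / lam))%C.
Proof.
  intros HR Hl HF. pose proof PI_RGT_0.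
  assert (Ex : exp (- (lam - ln R0)) = R0 * exp (- lam)).
  { replace (- (lam - ln R0)) with (ln R0 + - lam) by ring. rewrite exp_plus, exp_ln by exact HR. reflexivity. }
  assert (El : R0 * exp (- lam) < R0).
  { rewrite <- (Rmult_1_r R0) at 2. apply Rmult_lt_compat_l; [exact HR|]. rewrite <- exp_0. apply exp_increasing. lra. }
  rewrite (zcoef_cmean F R0 (lam - ln R0) N HF) by lra.
  assert (NR : RtoC R0 <> 0) by (apply RtoC_neq; lra).
  assert (E1 : cmean (fun z => F z / z ^ N)%C (lam - ln R0) = cmean (fun z => F (R0 * z) / (R0 * z) ^ N)%C lam).
  { apply CInt_ext. intros t _.
    assert (Ez : cexp (- ((lam - ln R0)%R, t)) = (R0 * cexp (- (lam, t)))%C).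
    { rewrite <- (exp_ln R0 HR) at 2. rewrite <- cexp_R, <- cexp_plus. f_equal.
      unfold Copp, Cplus, RtoC; cbn [fst snd]. f_equal; ring. }
    rewrite Ez. reflexivity. }
  rewrite E1, cmean_scaling by
    (first [exact Hl|intros z Hz; assert (Nz : z <> 0) by (eapply nz_of_Cmod_exp, Hz);
      apply Ccont_mult; [apply (Ccont_comp F (fun z => R0 * z)%C);
        [apply C_ex_derive_cont, C_ex_derive_mult; [apply C_ex_derive_const|apply C_ex_derive_id]
        |apply C_ex_derive_cont, HF; rewrite Cmod_mult, Cmod_R, Rabs_pos_eq by lra; rewrite Hz; exact El]
      |apply C_ex_derive_cont; apply (C_ex_derive_inv (fun z => (R0 * z) ^ N)%C);
        [apply (C_ex_derive_pow (fun z => R0 * z)%C), C_ex_derive_mult; [apply C_ex_derive_const|apply C_ex_derive_id]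
        |apply Cpow_nz, Cmult_neq_0; assumption]]]).
  assert (PN : 0 < R0 ^ N) by (apply pow_lt, HR).
  replace (RtoC (lam / (2 * PI) / R0 ^ N)) with (/ (2 * PI)%R * lam * / (R0 ^ N)%R)%C.
  2:{ unfold Rdiv. rewrite !RtoC_mult, !RtoC_inv, !RtoC_mult by lra. ring. }
  assert (HI : ex_CInt (fun t => F (R0 * cexp (- (lam * (1, t)))) * cexp (INR N * (lam * (1, t))))%C (- (1) * (PI / lam)) (PI / lam)).
  { apply ex_CInt_cont. intros t _.
    apply (RCcont_vline (fun w => F (R0 * cexp (- (lam * w))) * cexp (INR N * (lam * w)))%C).
    assert (D1 : C_ex_derive (fun w => lam * w)%C (1, t)) by (apply C_ex_derive_mult; [apply C_ex_derive_const|apply C_ex_derive_id]).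
    apply C_ex_derive_mult.
    - apply (C_ex_derive_comp F (fun w => R0 * cexp (- (lam * w)))%C).
      + apply C_ex_derive_mult; [apply C_ex_derive_const|]. apply C_ex_derive_cexp, C_ex_derive_opp, D1.
      + apply HF, Cmod_circle_lt; [exact HR|]. rewrite fst_Rmult. simpl. lra.
    - apply C_ex_derive_cexp, C_ex_derive_mult; [apply C_ex_derive_const|exact D1]. }
  rewrite <- !Cmult_assoc. do 2 f_equal.
  rewrite <- CInt_Cmult by exact HI.
  apply CInt_ext. intros t _. rewrite (cexp_pow (lam * (1, t))), cexp_opp.
  assert (Nc : (cexp (lam * (1, t)) ^ N)%C <> 0) by (apply Cpow_nz, cexp_nz).
  rewrite Cpow_mult_l, Cpow_inv by apply cexp_nz. rewrite RtoC_pow.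
  assert (NRN : (R0 ^ N)%C <> 0) by (apply Cpow_nz, NR).
  field. split; assumption.
Qed.

(** ** Null sequences *)

Lemma is_lim_seq_Rpower_neg (p : R) : 0 < p -> is_lim_seq (fun n => Rpower (INR n) (- p)) 0.
Proof.
  intros Hp. apply is_lim_seq_spec. intros eps.
  destruct (Rpower_lt_base_small p eps Hp (cond_pos eps)) as [d [Hd K]].
  destruct (INR_eventually_ge (/ d + 1)) as [n0 Hn0]. exists n0. intros n Hn. specialize (Hn0 n Hn).
  assert (P : 0 < / d) by (apply Rinv_0_lt_compat, Hd).
  rewrite Rminus_0_r, Rabs_pos_eq by (left; apply exp_pos).
  replace (Rpower (INR n) (- p)) with (Rpower (/ INR n) p) by (unfold Rpower; rewrite ln_Rinv by lra; f_equal; ring).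
  apply K. split; [apply Rinv_0_lt_compat; lra|]. rewrite <- (Rinv_inv d). apply Rinv_lt_contravar; nra.
Qed.

Lemma null_seq_le (e : nat -> R) (c p : R) : 0 < p -> (forall n, (1 <= n)%nat -> 0 <= e n <= c * Rpower (INR n) (- p)) ->
  is_lim_seq e 0.
Proof.
  intros Hp H. apply (is_lim_seq_le_le_loc (fun _ => 0) e (fun n => c * Rpower (INR n) (- p))).
  - exists 1%nat. exact H.
  - apply is_lim_seq_const.
  - replace (Finite 0) with (Rbar_mult c 0) by (simpl; f_equal; ring). apply is_lim_seq_scal_l, is_lim_seq_Rpower_neg, Hp.
Qed.

Lemma null_seq_eventually (e : nat -> R) (eps : R) : is_lim_seq e 0 -> 0 < eps -> exists n0, forall n, (n0 <= n)%nat -> e n <= eps.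
Proof.
  intros H He. apply is_lim_seq_spec in H. destruct (H (mkposreal eps He)) as [n0 Hn0]. exists n0. intros n Hn.
  specialize (Hn0 n Hn). simpl in Hn0. rewrite Rminus_0_r in Hn0. pose proof (Rle_abs (e n)). lra.
Qed.

Lemma nonneg_of_derive (f df : R -> R) (v : R) : (forall t, is_derive f t (df t)) -> f 0 = 0 ->
  (forall t, 0 <= t -> 0 <= df t) -> 0 <= v -> 0 <= f v.
Proof.
  intros D F0 Hd Hv. destruct (MVT_gen f 0 v df) as [c [Hc E]].
  - intros t _. apply D.
  - intros t _. apply continuity_pt_filterlim. apply (ex_derive_continuous (K := R_AbsRing) (V := R_NormedModule)). eexists; apply D.
  - rewrite Rmin_left in Hc by lra. specialize (Hd c (proj1 Hc)). rewrite F0 in E. nra.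
Qed.

Lemma exp_opp_taylor2 (v : R) : 0 <= v -> - (v ^ 3) <= exp (- v) - 1 + v - v ^ 2 / 2 <= 0.
Proof.
  intros Hv.
  assert (A : forall t, 0 <= t -> 0 <= 1 - t + t ^ 2 / 2 - exp (- t)).
  { intros t Ht. apply (nonneg_of_derive (fun t => 1 - t + t ^ 2 / 2 - exp (- t)) (fun t => - (1) + t + exp (- t))); [| | |exact Ht].
    - intros x. auto_derive; [exact I|]. simpl. field.
    - rewrite Ropp_0, exp_0. field.
    - intros x Hx. pose proof (exp_ineq1_le (- x)). lra. }
  split; [|specialize (A v Hv); lra].
  assert (B : 0 <= exp (- v) - (1 - v + v ^ 2 / 2 - v ^ 3 / 6)).
  { apply (nonneg_of_derive (fun t => exp (- t) - (1 - t + t ^ 2 / 2 - t ^ 3 / 6)) (fun t => 1 - t + t ^ 2 / 2 - exp (- t))); [| |exact A|exact Hv].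
    - intros x. auto_derive; [exact I|]. simpl. field.
    - rewrite Ropp_0, exp_0. field. }
  pose proof (pow_le v 3 Hv). lra.
Qed.

Lemma Rpower_half (x : R) : 0 < x -> Rpower x (- / 2) = / sqrt x.
Proof. intros H. rewrite Rpower_Ropp, Rpower_sqrt by exact H. reflexivity. Qed.

Lemma exp_opp_le_inv_sqr (x : R) : 0 < x -> exp (- x) <= 4 / x ^ 2.
Proof.
  intros H. pose proof (exp_ineq1_le (x / 2)) as E.
  assert (S : x ^ 2 / 4 <= exp x).
  { replace x with (x / 2 + x / 2) at 2 by field. rewrite exp_plus. nra. }
  rewrite exp_Ropp. replace (4 / x ^ 2) with (/ (x ^ 2 / 4)) by (field; lra). apply Rinv_le_contravar; [|exact S].
  pose proof (pow_lt x 2 H). lra.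
Qed.

Section Scales.

Variables (s a u : R).
Hypothesis (Hs : 1 < s < 2) (Ha : 0 < a) (Hu : 0 <= u).

Definition lam_ (N : nat) : R := Rpower (INR N * a) (- / s).
Definition q_ (N : nat) : R := exp (- u / sqrt (INR N)).

Lemma lam_pos (N : nat) : 0 < lam_ N.
Proof. apply exp_pos. Qed.

Lemma INR_ge_1 (N : nat) : (1 <= N)%nat -> 1 <= INR N.
Proof. intros H. apply (le_INR 1), H. Qed.

Lemma lam_split (N : nat) (p : R) : (1 <= N)%nat -> Rpower (lam_ N) p = Rpower a (- (p / s)) * Rpower (INR N) (- (p / s)).
Proof.
  intros HN. pose proof (INR_ge_1 N HN). unfold lam_. rewrite Rpower_mult, Rmult_comm with (r1 := INR N), Rpower_mult_base by lra.
  replace (- / s * p) with (- (p / s)) by (field; lra). reflexivity.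
Qed.

Lemma lam_pow_s (N : nat) : (1 <= N)%nat -> INR N * a * Rpower (lam_ N) s = 1.
Proof.
  intros HN. pose proof (INR_ge_1 N HN). unfold lam_. rewrite Rpower_mult. replace (- / s * s) with (- (1)) by (field; lra).
  rewrite Rpower_Ropp, Rpower_1 by nra. field. split; lra.
Qed.

Lemma q_bounds (N : nat) : (1 <= N)%nat -> 0 < q_ N <= 1 /\ 0 <= 1 - q_ N <= u * Rpower (INR N) (- / 2).
Proof.
  intros HN. pose proof (INR_ge_1 N HN) as H. unfold q_.
  assert (S : 0 < sqrt (INR N)) by (apply sqrt_lt_R0; lra).
  rewrite Rpower_half by lra.
  assert (V : 0 <= u / sqrt (INR N)) by (apply Rmult_le_pos; [lra|left; apply Rinv_0_lt_compat, S]).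
  replace (- u / sqrt (INR N)) with (- (u / sqrt (INR N))) by (field; lra).
  pose proof (exp_ineq1_le (- (u / sqrt (INR N)))).
  assert (exp (- (u / sqrt (INR N))) <= 1) by (rewrite <- exp_0; apply exp_le_compat; lra).
  pose proof (exp_pos (- (u / sqrt (INR N)))). unfold Rdiv in *. lra.
Qed.

Lemma null_lam_pow (p : R) : 0 < p -> is_lim_seq (fun N => Rpower (lam_ N) p) 0.
Proof.
  intros Hp. apply (null_seq_le _ (Rpower a (- (p / s))) (p / s)); [apply Rdiv_lt_0_compat; lra|].
  intros n Hn. rewrite lam_split by exact Hn. split; [left; apply Rmult_lt_0_compat; apply exp_pos|lra].
Qed.

Lemma null_lam : is_lim_seq lam_ 0.
Proof.
  apply (is_lim_seq_ext (fun N => Rpower (lam_ N) 1)); [intros n; apply Rpower_1, lam_pos|apply null_lam_pow; lra].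
Qed.

Lemma null_q : is_lim_seq (fun N => 1 - q_ N) 0.
Proof. apply (null_seq_le _ u (/ 2)); [lra|]. intros n Hn. apply q_bounds, Hn. Qed.

Lemma Rpower_opp_plus (x p q r : R) : p + q = r -> Rpower x p * Rpower x q = Rpower x r.
Proof. intros <-. symmetry. apply Rpower_plus. Qed.

(** ln N <= 4 N^{1/4}, against 1 - q = O(N^{-1/2}). *)
Lemma null_q_ln_lam : is_lim_seq (fun N => (1 - q_ N) * Rabs (ln (lam_ N))) 0.
Proof.
  apply (null_seq_le _ (u * (4 + Rabs (ln a))) (/ 4)); [lra|]. intros n Hn.
  pose proof (INR_ge_1 n Hn) as H. destruct (q_bounds n Hn) as [_ [Q1 Q2]].
  split; [apply Rmult_le_pos; [exact Q1|apply Rabs_pos]|].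
  assert (L : Rabs (ln (lam_ n)) <= (4 + Rabs (ln a)) * Rpower (INR n) (/ 4)).
  { unfold lam_, Rpower at 1. rewrite ln_exp, Rabs_mult, Rabs_Ropp, (Rabs_pos_eq (/ s)) by (left; apply Rinv_0_lt_compat; lra).
    rewrite ln_mult by lra.
    assert (S1 : / s <= 1) by (rewrite <- Rinv_1; apply Rinv_le_contravar; lra).
    assert (S0 : 0 < / s) by (apply Rinv_0_lt_compat; lra).
    assert (L0 : 0 <= ln (INR n)) by (rewrite <- ln_1; destruct H as [H|H]; [left; apply ln_increasing; lra|rewrite <- H; lra]).
    assert (LN : ln (INR n) <= 4 * Rpower (INR n) (/ 4)).
    { pose proof (ln_le_sub1 (Rpower (INR n) (/ 4)) (exp_pos _)) as W. unfold Rpower at 1 in W. rewrite ln_exp in W. lra. }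
    assert (G1 : 1 <= Rpower (INR n) (/ 4)).
    { rewrite <- exp_0. apply exp_le_compat. nra. }
    pose proof (Rabs_pos (ln a)). pose proof (Rabs_triang (ln (INR n)) (ln a)) as Tr. rewrite (Rabs_pos_eq (ln (INR n))) in Tr by exact L0.
    pose proof (Rabs_pos (ln (INR n) + ln a)). nra. }
  apply Rle_trans with (u * Rpower (INR n) (- / 2) * ((4 + Rabs (ln a)) * Rpower (INR n) (/ 4))).
  - apply Rmult_le_compat; [exact Q1|apply Rabs_pos|exact Q2|exact L].
  - replace (u * Rpower (INR n) (- / 2) * ((4 + Rabs (ln a)) * Rpower (INR n) (/ 4))) with
      (u * (4 + Rabs (ln a)) * (Rpower (INR n) (- / 2) * Rpower (INR n) (/ 4))) by ring.
    rewrite (Rpower_opp_plus _ _ _ (- / 4)) by field. lra.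
Qed.

(** The order is N^{1 - 1/2 - 1/s}, with a negative exponent precisely because s < 2. *)
Lemma null_q_lam : is_lim_seq (fun N => INR N * (1 - q_ N) * lam_ N) 0.
Proof.
  apply (null_seq_le _ (u * Rpower a (- (1 / s))) (/ s - / 2)).
  { assert (/ 2 < / s) by (apply Rinv_lt_contravar; lra). lra. }
  intros n Hn. pose proof (INR_ge_1 n Hn) as H. destruct (q_bounds n Hn) as [_ [Q1 Q2]].
  rewrite <- (Rpower_1 (lam_ n)) by apply lam_pos. rewrite lam_split by exact Hn.
  pose proof (exp_pos (- (1 / s) * ln a)) as P1. pose proof (exp_pos (- (1 / s) * ln (INR n))) as P2.
  fold (Rpower a (- (1 / s))) in P1. fold (Rpower (INR n) (- (1 / s))) in P2.
  split; [apply Rmult_le_pos; [nra|left; nra]|].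
  apply Rle_trans with (INR n * (u * Rpower (INR n) (- / 2)) * (Rpower a (- (1 / s)) * Rpower (INR n) (- (1 / s)))).
  - apply Rmult_le_compat_r; [left; nra|]. apply Rmult_le_compat_l; lra.
  - rewrite <- (Rpower_1 (INR n)) at 1 by lra.
    replace (Rpower (INR n) 1 * (u * Rpower (INR n) (- / 2)) * (Rpower a (- (1 / s)) * Rpower (INR n) (- (1 / s))))
      with (u * Rpower a (- (1 / s)) * ((Rpower (INR n) 1 * Rpower (INR n) (- / 2)) * Rpower (INR n) (- (1 / s)))) by ring.
    rewrite (Rpower_opp_plus _ _ _ (/ 2)) by field. rewrite (Rpower_opp_plus _ _ _ (- (/ s - / 2))) by (field; lra). lra.
Qed.

(** With v = u/sqrt N the exponent is K0 N (e^{-v} - 1 + v - v^2/2) = O(N v^3) = O(N^{-1/2}). The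
    quadratic term survives in the limit since N v^2 = u^2. *)
Lemma limit_q_taylor (K0 : R) :
  is_lim_seq (fun N => exp (q_ N * (INR N * K0) - (INR N * K0 - sqrt (INR N) * u * K0 + / 2 * u ^ 2 * K0))) 1.
Proof.
  replace (Finite 1) with (Finite (exp 0)) by (rewrite exp_0; reflexivity).
  apply (is_lim_seq_continuous exp (fun N => q_ N * (INR N * K0) - (INR N * K0 - sqrt (INR N) * u * K0 + / 2 * u ^ 2 * K0)) 0).
  { apply derivable_continuous_pt, derivable_pt_exp. }
  apply (is_lim_seq_abs_0).
  apply (null_seq_le _ (Rabs K0 * u ^ 3) (/ 2)); [lra|]. intros n Hn. pose proof (INR_ge_1 n Hn) as H.
  assert (S : 0 < sqrt (INR n)) by (apply sqrt_lt_R0; lra).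
  split; [apply Rabs_pos|].
  assert (SS : sqrt (INR n) * sqrt (INR n) = INR n) by (apply sqrt_sqrt; lra).
  set (v := u / sqrt (INR n)).
  assert (V : 0 <= v) by (apply Rmult_le_pos; [lra|left; apply Rinv_0_lt_compat, S]).
  pose proof (exp_opp_taylor2 v V) as T.
  replace (q_ n * (INR n * K0) - (INR n * K0 - sqrt (INR n) * u * K0 + / 2 * u ^ 2 * K0)) with
    (K0 * (INR n * (exp (- v) - 1 + v - v ^ 2 / 2))).
  2:{ unfold q_. replace (- u / sqrt (INR n)) with (- v) by (unfold v; field; lra).
      set (E := exp (- v)). unfold v. set (r := sqrt (INR n)) in *. rewrite <- SS. field. lra. }
  rewrite !Rabs_mult, (Rabs_pos_eq (INR n)) by lra. rewrite Rpower_half, Rmult_assoc by lra.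
  apply Rmult_le_compat_l; [apply Rabs_pos|].
  rewrite Rabs_left1 by lra.
  apply Rle_trans with (INR n * v ^ 3); [apply Rmult_le_compat_l; lra|].
  right. unfold v. set (r := sqrt (INR n)) in *. rewrite <- SS. field. lra.
Qed.

End Scales.

(** [Nf], [Nth] and [Nka] are the expansions at [z = R] read in [w = - log (z / R)]; [Far] controls the rest of the circle. *)
Section Saddle.

Variables (f gth gka : C -> C) (R0 th s a K0 d u C0 eps0 : R).
Hypothesis (HR : 0 < R0) (Hth : 0 <= th) (Hs : 1 < s < 2) (Ha : 0 < a) (Hd : 0 < d < 1) (Hu : 0 <= u)
  (HC0 : 0 < C0) (Heps0 : 0 < eps0 <= / 24).
Hypothesis (Hf : holo_disc R0 f) (Hgth : holo_disc R0 gth) (Hgka : holo_disc R0 gka).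
Hypothesis Nf : forall w, 0 < fst w -> Cmod w <= eps0 -> Cmod (f (R0 * cexp (- w)) - 1)%C <= C0 * Rpower (Cmod w) d.
Hypothesis Nth : forall w, 0 < fst w -> Cmod w <= eps0 ->
  Cmod (gth (R0 * cexp (- w)) - (- th * Clog w))%C <= C0 * Rpower (Cmod w) d.
Hypothesis Nka : forall w, 0 < fst w -> Cmod w <= eps0 ->
  Cmod (gka (R0 * cexp (- w)) - (K0 - w + a * cexp (s * Clog w)))%C <= C0 * Rpower (Cmod w) (s + d).
Hypothesis Far : forall e, 0 < e <= PI -> exists M m, 0 < M /\ 0 < m /\ forall x y, 0 < x <= eps0 -> e <= Rabs y <= PI ->
  Cmod (f (R0 * cexp (- (x, y)))%C) <= M /\ fst (gth (R0 * cexp (- (x, y)))%C) <= M - th * ln x /\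
  fst (gka (R0 * cexp (- (x, y)))%C) <= K0 - m.

Let lam := lam_ s a.
Let q := q_ u.

Definition pt (N : nat) (t : R) : C := (lam N * (1, t))%C.
Definition zt (N : nat) (t : R) : C := (R0 * cexp (- pt N t))%C.
(** The exponent of the Cauchy integrand after q N K0 is subtracted and th ln lam added: these two
    parts go into the asymptotic prefactor. The term N * pt is z^{-N} without its R^{-N}. *)
Definition expo (N : nat) (t : R) : C :=
  (th * ln (lam N) + q N * gth (zt N t) + INR N * (q N * (gka (zt N t) - K0) + pt N t))%C.
Definition integrand (N : nat) (t : R) : C := (f (zt N t) * cexp (expo N t))%C.

Lemma fst_pt N t : fst (pt N t) = lam N.
Proof. unfold pt. rewrite fst_Rmult. simpl. ring. Qed.

Lemma fst_pt_pos N t : 0 < fst (pt N t).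
Proof. rewrite fst_pt. apply lam_pos. Qed.

Lemma Cmod_pt N t : Cmod (pt N t) = lam N * Cmod (1, t).
Proof. unfold pt. rewrite Cmod_mult, Cmod_R, Rabs_pos_eq; [reflexivity|left; apply lam_pos]. Qed.

Lemma Clog_pt N t : Clog (pt N t) = (ln (lam N) + Clog (1, t))%C.
Proof. unfold pt. apply Clog_scale; [apply lam_pos|simpl; lra]. Qed.

Lemma Rpower_pt N t p : Rpower (Cmod (pt N t)) p = Rpower (lam N) p * Rpower (Cmod (1, t)) p.
Proof. rewrite Cmod_pt. apply Rpower_mult_base; [apply lam_pos|pose proof (Cmod_vline_ge_1 t); lra]. Qed.

Lemma scaled_power N t : (1 <= N)%nat ->
  (INR N * (a * cexp (s * Clog (pt N t))))%C = cexp (s * Clog (1, t)).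
Proof.
  intros HN. rewrite Clog_pt. replace (s * (ln (lam N) + Clog (1, t)))%C with ((s * ln (lam N))%R + s * Clog (1, t))%C by (rewrite RtoC_mult; ring).
  rewrite cexp_plus, cexp_R. fold (Rpower (lam N) s). rewrite !Cmult_assoc, <- !RtoC_mult.
  unfold lam. rewrite (lam_pow_s s a) by assumption. ring.
Qed.

Lemma zt_disc N t : Cmod (zt N t) < R0.
Proof. apply Cmod_circle_lt; [exact HR|apply fst_pt_pos]. Qed.

Lemma RCcont_integrand N t : RCcont (integrand N) t.
Proof.
  apply (RCcont_vline (fun w => f (R0 * cexp (- (lam N * w))) * cexp (th * ln (lam N) + q N * gth (R0 * cexp (- (lam N * w)))
    + INR N * (q N * (gka (R0 * cexp (- (lam N * w))) - K0) + lam N * w)))%C).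
  assert (D1 : C_ex_derive (fun w => lam N * w)%C (1, t)) by (apply C_ex_derive_mult; [apply C_ex_derive_const|apply C_ex_derive_id]).
  assert (D2 : C_ex_derive (fun w => R0 * cexp (- (lam N * w)))%C (1, t)).
  { apply C_ex_derive_mult; [apply C_ex_derive_const|]. apply C_ex_derive_cexp, C_ex_derive_opp, D1. }
  assert (D3 : forall g, holo_disc R0 g -> C_ex_derive (fun w => g (R0 * cexp (- (lam N * w))))%C (1, t)).
  { intros g Hg. apply (C_ex_derive_comp g (fun w => R0 * cexp (- (lam N * w)))%C); [exact D2|apply Hg, zt_disc]. }
  apply C_ex_derive_mult; [apply D3, Hf|]. apply C_ex_derive_cexp.
  apply C_ex_derive_plus; [apply C_ex_derive_plus; [apply C_ex_derive_const|]|].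
  - apply C_ex_derive_mult; [apply C_ex_derive_const|apply D3, Hgth].
  - apply C_ex_derive_mult; [apply C_ex_derive_const|]. apply C_ex_derive_plus; [|exact D1].
    apply C_ex_derive_mult; [apply C_ex_derive_const|]. apply C_ex_derive_minus; [apply D3, Hgka|apply C_ex_derive_const].
Qed.

(** For |1 + it| <= Y: the damping against ln lam, against log omega and omega^s, the remainders of
    the two expansions (with N lam^s = 1/a), and the part of the linear term that the damping keeps
    from cancelling. *)
Definition err (Y : R) (N : nat) : R :=
  th * ((1 - q N) * Rabs (ln (lam N))) + (th * (Y + 2) + Rpower Y s) * (1 - q N)
  + (C0 * Rpower Y d + C0 / a * Rpower Y (s + d)) * Rpower (lam N) d + Y * (INR N * (1 - q N) * lam N).

Lemma null_err (Y : R) : is_lim_seq (err Y) 0.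
Proof.
  replace (Finite 0) with (Finite (th * 0 + (th * (Y + 2) + Rpower Y s) * 0 + (C0 * Rpower Y d + C0 / a * Rpower Y (s + d)) * 0 + Y * 0)) by (f_equal; ring).
  unfold err. repeat apply is_lim_seq_plus'.
  - apply (is_lim_seq_scal_l _ th 0), null_q_ln_lam; assumption.
  - apply (is_lim_seq_scal_l _ _ 0), null_q; assumption.
  - apply (is_lim_seq_scal_l _ _ 0), null_lam_pow; [assumption|assumption|lra].
  - apply (is_lim_seq_scal_l _ Y 0), null_q_lam; assumption.
Qed.

Lemma expo_error N t Y : (1 <= N)%nat -> Cmod (1, t) <= Y -> Cmod (pt N t) <= eps0 ->
  Cmod (expo N t - (cexp (s * Clog (1, t)) - th * Clog (1, t)))%C <= err Y N.
Proof.
  intros HN HY Hw. pose proof (q_bounds u Hu N HN) as [[Q0 Q1] [Q2 _]]. fold q in Q0, Q1, Q2.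
  pose proof (Nth (pt N t) (fst_pt_pos N t) Hw) as B1. pose proof (Nka (pt N t) (fst_pt_pos N t) Hw) as B2.
  fold (zt N t) in B1, B2. rewrite Rpower_pt in B1, B2.
  set (e1 := (gth (zt N t) - (- th * Clog (pt N t)))%C) in *.
  set (e2 := (gka (zt N t) - (K0 - pt N t + a * cexp (s * Clog (pt N t))))%C) in *.
  pose proof (Cmod_vline_ge_1 t) as G. pose proof (INR_ge_1 N HN) as HN1. pose proof (lam_pos s a N) as L0. fold lam in L0.
  pose proof (Cmod_Clog_vline t) as CL. pose proof (ln_le_sub1 (Cmod (1, t)) ltac:(lra)) as LL.
  (* An exact identity; its four groups are estimated by the four terms of [err], in the same
     order. *)
  assert (E : (expo N t - (cexp (s * Clog (1, t)) - th * Clog (1, t)))%C =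
    ((th * ((1 - q N) * ln (lam N)))%R + ((th * (1 - q N))%R * Clog (1, t) + (q N - 1)%R * cexp (s * Clog (1, t)))
     + (q N * e1 + (q N * INR N)%R * e2) + (INR N * (1 - q N) * lam N)%R * (1, t))%C).
  { rewrite <- (scaled_power N t HN). unfold expo, e1, e2. rewrite !Clog_pt.
    rewrite !RtoC_mult, !RtoC_minus. unfold pt. ring. }
  rewrite E. clear E.
  assert (PS : Cmod (cexp (s * Clog (1, t))) = Rpower (Cmod (1, t)) s).
  { rewrite Cmod_cexp, fst_Rmult, Clog_pos by (simpl; lra). reflexivity. }
  assert (PM : forall p, 0 < p -> Rpower (Cmod (1, t)) p <= Rpower Y p) by (intros p Hp; apply Rle_Rpower_l; lra).
  unfold err.
  eapply Rle_trans; [apply Cmod_triangle|]. apply Rplus_le_compat; [eapply Rle_trans; [apply Cmod_triangle|]; apply Rplus_le_compat;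
    [eapply Rle_trans; [apply Cmod_triangle|]; apply Rplus_le_compat|]|].
  - rewrite Cmod_R, !Rabs_mult, (Rabs_pos_eq th), (Rabs_pos_eq (1 - q N)) by assumption. lra.
  - eapply Rle_trans; [apply Cmod_triangle|]. rewrite !Cmod_mult, !Cmod_R, PS.
    rewrite (Rabs_pos_eq (th * (1 - q N))) by nra. rewrite (Rabs_left1 (q N - 1)) by lra.
    pose proof (PM s ltac:(lra)).
    assert (Cmod (Clog (1, t)) <= Y + 2) by lra.
    assert (th * (1 - q N) * Cmod (Clog (1, t)) <= th * (1 - q N) * (Y + 2)) by (apply Rmult_le_compat_l; [nra|assumption]). nra.
  - eapply Rle_trans; [apply Cmod_triangle|]. rewrite !Cmod_mult, !Cmod_R.
    rewrite (Rabs_pos_eq (q N)), (Rabs_pos_eq (q N * INR N)) by nra.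
    pose proof (PM d ltac:(lra)) as M1. pose proof (PM (s + d) ltac:(lra)) as M2.
    pose proof (exp_pos (d * ln (lam N))) as Pl. fold (Rpower (lam N) d) in Pl.
    pose proof (Cmod_ge_0 e1). pose proof (Cmod_ge_0 e2).
    assert (T1 : q N * Cmod e1 <= C0 * Rpower Y d * Rpower (lam N) d).
    { apply Rle_trans with (1 * (C0 * (Rpower (lam N) d * Rpower Y d))); [|lra].
      apply Rmult_le_compat; try lra. eapply Rle_trans; [exact B1|]. apply Rmult_le_compat_l; [lra|]. apply Rmult_le_compat_l; lra. }
    assert (T2 : q N * INR N * Cmod e2 <= C0 / a * Rpower Y (s + d) * Rpower (lam N) d).
    { apply Rle_trans with (1 * INR N * (C0 * (Rpower (lam N) (s + d) * Rpower Y (s + d)))).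
      - apply Rmult_le_compat; try nra. eapply Rle_trans; [exact B2|]. apply Rmult_le_compat_l; [lra|].
        apply Rmult_le_compat_l; [left; apply exp_pos|lra].
      - right. rewrite (Rpower_plus s d (lam N)).
        pose proof (lam_pow_s s a Hs Ha N HN) as LP. fold lam in LP.
        replace (1 * INR N * (C0 * (Rpower (lam N) s * Rpower (lam N) d * Rpower Y (s + d)))) with
          (C0 / a * Rpower Y (s + d) * Rpower (lam N) d * (INR N * a * Rpower (lam N) s)) by (field; lra).
        rewrite LP. ring. }
    lra.
  - rewrite Cmod_mult, Cmod_R, Rabs_pos_eq by (repeat apply Rmult_le_pos; lra).
    rewrite (Rmult_comm Y). apply Rmult_le_compat_l; [repeat apply Rmult_le_pos; lra|exact HY].
Qed.

Lemma hankel_int_bound3 t : Cmod (hankel_int s th t) <= 3.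
Proof.
  unfold hankel_int. rewrite Cmod_cexp, fst_hankel_exponent.
  pose proof (Re_vline_pow_le_1 s t ltac:(lra)). pose proof (ln_Cmod_vline_ge_0 t).
  eapply Rle_trans; [apply exp_le_compat with (y := 1)|apply exp_1_lt_3]. nra.
Qed.

Lemma integrand_converges (T eps : R) : 0 < T -> 0 < eps -> exists n0, forall N, (n0 <= N)%nat ->
  forall t, - (1) * T <= t <= T -> Cmod (integrand N t - hankel_int s th t) <= eps.
Proof.
  intros HT He. set (Y := 1 + T).
  (* The final error is at most 3 * 7 eta: 3 bounds the limit integrand, and 7 = 4 + 3 collects the
     errors of f and of the exponential. *)
  set (eta := Rmin 1 (eps / 30)).
  assert (Heta : 0 < eta) by (apply Rmin_pos; lra). pose proof (Rmin_l 1 (eps / 30)) as E1. pose proof (Rmin_r 1 (eps / 30)) as E2. fold eta in E1, E2.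
  destruct (null_seq_eventually (err Y) eta (null_err Y) Heta) as [n1 H1].
  pose proof (null_lam s a Hs Ha) as NL. fold lam in NL.
  assert (NL2 : is_lim_seq (fun N => Y * lam N) 0).
  { replace (Finite 0) with (Rbar_mult Y 0) by (simpl; f_equal; ring). apply is_lim_seq_scal_l, NL. }
  destruct (null_seq_eventually _ eps0 NL2 (proj1 Heps0)) as [n2 H2].
  pose proof (null_lam_pow s a Hs Ha d (proj1 Hd)) as NP. fold lam in NP.
  assert (NP2 : is_lim_seq (fun N => (C0 * Rpower Y d) * Rpower (lam N) d) 0).
  { replace (Finite 0) with (Rbar_mult (C0 * Rpower Y d) 0) by (simpl; f_equal; ring). apply is_lim_seq_scal_l, NP. }
  destruct (null_seq_eventually _ eta NP2 Heta) as [n3 H3].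
  exists (n1 + n2 + n3 + 1)%nat. intros N HN t Ht.
  specialize (H1 N ltac:(lia)). specialize (H2 N ltac:(lia)). specialize (H3 N ltac:(lia)). cbv beta in H2, H3.
  assert (HN1 : (1 <= N)%nat) by lia.
  pose proof (Cmod_vline_ge_1 t) as G. pose proof (lam_pos s a N) as L0. fold lam in L0.
  assert (HY : Cmod (1, t) <= Y).
  { eapply Rle_trans; [apply Cmod_vline_le|]. unfold Y. assert (Rabs t <= T) by (apply Rabs_le; lra). lra. }
  assert (Hw : Cmod (pt N t) <= eps0) by (rewrite Cmod_pt; nra).
  pose proof (expo_error N t Y HN1 HY Hw) as B.
  pose proof (Nf (pt N t) (fst_pt_pos N t) Hw) as BF. fold (zt N t) in BF. rewrite Rpower_pt in BF.
  set (X := (expo N t - (cexp (s * Clog (1, t)) - th * Clog (1, t)))%C) in *.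
  assert (BF2 : Cmod (f (zt N t) - 1) <= eta).
  { eapply Rle_trans; [exact BF|]. eapply Rle_trans; [|exact H3].
    assert (Rpower (Cmod (1, t)) d <= Rpower Y d) by (apply Rle_Rpower_l; lra).
    pose proof (exp_pos (d * ln (lam N))) as Pl. fold (Rpower (lam N) d) in Pl.
    apply Rle_trans with (C0 * (Rpower (lam N) d * Rpower Y d)); [|lra]. apply Rmult_le_compat_l; [lra|]. apply Rmult_le_compat_l; lra. }
  unfold integrand.
  assert (EE : cexp (expo N t) = (hankel_int s th t * cexp X)%C).
  { unfold hankel_int. rewrite <- cexp_plus. f_equal. unfold X. ring. }
  rewrite EE.
  replace (f (zt N t) * (hankel_int s th t * cexp X) - hankel_int s th t)%C with
    (hankel_int s th t * ((f (zt N t) - 1) * cexp X + (cexp X - 1)))%C by ring.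
  rewrite Cmod_mult. pose proof (hankel_int_bound3 t).
  assert (BX : Cmod (cexp X - 1)%C <= 3 * eta) by (eapply Rle_trans; [apply cexp_sub_1_le; lra|lra]).
  assert (BX2 : Cmod (cexp X) <= 4).
  { replace (cexp X) with ((cexp X - 1) + 1)%C by ring. eapply Rle_trans; [apply Cmod_triangle|]. rewrite Cmod_1. lra. }
  assert (BS : Cmod ((f (zt N t) - 1) * cexp X + (cexp X - 1)) <= 7 * eta).
  { eapply Rle_trans; [apply Cmod_triangle|]. rewrite Cmod_mult.
    assert (Cmod (f (zt N t) - 1) * Cmod (cexp X) <= eta * 4) by (apply Rmult_le_compat; try apply Cmod_ge_0; assumption). lra. }
  apply Rle_trans with (3 * (7 * eta)); [apply Rmult_le_compat; try apply Cmod_ge_0; assumption|lra].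
Qed.

Lemma fst_expo N t : fst (expo N t) =
  th * ln (lam N) + q N * fst (gth (zt N t)) + INR N * (q N * (fst (gka (zt N t)) - K0) + lam N).
Proof.
  unfold expo. cbn [fst Cplus]. rewrite !fst_Rmult. cbn [fst Cplus Cminus Copp]. rewrite !fst_Rmult, fst_pt. cbn [fst RtoC Cplus Cminus Copp]. reflexivity.
Qed.

Lemma fst_le_of_Cmod (z w : C) (e : R) : Cmod (z - w) <= e -> fst z <= fst w + e.
Proof. intros H. pose proof (fst_le_Cmod (z - w)) as F. cbn [fst Cminus Cplus Copp] in F. pose proof (Rle_abs (fst z + - fst w)). lra. Qed.

(** Re(omega^s) <= B1 - b0 |omega|^s supplies the decay. Near R the relative remainder of g_kappa is
    small enough to consume only half of b0, and q >= 1/2 halves the rest. The singular part of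
    g_theta helps, since th ln|omega| >= 0. *)
Lemma near_bound : exists eps1 C1, 0 < eps1 <= eps0 /\ 0 < C1 /\ exists n0, forall N, (n0 <= N)%nat ->
  forall t, Cmod (pt N t) <= eps1 -> Cmod (integrand N t) <= C1 / (1 + t ^ 2).
Proof.
  destruct (Re_vline_pow_bound s Hs) as [b0 [B1 [Hb0 [HB1 RB]]]].
  (* After scaling, the remainder is (C0/a) |w|^d |omega|^s, which this choice keeps below (b0/2)
     |omega|^s. *)
  destruct (Rpower_lt_base_small d (a * b0 / (2 * C0))) as [d' [Hd' Kd']]; [lra|apply Rdiv_lt_0_compat; nra|].
  set (eps1 := Rmin eps0 (d' / 2)).
  assert (He1 : 0 < eps1) by (apply Rmin_pos; lra).
  assert (L1 : eps1 <= eps0) by apply Rmin_l. assert (L2 : eps1 <= d' / 2) by apply Rmin_r.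
  set (A := (1 + C0) * exp (C0 + 1 + B1)).
  assert (HA : 0 < A) by (apply Rmult_lt_0_compat; [lra|apply exp_pos]).
  exists eps1, (A * (64 / b0 ^ 2)). split; [lra|]. split; [apply Rmult_lt_0_compat; [exact HA|apply Rdiv_lt_0_compat; [lra|apply pow_lt, Hb0]]|].
  destruct (null_seq_eventually _ (/ 2) (null_q u Hu)) as [n1 H1]; [lra|].
  destruct (null_seq_eventually _ 1 (null_q_lam s a u Hs Ha Hu)) as [n2 H2]; [lra|].
  destruct (null_seq_eventually _ 1 (null_lam s a Hs Ha)) as [n3 H3]; [lra|].
  exists (n1 + n2 + n3 + 1)%nat. intros N HN t Hw.
  specialize (H1 N ltac:(lia)). specialize (H2 N ltac:(lia)). specialize (H3 N ltac:(lia)). fold lam in H2, H3. cbv beta in H1, H2. fold q in H1, H2.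
  assert (HN1 : (1 <= N)%nat) by lia.
  pose proof (q_bounds u Hu N HN1) as [[Q0 Q1] [Q2 _]]. fold q in Q0, Q1, Q2.
  pose proof (Cmod_vline_ge_1 t) as G. pose proof (INR_ge_1 N HN1) as HNN. pose proof (lam_pos s a N) as L0. fold lam in L0.
  pose proof (Nf (pt N t) (fst_pt_pos N t) ltac:(lra)) as BF. pose proof (Nth (pt N t) (fst_pt_pos N t) ltac:(lra)) as BT.
  pose proof (Nka (pt N t) (fst_pt_pos N t) ltac:(lra)) as BK. fold (zt N t) in BF, BT, BK.
  assert (Wp : 0 < Cmod (pt N t)) by (rewrite Cmod_pt; nra).
  assert (Wd1 : Rpower (Cmod (pt N t)) d <= 1) by (apply Rpower_le_1; lra).
  assert (Wd : Rpower (Cmod (pt N t)) d < a * b0 / (2 * C0)) by (apply Kd'; lra).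
  pose proof (exp_pos (d * ln (Cmod (pt N t)))) as Wd0. fold (Rpower (Cmod (pt N t)) d) in Wd0.
  unfold integrand. rewrite Cmod_mult, Cmod_cexp.
  assert (F1 : Cmod (f (zt N t)) <= 1 + C0).
  { replace (f (zt N t)) with ((f (zt N t) - 1) + 1)%C by ring. eapply Rle_trans; [apply Cmod_triangle|]. rewrite Cmod_1.
    assert (C0 * Rpower (Cmod (pt N t)) d <= C0 * 1) by (apply Rmult_le_compat_l; lra). lra. }
  apply fst_le_of_Cmod in BT. apply fst_le_of_Cmod in BK.
  rewrite Clog_pt in BT.
  set (Ls := exp (s * ln (Cmod (1, t)))) in *.
  assert (FK : INR N * (fst (gka (zt N t)) - K0 + lam N) <= Ls * cos (s * atan t) + b0 / 2 * Ls).
  { pose proof (scaled_power N t HN1) as SP. apply (f_equal fst) in SP. rewrite !fst_Rmult in SP.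
    assert (SP2 : fst (cexp (s * Clog (1, t))) = Ls * cos (s * atan t)).
    { rewrite Clog_vline. unfold cexp. cbn [fst]. rewrite fst_Rmult, snd_Rmult. reflexivity. }
    rewrite SP2 in SP. cbn [fst Cplus Cminus Copp RtoC] in BK. rewrite !fst_Rmult in BK. rewrite fst_pt in BK.
    apply Rle_trans with (INR N * (a * fst (cexp (s * Clog (pt N t)))) + INR N * (C0 * Rpower (Cmod (pt N t)) (s + d))).
    - rewrite <- Rmult_plus_distr_l. apply Rmult_le_compat_l; lra.
    - rewrite SP. apply Rplus_le_compat_l. rewrite Rpower_plus, (Rpower_pt N t s). fold Ls.
      change (Rpower (Cmod (1, t)) s) with Ls.
      pose proof (lam_pow_s s a Hs Ha N HN1) as LP. fold lam in LP.
      replace (INR N * (C0 * (Rpower (lam N) s * Ls * Rpower (Cmod (pt N t)) d))) with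
        ((INR N * a * Rpower (lam N) s) * (C0 / a * Rpower (Cmod (pt N t)) d * Ls)) by (field; lra).
      rewrite LP, Rmult_1_l. apply Rmult_le_compat_r; [left; apply exp_pos|].
      apply Rle_trans with (C0 / a * (a * b0 / (2 * C0))); [apply Rmult_le_compat_l; [left; apply Rdiv_lt_0_compat; lra|lra]|right; field; lra]. }
  assert (FT : fst (gth (zt N t)) <= - th * (ln (lam N) + ln (Cmod (1, t))) + C0).
  { eapply Rle_trans; [exact BT|].
    assert (E : fst (- th * (ln (lam N) + Clog (1, t)))%C = - th * (ln (lam N) + ln (Cmod (1, t)))).
    { rewrite Clog_vline. rewrite <- RtoC_opp, fst_Rmult. reflexivity. }
    rewrite E. apply Rplus_le_compat_l. rewrite <- (Rmult_1_r C0) at 2. apply Rmult_le_compat_l; lra. }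
  specialize (RB t). fold Ls in RB.
  assert (PL : 0 < Ls) by apply exp_pos.
  pose proof (ln_Cmod_vline_ge_0 t) as LV.
  assert (LL : ln (lam N) <= 0) by (rewrite <- ln_1; destruct H3 as [H3|H3]; [left; apply ln_increasing; lra|rewrite H3; lra]).
  assert (EXP : fst (expo N t) <= (C0 + 1 + B1) - b0 / 4 * Ls).
  { rewrite fst_expo.
    assert (X1 : th * ln (lam N) + q N * fst (gth (zt N t)) <= C0).
    { apply Rle_trans with (th * ln (lam N) + q N * (- th * (ln (lam N) + ln (Cmod (1, t))) + C0)); [apply Rplus_le_compat_l, Rmult_le_compat_l; lra|].
      assert (0 <= q N * (th * ln (Cmod (1, t)))) by (apply Rmult_le_pos; nra).
      assert (N1 : th * ln (lam N) <= 0) by nra.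
      assert (N2 : th * ln (lam N) * (1 - q N) <= 0) by nra.
      assert (N3 : q N * C0 <= C0) by nra. lra. }
    assert (X2 : INR N * (q N * (fst (gka (zt N t)) - K0) + lam N) = q N * (INR N * (fst (gka (zt N t)) - K0 + lam N)) + INR N * (1 - q N) * lam N) by ring.
    rewrite X2.
    assert (X3 : q N * (INR N * (fst (gka (zt N t)) - K0 + lam N)) <= q N * (B1 - b0 / 2 * Ls)) by (apply Rmult_le_compat_l; lra).
    assert (q N * B1 <= B1) by nra. assert (0 < b0 * Ls) by nra. nra. }
  assert (EXP2 : exp (fst (expo N t)) <= exp (C0 + 1 + B1) * (64 / b0 ^ 2 / (1 + t ^ 2))).
  { eapply Rle_trans; [apply exp_le_compat, EXP|]. unfold Rminus. rewrite exp_plus. apply Rmult_le_compat_l; [left; apply exp_pos|].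
    assert (GL : Cmod (1, t) <= Ls).
    { unfold Ls. rewrite <- (exp_ln (Cmod (1, t))) at 1 by lra. apply exp_le_compat. nra. }
    apply Rle_trans with (exp (- (b0 / 4 * Cmod (1, t)))); [apply exp_le_compat; nra|].
    eapply Rle_trans; [apply exp_opp_le_inv_sqr; nra|]. right.
    rewrite <- Cmod_vline_sqr. field. split; lra. }
  apply Rle_trans with ((1 + C0) * (exp (C0 + 1 + B1) * (64 / b0 ^ 2 / (1 + t ^ 2)))).
  - apply Rmult_le_compat; [apply Cmod_ge_0|left; apply exp_pos|exact F1|exact EXP2].
  - right. unfold A, Rdiv. ring.
Qed.

(** The integrand is O(e^{-mN/4}), while |t| <= pi/lam <= pi N a; exponential smallness in N
    therefore beats 1 + t^2. *)
Lemma far_integrand_bound (e : R) : 0 < e <= PI -> exists C1, 0 < C1 /\ exists n0, forall N, (n0 <= N)%nat ->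
  forall t, e <= Rabs (lam N * t) <= PI -> Cmod (integrand N t) <= C1 / (1 + t ^ 2).
Proof.
  intros He. pose proof PI_RGT_0. destruct (Far e He) as [M [m [HM [Hm HF]]]].
  set (C1 := M * exp M * (1 + PI ^ 2 * (a ^ 2 * (64 / m ^ 2)))).
  assert (Q0 : 0 <= PI ^ 2 * (a ^ 2 * (64 / m ^ 2))).
  { apply Rmult_le_pos; [apply pow2_ge_0|]. apply Rmult_le_pos; [apply pow2_ge_0|]. left. apply Rdiv_lt_0_compat; [lra|apply pow_lt, Hm]. }
  pose proof (exp_pos M) as PM.
  assert (HC1 : 0 < C1) by (unfold C1; repeat apply Rmult_lt_0_compat; lra).
  exists C1. split; [exact HC1|].
  destruct (null_seq_eventually _ (/ 2) (null_q u Hu)) as [n1 H1]; [lra|].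
  (* With q >= 1/2 and lam <= m/4, the coefficient of N in the exponent is at most - m/2 + m/4. *)
  destruct (null_seq_eventually _ (Rmin eps0 (m / 4)) (null_lam s a Hs Ha)) as [n2 H2]; [apply Rmin_pos; lra|].
  destruct (INR_eventually_ge (/ a)) as [n3 H3].
  exists (n1 + n2 + n3 + 1)%nat. intros N HN t Ht.
  specialize (H1 N ltac:(lia)). specialize (H2 N ltac:(lia)). specialize (H3 N ltac:(lia)). fold lam in H2. cbv beta in H1. fold q in H1.
  pose proof (Rmin_l eps0 (m / 4)). pose proof (Rmin_r eps0 (m / 4)).
  assert (HN1 : (1 <= N)%nat) by lia.
  pose proof (q_bounds u Hu N HN1) as [[Q1 Q2] [Q3 _]]. fold q in Q1, Q2, Q3.
  pose proof (INR_ge_1 N HN1) as HNN. pose proof (lam_pos s a N) as L0. fold lam in L0.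
  destruct (HF (lam N) (lam N * t) ltac:(lra) Ht) as [F1 [F2 F3]].
  assert (Ez : zt N t = (R0 * cexp (- (lam N, (lam N * t)%R)))%C).
  { unfold zt, pt. do 3 f_equal. unfold Cmult, RtoC; cbn [fst snd]. f_equal; ring. }
  rewrite <- Ez in F1, F2, F3.
  assert (LL : ln (lam N) <= 0) by (rewrite <- ln_1; left; apply ln_increasing; lra).
  unfold integrand. rewrite Cmod_mult, Cmod_cexp, fst_expo.
  assert (X : th * ln (lam N) + q N * fst (gth (zt N t)) + INR N * (q N * (fst (gka (zt N t)) - K0) + lam N) <= M + - (m / 4 * INR N)).
  { assert (X1 : th * ln (lam N) + q N * fst (gth (zt N t)) <= M).
    { apply Rle_trans with (th * ln (lam N) + q N * (M - th * ln (lam N))); [apply Rplus_le_compat_l, Rmult_le_compat_l; lra|].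
      assert (th * ln (lam N) * (1 - q N) <= 0) by (assert (th * ln (lam N) <= 0) by nra; nra). nra. }
    assert (X2 : q N * (fst (gka (zt N t)) - K0) + lam N <= - (m / 4)) by nra.
    assert (INR N * (q N * (fst (gka (zt N t)) - K0) + lam N) <= INR N * - (m / 4)) by (apply Rmult_le_compat_l; lra). lra. }
  assert (T2 : t ^ 2 <= PI ^ 2 * (INR N * a) ^ 2).
  { assert (NA : 1 <= INR N * a) by (apply Rmult_le_compat_r with (r := a) in H3; [|lra]; rewrite Rinv_l in H3; lra).
    assert (L1 : / (INR N * a) <= lam N).
    { unfold lam, lam_. rewrite <- (Rpower_1 (INR N * a)) at 1 by lra. rewrite <- Rpower_Ropp. apply Rle_Rpower; [exact NA|].
      apply Ropp_le_contravar. rewrite <- Rinv_1. apply Rinv_le_contravar; lra. }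
    rewrite <- (pow2_abs t), <- Rpow_mult_distr. apply pow_incr. split; [apply Rabs_pos|].
    destruct Ht as [_ Ht]. rewrite Rabs_mult, (Rabs_pos_eq (lam N)) in Ht by lra.
    apply Rmult_le_reg_l with (/ (INR N * a)); [apply Rinv_0_lt_compat; lra|].
    replace (/ (INR N * a) * (PI * (INR N * a))) with PI by (field; lra).
    eapply Rle_trans; [|exact Ht]. apply Rmult_le_compat_r; [apply Rabs_pos|exact L1]. }
  pose proof (exp_opp_le_inv_sqr (m / 4 * INR N) ltac:(nra)) as E4.
  assert (E5 : exp (- (m / 4 * INR N)) <= 1) by (rewrite <- exp_0; apply exp_le_compat; nra).
  set (E := exp (- (m / 4 * INR N))) in *. assert (HE : 0 < E) by apply exp_pos.
  assert (E6 : E * INR N ^ 2 <= 64 / m ^ 2).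
  { apply Rmult_le_compat_r with (r := INR N ^ 2) in E4; [|apply pow2_ge_0].
    replace (4 / (m / 4 * INR N) ^ 2 * INR N ^ 2) with (64 / m ^ 2) in E4 by (field; lra). exact E4. }
  assert (E7 : E * (1 + t ^ 2) <= 1 + PI ^ 2 * (a ^ 2 * (64 / m ^ 2))).
  { rewrite Rmult_plus_distr_l, Rmult_1_r. apply Rplus_le_compat; [exact E5|].
    apply Rle_trans with (E * (PI ^ 2 * (INR N * a) ^ 2)); [apply Rmult_le_compat_l; lra|].
    replace (E * (PI ^ 2 * (INR N * a) ^ 2)) with (PI ^ 2 * (a ^ 2 * (E * INR N ^ 2))) by ring.
    apply Rmult_le_compat_l; [apply pow2_ge_0|]. apply Rmult_le_compat_l; [apply pow2_ge_0|exact E6]. }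
  assert (P1 : 0 < 1 + t ^ 2) by (pose proof (pow2_ge_0 t); lra).
  apply Rmult_le_reg_r with (1 + t ^ 2); [exact P1|]. unfold Rdiv. rewrite (Rmult_assoc C1), Rinv_l, Rmult_1_r by lra.
  apply Rle_trans with (M * (exp M * E) * (1 + t ^ 2)).
  - apply Rmult_le_compat_r; [lra|]. apply Rmult_le_compat; [apply Cmod_ge_0|left; apply exp_pos|exact F1|].
    unfold E. rewrite <- exp_plus. apply exp_le_compat, X.
  - unfold C1. replace (M * (exp M * E) * (1 + t ^ 2)) with (M * exp M * (E * (1 + t ^ 2))) by ring.
    apply Rmult_le_compat_l; [apply Rmult_le_pos; lra|exact E7].
Qed.

Lemma saddle_limit (l : C) : Climit_infty (fun T => CInt (hankel_int s th) (- (1) * T) T) l ->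
  Climit_seq (fun N => CInt (integrand N) (- (1) * (PI / lam N)) (PI / lam N)) l.
Proof.
  intros Hl. pose proof PI_RGT_0. pose proof PI_4.
  assert (PI1 : 1 < PI) by (pose proof PI2_1; lra).
  destruct near_bound as [eps1 [C1 [He1 [HC1 [n1 H1]]]]].
  (* Once lam <= eps1/2, a point with |w| = lam |1 + it| > eps1 has lam |t| >= eps1/2, so the near
     and far regions cover the circle. *)
  destruct (far_integrand_bound (eps1 / 2)) as [C2 [HC2 [n2 H2]]]; [lra|].
  apply (dominated_convergence 1 (C1 + C2) integrand (hankel_int s th) (fun N => PI / lam N)).
  - auto.
  - lra.
  - intros T. assert (HT : 0 < PI / (Rabs T + 1)) by (apply Rdiv_lt_0_compat; [lra|pose proof (Rabs_pos T); lra]).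
    destruct (null_seq_eventually _ _ (null_lam s a Hs Ha) HT) as [n0 Hn0]. exists n0. intros N HN. specialize (Hn0 N HN). fold lam in Hn0.
    pose proof (lam_pos s a N) as L0. fold lam in L0. pose proof (Rabs_pos T). pose proof (Rle_abs T).
    apply Rmult_le_reg_r with (lam N); [exact L0|]. replace (PI / lam N * lam N) with PI by (field; lra).
    apply Rmult_le_compat_r with (r := Rabs T + 1) in Hn0; [|lra]. replace (PI / (Rabs T + 1) * (Rabs T + 1)) with PI in Hn0 by (field; lra). nra.
  - exists O. intros N _ t _. apply RCcont_integrand.
  - intros t _. apply RCcont_hankel_int.
  - exact integrand_converges.
  - destruct (null_seq_eventually _ (eps1 / 2) (null_lam s a Hs Ha)) as [n3 H3]; [lra|].
    exists (n1 + n2 + n3)%nat. intros N HN t Ht. specialize (H3 N ltac:(lia)). fold lam in H3.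
    pose proof (lam_pos s a N) as L0. fold lam in L0.
    assert (P1 : 0 < 1 + t ^ 2) by (pose proof (pow2_ge_0 t); lra).
    assert (D1 : C1 / (1 + t ^ 2) <= (C1 + C2) / (1 + t ^ 2)) by (apply Rmult_le_compat_r; [left; apply Rinv_0_lt_compat, P1|lra]).
    assert (D2 : C2 / (1 + t ^ 2) <= (C1 + C2) / (1 + t ^ 2)) by (apply Rmult_le_compat_r; [left; apply Rinv_0_lt_compat, P1|lra]).
    destruct (Rle_dec (Cmod (pt N t)) eps1) as [L|L].
    + eapply Rle_trans; [apply (H1 N ltac:(lia) t L)|exact D1].
    + eapply Rle_trans; [apply (H2 N ltac:(lia) t)|exact D2].
      rewrite Cmod_pt in L. pose proof (Cmod_vline_le t) as V.
      rewrite Rabs_mult, (Rabs_pos_eq (lam N)) by lra. split; [nra|].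
      assert (Rabs t <= PI / lam N).
      { apply Rabs_le. replace (- (1) * (PI / lam N)) with (- (PI / lam N)) in Ht by ring. exact Ht. }
      apply Rmult_le_compat_l with (r := lam N) in H4; [|lra]. replace (lam N * (PI / lam N)) with PI in H4 by (field; lra). exact H4.
  - exact Hl.
Qed.

Lemma zcoef_integrand (N : nat) : (1 <= N)%nat ->
  zcoef N (fun z => f z * cexp (q N * (gth z + INR N * gka z)))%C =
  ((lam N / (2 * PI) / R0 ^ N * (exp (q N * (INR N * K0)) * Rpower (lam N) (- th)))%R *
    CInt (integrand N) (- (1) * (PI / lam N)) (PI / lam N))%C.
Proof.
  intros HN. pose proof (lam_pos s a N) as L0. fold lam in L0.
  assert (HF : holo_disc R0 (fun z => f z * cexp (q N * (gth z + INR N * gka z)))%C).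
  { intros z Hz. apply C_ex_derive_mult; [apply Hf, Hz|]. apply C_ex_derive_cexp, C_ex_derive_mult; [apply C_ex_derive_const|].
    apply C_ex_derive_plus; [apply Hgth, Hz|]. apply C_ex_derive_mult; [apply C_ex_derive_const|apply Hgka, Hz]. }
  rewrite (zcoef_circle _ R0 (lam N) N HR L0 HF).
  rewrite (RtoC_mult (lam N / _ / _)), <- Cmult_assoc. f_equal.
  rewrite <- CInt_Cmult by (apply ex_CInt_cont; intros; apply RCcont_integrand).
  apply CInt_ext. intros t _. unfold integrand.
  fold (pt N t). fold (zt N t).
  unfold Rpower. rewrite <- exp_plus, <- cexp_R.
  replace (f (zt N t) * cexp (q N * (gth (zt N t) + INR N * gka (zt N t))) * cexp (INR N * pt N t))%C with
    (f (zt N t) * (cexp (q N * (gth (zt N t) + INR N * gka (zt N t))) * cexp (INR N * pt N t)))%C by ring.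
  replace (cexp (q N * (INR N * K0) + - th * ln (lam N))%R * (f (zt N t) * cexp (expo N t)))%C with
    (f (zt N t) * (cexp (q N * (INR N * K0) + - th * ln (lam N))%R * cexp (expo N t)))%C by ring.
  rewrite <- !cexp_plus. do 2 f_equal. unfold expo. rewrite RtoC_plus, !RtoC_mult, RtoC_opp. ring.
Qed.

End Saddle.

(** * The power series away from the singularity, and the coefficients as [H] *)

Lemma gcoef_ge_0 (c : nat -> R) (j : nat) : (forall j, (1 <= j)%nat -> 0 <= c j) -> 0 <= gcoef c j.
Proof.
  intros H. destruct j as [|j]; [simpl; lra|].
  change (0 <= c (S j) / INR (S j)). apply Rmult_le_pos; [apply H; lia|left; apply Rinv_0_lt_compat, lt_0_INR; lia].
Qed.

Lemma csum_circle_diff (b : nat -> R) (R0 x y : R) (M : nat) : 0 < R0 ->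
  fst (csum (fun k => b k * RtoC (Cmod (R0 * cexp (- (x, y)))) ^ k)%C M) - fst (csum (fun k => b k * (R0 * cexp (- (x, y))) ^ k)%C M) =
  rsum (fun k => exp (- (INR k * x)) * (b k * R0 ^ k * (1 - cos (INR k * y)))) M.
Proof.
  intros HR. rewrite Cmod_circle by lra. cbn [fst].
  induction M as [|M IH]; [simpl; ring|]. cbn [csum rsum Cplus fst]. rewrite <- IH.
  assert (E1 : fst (b M * RtoC (R0 * exp (- x)) ^ M)%C = b M * (R0 ^ M * exp (- (INR M * x)))).
  { rewrite <- RtoC_pow, <- RtoC_mult. cbn [fst RtoC]. rewrite Rpow_mult_distr, exp_pow. do 3 f_equal. ring. }
  assert (E2 : fst (b M * (R0 * cexp (- (x, y))) ^ M)%C = b M * (R0 ^ M * (exp (- (INR M * x)) * cos (INR M * y)))).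
  { rewrite Cpow_mult_l, <- cexp_pow, <- RtoC_pow, !fst_Rmult. do 2 f_equal.
    unfold cexp. cbn [fst]. rewrite fst_Rmult, snd_Rmult. cbn [fst snd Copp].
    replace (INR M * - y) with (- (INR M * y)) by ring. rewrite cos_neg. do 2 f_equal. ring. }
  cbn [fst Copp]. rewrite E1, E2. ring.
Qed.

Lemma Cmod_vreal (x : R) : 0 < x -> Cmod (x, 0) = x.
Proof. intros H. change (x, 0) with (RtoC x). rewrite Cmod_R. apply Rabs_pos_eq. lra. Qed.

Section FarFromSingularity.

Variables (f gth gka : C -> C) (theta kappa : nat -> R) (R0 th s a K0 d C0 eps0 eta phi : R).
Hypothesis (HR : 0 < R0) (Hth : 0 <= th) (Hs : 1 < s < 2) (Ha : 0 < a) (Hd : 0 < d < 1)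
  (HC0 : 0 < C0) (Heps0 : 0 < eps0 <= / 24) (Heta : 0 < eta) (Hphi : 0 < phi < PI / 2).
Hypothesis (Htheta : forall j, (1 <= j)%nat -> 0 <= theta j) (Hkappa : forall j, (1 <= j)%nat -> 0 <= kappa j).
Hypothesis (Hna : non_arithmetic kappa) (Hk2 : exists j, (2 <= j)%nat /\ 0 < kappa j).
Hypothesis Pth : forall z : C, Cmod z < R0 -> is_pseries (fun j => RtoC (gcoef theta j)) z (gth z).
Hypothesis Pka : forall z : C, Cmod z < R0 -> is_pseries (fun j => RtoC (gcoef kappa j)) z (gka z).
Hypothesis Hf : holomorphic_on (Delta0 R0 eta phi) f.
Hypothesis Nth : forall w, 0 < fst w -> Cmod w <= eps0 ->
  Cmod (gth (R0 * cexp (- w)) - (- th * Clog w))%C <= C0 * Rpower (Cmod w) d.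
Hypothesis Nka : forall w, 0 < fst w -> Cmod w <= eps0 ->
  Cmod (gka (R0 * cexp (- w)) - (K0 - w + a * cexp (s * Clog w)))%C <= C0 * Rpower (Cmod w) (s + d).

(** The local expansion on the positive axis. Since Re g_theta(z) <= g_theta(|z|), it bounds g_theta
    on the whole circle, and its logarithmic growth is offset by th ln lam. *)
Lemma gth_real_bound (x : R) : 0 < x <= eps0 -> fst (gth (R0 * exp (- x))%R) <= C0 - th * ln x.
Proof.
  intros Hx. pose proof (Nth (x, 0) ltac:(simpl; lra) ltac:(rewrite Cmod_vreal; lra)) as B.
  rewrite Cmod_vreal in B by lra.
  assert (E : (R0 * cexp (- (x, 0)))%C = (R0 * exp (- x))%R).
  { rewrite RtoC_mult, <- cexp_R. do 2 f_equal. unfold Copp, RtoC; simpl. f_equal. ring. }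
  rewrite E in B. apply fst_le_of_Cmod in B. change (Clog (x, 0)) with (Clog x) in B. rewrite Clog_R in B by lra.
  assert (E2 : fst (- th * ln x)%C = - th * ln x) by (rewrite <- RtoC_opp, <- RtoC_mult; reflexivity).
  rewrite E2 in B. pose proof (Rpower_le_1 x d ltac:(lra) ltac:(lra)). nra.
Qed.

(** The function increases on [0, R) and its local expansion shows that it tends to [K0] at R; no
    statement about convergence of the series at R enters. *)
Lemma gka_real_bound (r : R) : 0 <= r < R0 -> fst (gka r) <= K0.
Proof.
  intros Hr. apply le_epsilon. intros e He.
  (* For x <= 1 the terms a x^s and C0 x^{s+d} of the expansion are at most a x and C0 x. *)
  set (A := 1 + a + C0). assert (HA : 0 < A) by (unfold A; lra).
  assert (Hr' : exists x0, 0 < x0 /\ forall x, 0 < x <= x0 -> r <= R0 * exp (- x)).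
  { set (rho := (r + R0) / 2). exists (ln (R0 / rho)).
    assert (Q : 1 < R0 / rho).
    { apply Rmult_lt_reg_r with rho; [unfold rho; lra|]. unfold Rdiv. rewrite Rmult_assoc, Rinv_l by (unfold rho; lra). unfold rho; lra. }
    split; [rewrite <- ln_1; apply ln_increasing; lra|]. intros x Hx.
    apply Rle_trans with (R0 * exp (- ln (R0 / rho))).
    - rewrite exp_Ropp, exp_ln by lra. replace (R0 * / (R0 / rho)) with rho by (field; unfold rho; lra). unfold rho; lra.
    - apply Rmult_le_compat_l; [lra|]. apply exp_le_compat. lra. }
  destruct Hr' as [x0 [Hx0 Hr']].
  set (x := Rmin x0 (Rmin eps0 (e / A))).
  assert (EA : 0 < e / A) by (apply Rdiv_lt_0_compat; lra).
  assert (Hx : 0 < x) by (repeat apply Rmin_pos; lra).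
  assert (X1 : x <= x0) by apply Rmin_l.
  assert (X2 : x <= eps0) by (eapply Rle_trans; [apply Rmin_r|apply Rmin_l]).
  assert (X3 : x <= e / A) by (eapply Rle_trans; [apply Rmin_r|apply Rmin_r]).
  pose proof (Nka (x, 0) ltac:(simpl; lra) ltac:(rewrite Cmod_vreal; lra)) as B.
  rewrite Cmod_vreal in B by lra.
  assert (E : (R0 * cexp (- (x, 0)))%C = (R0 * exp (- x))%R).
  { rewrite RtoC_mult, <- cexp_R. do 2 f_equal. unfold Copp, RtoC; simpl. f_equal. ring. }
  rewrite E in B. apply fst_le_of_Cmod in B. change (Clog (x, 0)) with (Clog x) in B. rewrite Clog_R in B by lra.
  change (x, 0) with (RtoC x) in B. rewrite <- RtoC_mult, cexp_R, <- RtoC_mult, <- RtoC_minus, <- RtoC_plus in B. cbn [fst RtoC] in B.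
  assert (P1 : exp (s * ln x) <= x).
  { rewrite <- (Rpower_1 x) at 2 by lra. apply (Rpower_anti x s 1); lra. }
  assert (P2 : Rpower x (s + d) <= x).
  { rewrite <- (Rpower_1 x) at 2 by lra. apply (Rpower_anti x (s + d) 1); lra. }
  assert (I : fst (gka r) <= fst (gka (R0 * exp (- x))%R)).
  { apply (pseries_incr (gcoef kappa) gka R0); [intros; apply gcoef_ge_0, Hkappa|exact Pka| |].
    - split; [lra|apply Hr'; lra].
    - rewrite <- (Rmult_1_r R0) at 2. apply Rmult_lt_compat_l; [exact HR|]. rewrite <- exp_0. apply exp_increasing. lra. }
  assert (A * x <= e).
  { apply Rmult_le_compat_l with (r := A) in X3; [|lra]. replace (A * (e / A)) with e in X3 by (field; lra). exact X3. }
  assert (a * exp (s * ln x) <= a * x) by (apply Rmult_le_compat_l; lra).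
  assert (C0 * Rpower x (s + d) <= C0 * x) by (apply Rmult_le_compat_l; lra).
  unfold A in *. lra.
Qed.

Lemma far_region (e : R) : 0 < e <= PI -> exists M m, 0 < M /\ 0 < m /\ forall x y, 0 < x <= eps0 -> e <= Rabs y <= PI ->
  Cmod (f (R0 * cexp (- (x, y)))%C) <= M /\ fst (gth (R0 * cexp (- (x, y)))%C) <= M - th * ln x /\
  fst (gka (R0 * cexp (- (x, y)))%C) <= K0 - m.
Proof.
  intros He.
  destruct (far_bound_f f R0 eta phi e HR Heta Hphi (proj1 He) Hf) as [M1 [HM1 B1]].
  destruct (nonarithmetic_gap kappa R0 e Hkappa Hna Hk2 HR He) as [J [c [Hc B2]]].
  (* The gap [c] holds on |z| = R; moving to radius R e^{-x} multiplies the k-th term by e^{-kx},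
     which is at least e^{-J} as k < J and x <= 1. *)
  exists (M1 + C0), (exp (- INR J) * c). split; [lra|]. split; [apply Rmult_lt_0_compat; [apply exp_pos|exact Hc]|].
  intros x y Hx Hy.
  set (z := (R0 * cexp (- (x, y)))%C).
  assert (Hz : Cmod z < R0) by (apply Cmod_circle_lt; [exact HR|simpl; lra]).
  assert (Mz : Cmod z = R0 * exp (- x)) by (unfold z; rewrite Cmod_circle by lra; reflexivity).
  split; [|split].
  - eapply Rle_trans; [apply B1; lra|lra].
  - pose proof (pseries_Re_le (gcoef theta) gth R0 (fun j => gcoef_ge_0 theta j Htheta) Pth z 0 Hz) as P. simpl csum in P.
    rewrite Mz in P. pose proof (gth_real_bound x Hx). simpl fst in P. lra.
  - pose proof (pseries_Re_le (gcoef kappa) gka R0 (fun j => gcoef_ge_0 kappa j Hkappa) Pka z J Hz) as P.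
    unfold z at 3 4 in P. rewrite csum_circle_diff in P by exact HR. rewrite Mz in P.
    assert (G : fst (gka (R0 * exp (- x))%R) <= K0).
    { apply gka_real_bound. rewrite <- Mz. split; [apply Cmod_ge_0|exact Hz]. }
    assert (S : exp (- INR J) * c <= rsum (fun k => exp (- (INR k * x)) * (gcoef kappa k * R0 ^ k * (1 - cos (INR k * y)))) J).
    { specialize (B2 y Hy).
      apply Rle_trans with (exp (- INR J) * rsum (fun j => gcoef kappa j * R0 ^ j * (1 - cos (INR j * y))) J).
      - apply Rmult_le_compat_l; [left; apply exp_pos|exact B2].
      - assert (Sc : forall n, exp (- INR J) * rsum (fun j => gcoef kappa j * R0 ^ j * (1 - cos (INR j * y))) n =
          rsum (fun j => exp (- INR J) * (gcoef kappa j * R0 ^ j * (1 - cos (INR j * y)))) n).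
        { induction n as [|n IH]; simpl rsum; [ring|]. rewrite <- IH. ring. }
        rewrite Sc. apply rsum_le. intros k Hk. apply Rmult_le_compat_r.
        + pose proof (COS_bound (INR k * y)). repeat apply Rmult_le_pos; [apply gcoef_ge_0, Hkappa|apply pow_le; lra|lra].
        + apply exp_le_compat. assert (INR k <= INR J) by (apply le_INR; lia). pose proof (pos_INR k). nra. }
    lra.
Qed.

(** Both sequences start at 1 and obey the same recursion, with [N] frozen in the weights; the
    factor k+1 cancels the division by k+1 in [gcoef]. The induction covers all sizes and is read
    off at size [N]. *)
Lemma zcoef_cycle_index (N : nat) : holo_disc R0 gth -> holo_disc R0 gka ->
  zcoef N (fun z => cexp (gth z + INR N * gka z)) = H theta kappa N.
Proof.
  intros Dth Dka. destruct (CycleIndex.H_recurrence theta kappa N) as [h [h0 EH hrec]].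
  rewrite EH.
  set (G := fun z => (gth z + INR N * gka z)%C).
  assert (DN : holo_disc R0 (fun z => INR N * gka z)%C) by (intros z Hz; apply C_ex_derive_mult; [apply C_ex_derive_const|apply Dka, Hz]).
  assert (DG : holo_disc R0 G) by (intros z Hz; apply C_ex_derive_plus; [apply Dth, Hz|apply DN, Hz]).
  assert (CG : forall n, zcoef n G = gcoef theta n + INR N * gcoef kappa n).
  { intros n. unfold G. rewrite (zcoef_plus R0 HR) by assumption. rewrite (zcoef_Cmult R0 HR) by assumption.
    rewrite (zcoef_pseries (gcoef theta) gth R0 (fun j => gcoef_ge_0 theta j Htheta) Pth n HR Dth).
    rewrite (zcoef_pseries (gcoef kappa) gka R0 (fun j => gcoef_ge_0 kappa j Hkappa) Pka n HR Dka).
    rewrite RtoC_plus, RtoC_mult. reflexivity. }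
  assert (Main : forall n m, (m <= n)%nat -> zcoef m (fun z => cexp (G z)) = h m).
  { induction n as [|n IH]; intros m Hm.
    - replace m with O by lia. rewrite zcoef_0, h0. pose proof (CG O) as Z. rewrite zcoef_0 in Z. rewrite Z. simpl.
      replace (0 + INR N * 0) with 0 by ring. apply cexp_0.
    - destruct (Nat.eq_dec m (S n)) as [->|Ne]; [|apply IH; lia].
      pose proof (zcoef_cexp R0 HR G n DG) as E. pose proof (hrec n) as E2.
      assert (NN : RtoC (INR (S n)) <> 0) by (apply RtoC_neq, not_0_INR; lia).
      assert (E3 : (INR (S n) * zcoef (S n) (fun z => cexp (G z)))%C = (INR (S n) * h (S n))%C).
      { rewrite E, <- RtoC_mult. etransitivity; [|symmetry; exact E2]. apply csum_ext. intros k Hk. rewrite IH by lia. rewrite CG.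
        assert (P : INR (S k) <> 0) by (apply not_0_INR; lia).
        rewrite <- !RtoC_mult. f_equal.
        change (gcoef theta (S k)) with (theta (S k) / INR (S k)). change (gcoef kappa (S k)) with (kappa (S k) / INR (S k)).
        apply (f_equal (fun x : R => x * h (n - k)%nat)). field. exact P. }
      replace (zcoef (S n) (fun z => cexp (G z))) with (/ INR (S n) * (INR (S n) * zcoef (S n) (fun z => cexp (G z))))%C by (field; exact NN).
      rewrite E3. field. exact NN. }
  exact (Main N N (Nat.le_refl N)).
Qed.

End FarFromSingularity.

(** * Assembling the asymptotics *)

Lemma Climit_seq_filterlim (u : nat -> C) (l : C) : Climit_seq u l -> filterlim u eventually (locally l).
Proof.
  intros H P [eps HP]. destruct (H (eps / 2)) as [n0 Hn0]; [pose proof (cond_pos eps); lra|].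
  exists n0. intros n Hn. apply HP. specialize (Hn0 n Hn). pose proof (cond_pos eps).
  pose proof (fst_le_Cmod (u n - l)) as F1. pose proof (snd_le_Cmod (u n - l)) as F2.
  split; unfold ball; simpl; unfold AbsRing_ball, abs, minus, plus, opp; simpl; eapply Rle_lt_trans;
    [exact F1| |exact F2|]; lra.
Qed.

Theorem theorem3p13
  (theta kappa : nat -> R) (R0 : R) (gth gka : C -> C) (eta phi : R)
  (thetas delta s a_s : R) :
  (* standing assumptions *)
  (forall j, (1 <= j)%nat -> 0 <= theta j) ->
  (forall j, (1 <= j)%nat -> 0 <= kappa j) ->
  non_arithmetic kappa ->
  (exists j, (2 <= j)%nat /\ 0 < kappa j) ->
  (* g_theta, g_kappa have radius of convergence R > 0 *)
  0 < R0 ->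
  CV_radius (gcoef theta) = Finite R0 ->
  CV_radius (gcoef kappa) = Finite R0 ->
  (* gth, gka : the holomorphic continuations of g_theta, g_kappa to Delta_0 *)
  0 < eta -> 0 < phi < PI / 2 ->
  (forall z : C, Cmod z < R0 ->
     is_pseries (fun j => RtoC (gcoef theta j)) z (gth z)) ->
  (forall z : C, Cmod z < R0 ->
     is_pseries (fun j => RtoC (gcoef kappa j)) z (gka z)) ->
  holomorphic_on (Delta0 R0 eta phi) gth ->
  holomorphic_on (Delta0 R0 eta phi) gka ->
  (* g_kappa^{1}(R) = 1 *)
  filterlim (fun r => PSeries (g1coef kappa) r) (at_left R0) (locally 1) ->
  0 <= thetas -> 0 < delta -> 1 < s < 2 -> 0 < a_s ->
  (* g_theta(z) = -theta* log(1 - z/R) + O((1 - z/R)^delta) *)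
  (exists K eps, 0 < eps /\
     forall z, Delta0 R0 eta phi z -> Cmod (z - RtoC R0)%C < eps ->
       Cmod (gth z - (- RtoC thetas * Clog (1 - z / RtoC R0)))%C
         <= K * Rpower (Cmod (1 - z / RtoC R0)%C) delta) ->
  (* g_kappa(z) = g_kappa(R) - (1 - z/R) + a_s (1 - z/R)^s + O((1 - z/R)^(s+delta)) *)
  (exists K eps, 0 < eps /\
     forall z, Delta0 R0 eta phi z -> Cmod (z - RtoC R0)%C < eps ->
       Cmod (gka z - (RtoC (PSeries (gcoef kappa) R0) - (1 - z / RtoC R0)
                      + RtoC a_s * Cpower (1 - z / RtoC R0) (RtoC s)))%C
         <= K * Rpower (Cmod (1 - z / RtoC R0)%C) (s + delta)) ->
  (forall f : C -> C,
     holomorphic_on (Delta0 R0 eta phi) f ->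
     (exists K eps, 0 < eps /\
        forall z, Delta0 R0 eta phi z -> Cmod (z - RtoC R0)%C < eps ->
          Cmod (f z - 1)%C <= K * Rpower (Cmod (1 - z / RtoC R0)%C) delta) ->
     forall u : R, 0 <= u ->
       filterlim
         (fun N : nat =>
            (zcoef N (fun z => f z * cexp (RtoC (exp (- u / sqrt (INR N)))
                                      * (gth z + RtoC (INR N) * gka z)))
             / RtoC (exp (INR N * PSeries (gcoef kappa) R0
                          - sqrt (INR N) * u * PSeries (gcoef kappa) R0
                          + / 2 * u ^ 2 * PSeries (gcoef kappa) R0)
                     / R0 ^ N
                     * (Rpower (INR N * a_s) ((thetas - 1) / s)
                        / (s * Gamma ((s - 1 + thetas) / s)))))%C)
         eventually (locally (RtoC 1)))
  /\
  is_lim_seq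
    (fun N : nat =>
       H theta kappa N
       / (exp (INR N * PSeries (gcoef kappa) R0)
          * Rpower (INR N * a_s) ((thetas - 1) / s)
          / (s * R0 ^ N * Gamma ((s - 1 + thetas) / s))))
    1.
Proof.
  intros Htheta Hkappa Hna Hk2 HR _ _ Heta Hphi Pth Pka Holth Holka _ Hth Hdelta Hs Ha Eth Eka.
  pose proof PI_RGT_0 as HPi.
  set (K0 := PSeries (gcoef kappa) R0) in *.
  (* One exponent below both delta and 2 - s: the first for the given error terms, the second to
     absorb the O(w^2) from the change of coordinate. Halving also makes d < 1. *)
  set (d := Rmin delta (2 - s) / 2).
  assert (D0 : 0 < Rmin delta (2 - s)) by (apply Rmin_pos; lra).
  pose proof (Rmin_l delta (2 - s)) as D1. pose proof (Rmin_r delta (2 - s)) as D2.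
  assert (Hd : 0 < d < 1) by (unfold d; lra). assert (Hdd : d <= delta) by (unfold d; lra). assert (Hsd : s + d <= 2) by (unfold d; lra).
  destruct (expansion_gth R0 eta phi delta d HR Heta Hphi Hd Hdd gth thetas Hth Eth) as [K1 [e1 [HK1 [He1 B1]]]].
  destruct (expansion_gka R0 eta phi delta d HR Heta Hphi Hd Hdd gka s a_s K0 Hs Ha Hsd Eka) as [K2 [e2 [HK2 [He2 B2]]]].
  assert (Disc : forall g, holomorphic_on (Delta0 R0 eta phi) g -> holo_disc R0 g).
  { intros g Hg z Hz. apply Hg, lt_disc_Delta0; assumption. }
  destruct (hankel_formula s thetas Hs Hth) as [l [Hl El]].
  set (G := s * Gamma ((s - 1 + thetas) / s)) in *.
  assert (HG : G <> 0).
  { intros Z. rewrite Z in El. apply (f_equal fst) in El. simpl in El. lra. }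
  set (A := fun (u : R) (N : nat) => INR N * K0 - sqrt (INR N) * u * K0 + / 2 * u ^ 2 * K0).
  set (Den := fun (u : R) (N : nat) => exp (A u N) / R0 ^ N * (Rpower (INR N * a_s) ((thetas - 1) / s) / G)).
  assert (Main : forall f : C -> C, holomorphic_on (Delta0 R0 eta phi) f ->
     (exists K eps, 0 < eps /\ forall z, Delta0 R0 eta phi z -> Cmod (z - RtoC R0)%C < eps ->
          Cmod (f z - 1)%C <= K * Rpower (Cmod (1 - z / RtoC R0)%C) delta) ->
     forall u : R, 0 <= u ->
     Climit_seq (fun N => zcoef N (fun z => f z * cexp (q_ u N * (gth z + INR N * gka z))) / Den u N)%C 1).
  { intros f Hf Ef u Hu.
    destruct (expansion_f R0 eta phi delta d HR Heta Hphi Hd Hdd f Ef) as [K3 [e3 [HK3 [He3 B3]]]].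
    set (C0 := K1 + K2 + K3). set (eps0 := Rmin e1 (Rmin e2 e3)).
    assert (E0 : 0 < eps0) by (repeat apply Rmin_pos; lra).
    assert (E1 : eps0 <= e1) by apply Rmin_l.
    assert (E2 : eps0 <= e2) by (eapply Rle_trans; [apply Rmin_r|apply Rmin_l]).
    assert (E3 : eps0 <= e3) by (eapply Rle_trans; [apply Rmin_r|apply Rmin_r]).
    assert (HC0 : 0 < C0) by (unfold C0; lra).
    assert (Inc : forall K w p, 0 < K <= C0 -> K * Rpower (Cmod w) p <= C0 * Rpower (Cmod w) p).
    { intros K w p HK. apply Rmult_le_compat_r; [left; apply exp_pos|lra]. }
    assert (Nth : forall w, 0 < fst w -> Cmod w <= eps0 -> Cmod (gth (R0 * cexp (- w)) - (- thetas * Clog w))%C <= C0 * Rpower (Cmod w) d).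
    { intros w Hw1 Hw2. eapply Rle_trans; [apply B1; [exact Hw1|lra]|]. apply Inc. unfold C0; lra. }
    assert (Nka : forall w, 0 < fst w -> Cmod w <= eps0 -> Cmod (gka (R0 * cexp (- w)) - (K0 - w + a_s * cexp (s * Clog w)))%C <= C0 * Rpower (Cmod w) (s + d)).
    { intros w Hw1 Hw2. eapply Rle_trans; [apply B2; [exact Hw1|lra]|]. apply Inc. unfold C0; lra. }
    assert (Nf : forall w, 0 < fst w -> Cmod w <= eps0 -> Cmod (f (R0 * cexp (- w)) - 1)%C <= C0 * Rpower (Cmod w) d).
    { intros w Hw1 Hw2. eapply Rle_trans; [apply B3; [exact Hw1|lra]|]. apply Inc. unfold C0; lra. }
    assert (He0 : 0 < eps0 <= / 24) by lra.
    pose proof (far_region f gth gka theta kappa R0 thetas s a_s K0 d C0 eps0 eta phi HR Hs Ha Hd HC0 He0 Heta Hphi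
      Htheta Hkappa Hna Hk2 Pth Pka Hf Nth Nka) as Far.
    pose proof (saddle_limit f gth gka R0 thetas s a_s K0 d u C0 eps0 HR Hth Hs Ha Hd Hu HC0 He0
      (Disc f Hf) (Disc gth Holth) (Disc gka Holka) Nf Nth Nka Far l Hl) as SL.
    pose proof (is_lim_seq_Climit _ _ (limit_q_taylor u Hu K0)) as QL.
    (* The quotient factors into the damping at z = R, the scaled integral and a constant, with
       limits 1, l and G/(2 pi). *)
    pose proof (Climit_seq_mult _ _ _ _ (Climit_seq_mult _ _ _ _ QL SL) (Climit_seq_const (G / (2 * PI))%R)) as PR.
    assert (EL : (1 * l * (G / (2 * PI))%R)%C = 1).
    { rewrite RtoC_div by lra. unfold Cdiv. replace (1 * l * (G * / RtoC (2 * PI)))%C with (l * G * / RtoC (2 * PI))%C by ring.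
      rewrite El. field. apply RtoC_neq. lra. }
    rewrite EL in PR. revert PR. apply Climit_seq_ext with (n1 := 1%nat). intros N HN.
    pose proof (INR_ge_1 N HN) as HN1.
    rewrite (zcoef_integrand f gth gka R0 thetas s a_s K0 u HR (Disc f Hf) (Disc gth Holth) (Disc gka Holka) N HN).
    assert (L0 : 0 < lam_ s a_s N) by apply lam_pos.
    (* One power of lam is the Jacobian of the scaling; the power -thetas was split off from
       g_theta. *)
    assert (EP : Rpower (INR N * a_s) ((thetas - 1) / s) = lam_ s a_s N * Rpower (lam_ s a_s N) (- thetas)).
    { rewrite <- (Rpower_1 (lam_ s a_s N)) at 1 by exact L0. rewrite <- Rpower_plus. unfold lam_. rewrite Rpower_mult. f_equal. field. lra. }
    assert (RN : 0 < R0 ^ N) by (apply pow_lt, HR).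
    assert (PT : 0 < Rpower (lam_ s a_s N) (- thetas)) by apply exp_pos.
    pose proof (exp_pos (A u N)) as PA.
    assert (DN : Den u N <> 0).
    { unfold Den. rewrite EP. apply Rmult_integral_contrapositive_currified.
      - apply Rgt_not_eq, Rdiv_lt_0_compat; assumption.
      - apply Rmult_integral_contrapositive_currified; [apply Rgt_not_eq; apply Rmult_lt_0_compat; assumption|apply Rinv_neq_0_compat, HG]. }
    set (I := CInt _ _ _).
    assert (ER : lam_ s a_s N / (2 * PI) / R0 ^ N * (exp (q_ u N * (INR N * K0)) * Rpower (lam_ s a_s N) (- thetas)) =
      exp (q_ u N * (INR N * K0) - A u N) * (G / (2 * PI)) * Den u N).
    { unfold Den. rewrite EP. unfold Rminus. rewrite exp_plus, exp_Ropp. field. repeat split; lra. }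
    rewrite ER. rewrite !RtoC_mult. fold (A u N). field. apply RtoC_neq, DN. }
  split.
  - intros f Hf Ef u Hu. apply Climit_seq_filterlim. exact (Main f Hf Ef u Hu).
  (* The case f = 1, u = 0, where the damping factor is 1. *)
  - assert (H1 : Climit_seq (fun N => zcoef N (fun z => 1 * cexp (q_ 0 N * (gth z + INR N * gka z))) / Den 0 N)%C 1).
    { apply (Main (fun _ => 1)); [|exists 0, 1; split; [lra|]|lra].
      - intros z _. apply C_ex_derive_const.
      - intros z _ _. replace (1 - 1)%C with (RtoC 0) by ring. rewrite Cmod_0. lra. }
    apply is_lim_seq_spec. intros eps. destruct (H1 (eps / 2)) as [n0 Hn0]; [pose proof (cond_pos eps); lra|].
    exists (S n0). intros N HN. specialize (Hn0 N ltac:(lia)). pose proof (cond_pos eps) as Pe.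
    assert (Q1 : q_ 0 N = 1).
    { unfold q_. replace (- 0 / sqrt (INR N)) with 0 by (unfold Rdiv; ring). apply exp_0. }
    assert (Z : zcoef N (fun z => 1 * cexp (q_ 0 N * (gth z + INR N * gka z)))%C = H theta kappa N).
    { rewrite <- (zcoef_cycle_index gth gka theta kappa R0 HR Htheta Hkappa Pth Pka N (Disc gth Holth) (Disc gka Holka)).
      apply (zcoef_ext_disc R0 HR).
      - intros z Hz. apply C_ex_derive_mult; [apply C_ex_derive_const|]. apply C_ex_derive_cexp, C_ex_derive_mult; [apply C_ex_derive_const|].
        apply C_ex_derive_plus; [apply (Disc gth Holth), Hz|]. apply C_ex_derive_mult; [apply C_ex_derive_const|apply (Disc gka Holka), Hz].
      - intros z _. rewrite Q1. rewrite !Cmult_1_l. reflexivity. }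
    rewrite Z in Hn0.
    assert (ED : Den 0 N = exp (INR N * K0) * Rpower (INR N * a_s) ((thetas - 1) / s) / (s * R0 ^ N * Gamma ((s - 1 + thetas) / s))).
    { unfold Den, A, G. replace (INR N * K0 - sqrt (INR N) * 0 * K0 + / 2 * 0 ^ 2 * K0) with (INR N * K0) by ring.
      unfold Rdiv. rewrite !Rinv_mult. ring. }
    rewrite <- ED.
    assert (DN : Den 0 N <> 0).
    { unfold Den. apply Rmult_integral_contrapositive_currified.
      - apply Rgt_not_eq, Rdiv_lt_0_compat; [apply exp_pos|apply pow_lt, HR].
      - apply Rmult_integral_contrapositive_currified; [apply Rgt_not_eq, exp_pos|apply Rinv_neq_0_compat, HG]. }
    rewrite <- RtoC_div, <- RtoC_minus, Cmod_R in Hn0 by exact DN. lra.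
Qed.
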